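(* All implicit constants below depend only on the space and on $m$, and are uniform in integers $n\ge1$ and in $\theta$ in the stated range; the functions $\psi_n^\pm$, $\lambda_n^\pm$ ($n\ge0$), $E$, $E_1$, $E_2$ may depend on $m$ and on the space. $Z_n$ is the zonal spherical function of degree $n\ge1$. (1) On $P^d(\mathbb{R})$ ($d\ge2$), for every integer $m\ge1$ there are functions such that for $\theta\in[0,\pi]$ and $n\ge 1$, $$Z_n(\theta)=\psi^+_n(\theta)e^{in\frac\theta2}+\psi^-_n(\theta)e^{-in\frac\theta2}+E(\theta,n),$$ where $$|\psi^\pm_n(\theta)|\lesssim\frac{n^{d-1}}{\langle n\theta\rangle^{\frac{d-1}2}},\qquad |\psi^\pm_n(\theta)-\psi^\pm_{n-1}(\theta)|\lesssim\frac{n^{d-2}}{\langle n\theta\rangle^{\frac{d-1}2}},\qquad |E(\theta,n)|\lesssim n^{d-(m+1)}.$$ (2) On $\mathbb{S}^d$ ($d\ge 2$), $P^d(\mathbb{C})$, $P^d(\mathbb{H})$ and $P^{16}(Cay)$, for every integer $m\ge1$ there are functions such that for $\theta\in[0,\frac\pi2]$ and $n\ge 1$, $$Z_n(\theta)=\psi^+_n(\theta)e^{in\theta}+\psi^-_n(\theta)e^{-in\theta}+E_1(\theta,n),$$ where $$|\psi^\pm_n(\theta)|\lesssim\frac{n^{d-1}}{\langle n\theta\rangle^{\frac{d-1}2}},\qquad |\psi^\pm_n(\theta)-\psi^\pm_{n-1}(\theta)|\lesssim\frac{n^{d-2}}{\langle n\theta\rangle^{\frac{d-1}2}},\qquad |E_1(\theta,n)|\lesssim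 n^{d-(m+1)}.$$ (3) On $\mathbb{S}^d$ ($d\ge 2$), $P^d(\mathbb{C})$, $P^d(\mathbb{H})$ and $P^{16}(Cay)$, for every positive integer $m>\frac{d-2(1+\beta)}4$ there are functions such that for $\theta\in[\frac\pi2,\pi]$ and $n\ge 1$, $$Z_n(\theta)=\lambda^+_n(\theta)e^{in\theta}+\lambda^-_n(\theta)e^{-in\theta}+E_2(\theta,n),$$ where $$|\lambda^\pm_n(\theta)|\lesssim\frac{n^{\beta+\frac d2}}{\langle n(\pi-\theta)\rangle^{\beta+\frac12}},\qquad |\lambda^\pm_n(\theta)-\lambda^\pm_{n-1}(\theta)|\lesssim\frac{n^{(\beta+\frac d2)-1}}{\langle n(\pi-\theta)\rangle^{\beta+\frac12}},\qquad |E_2(\theta,n)|\lesssim n^{(\beta+\frac d2)-m}.$$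
   Context: The spaces $\mathbb{X}$ (of real dimension $d$) are the rank one Riemannian symmetric spaces of compact type: $\mathbb{S}^d$ ($d\ge 2$), $P^d(\mathbb{R})$ ($d\ge2$), $P^d(\mathbb{C})$ ($d=4,6,8,\dots$), $P^d(\mathbb{H})$ ($d=8,12,16,\dots$), $P^{16}(Cay)$ ($d=16$), with the invariant metric scaled to have diameter $\pi$. $\langle x\rangle:=(1+|x|^2)^{1/2}$. Parameters: $\alpha=\frac{d-2}2$ for all spaces (so $\alpha=7$ for $P^{16}(Cay)$); $\beta=\frac{d-2}2$ for $\mathbb{S}^d$ and $P^d(\mathbb{R})$, $\beta=0$ for $P^d(\mathbb{C})$, $\beta=1$ for $P^d(\mathbb{H})$, $\beta=3$ for $P^{16}(Cay)$. Also $s=2$ for $P^d(\mathbb{R})$ and $s=1$ for the other spaces. $d_n$ is the dimension of the eigenspace $\mathscr{H}_n(\mathbb{X})$ of the Laplace–Beltrami operator for its $n$-th distinct eigenvalue (in increasing order, the $0$-th being $0$). The zonal spherical function of degree $n$, as a function of the distance $\theta\in[0,\pi]$, is $$Z_n(\theta)=d_n\frac{P_n^{(\alpha,\beta)}\big(\cos(\theta/s)\big)}{P_n^{(\alpha,\beta)}(1)},$$ where $P_n^{(\alpha,\beta)}$ are the Jacobi polynomials in the standard normalization $P_n^{(\alpha,\beta)}(1)=\binom{n+\alpha}{n}$. *)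

(* Defs.v *)
From HB Require Import structures.
From mathcomp Require Import all_boot all_order all_algebra.
From mathcomp Require Import complex.
From mathcomp Require Import all_classical all_reals all_analysis.
Import Order.TTheory GRing.Theory Num.Theory.
Import numFieldNormedType.Exports.

Set Implicit Arguments.
Unset Strict Implicit.
Unset Printing Implicit Defensive.

Local Open Scope classical_set_scope.
Local Open Scope ring_scope.

(* X is a compact smooth submanifold of the Euclidean space 'M[R]_(p, q), with
   the induced Riemannian metric.  Functions on X are represented by functions
   on the ambient space, of which only the values on X matter. *)

Section LaplaceBeltrami.
Context {R : realType} {p q : nat}.
Local Notation V := 'M[R]_(p, q).
Implicit Types (X : set V) (x v : V) (c : R -> V) (f : V -> R).

Definition dot (u v : V) : R := \sum_i \sum_j u i j * v i j.

Definition tangent X x : set V := [set v | exists c : R -> V,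
  [/\ forall t, X (c t), c 0 = x, derivable c 0 1 & derive1 c 0 = v]].

(* A curve of a Riemannian submanifold is a geodesic if and only if its
   acceleration is everywhere normal to the submanifold. *)
Definition geodesic X c : Prop :=
  [/\ forall t, X (c t),
      forall t, derivable c t 1,
      forall t, derivable (derive1 c) t 1
    & forall t v, tangent X (c t) v -> dot (derive1n 2 c t) v = 0].

(* F is C^oo: every iterated directional derivative of F is differentiable. *)
Definition smooth (F : V -> R) : Prop :=
  forall (vs : seq V) x, differentiable (foldr (fun v G => 'D_v G) F vs) x.

Definition smooth_on X f : Prop :=
  exists2 F : V -> R, smooth F & forall x, X x -> f x = F x.

(* The trace of the Hessian: the value l at x of the Laplace-Beltrami operator
   on f is the sum of the second derivatives of f along d geodesics issued from
   x with orthonormal initial velocities, where d = dim X. *)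
Definition laplace_beltrami X (d : nat) f x (l : R) : Prop :=
  forall c : 'I_d -> R -> V,
    (forall i, geodesic X (c i)) -> (forall i, c i 0 = x) ->
    (forall i j, dot (derive1 (c i) 0) (derive1 (c j) 0) = (i == j)%:R) ->
  \sum_i derive1n 2 (f \o c i) 0 = l.

(* Sign convention: eigenvalues are those of the nonnegative operator. *)
Definition eigenspace_LB X d (mu : R) : set (V -> R) := [set f |
  smooth_on X f /\ forall x, X x -> laplace_beltrami X d f x (- (mu * f x))].

Definition eigenvalue_LB X d : set R := [set mu |
  exists2 f, eigenspace_LB X d mu f & exists2 x, X x & f x != 0].

Definition has_dim_on X (H : set (V -> R)) (k : nat) : Prop :=
  exists e : 'I_k -> V -> R,
  [/\ forall i, H (e i),
      forall a : 'I_k -> R, (forall x, X x -> \sum_i a i * e i x = 0) ->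
        forall i, a i = 0
    & forall f, H f -> exists a : 'I_k -> R,
        forall x, X x -> f x = \sum_i a i * e i x].

Definition is_eigdim X d (n k : nat) : Prop :=
  exists lam : nat -> R,
  [/\ {homo lam : i j / (i < j)%N >-> i < j},
      eigenvalue_LB X d = range lam
    & has_dim_on X (eigenspace_LB X d (lam n)) k].

(* The spectrum of a connected compact X is an increasing sequence of
   eigenvalues of finite multiplicity, so the default value 0 is not used. *)
Definition eigdim X d (n : nat) : nat := xget 0%N [set k | is_eigdim X d n k].

End LaplaceBeltrami.

(* Cayley-Dickson doubling from R: the levels 0, 1, 2, 3 are R, C, H and the
   octonions. *)

Fixpoint cddim (k : nat) : nat := if k is k'.+1 then cddim k' + cddim k' else 1.

Section CayleyDickson.
Context {R : realType}.
Notation CD k := 'rV[R]_(cddim k).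

Fixpoint cd1 k : CD k :=
  if k is k'.+1 return CD k then row_mx (cd1 k') 0 else 1%:M.

Fixpoint cdconj k : CD k -> CD k :=
  if k is k'.+1 return CD k -> CD k then
    fun x => row_mx (cdconj (lsubmx x)) (- rsubmx x)
  else id.

Fixpoint cdmul k : CD k -> CD k -> CD k :=
  if k is k'.+1 return CD k -> CD k -> CD k then
    fun x y =>
      let a := lsubmx x in let b := rsubmx x in
      let c := lsubmx y in let d := rsubmx y in
      row_mx (cdmul a c - cdmul (cdconj d) b) (cdmul d a + cdmul b (cdconj c))
  else fun x y => x *m y.

Definition unit_sphere d : set 'rV[R]_d.+1 := [set x | dot x x = 1].

(* A square matrix of size r.+1 over the k-th algebra is stored as a real matrix
   whose rows are its entries. *)
Definition entry k r (x : 'M[R]_(r.+1 * r.+1, cddim k)) (i j : 'I_r.+1) : CD k :=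
  row (mxvec_index i j) x.

(* The projective space of dimension r over the k-th algebra (for k = 3, only
   r = 2 is used) is the space of Hermitian idempotent matrices A of trace 1;
   the points below are x = sqrt 2 A.  A line with unit speed is
   sqrt 2 (cos (t/2)^2 A + sin (t/2)^2 B) + sin t / sqrt 2 W, with A, B
   orthogonal and W off-diagonal of norm sqrt 2, so that the diameter is pi. *)
Definition projective_space k r : set 'M[R]_(r.+1 * r.+1, cddim k) := [set x |
  [/\ forall i j, entry x j i = cdconj (entry x i j),
      forall i j, \sum_l cdmul (entry x i l) (entry x l j) =
                  Num.sqrt 2 *: entry x i j
    & \sum_i entry x i i = Num.sqrt 2 *: cd1 k]].

End CayleyDickson.

(* The parameter is the real dimension. *)
Inductive rank_one_space :=
  | Sphere of nat
  | RealProj of nat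
  | ComplexProj of nat
  | QuatProj of nat
  | CayleyPlane.

Definition admissible (X : rank_one_space) : bool :=
  match X with
  | Sphere d | RealProj d => (2 <= d)%N
  | ComplexProj d => (4 <= d)%N && (2 %| d)%N
  | QuatProj d => (8 <= d)%N && (4 %| d)%N
  | CayleyPlane => true
  end.

Definition is_real_proj (X : rank_one_space) : bool :=
  if X is RealProj _ then true else false.

Definition dimX (X : rank_one_space) : nat :=
  match X with
  | Sphere d | RealProj d | ComplexProj d | QuatProj d => d
  | CayleyPlane => 16
  end.

Section Zonal.
Variable R : realType.
Implicit Types (X : rank_one_space) (n : nat).

Definition alpha X : R := ((dimX X)%:R - 2) / 2.

Definition beta X : R :=
  match X with
  | Sphere d | RealProj d => (d%:R - 2) / 2
  | ComplexProj _ => 0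
  | QuatProj _ => 1
  | CayleyPlane => 3
  end.

Definition sX X : R := if is_real_proj X then 2 else 1.

(* For RealProj d, the n-th eigenspace lifts to the spherical harmonics of degree
   2 n on the sphere of dimension d. *)
Definition dimH X n : nat :=
  match X with
  | Sphere d => eigdim (@unit_sphere R d) d n
  | RealProj d => eigdim (@projective_space R 0 d) d n
  | ComplexProj d => eigdim (@projective_space R 1 (d %/ 2)) d n
  | QuatProj d => eigdim (@projective_space R 2 (d %/ 4)) d n
  | CayleyPlane => eigdim (@projective_space R 3 2) 16 n
  end.

Definition gbin (a : R) (k : nat) : R := (\prod_(i < k) (a - i%:R)) / k`!%:R.

(* Szego, Orthogonal polynomials, (4.3.2), with (n + a choose n) as value at 1. *)
Definition jacobi (a b : R) n (x : R) : R :=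
  \sum_(k < n.+1) gbin (n%:R + a) (n - k) * gbin (n%:R + b) k *
    ((x - 1) / 2) ^+ k * ((x + 1) / 2) ^+ (n - k).

Definition zonal X n (theta : R) : R :=
  (dimH X n)%:R * (jacobi (alpha X) (beta X) n (cos (theta / sX X)) /
                   jacobi (alpha X) (beta X) n 1).

Definition japanese (x : R) : R := Num.sqrt (1 + `|x| ^+ 2).

Definition expi (x : R) : R[i] := Complex (cos x) (sin x).

Definition cabs (z : R[i]) : R := Normc.normc z.

End Zonal.

(* Main.v *)
Require Import Defs.
From HB Require Import structures.
From mathcomp Require Import all_boot all_order all_algebra.
From mathcomp Require Import complex.
From mathcomp Require Import all_classical all_reals all_analysis.
From mathcomp Require Import ring lra zify.
Import Order.TTheory GRing.Theory Num.Theory.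
Import numFieldNormedType.Exports.

(** The zonal function is D n times the ratio of a Jacobi polynomial to its value at 1,
    where D n is the n-th multiplicity.  Bounds for both factors and
    their increments in n give the theorem without any asymptotic expansion: the
    remainders E, E1 and E2 are zero for every m.

    The Jacobi factor.  For parameters a, b >= 0 and g = a + 1/2 the ratio satisfies a
    three-term recurrence in n.  As long as n p <= 3 it does not oscillate: it is O(1)
    with increments O(p) ([hyp_near]).  Multiplied by a product of order n^g, it satisfies
    the recurrence of the Chebyshev polynomials up to O(n^-2) ([recurrence_errors]), so
    that beyond the index N of order 1/p the complex amplitude in front of exp(i n p)
    changes by a total factor O(1) (discrete Gronwall, [amplitude_bounds]).  Dividing by
    the product again gives amplitudes of size (N/n)^g with increments smaller by 1/n.
    Below N the two amplitudes need only be bounded with increments O(p): the second is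
    frozen at its value at N and the first one absorbs the rest
    ([jacobi_decomposition]).  Near the antipode, the reflection of the angle exchanges
    a and b and introduces the ratio of the two values at 1, of order n^(b-a)
    ([tame_growth_ratio]).

    The multiplicities.  It remains to show that D n = O(n^(d-1)) with increments
    O(n^(d-2)) ([dimH_le]), for D n defined by the spectrum of the Laplacian.  Each space
    is embedded in a Euclidean space so that the orthogonal projection on the tangent
    space at x has entries m(x) - x (x) x with m affine, and the Laplacian of the
    coordinates is affine.  On polynomials of degree n the Laplacian is then a scalar
    - mu n modulo lower degree ([Pol_frame]), which splits polynomials into polynomial
    eigenfunctions ([Pol_decomposition]).  There are no other eigenfunctions: by the
    maximum principle the resolvents are contractions for the supremum norm, products of
    functions of the Laplacian can kill all the mu i but one with a uniformly bounded
    norm, and polynomials are dense ([eig_approx]).  Hence D n is the increment of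
    the dimension h n of the polynomials of degree n on X ([eigdim_hilbert]).  Now h is
    the Hilbert function of a graded algebra, which is eventually polynomial by the
    combinatorics of monomial ideals ([evpoly_hilbert]), and it is O(n^d) because X is
    covered by finitely many charts with d rational coordinates ([hilbert_le]).  So the
    second difference of h is O(n^(d-2)) ([hilbert_diff2_le]).

    The geometry.  For the sphere everything is explicit.  A projective space consists of
    projectors of rank one, over an algebra obtained by Cayley-Dickson doubling; what is
    needed are Peirce identities of the Jordan product ([proj_eigdim_diff_le]).
    They are elementary over an associative algebra; over the octonions they come from
    the Cayley-Hamilton theorem for Hermitian matrices of size 3 and its polarisations
    ([cayley_hamilton], [cayley_hamilton_polar]), which only use alternativity. *)

Set Implicit Arguments.
Unset Strict Implicit.
Unset Printing Implicit Defensive.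
Local Open Scope classical_set_scope.
Local Open Scope ring_scope.

(** * Eventually polynomial sequences and monomial ideals *)

Section FiniteDifferences.
Context {R : realType}.
Implicit Types (u v h : nat -> R) (k n j d i : nat).

Definition fdiff u n : R := u n.+1 - u n.

(** A sequence is eventually polynomial when some iterated difference of it is
    eventually zero; no polynomial has to be named. *)
Definition evpoly u : Prop :=
  exists k n0, forall n, (n0 <= n)%N -> iter k fdiff u n = 0.

Lemma iter_fdiffS k u n :
  iter k.+1 fdiff u n = iter k fdiff u n.+1 - iter k fdiff u n.
Proof. by []. Qed.

Lemma iter_fdiffD k u v n :
  iter k fdiff (fun m => u m + v m) n = iter k fdiff u n + iter k fdiff v n.
Proof. by elim: k n => // k IH n; rewrite !iter_fdiffS !IH; ring. Qed.

Lemma iter_fdiffN k u n :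
  iter k fdiff (fun m => - u m) n = - iter k fdiff u n.
Proof. by elim: k n => // k IH n; rewrite !iter_fdiffS !IH; ring. Qed.

Lemma eq_iter_fdiff k u v n0 :
  (forall n, (n0 <= n)%N -> u n = v n) ->
  forall n, (n0 <= n)%N -> iter k fdiff u n = iter k fdiff v n.
Proof.
move=> uv; elim: k => // k IH n n0n.
by rewrite !iter_fdiffS !IH // leqW.
Qed.

Lemma iter_fdiff_shift k u j n :
  (j <= n)%N -> iter k fdiff (fun m => u (m - j)%N) n = iter k fdiff u (n - j)%N.
Proof.
elim: k n => // k IH n jn.
by rewrite !iter_fdiffS !IH ?leqW // subSn.
Qed.

Lemma iter_fdiff_ev0 k l u n0 : (k <= l)%N ->
  (forall n, (n0 <= n)%N -> iter k fdiff u n = 0) ->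
  forall n, (n0 <= n)%N -> iter l fdiff u n = 0.
Proof.
move=> /subnKC <- u0; elim: (l - k)%N => [|m IH] n n0n; first by rewrite addn0 u0.
by rewrite addnS iter_fdiffS !IH ?subrr // leqW.
Qed.

Lemma evpoly_eq u v n0 :
  (forall n, (n0 <= n)%N -> u n = v n) -> evpoly v -> evpoly u.
Proof.
move=> uv [k [n1 v0]]; exists k, (maxn n0 n1) => n.
by rewrite geq_max => /andP[h0 h1]; rewrite (eq_iter_fdiff k uv) // v0.
Qed.

Lemma evpolyD u v : evpoly u -> evpoly v -> evpoly (fun n => u n + v n).
Proof.
move=> [k [n0 u0]] [l [n1 v0]]; exists (maxn k l), (maxn n0 n1) => n.
rewrite geq_max => /andP[h0 h1]; rewrite iter_fdiffD.
rewrite (iter_fdiff_ev0 (leq_maxl k l) u0) //.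
by rewrite (iter_fdiff_ev0 (leq_maxr k l) v0) // addr0.
Qed.

Lemma evpolyN u : evpoly u -> evpoly (fun n => - u n).
Proof.
by move=> [k [n0 u0]]; exists k, n0 => n h; rewrite iter_fdiffN u0 ?oppr0.
Qed.

Lemma evpoly_shift u j : evpoly u -> evpoly (fun n => u (n - j)%N).
Proof.
move=> [k [n0 u0]]; exists k, (n0 + j)%N => n h.
have jn : (j <= n)%N by apply: leq_trans h; rewrite leq_addl.
by rewrite iter_fdiff_shift // u0 // leq_subRL // addnC.
Qed.

Lemma evpoly_bigsum J (u : nat -> nat -> R) :
  (forall j, (j < J)%N -> evpoly (u j)) -> evpoly (fun n => \sum_(j < J) u j n).
Proof.
elim: J => [|J IH] uP.
  by exists 0%N, 0%N => n _ /=; rewrite big_ord0.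
apply: (@evpoly_eq _ (fun n => \sum_(j < J) u j n + u J n) 0%N).
  by move=> n _; rewrite big_ord_recr.
by apply: evpolyD; [apply: IH => j jJ; apply: uP; rewrite ltnW | exact: uP].
Qed.

Lemma evpoly_sum u : evpoly u -> evpoly (fun n => \sum_(i < n.+1) u i).
Proof.
move=> [k [n0 u0]]; exists k.+1, n0 => n n0n.
rewrite iterSr.
rewrite (@eq_iter_fdiff k _ (fun m => u m.+1) 0%N) //.
  have -> : iter k fdiff (fun m => u m.+1) n = iter k fdiff u n.+1.
    by elim: k {u0} n {n0n} => // k IH n; rewrite !iter_fdiffS !IH.
  by rewrite u0 // leqW.
by move=> m _; rewrite /fdiff big_ord_recr /=; ring.
Qed.

Lemma fdiff_ge_growth u (c : R) i n0 : 0 < c ->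
  (forall n, (n0 <= n)%N -> c * n%:R ^+ i <= fdiff u n) ->
  exists c' : R, 0 < c' /\ exists n1, forall n, (n1 <= n)%N -> c' * n%:R ^+ i.+1 <= u n.
Proof.
move=> c0 uge.
have step m p : (n0 <= m)%N -> u m + p%:R * (c * m%:R ^+ i) <= u (m + p)%N.
  move=> n0m; elim: p => [|p IH]; first by rewrite mul0r addr0 addn0.
  have h := uge (m + p)%N (leq_trans n0m (leq_addr _ _)).
  rewrite addnS /fdiff in h *.
  have : c * m%:R ^+ i <= c * (m + p)%:R ^+ i :> R.
    rewrite ler_wpM2l ?(ltW c0) // lerXn2r ?nnegrE ?ler0n // ler_nat.
    exact: leq_addr.
  by rewrite -natr1; move: h IH; lra.
(* beyond 2m one has gained at least m increments of size c m^i *)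
pose K : R := `|u n0| + 1.
have [N1 N1P] : exists N1 : nat, forall m, (N1 <= m)%N -> K <= c / 2 * m%:R.
  exists (Num.truncn (K / (c / 2))).+1 => m hm.
  rewrite mulrC -ler_pdivrMr ?divr_gt0 //.
  apply: (le_trans (ltW (truncnS_gt _))); by rewrite ler_nat.
pose c' := c / 2 / 3 ^+ i.+1.
have c'0 : 0 < c' by rewrite /c' !divr_gt0 // exprn_gt0.
have umono m : (n0 <= m)%N -> u n0 <= u m.
  move=> /subnKC <-; have := step n0 (m - n0)%N (leqnn _).
  apply: le_trans; rewrite lerDl mulr_ge0 ?ler0n // mulr_ge0 ?(ltW c0) //.
exists c'; split=> //; exists (2 * maxn (maxn n0 N1) 1)%N.+1 => n hn.
set m := (n %/ 2)%N.
have mP : (maxn (maxn n0 N1) 1 <= m)%N by rewrite /m; lia.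
move: (mP); rewrite !geq_max => /andP[/andP[n0m N1m] m1].
have n3 : (n <= 3 * m)%N by rewrite /m in m1 *; lia.
have := step m (n - m)%N n0m; rewrite subnKC; last by rewrite /m; lia.
apply: le_trans.
have h1 : m%:R * (c * m%:R ^+ i) <= (n - m)%:R * (c * m%:R ^+ i) :> R.
  rewrite ler_wpM2r ?mulr_ge0 ?(ltW c0) ?exprn_ge0 // ler_nat.
  by rewrite /m; lia.
have h2 : c' * n%:R ^+ i.+1 <= c / 2 * m%:R ^+ i.+1.
  rewrite /c' -mulrA ler_wpM2l ?divr_ge0 ?(ltW c0) //.
  rewrite mulrC ler_pdivrMr ?exprn_gt0 // -exprMn lerXn2r ?nnegrE //.
  by rewrite -natrM ler_nat mulnC.
have h3 : - u m <= c / 2 * m%:R ^+ i.+1.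
  apply: (@le_trans _ _ (c / 2 * m%:R)).
    apply: le_trans (N1P _ N1m); rewrite /K.
    have := umono _ n0m; have := ler_norm (- u n0); rewrite normrN; lra.
  rewrite ler_wpM2l ?divr_ge0 ?(ltW c0) // exprS ler_peMr //.
  by rewrite -natrX ler1n expn_gt0 m1.
have h4 : m%:R * (c * m%:R ^+ i) = c * m%:R ^+ i.+1 by rewrite exprS; ring.
by move: h1 h2 h3 h4; lra.
Qed.

Lemma iter_fdiff_ge_growth j u (c : R) n0 : 0 < c ->
  (forall n, (n0 <= n)%N -> c <= iter j fdiff u n) ->
  exists c' : R, 0 < c' /\ exists n1, forall n, (n1 <= n)%N -> c' * n%:R ^+ j <= u n.
Proof.
move=> c0 uge.
suff H i : (i <= j)%N -> exists c' : R, 0 < c' /\ exists n1, forall n, (n1 <= n)%N ->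
    c' * n%:R ^+ i <= iter (j - i) fdiff u n.
  by have := H j (leqnn _); rewrite subnn.
elim: i => [|i IH] ij.
  by exists c; split=> //; exists n0 => n /uge; rewrite expr0 mulr1 subn0.
have [c1 [c10 [n1 h]]] := IH (ltnW ij).
apply: (fdiff_ge_growth c10 (n0 := n1)) => n /h.
by rewrite -subnSK.
Qed.

(** A nonzero eventually constant j-th difference forces growth of order n^j. *)
Lemma evpoly_degree h (C : R) d :
  evpoly h -> (forall n, (1 <= n)%N -> `|h n| <= C * n%:R ^+ d) ->
  exists n0, forall n, (n0 <= n)%N -> iter d.+1 fdiff h n = 0.
Proof.
move=> [k [n0 h0]] hC.
have nogrow v j c : (d < j)%N -> 0 < c ->
    (forall n, (1 <= n)%N -> `|v n| <= C * n%:R ^+ d) ->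
    (exists n1, forall n, (n1 <= n)%N -> iter j fdiff v n = c) -> False.
  move=> dj c0 vC [n1 vc].
  have [|c' [c'0 [n2 vge]]] := @iter_fdiff_ge_growth j v c n1 c0.
    by move=> n /vc ->.
  pose n := (maxn n2 (Num.truncn (C / c'))).+1.
  have n2n : (n2 <= n)%N by rewrite /n; apply: leqW; exact: leq_maxl.
  have := le_trans (vge _ n2n) (le_trans (ler_norm _) (vC n isT)).
  have np : 0 < n%:R ^+ d :> R by rewrite exprn_gt0.
  have -> : j = (d + (j - d))%N by rewrite subnKC // ltnW.
  rewrite exprD mulrCA mulrC ler_pM2r // => h1.
  have h2 : c' * n%:R <= C.
    apply: le_trans h1; rewrite ler_wpM2l ?(ltW c'0) //.
    rewrite -[leLHS]expr1 ler_weXn2l ?ler1n ?subn_gt0 //.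
  have : C / c' < n%:R.
    apply: (lt_le_trans (truncnS_gt _)); rewrite ler_nat /n ltnS; exact: leq_maxr.
  by rewrite ltr_pdivrMr // mulrC ltNge h2.
elim: k n0 h0 => [|k IH] n0 h0.
  by exists n0; apply: iter_fdiff_ev0 h0.
have [dk|kd] := ltnP d k; last by exists n0; apply: (iter_fdiff_ev0 _ h0); lia.
have hc n : (n0 <= n)%N -> iter k fdiff h n = iter k fdiff h n0.
  elim: n => [|n IHn]; first by rewrite leqn0 => /eqP ->.
  rewrite leq_eqVlt => /orP[/eqP <- //|]; rewrite ltnS => nn.
  by rewrite -(IHn nn); have := h0 _ nn; rewrite iter_fdiffS; lra.
have [c0|c0|c0] := ltrgtP (iter k fdiff h n0) 0.
- exfalso; apply: (@nogrow (fun n => - h n) k (- iter k fdiff h n0)) => //.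
  + by rewrite oppr_gt0.
  + by move=> n n1; rewrite normrN hC.
  + by exists n0 => n nn; rewrite iter_fdiffN hc.
- by exfalso; apply: (@nogrow h k (iter k fdiff h n0)) => //; exists n0.
- by apply: (IH n0) => n nn; rewrite hc.
Qed.

(** The converse estimate, by k summations. *)
Lemma fdiff_bounded k u n0 :
  (forall n, (n0 <= n)%N -> iter k.+1 fdiff u n = 0) ->
  exists C : R, forall n, `|u n| <= C * n.+1%:R ^+ k.
Proof.
elim: k u => [|k IH] u u0.
  exists (\sum_(i < n0.+1) `|u i|) => n; rewrite expr0 mulr1.
  have bd m : (m <= n0)%N -> `|u m| <= \sum_(i < n0.+1) `|u i|.
    move=> mn; rewrite (bigD1 (Ordinal (mn : (m < n0.+1)%N))) //= lerDl.
    exact: sumr_ge0.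
  have [nn|nn] := leqP n n0; first exact: bd.
  suff -> : u n = u n0 by exact: bd.
  elim: n {nn}(ltnW nn) => [|n IHn]; first by rewrite leqn0 => /eqP ->.
  rewrite leq_eqVlt => /orP[/eqP <- //|]; rewrite ltnS => nn.
  by rewrite -(IHn nn); have := u0 _ nn; rewrite iter_fdiffS /=; lra.
have [|C hC] := IH (fdiff u); first by move=> n /u0; rewrite iterSr.
have C0 : 0 <= C by have := hC 0%N; rewrite expr1n mulr1; apply: le_trans.
exists (`|u 0| + C) => n.
have : `|u n| <= `|u 0| + n%:R * (C * n.+1%:R ^+ k).
  elim: n => [|n IHn]; first by rewrite mul0r addr0.
  have -> : u n.+1 = u n + fdiff u n by rewrite /fdiff; ring.
  apply: (le_trans (ler_normD _ _)).
  have h1 := hC n.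
  have h2 : C * n.+1%:R ^+ k <= C * n.+2%:R ^+ k.
    by rewrite ler_wpM2l // lerXn2r ?nnegrE // ler_nat.
  have h3 : n%:R * (C * n.+1%:R ^+ k) <= n%:R * (C * n.+2%:R ^+ k).
    by rewrite ler_wpM2l.
  by rewrite -natr1; move: h1 h2 h3 IHn; lra.
move=> /le_trans; apply; rewrite mulrDl lerD //.
  by rewrite ler_peMr // -natrX ler1n expn_gt0.
rewrite mulrCA ler_wpM2l // exprS ler_wpM2r ?exprn_ge0 //.
by rewrite ler_nat.
Qed.

(** The growth bound caps the degree by d, so the second difference has degree at
    most d - 2: a crude bound on the size becomes a sharp one on the increments. *)
Lemma evpoly_diff2_le h (C : R) d : (2 <= d)%N ->
  evpoly h -> (forall n, (1 <= n)%N -> `|h n| <= C * n%:R ^+ d) ->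
  exists C' : R, forall n, `|h n.+2 - 2 * h n.+1 + h n| <= C' * n.+1%:R ^+ (d - 2).
Proof.
move=> d2 hP hC; have [n0 h0] := evpoly_degree hP hC.
have [|C' hC'] := @fdiff_bounded (d - 2) (fdiff (fdiff h)) n0.
  move=> n /h0; rewrite -[X in iter X _ _](_ : (d - 2).+1.+2 = d.+1); last by lia.
  by rewrite 2!iterSr.
exists C' => n; apply: le_trans (hC' n).
by rewrite le_eqVlt /fdiff; apply/orP; left; apply/eqP; congr `|_|; ring.
Qed.

End FiniteDifferences.

Section Upsets.
Implicit Types (U : set (seq nat)) (s t : seq nat).

Fixpoint expo (r n : nat) : seq (seq nat) :=
  if r is r'.+1 then
    flatten [seq [seq j :: s | s <- expo r' (n - j)] | j <- iota 0 n.+1]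
  else if n == 0%N then [:: [::]] else [::].

Lemma expoS r n :
  expo r.+1 n = flatten [seq [seq j :: s | s <- expo r (n - j)] | j <- iota 0 n.+1].
Proof. by []. Qed.

Lemma mem_expo r n s : (s \in expo r n) = (size s == r) && (sumn s == n).
Proof.
elim: r n s => [|r IH] n s.
  by case: s => [|a s] /=; case: n.
rewrite expoS; apply/flattenP/andP => [[l /mapP[j]]|[/eqP ss /eqP <-]].
  rewrite mem_iota /= add0n ltnS => jn -> /mapP[t].
  by rewrite IH => /andP[/eqP <- /eqP tn] -> /=; rewrite eqxx tn subnKC.
case: s ss => [//|j s] [ss].
have -> : sumn (j :: s) = (j + sumn s)%N by [].
exists [seq j :: t | t <- expo r (j + sumn s - j)].
  apply: (map_f (fun i => [seq i :: t | t <- expo r (j + sumn s - i)])).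
  by rewrite mem_iota add0n ltnS leq_addr.
by apply/mapP; exists s => //; rewrite IH ss eqxx addKn /=.
Qed.

Lemma uniq_expo r n : uniq (expo r n).
Proof.
elim: r n => [|r IH] n; first by case: n.
rewrite expoS; elim: (iota _ _) (iota_uniq 0 n.+1) => //= j js IHj /andP[jjs ujs].
rewrite cat_uniq IHj // andbT map_inj_uniq ?IH //=; last by move=> s t [].
apply/hasPn => s /flattenP[l /mapP[i ijs ->]] /mapP[t _ ->].
by apply/mapP => -[u _ [ij _]]; rewrite -ij ijs in jjs.
Qed.

(** The sets of exponents of monomial ideals in r variables. *)
Definition upset (r : nat) U : Prop :=
  forall s t, size s = r -> size t = r -> all2 leq s t -> U s -> U t.

Definition slice U (j : nat) : set (seq nat) := [set s | U (j :: s)].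

Lemma upset_slice r U j : upset r.+1 U -> upset r (slice U j).
Proof. by move=> uU s t ss tt st; apply: uU; rewrite /= ?ss ?tt ?leqnn. Qed.

Lemma all2_leqnn s : all2 leq s s.
Proof. by elim: s => //= a s ->; rewrite leqnn. Qed.

Lemma slice_mono r U i j s :
  upset r.+1 U -> (i <= j)%N -> size s = r -> slice U i s -> slice U j s.
Proof. by move=> uU ij ss; apply: uU; rewrite /= ?ss // ij all2_leqnn. Qed.

(** Dickson's lemma in the form of an ascending chain condition: in the slices
    of a chain indexed by (j, i), the diagonal controls all but finitely many i. *)
Lemma upset_chain r (U : nat -> set (seq nat)) :
  (forall j, upset r (U j)) ->
  (forall i j s, (i <= j)%N -> size s = r -> U i s -> U j s) ->
  exists J, forall j s, (J <= j)%N -> size s = r -> U j s -> U J s.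
Proof.
elim: r U => [|r IH] U uU mU.
  have [[J UJ]|nU] := pselect (exists J, U J [::]).
    by exists J => j [] // _ _.
  by exists 0%N => j [|//] _ _ Uj; exfalso; apply: nU; exists j.
have [|i j s ij ss|J HJ] := IH (fun i => slice (U i) i).
- by move=> j; apply: upset_slice.
- move=> h; apply: (slice_mono (uU j) ij ss).
  by apply: (mU i) => //=; rewrite ss.
have HJi i : exists K, forall j s, (K <= j)%N -> size s = r ->
    slice (U j) i s -> slice (U K) i s.
  apply: IH => [j|j k s jk ss]; first exact: upset_slice.
  by apply: mU => //=; rewrite ss.
have [K HK] := choice HJi.
exists (maxn J (\max_(i < J) K i)) => j [//|i s].
rewrite geq_max => /andP[Jj Kj] [ss] Us.
have [iJ|Ji] := ltnP i J.
  have Ki : (K i <= \max_(i < J) K i)%N by exact: (leq_bigmax (Ordinal iJ)).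
  apply: (mU (K i)); rewrite /= ?ss //; first by rewrite leq_max Ki orbT.
  by apply: (HK i j s) => //; apply: leq_trans Kj.
apply: (mU J); rewrite /= ?ss ?leq_maxl //.
apply: (uU J (J :: s)); rewrite /= ?ss ?Ji ?all2_leqnn //.
apply: (HJ (maxn i j)) => //; first by rewrite leq_max Ji.
apply: (slice_mono (uU _) (leq_maxl _ _)) => //.
by apply: (mU j); rewrite /= ?ss ?leq_maxr.
Qed.

Definition count_deg (r : nat) U (n : nat) : nat :=
  count (fun s => `[< U s >]) (expo r n).

Lemma count_degS r U n :
  count_deg r.+1 U n = (\sum_(j < n.+1) count_deg r (slice U j) (n - j))%N.
Proof.
rewrite /count_deg expoS count_flatten sumnE !big_map.
rewrite -[iota 0 n.+1]/(index_iota 0 n.+1) big_mkord.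
by apply: eq_bigr => j _; rewrite count_map.
Qed.

Lemma eq_count_deg r U U' n : (forall s, size s = r -> U s <-> U' s) ->
  count_deg r U n = count_deg r U' n.
Proof.
move=> UU'; apply: eq_in_count => s; rewrite mem_expo => /andP[/eqP ss _].
by apply: asbool_equiv_eq; exact: UU'.
Qed.

(** The Hilbert function of a monomial ideal is eventually polynomial: the
    slices by the first exponent stabilize, and the stable part contributes the
    summatory function of the Hilbert function of one slice. *)
Lemma evpoly_count_deg (R : realType) r U : upset r U ->
  evpoly (fun n => (count_deg r U n)%:R : R).
Proof.
elim: r U => [|r IH] U uU.
  by exists 0%N, 1%N => -[|n] //.
have [|i j s ij ss|J HJ] := @upset_chain r (slice U).
- by move=> j; apply: upset_slice.
- exact: (slice_mono uU).
apply: (@evpoly_eq _ _ (fun n => \sum_(j < J) (count_deg r (slice U j) (n - j))%:R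
   + \sum_(i < (n - J).+1) (count_deg r (slice U J) i)%:R) J); last first.
  apply: evpolyD.
    apply: (@evpoly_bigsum _ J (fun j n => (count_deg r (slice U j) (n - j))%:R)).
    move=> j _.
    by apply: (@evpoly_shift _ (fun n => (count_deg r (slice U j) n)%:R)); apply: IH;
       apply: upset_slice.
  pose S := fun n => \sum_(i < n.+1) (count_deg r (slice U J) i)%:R : R.
  apply: (@evpoly_shift _ S J).
  apply: (@evpoly_sum _ (fun i => (count_deg r (slice U J) i)%:R)).
  by apply: IH; apply: upset_slice.
move=> n Jn; rewrite count_degS natr_sum.
rewrite -(big_mkord xpredT (fun j => (count_deg r (slice U j) (n - j))%:R)).
rewrite (@big_cat_nat _ _ _ J) //=; last by rewrite leqW.
rewrite big_mkord; congr (_ + _).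
rewrite -{1}[J]add0n big_addn subSn // big_mkord.
rewrite (reindex_inj rev_ord_inj) /=; apply: eq_bigr => i _.
have hi : (i <= n - J)%N by rewrite -ltnS.
have -> : (n - ((n - J).+1 - i.+1 + J) = i)%N by lia.
congr (_%:R); apply: eq_count_deg => s ss; split.
  by apply: HJ => //; rewrite leq_addl.
by apply: (slice_mono uU) => //; rewrite leq_addl.
Qed.

End Upsets.

(** * Finite-dimensional spaces of functions on a set *)

Section FunctionSpaces.
Context {R : realType} {T : Type}.
Variable X : set T.
Implicit Types (f g : T -> R) (x : T).

Definition indep_on k (e : 'I_k -> T -> R) : Prop :=
  forall a : 'I_k -> R, (forall x, X x -> \sum_i a i * e i x = 0) ->
    forall i, a i = 0.

Definition span_on k (e : 'I_k -> T -> R) f : Prop :=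
  exists a : 'I_k -> R, forall x, X x -> f x = \sum_i a i * e i x.

Lemma span_on_sum k (e : 'I_k -> T -> R) (I : Type) (r : seq I) (c : I -> R)
    (g : I -> T -> R) f :
  (forall i, span_on e (g i)) ->
  (forall x, X x -> f x = \sum_(i <- r) c i * g i x) -> span_on e f.
Proof.
move=> /choice[a ag] fE; exists (fun j => \sum_(i <- r) c i * a i j) => x Xx.
rewrite fE //; under eq_bigr do rewrite ag // mulr_sumr.
rewrite exchange_big /=; apply: eq_bigr => j _.
by rewrite mulr_suml; apply: eq_bigr => i _; rewrite mulrA.
Qed.

Lemma indep_le_span m n (e : 'I_m -> T -> R) (g : 'I_n -> T -> R) :
  indep_on e -> (forall i, span_on g (e i)) -> (m <= n)%N.
Proof.
move=> ei /choice[a ag].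
have free : row_free (\matrix_(i, j) a i j).
  apply: inj_row_free => v v0; apply/rowP => i; rewrite mxE.
  apply: (ei (v 0)) => x Xx; under eq_bigr do rewrite ag // mulr_sumr.
  rewrite exchange_big /= big1 // => j _.
  have vj : \sum_l v 0 l * a l j = 0.
    by have /rowP/(_ j) := v0; rewrite !mxE => h; rewrite -[RHS]h; apply: eq_bigr => l _; rewrite mxE.
  by under eq_bigr do rewrite mulrA; rewrite -mulr_suml vj mul0r.
by rewrite -(eqP free) rank_leq_col.
Qed.

(** A basis is obtained from an independent family of maximal length. *)
Lemma exists_basis_on N (g : 'I_N -> T -> R) (W : (T -> R) -> Prop) :
  (forall f, W f -> span_on g f) ->
  exists k, exists e : 'I_k -> T -> R,
    [/\ forall i, W (e i), indep_on e & forall f, W f -> span_on e f].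
Proof.
move=> Wg.
pose P k := `[< exists e : 'I_k -> T -> R, (forall i, W (e i)) /\ indep_on e >].
have P0 : exists k, P k.
  by exists 0%N; apply/asboolP; exists (fun _ _ => 0); split=> [[]|a _ []].
have PN k : P k -> (k <= N)%N.
  move=> /asboolP[e [eW ei]]; apply: (indep_le_span ei) => i; exact/Wg.
case: (ex_maxnP P0 PN) => k /asboolP[e [eW ei]] kmax.
exists k, e; split=> // f Wf.
have [//|nf] := pselect (span_on e f).
pose e' (i : 'I_k.+1) := if unlift ord_max i is Some j then e j else f.
have e'w (j : 'I_k) : e' (widen_ord (leqnSn k) j) = e j.
  rewrite /e' (_ : widen_ord _ _ = lift ord_max j) ?liftK //.
  by apply: val_inj; rewrite /= /bump leqNgt ltn_ord.
have e'm : e' ord_max = f by rewrite /e' unlift_none.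
suff : P k.+1 by move=> /kmax; rewrite ltnn.
apply/asboolP; exists e'; split.
  by move=> i; rewrite /e'; case: unliftP.
move=> a a0.
have am : a ord_max = 0.
  apply: contrapT => /eqP am; apply: nf.
  exists (fun j => - a (widen_ord (leqnSn k) j) / a ord_max) => x Xx.
  have := a0 x Xx; rewrite big_ord_recr /= e'm => h.
  have -> : f x = - (\sum_(j < k) a (widen_ord (leqnSn k) j) * e j x) / a ord_max.
    move: h; under eq_bigr do rewrite e'w; move=> h.
    by apply: (mulfI am); rewrite mulrCA divff // mulr1; move: h; lra.
  by rewrite -sumrN mulr_suml; apply: eq_bigr => j _; ring.
have aw : forall j, a (widen_ord (leqnSn k) j) = 0.
  apply: ei => x Xx; have := a0 x Xx.
  by rewrite big_ord_recr /= am mul0r addr0; under eq_bigr do rewrite e'w.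
move=> i; have [ik|] := ltnP i k.
  by rewrite -(aw (Ordinal ik)); congr (a _); apply: val_inj.
by move=> ki; rewrite -am; congr (a _); apply: val_inj => /=;
  apply/eqP; rewrite eqn_leq ki -ltnS ltn_ord.
Qed.

(** The determinant of the values of an independent family, as a function of
    the last point, is a combination with a nonzero coefficient. *)
Lemma interpolation_points k (e : 'I_k -> T -> R) : indep_on e ->
  exists p : 'I_k -> T, (forall j, X (p j)) /\
    (\matrix_(i, j) e i (p j)) \in unitmx.
Proof.
elim: k e => [|k IH] e ei.
  by exists (fun i : 'I_0 => match i with Ordinal _ h => False_rect T (notF h) end);
     split=> [[]//|]; rewrite unitmxE det_mx00 unitr1.
have [|p [pX pU]] := IH (fun i => e (lift ord_max i)).
  move=> a a0 i.
  have := ei (fun i => oapp a 0 (unlift ord_max i)) _ (lift ord_max i).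
  rewrite liftK; apply=> x Xx; rewrite (bigD1 ord_max) //= unlift_none mul0r add0r.
  rewrite -[RHS](a0 x Xx) (reindex_onto (lift ord_max) (odflt i \o unlift ord_max)).
    apply: eq_big => [j|j _]; last by rewrite liftK.
    by rewrite /= liftK eqxx andbT eq_sym neq_lift.
  by move=> j jm /=; case: unliftP jm => [l ->//|->]; rewrite eqxx.
pose q x j := if unlift ord_max j is Some l then p l else x.
pose M x := \matrix_(i, j) e i (q x j) : 'M[R]_k.+1.
have detM x : \det (M x) = \sum_i e i x * cofactor (M x) i ord_max.
  rewrite (expand_det_col _ ord_max); apply: eq_bigr => i _.
  by rewrite mxE /q unlift_none.
have cofM x x' i : cofactor (M x) i ord_max = cofactor (M x') i ord_max.
  rewrite /cofactor; congr (_ * \det _); apply/matrixP => a b.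
  by rewrite !mxE /q liftK.
have [[x0 Xx0]|Xe] := pselect (exists x, X x); last first.
  have : (1 : R) = 0 by apply: (ei (fun=> 1) _ ord0) => x Xx; exfalso; apply: Xe; exists x.
  by move/eqP; rewrite oner_eq0.
have [[x [Xx dx]]|nx] := pselect (exists x, X x /\ \det (M x) != 0).
  exists (q x); split; last by rewrite unitmxE unitfE.
  by move=> j; rewrite /q; case: unliftP.
have c0 := ei (fun i => cofactor (M x0) i ord_max) _ ord_max.
have : cofactor (M x0) ord_max ord_max = 0.
  apply: c0 => x Xx; under eq_bigr do rewrite (cofM x0 x) mulrC.
  rewrite -detM; apply: contrapT => /eqP h; apply: nx; by exists x.
move=> /eqP; rewrite /cofactor mulf_eq0 signr_eq0 /= => /eqP d0.
move: pU; rewrite unitmxE unitfE => /eqP[].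
rewrite -[RHS]d0; congr (\det _); apply/matrixP => a b.
by rewrite !mxE /q liftK.
Qed.

(** Values at interpolation points determine the coefficients continuously, so the
    coefficients of approximations in the span are as close to each other as the
    approximations themselves. *)
Lemma span_on_closed k (e : 'I_k -> T -> R) f : indep_on e ->
  (forall eps, 0 < eps -> exists2 g, span_on e g &
      forall x, X x -> `|f x - g x| <= eps) -> span_on e f.
Proof.
move=> ei fa; have [p [pX]] := interpolation_points ei.
set M := \matrix_(i, j) _ => MU.
pose L i j := invmx M i j.
have coef (a : 'I_k -> R) i :
    a i = \sum_j (\sum_l a l * e l (p j)) * L j i.
  have : \row_l a l = (\row_l a l *m M) *m invmx M by rewrite mulmxK.
  move=> /rowP/(_ i); rewrite !mxE => ->.
  apply: eq_bigr => j _; rewrite !mxE; congr (_ * _).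
  by apply: eq_bigr => l _; rewrite !mxE.
exists (fun i => \sum_j f (p j) * L j i) => x Xx.
pose K := 1 + \sum_i (\sum_j `|L j i|) * `|e i x|.
have K0 : 0 < K.
  rewrite ltr_pwDl //; apply: sumr_ge0 => i _; apply: mulr_ge0 => //.
  exact: sumr_ge0.
apply/eqP; rewrite -subr_eq0 -normr_eq0 eq_le normr_ge0 andbT.
apply/ler_addgt0Pl => eps eps0; rewrite addr0.
have [g [a ga] fg] := fa (eps / K) (divr_gt0 eps0 K0).
have -> : f x - \sum_i (\sum_j f (p j) * L j i) * e i x =
    (f x - g x) - \sum_i (\sum_j (f (p j) - g (p j)) * L j i) * e i x.
  have -> : g x = \sum_i (\sum_j g (p j) * L j i) * e i x.
    rewrite ga //; apply: eq_bigr => i _; rewrite {1}coef; congr (_ * _).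
    by apply: eq_bigr => j _; rewrite -ga.
  rewrite -addrA -opprD -big_split /=; congr (_ - _); apply: eq_bigr => i _.
  rewrite -mulrDl -big_split /=; congr (_ * _); apply: eq_bigr => j _; ring.
apply: (le_trans (ler_normB _ _)).
have -> : eps = eps / K * K by rewrite divfK // gt_eqF.
rewrite /K mulrDr mulr1 lerD ?fg //.
apply: (le_trans (ler_norm_sum _ _ _)); rewrite mulr_sumr ler_sum // => i _.
rewrite normrM mulrA ler_wpM2r // mulr_sumr.
apply: (le_trans (ler_norm_sum _ _ _)); rewrite ler_sum // => j _.
by rewrite normrM ler_wpM2r // fg.
Qed.

End FunctionSpaces.

(** * The Hilbert function of an algebra of functions *)

Section HilbertFunction.
Context {R : realType} {T : Type}.
Variable X : set T.
Implicit Types (f g : T -> R) (x : T) (ys zs : seq (T -> R)) (s t : seq nat).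

Local Arguments expo : simpl never.

Fixpoint mon ys s x : R :=
  if (ys, s) is (y :: ys', k :: s') then y x ^+ k * mon ys' s' x else 1.

Definition lincomb ys (l : seq (R * seq nat)) x : R :=
  \sum_(p <- l) p.1 * mon ys p.2 x.

Fixpoint adds s t : seq nat :=
  if (s, t) is (a :: s', b :: t') then (a + b)%N :: adds s' t' else [::].

Fixpoint lexlt s t : bool :=
  if (s, t) is (a :: s', b :: t') then (a < b)%N || (a == b) && lexlt s' t'
  else false.

Lemma size_adds r s t : size s = r -> size t = r -> size (adds s t) = r.
Proof. by elim: r s t => [|r IH] [|a s] [|b t] //= [ss] [tt]; rewrite IH. Qed.

Lemma sumn_adds r s t : size s = r -> size t = r ->
  sumn (adds s t) = (sumn s + sumn t)%N.
Proof.
elim: r s t => [|r IH] [|a s] [|b t] //= [ss] [tt]; rewrite IH //.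
by rewrite addnACA.
Qed.

Lemma mon_adds ys s t x : size s = size ys -> size t = size ys ->
  mon ys (adds s t) x = mon ys s x * mon ys t x.
Proof.
elim: ys s t => [|y ys IH] [|a s] [|b t] //=; first by rewrite mulr1.
by move=> [ss] [tt]; rewrite IH // exprD mulrACA.
Qed.

Lemma lexlt_adds r s t w : size s = r -> size t = r -> size w = r ->
  lexlt s t -> lexlt (adds s w) (adds t w).
Proof.
elim: r s t w => [|r IH] [|a s] [|b t] [|c w] //= [ss] [tt] [ww].
by rewrite ltn_add2r eqn_add2r => /orP[->//|/andP[-> h]]; rewrite IH ?orbT.
Qed.

Lemma lexlt_irr s : lexlt s s = false.
Proof. by elim: s => //= a s ->; rewrite ltnn andbF. Qed.

Lemma lexlt_trans s t w : lexlt s t -> lexlt t w -> lexlt s w.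
Proof.
elim: s t w => [|a s IH] [|b t] [|c w] //=.
move=> /orP[ab|/andP[/eqP <- st]] /orP[bc|/andP[/eqP <- tw]].
- by rewrite (ltn_trans ab bc).
- by rewrite ab.
- by rewrite bc.
- by rewrite eqxx (IH _ _ st tw) orbT.
Qed.

Lemma lexlt_total r s t : size s = r -> size t = r ->
  [|| lexlt s t, s == t | lexlt t s].
Proof.
elim: r s t => [|r IH] [|a s] [|b t] //= [ss] [tt].
have := IH s t ss tt; rewrite eqseq_cons; by case: ltngtP => //=; rewrite ?orbT.
Qed.

Lemma count_lexlt s t (L : seq (seq nat)) : lexlt s t -> s \in L ->
  (count (lexlt^~ s) L < count (lexlt^~ t) L)%N.
Proof.
move=> st /splitPr[p1 p2].
rewrite !count_cat /= lexlt_irr st add0n add1n addnS ltnS.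
by apply: leq_add; apply: sub_count => u us; apply: lexlt_trans st.
Qed.

Section Generators.
Variable ys : seq (T -> R).
Let r := size ys.

(** The exponents of the leading monomials, for the lexicographic order, of the
    homogeneous relations between the generators. *)
Definition leading : set (seq nat) := [set s | exists l : seq (R * seq nat),
  all (fun p => [&& size p.2 == r, sumn p.2 == sumn s & lexlt p.2 s]) l /\
  forall x, X x -> mon ys s x = lincomb ys l x].

Lemma all2_leq_adds s t : size s = r -> size t = r -> all2 leq s t ->
  exists w, size w = r /\ t = adds s w.
Proof.
elim: r s t => [|k IH] [|a s] [|b t] //=; first by exists [::].
move=> [ss] [tt] /andP[ab st]; have [w [sw ->]] := IH _ _ ss tt st.
by exists ((b - a)%N :: w); rewrite /= sw subnKC.
Qed.

Lemma upset_leading : upset r leading.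
Proof.
move=> s t ss tt st [l [lP lE]].
have [w [sw ->]] := all2_leq_adds ss tt st.
exists [seq (p.1, adds p.2 w) | p <- l]; split.
  rewrite all_map; apply/allP => p /(allP lP) /= /and3P[/eqP sp /eqP np ps].
  rewrite (size_adds sp sw) eqxx !(@sumn_adds r) // np eqxx /=.
  exact: (@lexlt_adds r).
move=> x Xx; rewrite mon_adds // lE // /lincomb big_map mulr_suml.
rewrite !big_seq; apply: eq_bigr => p /(allP lP) /= /and3P[/eqP sp _ _].
by rewrite mon_adds // mulrA.
Qed.

Definition standard n : seq (seq nat) :=
  [seq s <- expo r n | ~~ `[< leading s >]].

(** The standard monomials of degree n form a basis of the restrictions to X of the
    forms of degree n in ys, whence the value of this Hilbert function. *)
Definition hilbert n : nat := size (standard n).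

Definition std_mon n (i : 'I_(hilbert n)) : T -> R :=
  mon ys (nth [::] (standard n) i).

Lemma standardP n s : s \in standard n -> [/\ size s = r, sumn s = n & ~ leading s].
Proof.
by rewrite mem_filter mem_expo => /and3P[/asboolP h /eqP ? /eqP ?].
Qed.

Lemma indep_std_mon n : indep_on X (@std_mon n).
Proof.
move=> a a0; apply: contrapT => /existsNP[i0 /eqP ai0].
(* take the largest standard monomial with a nonzero coefficient *)
pose key i := count (lexlt^~ (nth [::] (standard n) i)) (expo r n).
have [i ai imax] : exists2 i, a i != 0 & forall j, a j != 0 -> (key j <= key i)%N.
  by case: (@arg_maxnP _ i0 (fun i => a i != 0) key ai0) => i ? ?; exists i.
have st (j : 'I_(hilbert n)) : nth [::] (standard n) j \in standard n.
  exact: mem_nth.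
have key_lt (j k : 'I_(hilbert n)) : lexlt (nth [::] (standard n) j) (nth [::] (standard n) k) ->
    (key j < key k)%N.
  move=> jk; rewrite /key.
  have [sj nj _] := standardP (st j).
  have jin : nth [::] (standard n) j \in expo r n by rewrite mem_expo sj nj !eqxx.
  exact: count_lexlt.
have [si ni nlead] := standardP (st i); apply: nlead.
exists [seq (- a j / a i, nth [::] (standard n) j) |
         j <- enum 'I_(hilbert n) & (a j != 0) && (j != i)]; split.
  rewrite all_map; apply/allP => j; rewrite mem_filter /= => /andP[/andP[aj ji] _].
  have [sj nj _] := standardP (st j); rewrite sj nj ni !eqxx /=.
  have := lexlt_total sj si; case/or3P => // [/eqP e|h].
    move: ji; rewrite -val_eqE /= -(nth_uniq [::] (ltn_ord j) (ltn_ord i)).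
      by rewrite e eqxx.
    by rewrite filter_uniq // uniq_expo.
  by have := imax _ aj; rewrite leqNgt key_lt.
move=> x Xx; rewrite /lincomb big_map big_filter big_enum_cond /=.
have := a0 x Xx; rewrite (bigD1 i) //= {1}/std_mon => h.
have -> : \sum_(j | (a j != 0) && (j != i)) - a j / a i * mon ys (nth [::] (standard n) j) x
    = - (\sum_(j | j != i) a j * std_mon j x) / a i.
  rewrite -sumrN mulr_suml [RHS](bigID (fun j => a j != 0)) /=.
  rewrite [X in _ + X]big1 ?addr0.
    apply: eq_big => [j|j _]; first by rewrite andbC.
    by rewrite /std_mon; ring.
  by move=> j /andP[_ /negbNE /eqP ->]; rewrite mul0r oppr0 mul0r.
by apply: (mulfI ai); rewrite mulrCA divff // mulr1; move: h; lra.
Qed.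

(** A leading monomial is rewritten by lexicographically smaller ones, which
    terminates because there are finitely many monomials of each degree. *)
Lemma std_mon_span n s : s \in expo r n -> span_on X (@std_mon n) (mon ys s).
Proof.
have [m] := ubnP (count (lexlt^~ s) (expo r n)); elim: m s => // m IH s.
rewrite ltnS => sm sn.
have [[l [lP lE]]|nl] := pselect (leading s); last first.
  have sS : s \in standard n by rewrite mem_filter sn andbT; apply/asboolP.
  have iS : (index s (standard n) < hilbert n)%N by rewrite index_mem.
  exists (fun i => (i == Ordinal iS)%:R) => x Xx.
  rewrite (bigD1 (Ordinal iS)) //= eqxx mul1r big1 ?addr0.
    by rewrite /std_mon /= nth_index.
  by move=> j /negbTE ->; rewrite mul0r.
have lspan p : p \in l -> span_on X (@std_mon n) (mon ys p.2).
  move=> /(allP lP) /and3P[/eqP sp /eqP np ps].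
  have pin : p.2 \in expo r n.
    rewrite mem_expo sp eqxx np /=; by move: sn; rewrite mem_expo => /andP[].
  apply: IH => //; apply: leq_trans sm.
  exact: count_lexlt.
have lspan' p : span_on X (@std_mon n) (if p \in l then mon ys p.2 else cst 0).
  case: ifP => [/lspan//|_]; exists (fun=> 0) => x _.
  by rewrite big1 // => i _; rewrite mul0r.
apply: (span_on_sum (r := l) (c := fst) lspan') => x Xx.
by rewrite lE // /lincomb !big_seq; apply: eq_bigr => p ->.
Qed.

Lemma evpoly_hilbert : evpoly (fun n => (hilbert n)%:R : R).
Proof.
apply: (@evpoly_eq _ _ (fun n => (count_deg r setT n)%:R
                         + - (count_deg r leading n)%:R) 0%N).
  move=> n _; rewrite /hilbert /standard size_filter.
  have -> : count_deg r setT n = size (expo r n).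
    by rewrite -count_predT; apply: eq_count => s; apply/asboolP.
  by rewrite -(count_predC (fun s => `[< leading s >])) natrD /count_deg; ring.
apply: evpolyD; first by apply: evpoly_count_deg.
by apply/evpolyN/evpoly_count_deg/upset_leading.
Qed.

End Generators.

Lemma leq_expn_base d m n : (m <= n)%N -> (m ^ d <= n ^ d)%N.
Proof. by case: d => // d mn; rewrite leq_exp2r. Qed.

Lemma size_expo d n : (size (expo d.+1 n) <= n.+1 ^ d)%N.
Proof.
elim: d n => [|d IH] n.
  rewrite expn0; apply: (@uniq_leq_size _ (expo 1 n) [:: [:: n]] (uniq_expo _ _)) => s.
  by rewrite mem_expo; case: s => [|a [|b s]] //=; rewrite addn0 inE => /eqP ->.
rewrite expoS size_flatten /shape -map_comp sumnE big_map.
rewrite -[iota 0 n.+1]/(index_iota 0 n.+1) big_mkord expnS.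
apply: (@leq_trans (\sum_(j < n.+1) n.+1 ^ d)); last first.
  by rewrite sum_nat_const card_ord.
apply: leq_sum => j _; rewrite /= size_map; apply: leq_trans (IH _) _.
by apply: leq_expn_base; rewrite ltnS leq_subr.
Qed.

(** The restrictions to X of the homogeneous polynomials of degree m in the
    functions zs. *)
Definition homspan zs m f : Prop := exists l : seq (R * seq nat),
  all (fun p => p.2 \in expo (size zs) m) l /\
  forall x, X x -> f x = lincomb zs l x.

Lemma homspanD zs m f g : homspan zs m f -> homspan zs m g ->
  homspan zs m (fun x => f x + g x).
Proof.
move=> [l [lP lE]] [k [kP kE]]; exists (l ++ k); rewrite all_cat lP kP.
by split=> // x Xx; rewrite /lincomb big_cat lE ?kE.
Qed.

Lemma homspanZ zs m (c : R) f : homspan zs m f -> homspan zs m (fun x => c * f x).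
Proof.
move=> [l [lP lE]]; exists [seq (c * p.1, p.2) | p <- l]; split.
  by rewrite all_map; apply: sub_all lP.
move=> x Xx; rewrite lE // /lincomb big_map mulr_sumr.
by apply: eq_bigr => p _; rewrite mulrA.
Qed.

Lemma homspan_sum zs m (I : Type) (s : seq I) (f : I -> T -> R) :
  (forall i, homspan zs m (f i)) -> homspan zs m (fun x => \sum_(i <- s) f i x).
Proof.
move=> fP; elim: s => [|i s IH].
  by exists [::]; split=> // x _; rewrite /lincomb !big_nil.
have [l [lP lE]] := homspanD (fP i) IH; exists l; split=> // x Xx.
by rewrite big_cons lE.
Qed.

Lemma eq_homspan zs m f g : (forall x, X x -> f x = g x) ->
  homspan zs m g -> homspan zs m f.
Proof.
by move=> fg [l [lP lE]]; exists l; split=> // x Xx; rewrite fg ?lE.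
Qed.

Lemma homspanM zs m n f g : homspan zs m f -> homspan zs n g ->
  homspan zs (m + n) (fun x => f x * g x).
Proof.
move=> [l [lP lE]] [k [kP kE]].
exists [seq (p.1 * q.1, adds p.2 q.2) | p <- l, q <- k]; split.
  apply/allP => _ /allpairsP[[p q] [/= /(allP lP) pl /(allP kP) qk ->]] /=.
  move: pl qk; rewrite !mem_expo => /andP[/eqP sp /eqP <-] /andP[/eqP sq /eqP <-].
  by rewrite (size_adds sp sq) (sumn_adds sp sq) !eqxx.
move=> x Xx; rewrite lE // kE // /lincomb big_allpairs_dep /= mulr_suml.
rewrite !big_seq; apply: eq_bigr => p /(allP lP).
rewrite mem_expo => /andP[/eqP sp _].
rewrite mulr_sumr !big_seq; apply: eq_bigr => q /(allP kP).
rewrite mem_expo => /andP[/eqP sq _].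
by rewrite mon_adds // mulrACA.
Qed.

Lemma homspan0 zs : homspan zs 0 (fun=> 1).
Proof.
exists [:: (1, nseq (size zs) 0%N)]; rewrite /= mem_expo size_nseq eqxx andbT /=.
split; first by rewrite sumn_nseq.
move=> x _; rewrite /lincomb big_seq1 mul1r.
by elim: zs => //= z zs <-; rewrite expr0 mulr1.
Qed.

Lemma homspanX zs f n : homspan zs 2 f -> homspan zs (2 * n) (fun x => f x ^+ n).
Proof.
move=> fP; elim: n => [|n IH].
  by rewrite muln0; apply: eq_homspan (homspan0 zs) => x _; rewrite expr0.
rewrite mulnS; apply: eq_homspan (homspanM fP IH) => x _; exact: exprS.
Qed.

Lemma homspan_gen zs i : (i < size zs)%N -> homspan zs 1 (nth (cst 0) zs i).
Proof.
move=> iz; exists [:: (1, mkseq (fun j => (j == i) : nat) (size zs))].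
have mE k x : mon zs (mkseq (fun j => (j + k == i)%N : nat) (size zs)) x =
    if (k <= i)%N then nth (cst 1) zs (i - k) x else 1.
  elim: zs k {iz} => [|z zs IH] k.
    by rewrite nth_nil; case: ifP.
  rewrite /mkseq /= add0n -[iota 1 _]/(iota (1 + 0) _) iotaDl -map_comp.
  rewrite (eq_map (g := fun j => (j + k.+1 == i)%N : nat)); last first.
    by move=> j /=; rewrite addnS.
  rewrite -/(mkseq _ (size zs)) IH.
  case: (ltngtP k i) => [ki|ki|->].
  - by rewrite expr0 mul1r -(subnSK ki).
  - by rewrite expr0 mul1r.
  - by rewrite subnn expr1 mulr1.
split.
  rewrite /= andbT mem_expo size_mkseq eqxx /= sumnE big_map.
  have -> : iota 0 (size zs) = index_iota 0 (size zs) by rewrite /index_iota subn0.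
  rewrite big_mkord.
  rewrite (bigD1 (Ordinal iz)) //= eqxx big1 //.
  by move=> j; rewrite -val_eqE /= => /negbTE ->.
move=> x _; rewrite /lincomb big_seq1 mul1r /=.
have := mE 0%N x; rewrite subn0 /=.
rewrite (eq_mkseq (g := fun j => (j == i) : nat)); last by move=> j; rewrite addn0.
by move=> ->; congr (_ x); apply: set_nth_default.
Qed.

(** Multiplication by q^n turns a form of degree n in the generators into a form of
    degree 2n in the d+1 functions of a chart, and the charts together lose no
    information because the functions q have no common zero. *)
Lemma hilbert_le ys d (I : finType) (q : I -> T -> R) (zs : I -> seq (T -> R)) :
  (forall x, X x -> exists i, q i x != 0) ->
  (forall i, size (zs i) = d.+1) ->
  (forall i j, (j < size ys)%N ->
     homspan (zs i) 2 (fun x => q i x * nth (cst 0) ys j x)) ->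
  forall n, (hilbert ys n <= #|I| * (2 * n).+1 ^ d)%N.
Proof.
move=> qX sz qy n.
have qmon i s : size s = size ys ->
    homspan (zs i) (2 * sumn s) (fun x => q i x ^+ sumn s * mon ys s x).
  have := qy i; move: (ys) s; elim => [|y ys' IH] [|k s] //= qyi.
    move=> _; rewrite muln0; apply: eq_homspan (homspan0 _) => x _.
    by rewrite expr0 mulr1.
  move=> [ss]; rewrite mulnDr.
  have h1 := homspanX k (qyi 0%N isT).
  have h2 := IH s (fun j jy => qyi j.+1 jy) ss.
  apply: eq_homspan (homspanM h1 h2) => x _ /=.
  by rewrite exprMn exprD; ring.
pose N := size (expo d.+1 (2 * n)).
have key (p : 'I_(hilbert ys n) * I) : exists a : 'I_N -> R, forall x, X x ->
    q p.2 x ^+ n * std_mon p.1 x = \sum_k a k * mon (zs p.2) (nth [::] (expo d.+1 (2 * n)) k) x.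
  case: p => j i /=.
  have [sj nj _] := standardP (mem_nth [::] (ltn_ord j)).
  have [l [lP lE]] := qmon i _ sj; rewrite nj sz in lP lE.
  exists (fun k => \sum_(p <- l | p.2 == nth [::] (expo d.+1 (2 * n)) k) p.1) => x Xx.
  rewrite lE // /lincomb.
  under [RHS]eq_bigr do rewrite mulr_suml big_mkcond.
  rewrite exchange_big /= !big_seq; apply: eq_bigr => p /(allP lP) pin.
  have ip : (index p.2 (expo d.+1 (2 * n)) < N)%N by rewrite index_mem.
  rewrite (bigD1 (Ordinal ip)) //= nth_index // eqxx big1 ?addr0 // => k kp.
  case: eqP => // pk; case/eqP: kp; apply: val_inj => /=.
  by rewrite pk index_uniq ?uniq_expo.
have [a aE] := choice key.
pose A := \matrix_(j < hilbert ys n, k < #|{: I * 'I_N}|)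
   a (j, (enum_val k).1) (enum_val k).2.
have free : row_free A.
  apply: inj_row_free => v v0; apply/rowP => j; rewrite mxE.
  apply: (@indep_std_mon ys n (v 0)) => x Xx; have [i qi] := qX x Xx.
  apply/eqP; rewrite -(mulrI_eq0 _ (mulfI (expf_neq0 n qi))).
  rewrite mulr_sumr; under eq_bigr => l _.
    rewrite mulrCA (aE (l, i)) // mulr_sumr /=; over.
  rewrite exchange_big big1 //= => k _.
  have vk : \sum_l v 0 l * a (l, i) k = 0.
    have /rowP/(_ (enum_rank (i, k))) := v0; rewrite !mxE => h; rewrite -[RHS]h.
    by apply: eq_bigr => l _; rewrite mxE enum_rankK.
  by under eq_bigr do rewrite mulrA; rewrite -mulr_suml vk mul0r.
have := rank_leq_col A; rewrite (eqP free) card_prod card_ord => /leq_trans; apply.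
by rewrite leq_mul2l size_expo orbT.
Qed.

Theorem hilbert_diff2_le ys d (I : finType) (q : I -> T -> R)
    (zs : I -> seq (T -> R)) : (2 <= d)%N ->
  (forall x, X x -> exists i, q i x != 0) ->
  (forall i, size (zs i) = d.+1) ->
  (forall i j, (j < size ys)%N ->
     homspan (zs i) 2 (fun x => q i x * nth (cst 0) ys j x)) ->
  exists C : R, forall n, `|(hilbert ys n.+2)%:R - 2 * (hilbert ys n.+1)%:R
      + (hilbert ys n)%:R| <= C * n.+1%:R ^+ (d - 2).
Proof.
move=> d2 qX sz qy.
apply: (evpoly_diff2_le (C := (#|I| * 3 ^ d)%:R) d2 (evpoly_hilbert ys)) => n n1.
rewrite ger0_norm // -natrX -natrM ler_nat.
apply: leq_trans (hilbert_le qX sz qy n) _; rewrite -mulnA leq_mul2l -expnMn.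
by apply/orP; right; apply: leq_expn_base; lia.
Qed.

End HilbertFunction.

(** * Second derivatives along curves *)

Section SecondDerivative.
Context {R : realType}.
Implicit Types (u v : R -> R) (t a b : R).

Definition d2 u u1 u2 : Prop :=
  (forall t, is_derive t 1 u (u1 t)) /\ (forall t, is_derive t 1 u1 (u2 t)).

Lemma d2_derive1 u u1 u2 : d2 u u1 u2 -> derive1 u = u1.
Proof. by move=> [h _]; apply/funext => t; rewrite derive1E; apply: derive_val. Qed.

Lemma d2_derive2 u u1 u2 : d2 u u1 u2 -> derive1n 2 u = u2.
Proof.
move=> h; change (derive1 (derive1 u) = u2); rewrite (d2_derive1 h).
apply/funext => t; by rewrite derive1E; apply: derive_val; case: h.
Qed.

Lemma d2_cst a : d2 (fun=> a) (fun=> 0) (fun=> 0).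
Proof. by split=> t; apply: is_derive_cst. Qed.

Lemma d2D u u1 u2 v v1 v2 : d2 u u1 u2 -> d2 v v1 v2 ->
  d2 (fun t => u t + v t) (fun t => u1 t + v1 t) (fun t => u2 t + v2 t).
Proof. by move=> [? ?] [? ?]; split=> t; apply: is_deriveD. Qed.

Lemma is_deriveM' u v t a b : is_derive t 1 u a -> is_derive t 1 v b ->
  is_derive t 1 (fun s => u s * v s) (a * v t + u t * b).
Proof.
move=> h1 h2; apply: is_derive_eq (is_deriveM h1 h2) _.
by rewrite /GRing.scale /=; ring.
Qed.

Lemma d2M u u1 u2 v v1 v2 : d2 u u1 u2 -> d2 v v1 v2 ->
  d2 (fun t => u t * v t) (fun t => u1 t * v t + u t * v1 t)
     (fun t => u2 t * v t + 2 * (u1 t * v1 t) + u t * v2 t).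
Proof.
move=> [u1P u2P] [v1P v2P]; split=> t; first exact: is_deriveM'.
apply: is_derive_eq (is_deriveD (is_deriveM' (u2P t) (v1P t)) (is_deriveM' (u1P t) (v2P t))) _.
ring.
Qed.

Lemma d2Z a u u1 u2 : d2 u u1 u2 ->
  d2 (fun t => a * u t) (fun t => a * u1 t) (fun t => a * u2 t).
Proof.
move=> uP; have [h1 h2] := d2M (d2_cst a) uP; split=> t.
  by have := h1 t; rewrite mul0r add0r.
by have := h2 t; rewrite !mul0r mulr0 !add0r; under eq_fun do rewrite mul0r add0r.
Qed.

Lemma is_derive_bigsum (I : Type) (r : seq I) (u : I -> R -> R) (a : I -> R) t :
  (forall i, is_derive t 1 (u i) (a i)) ->
  is_derive t 1 (fun s => \sum_(i <- r) u i s) (\sum_(i <- r) a i).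
Proof.
move=> uP; elim: r => [|i r IH].
  under eq_fun do rewrite big_nil.
  by rewrite big_nil; apply: is_derive_cst.
under eq_fun do rewrite big_cons.
by rewrite big_cons; apply: is_deriveD.
Qed.

Lemma d2_sum (I : Type) (r : seq I) (u u1 u2 : I -> R -> R) :
  (forall i, d2 (u i) (u1 i) (u2 i)) ->
  d2 (fun t => \sum_(i <- r) u i t) (fun t => \sum_(i <- r) u1 i t)
     (fun t => \sum_(i <- r) u2 i t).
Proof. by move=> uP; split=> t; apply: is_derive_bigsum => i; case: (uP i). Qed.

Lemma d2_at_max u u1 u2 : d2 u u1 u2 -> (forall t, u t <= u 0) -> u2 0 <= 0.
Proof.
move=> [u1P u2P] umax.
have u10 : u1 0 = 0.
  have : is_derive (0 : R) 1 u (0 : R).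
    apply: (@derive1_at_max R u (-1) 1 0).
    - lra.
    - by move=> t _; case: (u1P t).
    - by rewrite in_itv /= ltrN10 ltr01.
    - by move=> t _; exact: umax.
  by move=> [_ h]; case: (u1P 0) => _ <-.
rewrite leNgt; apply/negP => u20.
(* the derivative u1 would be positive on an interval ]0, e[ *)
have [_ [e e0 eP]] : [/\ True & exists2 e, 0 < e &
    forall t, 0 < t < e -> 0 < u1 t].
  split=> //; case: (u2P 0) => + u2v; rewrite /derivable.
  move=> /cvg_ex[/= l hl].
  have lE : l = u2 0 by rewrite -u2v; apply/esym/cvg_lim.
  move/cvgrPdist_lt : hl => /(_ (u2 0) u20); rewrite lE => -[/= e e0 he].
  exists e => // t /andP[t0 te].
  have := he t; rewrite /ball_ /= sub0r normrN gtr0_norm // => /(_ te).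
  move=> /(_ (lt0r_neq0 t0)); rewrite /GRing.scale /= mulr1 addr0 u10 subr0.
  rewrite ltr_norml => /andP[_ h]; have {}h : 0 < t^-1 * u1 t by move: h; lra.
  by move: h; rewrite pmulr_rgt0 // invr_gt0.
have e2 : 0 < e / 2 by rewrite divr_gt0.
have [|t] := @MVT R u u1 0 (e / 2) e2 (fun t _ => u1P t).
  apply: derivable_within_continuous => t _; exact: (ex_derive (is_derive := u1P t)).
rewrite in_itv /= => /andP[t0 te]; rewrite subr0 => h.
have := umax (e / 2); apply/negP; rewrite -ltNge -subr_gt0 h mulr_gt0 // eP //.
by rewrite t0 /=; lra.
Qed.

End SecondDerivative.

(** * The Laplace-Beltrami operator on polynomial functions *)

Section Laplacian.
Context {R : realType} {p q : nat}.
Local Notation V := 'M[R]_(p, q).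
Local Arguments derive1n : simpl never.
Variables (X : set V) (d : nat).
Implicit Types (x v : V) (c : R -> V) (f g F : V -> R) (cs : 'I_d -> R -> V).

Lemma geodesic_coord c i j : geodesic X c ->
  d2 (fun t => c t i j) (fun t => derive1 c t i j) (fun t => derive1n 2 c t i j).
Proof.
move=> [_ c1 c2 _]; split=> t.
  apply: DeriveDef; first by have /derivable_mxP := c1 t.
  by rewrite derive1E derive_mx // mxE.
apply: DeriveDef; first by have /derivable_mxP := c2 t.
by rewrite -[derive1n 2 c]/(derive1 (derive1 c)) derive1E derive_mx // mxE.
Qed.

Lemma is_derive_comp_curve F c t : differentiable F (c t) -> derivable c t 1 ->
  is_derive t 1 (F \o c)
    (\sum_i \sum_j derive1 c t i j * 'D_(delta_mx i j) F (c t)).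
Proof.
move=> dF /derivable1_diffP dc.
have dFc : differentiable (F \o c) t by apply: differentiable_comp.
apply: DeriveDef; first exact: diff_derivable.
rewrite deriveE // diff_comp //= -derive1E' //.
rewrite [in LHS](matrix_sum_delta (derive1 c t)) linear_sum; apply: eq_bigr => i _.
rewrite linear_sum; apply: eq_bigr => j _.
by rewrite linearZ deriveE.
Qed.

Lemma smooth_differentiable F x : smooth F -> differentiable F x.
Proof. by move=> /(_ [::] x). Qed.

Lemma smooth_derive F v : smooth F -> smooth ('D_v F).
Proof. by move=> h vs x; have := h (rcons vs v) x; rewrite foldr_rcons. Qed.

Lemma smooth_d2 F c : smooth F -> geodesic X c -> exists u1 u2, d2 (F \o c) u1 u2.
Proof.
move=> sF gc; have [_ c1 c2 _] := gc.
exists (fun t => \sum_i \sum_j derive1 c t i j * 'D_(delta_mx i j) F (c t)).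
exists (fun t => \sum_i \sum_j (derive1n 2 c t i j * 'D_(delta_mx i j) F (c t) +
   derive1 c t i j * \sum_k \sum_l derive1 c t k l *
      'D_(delta_mx k l) ('D_(delta_mx i j) F) (c t))).
split=> t; first by apply: is_derive_comp_curve => //; apply: smooth_differentiable.
rewrite /=; apply: is_derive_bigsum => i; apply: is_derive_bigsum => j.
have [_ hc2] := geodesic_coord i j gc.
have hF : is_derive t 1 ('D_(delta_mx i j) F \o c)
    (\sum_k \sum_l derive1 c t k l * 'D_(delta_mx k l) ('D_(delta_mx i j) F) (c t)).
  apply: is_derive_comp_curve => //.
  exact/smooth_differentiable/smooth_derive.
exact: is_deriveM'.
Qed.

Lemma smooth_on_d2 f c : smooth_on X f -> geodesic X c ->
  exists u1 u2, d2 (f \o c) u1 u2.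
Proof.
move=> [F sF fF] gc; have [cX _ _ _] := gc.
rewrite (_ : f \o c = F \o c); first exact: smooth_d2.
by apply/funext => t /=; rewrite fF.
Qed.

Lemma derive_lin (a b : R) F G x v : derivable F x v -> derivable G x v ->
  'D_v (fun y => a * F y + b * G y) x = a * 'D_v F x + b * 'D_v G x.
Proof.
move=> dF dG.
have -> : (fun y => a * F y + b * G y) = a *: F + b *: G by apply/funext.
rewrite deriveD; [by rewrite (deriveZ _ dF) (deriveZ _ dG) | exact: derivableZ | exact: derivableZ].
Qed.

Lemma smooth_lin (a b : R) F G : smooth F -> smooth G ->
  smooth (fun x => a * F x + b * G x).
Proof.
move=> sF sG vs; suff [E D] : foldr (fun v G => 'D_v G) (fun x => a * F x + b * G x) vs
    = (fun x => a * foldr (fun v G => 'D_v G) F vs x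
              + b * foldr (fun v G => 'D_v G) G vs x) /\
   forall x, differentiable (foldr (fun v G => 'D_v G) (fun x => a * F x + b * G x) vs) x.
  exact: D.
have diffl (f g : V -> R) x : differentiable f x -> differentiable g x ->
    differentiable (fun x => a * f x + b * g x) x.
  by move=> df dg; apply: differentiableD; apply: (differentiableM (differentiable_cst _ _)).
elim: vs => [|v vs [IH _]] /=.
  by split=> // x; apply: diffl; [have := sF [::] x|have := sG [::] x].
have E : 'D_v (foldr (fun v G => 'D_v G) (fun x => a * F x + b * G x) vs)
    = (fun x => a * 'D_v (foldr (fun v G => 'D_v G) F vs) x
              + b * 'D_v (foldr (fun v G => 'D_v G) G vs) x).
  rewrite IH; apply/funext => x.
  have dF : derivable _ x v := diff_derivable (sF vs x).
  have dG : derivable _ x v := diff_derivable (sG vs x).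
  exact: derive_lin.
split=> // x; rewrite E; apply: diffl.
  by have := sF (v :: vs) x.
by have := sG (v :: vs) x.
Qed.

Lemma smooth_on_lin (a b : R) f g : smooth_on X f -> smooth_on X g ->
  smooth_on X (fun x => a * f x + b * g x).
Proof.
move=> [F sF fF] [G sG gG]; exists (fun x => a * F x + b * G x); first exact: smooth_lin.
by move=> x Xx; rewrite fF ?gG.
Qed.

Lemma laplace_beltrami_lin (a b : R) f g x k l : smooth_on X f -> smooth_on X g ->
  laplace_beltrami X d f x k -> laplace_beltrami X d g x l ->
  laplace_beltrami X d (fun x => a * f x + b * g x) x (a * k + b * l).
Proof.
move=> sf sg lf lg c gc c0 co.
rewrite -(lf c) // -(lg c) // !mulr_sumr -big_split /=; apply: eq_bigr => i _.
have [f1 [f2 fP]] := smooth_on_d2 sf (gc i).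
have [g1 [g2 gP]] := smooth_on_d2 sg (gc i).
rewrite (d2_derive2 fP) (d2_derive2 gP).
by rewrite (d2_derive2 (d2D (d2Z a fP) (d2Z b gP))).
Qed.

Local Notation eig := (@eigenspace_LB R p q X d).

Lemma eigenspace_lin (a b mu : R) f g : eig mu f -> eig mu g ->
  eig mu (fun x => a * f x + b * g x).
Proof.
move=> [sf ef] [sg eg]; split; first exact: smooth_on_lin.
move=> x Xx; have -> : - (mu * (a * f x + b * g x)) =
  a * - (mu * f x) + b * - (mu * g x) by ring.
by apply: laplace_beltrami_lin => //; [apply: ef | apply: eg].
Qed.

(** The polynomial functions of degree at most n, generated by operations along
    which derivatives are easily followed. *)
Inductive Pol : nat -> (V -> R) -> Prop :=
| Pol_cst n (a : R) : Pol n (fun=> a)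
| Pol_add n f g : Pol n f -> Pol n g -> Pol n (fun x => f x + g x)
| Pol_scale n a f : Pol n f -> Pol n (fun x => a * f x)
| Pol_coord n i j f : Pol n f -> Pol n.+1 (fun x => x i j * f x)
| Pol_weak n f : Pol n f -> Pol n.+1 f.

Lemma Pol_leq n m f : (n <= m)%N -> Pol n f -> Pol m f.
Proof.
move=> /subnKC <-; elim: (m - n)%N => [|k IH] fP; first by rewrite addn0.
by rewrite addnS; apply/Pol_weak/IH.
Qed.

Lemma Pol_lin n (a b : R) f g : Pol n f -> Pol n g -> Pol n (fun x => a * f x + b * g x).
Proof. by move=> fP gP; apply: Pol_add; apply: Pol_scale. Qed.

Lemma Pol_sum n (I : Type) (r : seq I) (f : I -> V -> R) :
  (forall i, Pol n (f i)) -> Pol n (fun x => \sum_(i <- r) f i x).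
Proof.
move=> fP; elim: r => [|i r IH].
  by under eq_fun do rewrite big_nil; exact: Pol_cst.
by under eq_fun do rewrite big_cons; exact: Pol_add.
Qed.

Lemma Pol_coord1 i j : Pol 1 (fun x => x i j).
Proof.
have := Pol_coord i j (Pol_cst 0 1); by under eq_fun do rewrite mulr1.
Qed.

Lemma PolM n m f g : Pol n f -> Pol m g -> Pol (n + m) (fun x => f x * g x).
Proof.
move=> fP gP; elim: n f / fP => [n a|n f1 f2 _ h1 _ h2|n a f1 _ h1|n i j f1 _ h1|n f1 _ h1].
- by apply: (@Pol_leq m); [exact: leq_addl | exact: Pol_scale].
- by under eq_fun do rewrite mulrDl; exact: Pol_add.
- by under eq_fun do rewrite -mulrA; exact: Pol_scale.
- by under eq_fun do rewrite -mulrA; rewrite addSn; exact: Pol_coord.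
- by rewrite addSn; exact: Pol_weak.
Qed.

Lemma Pol_differentiable n f x : Pol n f -> differentiable f x.
Proof.
move=> fP; elim: n f / fP => [n a|n f1 f2 _ h1 _ h2|n a f1 _ h1|n i j f1 _ h1|//].
- exact: differentiable_cst.
- exact: differentiableD.
- exact: (differentiableM (differentiable_cst _ _)).
- exact: (differentiableM (differentiable_coord _ _ _)).
Qed.

Lemma Pol_derive n f v : Pol n f -> Pol n ('D_v f).
Proof.
move=> fP; elim: n f / fP => [n a|n f1 f2 p1 h1 p2 h2|n a f1 p1 h1|n i j f1 p1 h1|n f1 _ h1].
- rewrite (_ : 'D_v _ = fun=> 0); first exact: Pol_cst.
  by apply/funext => x; rewrite -[fun=> a]/(cst a) derive_cst.
- rewrite (_ : 'D_v _ = fun x => 'D_v f1 x + 'D_v f2 x); first exact: Pol_add.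
  apply/funext => x; apply: deriveD; apply: diff_derivable.
    exact: Pol_differentiable p1.
  exact: Pol_differentiable p2.
- rewrite (_ : 'D_v _ = fun x => a * 'D_v f1 x); first exact: Pol_scale.
  apply/funext => x; apply: deriveZ; apply: diff_derivable.
  exact: Pol_differentiable p1.
- rewrite (_ : 'D_v _ = fun x => x i j * 'D_v f1 x + v i j * f1 x).
    by apply: Pol_add; [exact: Pol_coord | apply/Pol_weak/Pol_scale].
  apply/funext => x; rewrite deriveM.
  + rewrite /GRing.scale /=; congr (_ + _); rewrite mulrC; congr (_ * _).
    have := @derive_mx _ _ p q (id : V -> V) x v (@derivable_id _ _ x v).
    by move=> h; have /matrixP/(_ i j) := etrans (esym h) (derive_id x v); rewrite mxE.
  + exact/diff_derivable/differentiable_coord.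
  + by apply: diff_derivable; apply: Pol_differentiable p1.
- exact: Pol_weak.
Qed.

Lemma Pol_smooth n f : Pol n f -> smooth f.
Proof.
move=> fP vs x; suff : Pol n (foldr (fun v G => 'D_v G) f vs).
  exact: Pol_differentiable.
by elim: vs => //= v vs; apply: Pol_derive.
Qed.

Lemma Pol_smooth_on n f : Pol n f -> smooth_on X f.
Proof. by move=> fP; exists f => //; apply: Pol_smooth fP. Qed.

Definition frame cs x : Prop :=
  [/\ forall i, geodesic X (cs i), forall i, cs i 0 = x &
   forall i j, dot (derive1 (cs i) 0) (derive1 (cs j) 0) = (i == j)%:R].

Variables (lam : R) (z : V) (m : 'I_p -> 'I_q -> 'I_p -> 'I_q -> V -> R).
Hypothesis lam0 : 0 < lam.
Hypothesis mP : forall i j k l, Pol 1 (m i j k l).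
(** The gradients of the coordinates: the tangent projection at x has the
    entries m(x) - x (x) x with m affine. *)
Hypothesis frame_gram : forall x cs, X x -> frame cs x -> forall i j k l,
  \sum_a derive1 (cs a) 0 i j * derive1 (cs a) 0 k l = m i j k l x - x i j * x k l.
(** The Laplacian of each coordinate function is affine. *)
Hypothesis frame_acc : forall x cs, X x -> frame cs x -> forall i j,
  \sum_a derive1n 2 (cs a) 0 i j = - lam * x i j + z i j.

Definition mu (n : nat) : R := lam * n%:R + n%:R * (n%:R - 1).

Definition Pol_lt n f : Prop := if n is n'.+1 then Pol n' f else f = (fun=> 0).

Lemma Pol_lt_weak n f : Pol_lt n f -> Pol n f.
Proof. by case: n => [->|n]; [exact: Pol_cst | exact: Pol_weak]. Qed.

(** The top degree part of the Laplacian is scalar, because the gradients of the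
    coordinates are - x (x) x up to affine terms. *)
Lemma Pol_frame n f : Pol n f -> exists (r : 'I_p -> 'I_q -> V -> R) (s : V -> R),
  [/\ forall i j, Pol n (r i j), Pol_lt n s &
  forall x cs, X x -> frame cs x -> exists u1 u2 : 'I_d -> R -> R,
   [/\ forall a, d2 (f \o cs a) (u1 a) (u2 a),
       forall i j, \sum_a derive1 (cs a) 0 i j * u1 a 0 =
                   - (n%:R * x i j * f x) + r i j x &
       \sum_a u2 a 0 = - (mu n * f x) + s x]].
Proof.
move=> fP; elim: n f / fP => [n a|n f1 f2 p1 h1 p2 h2|n a f1 p1 h1|n i j f1 p1 h1|n f1 p1 h1].
- exists (fun i j x => n%:R * x i j * a), (if n is 0 then fun=> 0 else fun=> mu n * a).
  split.
  + case: n => [|n] i j.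
      by under eq_fun do rewrite !mul0r; exact: Pol_cst.
    under eq_fun do rewrite -mulrA mulrCA.
    exact/Pol_coord/Pol_cst.
  + by case: n => [//|n]; exact: Pol_cst.
  move=> x cs Xx fr; exists (fun _ _ => 0), (fun _ _ => 0); split.
  + by move=> b; exact: d2_cst.
  + by move=> i j; rewrite big1 ?addNr // => b _; rewrite mulr0.
  + rewrite big1 //; case: n => [|n]; last by rewrite addNr.
    by rewrite /mu; ring.
- have [r1 [s1 [r1P s1P H1]]] := h1; have [r2 [s2 [r2P s2P H2]]] := h2.
  exists (fun i j x => r1 i j x + r2 i j x), (fun x => s1 x + s2 x); split.
  + by move=> i j; exact: Pol_add.
  + case: n {p1 p2 h1 h2 r1P r2P H1 H2} s1P s2P => [-> ->|n] /=; last exact: Pol_add.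
    by apply/funext => x; rewrite addr0.
  move=> x cs Xx fr.
  have [u1 [u2 [uP uG uL]]] := H1 x cs Xx fr.
  have [v1 [v2 [vP vG vL]]] := H2 x cs Xx fr.
  exists (fun a t => u1 a t + v1 a t), (fun a t => u2 a t + v2 a t); split.
  + by move=> a; exact: (d2D (uP a) (vP a)).
  + by move=> i j; under eq_bigr do rewrite mulrDr; rewrite big_split /= uG vG; ring.
  + by rewrite big_split /= uL vL; ring.
- have [r1 [s1 [r1P s1P H1]]] := h1.
  exists (fun i j x => a * r1 i j x), (fun x => a * s1 x); split.
  + by move=> i j; exact: Pol_scale.
  + case: n {p1 h1 r1P H1} s1P => [->|n] /=; last exact: Pol_scale.
    by apply/funext => x; rewrite mulr0.
  move=> x cs Xx fr; have [u1 [u2 [uP uG uL]]] := H1 x cs Xx fr.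
  exists (fun b t => a * u1 b t), (fun b t => a * u2 b t); split.
  + by move=> b; exact: (d2Z a (uP b)).
  + by move=> i j; under eq_bigr do rewrite mulrCA; rewrite -mulr_sumr uG; ring.
  + by rewrite -mulr_sumr uL; ring.
- have [r1 [s1 [r1P s1P H1]]] := h1.
  exists (fun k l x => x i j * r1 k l x + m i j k l x * f1 x).
  exists (fun x => (x i j * s1 x + 2 * r1 i j x) + z i j * f1 x); split.
  + move=> k l; apply: Pol_add; first exact: Pol_coord.
    by rewrite -add1n; exact: PolM.
  + rewrite /=; apply: Pol_add; last exact: Pol_scale.
    apply: Pol_add; last exact: Pol_scale.
    case: n {p1 h1 r1P H1} s1P => [->|n s1P]; last exact: Pol_coord.
    by under eq_fun do rewrite mulr0; exact: Pol_cst.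
  move=> x cs Xx fr; have [u1 [u2 [uP uG uL]]] := H1 x cs Xx fr.
  have [gc c0 _] := fr.
  exists (fun a t => derive1 (cs a) t i j * f1 (cs a t) + cs a t i j * u1 a t).
  exists (fun a t => derive1n 2 (cs a) t i j * f1 (cs a t)
     + 2 * (derive1 (cs a) t i j * u1 a t) + cs a t i j * u2 a t); split.
  + by move=> a; apply: (d2M (geodesic_coord i j (gc a)) (uP a)).
  + move=> k l; under eq_bigr do rewrite c0 mulrDr mulrA [X in _ + X]mulrCA.
    rewrite big_split /= -mulr_suml -mulr_sumr uG.
    under [X in X * f1 x + _]eq_bigr do rewrite mulrC.
    by rewrite (frame_gram Xx fr) -natr1; ring.
  + under eq_bigr do rewrite c0; rewrite !big_split /= -mulr_suml -!mulr_sumr.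
    by rewrite (frame_acc Xx fr) uG uL /mu -natr1; ring.
- have [r1 [s1 [r1P s1P H1]]] := h1.
  exists (fun i j x => x i j * f1 x + r1 i j x), (fun x => (mu n.+1 - mu n) * f1 x + s1 x).
  split.
  + by move=> i j; apply: Pol_add; [exact: Pol_coord | exact: Pol_weak].
  + by apply: Pol_add; [exact: Pol_scale | exact: Pol_lt_weak].
  move=> x cs Xx fr; have [u1 [u2 [uP uG uL]]] := H1 x cs Xx fr.
  exists u1, u2; split=> //.
  + by move=> i j; rewrite uG -natr1; ring.
  + by rewrite uL; ring.
Qed.

Lemma mu_homo : {homo mu : i j / (i < j)%N >-> i < j}.
Proof.
apply: homo_ltn; first exact: lt_trans.
move=> n; rewrite -subr_gt0.
have -> : mu n.+1 - mu n = lam + 2 * n%:R by rewrite /mu -natr1; ring.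
by rewrite ltr_pwDl // mulr_ge0.
Qed.

Lemma mu_inj i j : mu i = mu j -> i = j.
Proof.
by move=> e; case: (ltngtP i j) => // /mu_homo; rewrite e ltxx.
Qed.

(** The Laplacian of f is - mu n * f up to a polynomial s of lower degree.  If s is
    the sum of the eigenfunctions g i, then f minus the sum of the functions
    g i / (mu n - mu i) has eigenvalue mu n. *)
Lemma Pol_lt_decomposition k f : Pol_lt k f -> exists g : nat -> V -> R,
  [/\ forall i, Pol i (g i), forall i, eig (mu i) (g i) &
      forall x, X x -> f x = \sum_(i < k) g i x].
Proof.
have eig0 l : eig l (fun=> 0).
  split; first exact/Pol_smooth_on/(Pol_cst 0).
  move=> x Xx cs _ _ _; rewrite mulr0 oppr0 big1 // => a _.
  by rewrite (d2_derive2 (d2_cst 0)).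
elim: k f => [|k IH] f.
  move=> ->; exists (fun _ _ => 0); split=> [i|i|x _]; [exact: Pol_cst|exact: eig0|].
  by rewrite big_ord0.
move=> fP; rewrite /= in fP; have [r [s [_ sP H]]] := Pol_frame fP.
have [g [gP ge sg]] := IH s sP.
pose h := fun x => 1 * f x + (- 1) * \sum_(i < k) (mu k - mu i)^-1 * g i x.
have hP : Pol k h.
  apply: Pol_lin => //; apply: Pol_sum => i; apply: Pol_scale.
  by apply: Pol_leq (gP i); rewrite ltnW.
have sumP : smooth_on X (fun x => \sum_(i < k) (mu k - mu i)^-1 * g i x) /\
   forall x, X x -> laplace_beltrami X d (fun x => \sum_(i < k) (mu k - mu i)^-1 * g i x)
     x (\sum_(i < k) (mu k - mu i)^-1 * - (mu i * g i x)).
  split.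
    apply: (@Pol_smooth_on k); apply: Pol_sum => i; apply: Pol_scale.
    by apply: Pol_leq (gP i); rewrite ltnW.
  move=> x Xx cs gc c0 co.
  rewrite (eq_bigr (fun a => \sum_(i < k) (mu k - mu i)^-1 * derive1n 2 (g i \o cs a) 0)).
    rewrite exchange_big; apply: eq_bigr => i _ /=; rewrite -mulr_sumr; congr (_ * _).
    by have [_ ei] := ge i; apply: ei.
  move=> a _; have gd i : exists u, d2 (g i \o cs a) u.1 u.2.
    have [u1 [u2 uP]] := smooth_on_d2 (ge i).1 (gc a).
    by exists (u1, u2).
  have [u uP] := choice gd.
  rewrite (d2_derive2 (d2_sum (index_enum 'I_k)
     (fun i => d2Z (mu k - mu (nat_of_ord i))^-1 (uP i)))).
  by apply: eq_bigr => i _; rewrite (d2_derive2 (uP i)).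
have he : eig (mu k) h.
  split; first exact: Pol_smooth_on hP.
  move=> x Xx.
  have lf : laplace_beltrami X d f x (- (mu k * f x) + s x).
    move=> cs gc c0 co; have [//|u1 [u2 [uP _ <-]]] := H x cs Xx.
    by apply: eq_bigr => a _; rewrite (d2_derive2 (uP a)).
  have := laplace_beltrami_lin 1 (- 1) (Pol_smooth_on fP) sumP.1 lf (sumP.2 x Xx).
  congr (laplace_beltrami _ _ _ _ _); rewrite sg // /h.
  rewrite !mul1r !mulN1r mulrBr -sumrN mulr_sumr -!sumrN -addrA -big_split /=.
  rewrite opprD -sumrN; congr (_ + _).
  apply: eq_bigr => i _; field.
  by rewrite subr_eq0 gt_eqF // mu_homo.
exists (fun i => if i == k then h else if (i < k)%N then
   (fun x => (mu k - mu i)^-1 * g i x) else fun=> 0).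
split.
- move=> i; case: eqP => [->//|_]; case: ifP => _; last exact: Pol_cst.
  exact: Pol_scale.
- move=> i; case: eqP => [->//|_]; case: ifP => _; last exact: eig0.
  have := eigenspace_lin (mu k - mu i)^-1 0 (ge i) (ge i).
  by congr (eigenspace_LB _ _ _ _); apply/funext => x; rewrite mul0r addr0.
- move=> x Xx; rewrite big_ord_recr /= eqxx.
  under eq_bigr => i _ do rewrite ltn_eqF ?ltn_ord //.
  by rewrite /h mul1r mulN1r addrC subrK.
Qed.

Lemma Pol_decomposition n f : Pol n f -> exists g : nat -> V -> R,
  [/\ forall i, Pol i (g i), forall i, eig (mu i) (g i) &
      forall x, X x -> f x = \sum_(i < n.+1) g i x].
Proof. exact: (@Pol_lt_decomposition n.+1). Qed.

End Laplacian.

(** * Polynomial approximation on a cube *)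

Section Bernstein.
Context {R : realType}.
Implicit Types (t : R) (g h : nat -> R) (N k : nat).

(** The mean of g over the number of successes in N Bernoulli trials with
    probability t, that is, a Bernstein polynomial; conditioning on one trial
    gives a recursion without binomial coefficients. *)
Fixpoint bern N g t : R :=
  if N is N'.+1 then (1 - t) * bern N' g t + t * bern N' (g \o S) t else g 0%N.

Lemma bern_le N g h t : 0 <= t <= 1 -> (forall k, (k <= N)%N -> g k <= h k) ->
  bern N g t <= bern N h t.
Proof.
move=> /andP[t0 t1]; elim: N g h => [|N IH] g h gh /=; first exact: gh.
apply: lerD; apply: ler_wpM2l; rewrite ?subr_ge0 //; apply: IH => k kN.
  by apply: gh; rewrite ltnW.
exact: gh.
Qed.

Lemma bernD N g h t : bern N (fun k => g k + h k) t = bern N g t + bern N h t.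
Proof. by elim: N g h => //= N IH g h; rewrite IH (IH (g \o S) (h \o S)); ring. Qed.

Lemma bernZ N (a : R) g t : bern N (fun k => a * g k) t = a * bern N g t.
Proof. by elim: N g => //= N IH g; rewrite IH (IH (g \o S)); ring. Qed.

Lemma bern_cst N (a : R) t : bern N (fun=> a) t = a.
Proof. by elim: N => //= N IH; rewrite IH; ring. Qed.

Lemma bern_norm N g t : 0 <= t <= 1 -> `|bern N g t| <= bern N (fun k => `|g k|) t.
Proof.
move=> t01; rewrite ler_norml -mulN1r -bernZ; apply/andP; split; apply: bern_le => // k _.
  by rewrite mulN1r lerNl -normrN ler_norm.
exact: ler_norm.
Qed.

Lemma bern_var N (c t : R) :
  bern N (fun k => (k%:R - c) ^+ 2) t = N%:R * (t * (1 - t)) + (N%:R * t - c) ^+ 2.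
Proof.
elim: N c => [|N IH] c /=; first by ring.
rewrite IH (_ : _ \o S = fun k => (k%:R - (c - 1)) ^+ 2).
  by rewrite IH -natr1; ring.
by apply/funext => k /=; rewrite -natr1; congr (_ ^+ 2); ring.
Qed.

End Bernstein.

Section Approximation.
Context {R : realType} {p q : nat}.
Local Notation V := 'M[R]_(p, q).
Implicit Types (x y : V) (f F : V -> R) (B t : R).

Definition cube B : set V := [set x | forall i j, `|x i j| <= B].

Lemma compact_cube B : compact (cube B).
Proof.
have cv : continuous (vec_mx : 'rV[R]_(p * q) -> V).
  move=> v; apply/(@cvgrPdist_le _ _ _ (nbhs v)) => e e0.
  apply: filterS (nbhsx_ballx v e e0) => w [_ vw].
  rewrite -linearB [leLHS]/Num.Def.normr /= mx_normrE.
  apply: bigmax_le; first exact: ltW.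
  by move=> [i j] _; rewrite !mxE /=; apply/ltW; exact: vw.
have := @rV_compact R (p * q) (fun=> `[- B, B]%classic)
  (fun=> @segment_compact R (- B) B).
move=> /(continuous_compact (continuous_subspaceT cv)).
congr compact; apply/seteqP; split => [_ [v vB <-] i j|x xB].
  by have := vB (mxvec_index i j); rewrite /= in_itv /= mxE ler_norml.
exists (mxvec x); last exact: mxvecK.
move=> k /=; rewrite in_itv /= -ler_norml.
by case/mxvec_indexP: k => i j; rewrite mxvecE.
Unshelve. all: by end_near. Qed.

Definition near_entries e x y : Prop := forall i j, `|x i j - y i j| < e.

(** Uniformly continuous and bounded on the cube. *)
Definition ucb B F : Prop :=
  (forall e : R, 0 < e -> exists2 r : R, 0 < r & forall x y, cube B x -> cube B y ->
      near_entries r x y -> `|F x - F y| <= e) /\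
  exists M : R, forall x, cube B x -> `|F x| <= M.

Lemma ball_entries x y e : 0 < e -> near_entries e x y -> ball x e y.
Proof. by move=> e0 xy; split=> // i j; exact: xy. Qed.

Lemma continuous_ucb B F : continuous F -> ucb B F.
Proof.
move=> cF; split; last first.
  have : bounded_set (F @` cube B).
    by apply/compact_bounded/continuous_compact/compact_cube/continuous_subspaceT.
  move=> /ex_strict_bound_gt0[M _ /= hM]; exists M => x Bx; apply/ltW/hM; exact: imageP.
move=> e e0.
have /compact_near_coveringP := @compact_cube B.
move=> /(_ R (at_right 0) (fun r x => forall y, ball x r y -> `|F x - F y| <= e)).
case.
- move=> x Bx; have e2 : 0 < e / 2 by rewrite divr_gt0.
  have /(@cvgrPdist_lt _ _ _ (nbhs x))/(_ _ e2)/nbhs_ballP[r /= r0 hr] := cF x.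
  have r2 : 0 < r / 2 by rewrite divr_gt0.
  near=> x' r' => y hy.
  have xx' : ball x (r / 2) x'.
    by near: x'; exact: nbhsx_ballx.
  have r'r : r' <= r / 2.
    by near: r'; exact: nbhs_right_le.
  have h1 : `|F x - F x'| < e / 2.
    by apply: hr; apply: le_ball xx'; lra.
  have h2 : `|F x - F y| < e / 2.
    apply: hr; rewrite [r]splitr; apply: ball_triangle xx' _.
    exact: le_ball hy.
  have -> : F x' - F y = (F x - F y) - (F x - F x') by ring.
  by apply: le_trans (ler_normB _ _) _; lra.
- move=> r /= r0 hr; exists (r / 2); first by rewrite /= divr_gt0.
  move=> x y Bx By xy; apply: (hr (r / 2)) => //.
  + by rewrite /ball_ /= sub0r normrN gtr0_norm; lra.
  + by rewrite divr_gt0.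
  + by apply: ball_entries => //; rewrite divr_gt0.
Unshelve. all: by end_near. Qed.

Definition upd (a : 'I_p * 'I_q) t x : V :=
  \matrix_(i, j) if (i, j) == a then t else x i j.

Lemma cube_upd B a t x : `|t| <= B -> cube B x -> cube B (upd a t x).
Proof. by move=> tB xB i j; rewrite mxE; case: ifP. Qed.

Lemma ucb_upd B F a t : `|t| <= B -> ucb B F -> ucb B (F \o upd a t).
Proof.
move=> tB [uF [M MF]]; split; last by exists M => x Bx; apply: MF; exact: cube_upd.
move=> e /uF[r r0 hr]; exists r => // x y Bx By xy; apply: hr; try exact: cube_upd.
by move=> i j; rewrite !mxE; case: ifP => // _; rewrite subrr normr0.
Qed.

Lemma Pol_bern N (f : nat -> V -> R) (t : V -> R) :
  (exists n, Pol n t) -> (forall k, (k <= N)%N -> exists n, Pol n (f k)) ->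
  exists n, Pol n (fun x => bern N (f^~ x) (t x)).
Proof.
move=> [nt tP]; elim: N f => [|N IH] f fP /=; first exact: (fP 0%N).
have [k kN|n1 h1] := IH f; first by apply: fP; rewrite ltnW.
have [k kN|n2 h2] := IH (fun k => f k.+1); first exact: fP.
have tP' : Pol nt (fun x => 1 - t x).
  have := Pol_lin 1 (- 1) (Pol_cst nt 1) tP.
  by congr Pol; apply/funext => x; ring.
exists (maxn (nt + n1) (nt + n2)); apply: Pol_add.
  by apply: Pol_leq (PolM tP' h1); exact: leq_maxl.
by apply: Pol_leq (PolM tP h2); exact: leq_maxr.
Qed.

(** Weierstrass approximation, one coordinate at a time: the Bernstein polynomial in
    one coordinate has as coefficients functions of the remaining ones. *)
Lemma Pol_approx_coords B (L : seq ('I_p * 'I_q)) F : 0 < B -> ucb B F ->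
  (forall x y, cube B x -> cube B y ->
     (forall a, a \in L -> x a.1 a.2 = y a.1 a.2) -> F x = F y) ->
  forall e : R, 0 < e -> exists2 f, exists n, Pol n f &
    forall x, cube B x -> `|F x - f x| <= e.
Proof.
move=> B0; elim: L F => [|a L IH] F uF FL e e0.
  exists (fun=> F 0); first by exists 0%N; exact: Pol_cst.
  move=> x Bx; rewrite (FL x 0) ?subrr ?normr0 ?ltW //.
  by move=> i j; rewrite mxE normr0 ltW.
have [uc [M MF]] := uF.
have M0 : 0 <= M by apply: le_trans (MF 0 _) => //= i j; rewrite mxE normr0 ltW.
have e4 : 0 < e / 4 by rewrite divr_gt0.
have [r r0 hr] := uc _ e4.
(* the number N of nodes makes the variance term small *)
pose K := 2 * M / r ^+ 2 * (2 * B) ^+ 2.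
have K0 : 0 <= K by rewrite /K mulr_ge0 ?divr_ge0 ?exprn_ge0 ?mulr_ge0 // ltW.
pose N := (Num.truncn (K / (e / 4))).+1.
have N0 : 0 < N%:R :> R by rewrite ltr0n.
have KN : K / N%:R <= e / 4.
  by rewrite ler_pdivrMr // mulrC -ler_pdivrMr // ltW // truncnS_gt.
pose nd k : R := 2 * B * (k%:R / N%:R) - B.
have ndB k : (k <= N)%N -> `|nd k| <= B.
  move=> kN; have : 0 <= (k%:R / N%:R : R) <= 1.
    by rewrite divr_ge0 //= ler_pdivrMr // mul1r ler_nat.
  by move=> /andP[h0 h1]; rewrite /nd ler_norml; apply/andP; split; nra.
have app k : exists f, (k <= N)%N -> (exists n, Pol n f) /\
    forall x, cube B x -> `|F (upd a (nd k) x) - f x| <= e / 2.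
  have [kN|nkN] := leqP k N; last by exists (fun=> 0).
  have [|||f fP fF] := IH (F \o upd a (nd k)) _ _ (e / 2).
  - by apply: ucb_upd => //; exact: ndB.
  - move=> x y Bx By xy; apply: FL; try by apply: cube_upd => //; exact: ndB.
    move=> b; rewrite inE !mxE -surjective_pairing => /orP[/eqP ->|bL].
      by rewrite eqxx.
    by case: ifP => // _; exact: xy.
  - by rewrite divr_gt0.
  by exists f.
have [f fP] := choice app.
pose tau x := (x a.1 a.2 + B) / (2 * B).
exists (fun x => bern N (f^~ x) (tau x)).
  apply: Pol_bern => [|k kN]; last by have [] := fP k kN.
  exists 1%N; have := Pol_lin (2 * B)^-1 (1 / 2) (Pol_coord1 a.1 a.2) (Pol_cst 1 1).
  congr Pol; apply/funext => x; rewrite /tau; field; exact: lt0r_neq0.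
move=> x Bx.
have tau01 : 0 <= tau x <= 1.
  have := Bx a.1 a.2; rewrite ler_norml => /andP[h1 h2].
  have B2 : 0 < 2 * B by rewrite mulr_gt0.
  by apply/andP; split; [apply: divr_ge0; lra | rewrite ler_pdivrMr //; lra].
have -> : F x - bern N (f^~ x) (tau x) = bern N (fun k => F x - f k x) (tau x).
  have := bernD N (fun=> F x) (fun k => -1 * f k x) (tau x).
  by rewrite bernZ bern_cst mulN1r => <-; congr bern; apply/funext => k; rewrite mulN1r.
apply: (le_trans (bern_norm _ _ tau01)).
apply: (@le_trans _ _ (bern N (fun k => (e / 2 + e / 4) +
    K / N%:R ^+ 2 * (k%:R - N%:R * tau x) ^+ 2) (tau x))).
  apply: bern_le => // k kN; have [_ fF] := fP k kN.
  have -> : F x - f k x = (F (upd a (nd k) x) - f k x) + (F x - F (upd a (nd k) x)) by ring.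
  apply: (le_trans (ler_normD _ _)); rewrite -addrA lerD ?fF //.
  have Bu : cube B (upd a (nd k) x) by apply: cube_upd => //; exact: ndB.
  have diff : K / N%:R ^+ 2 * (k%:R - N%:R * tau x) ^+ 2
     = 2 * M / r ^+ 2 * (x a.1 a.2 - nd k) ^+ 2.
    rewrite /K /nd /tau; field.
    by rewrite !lt0r_neq0 ?pnatr_eq0.
  rewrite diff; have [near|far] := ltP `|x a.1 a.2 - nd k| r.
    rewrite -[X in X <= _]addr0 lerD //.
      apply: hr => // i j; rewrite !mxE; case: eqP => [ij|_]; last by rewrite subrr normr0.
      by move: near; rewrite -ij.
    by rewrite mulr_ge0 ?sqr_ge0 // divr_ge0 ?sqr_ge0 // mulr_ge0.
  rewrite -[X in X <= _]add0r; apply: lerD; first exact: ltW.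
  apply: (@le_trans _ _ (2 * M)).
    apply: le_trans (ler_normB _ _) _; have := MF _ Bx; have := MF _ Bu; lra.
  rewrite mulrAC ler_pdivlMr ?exprn_gt0 // ler_wpM2l ?mulr_ge0 //.
  by rewrite -[leRHS]real_normK ?num_real // lerXn2r ?nnegrE ?(ltW r0).
rewrite bernD bern_cst bernZ bern_var subrr expr0n addr0.
have : K / N%:R ^+ 2 * (N%:R * (tau x * (1 - tau x))) <= K / N%:R.
  have -> : K / N%:R ^+ 2 * (N%:R * (tau x * (1 - tau x))) =
     K / N%:R * (tau x * (1 - tau x)) by field; rewrite lt0r_neq0.
  rewrite -[leRHS]mulr1 ler_wpM2l ?divr_ge0 //; move: tau01 => /andP[? ?]; nra.
by move: KN; lra.
Qed.

Lemma Pol_approx (X : set V) B F : X `<=` cube B -> continuous F ->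
  forall e : R, 0 < e -> exists2 f, exists n, Pol n f & forall x, X x -> `|F x - f x| <= e.
Proof.
move=> XB cF e e0.
have XB' : X `<=` cube (`|B| + 1).
  by move=> x /XB h i j; apply: (le_trans (h i j)); have := ler_norm B; lra.
have [|||f fP fF] := @Pol_approx_coords (`|B| + 1) (enum predT) F _ _ _ e e0.
- by rewrite ltr_wpDl.
- exact: continuous_ucb.
- move=> x y _ _ xy; congr F; apply/matrixP => i j.
  by apply: (xy (i, j)); rewrite mem_enum.
by exists f => // x /XB'; exact: fF.
Qed.

End Approximation.

(** * Eigenfunctions are polynomials *)

Section Products.
Context {R : realType}.
Implicit Types (m M : nat) (K : R).

(** The power m^(-3/2) is summable, while m^2 times it tends to infinity; the
    eigenvalues grow like m^2. *)
Definition decay m : R := (Num.sqrt m.+1%:R ^+ 3)^-1.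

Lemma decay_gt0 m : 0 < decay m.
Proof. by rewrite invr_gt0 exprn_gt0 // sqrtr_gt0. Qed.

Lemma sum_decay M : \sum_(m < M) decay m <= 3.
Proof.
suff H N : \sum_(m < N.+1) decay m <= 3 - 2 / Num.sqrt N.+1%:R.
  case: M => [|M]; first by rewrite big_ord0.
  by apply: le_trans (H M) _; rewrite gerBl divr_ge0 // sqrtr_ge0.
elim: N => [|N IH].
  by rewrite big_ord_recr big_ord0 /= /decay sqrtr1 expr1n invr1; lra.
rewrite big_ord_recr /=; apply: le_trans (lerD IH (lexx _)) _.
rewrite /decay; set a := Num.sqrt N.+1%:R; set b := Num.sqrt N.+2%:R.
have a0 : 0 < a by rewrite sqrtr_gt0.
have b0 : 0 < b by rewrite sqrtr_gt0.
have ab : a <= b by rewrite ler_sqrt // ler_nat.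
have ab1 : b ^+ 2 - a ^+ 2 = 1.
  by rewrite !sqr_sqrtr ?ler0n // -[N.+2%:R]natr1; ring.
have -> : 3 - 2 / b = 3 - 2 / a + 2 * (b - a) / (a * b) by field; rewrite !gt_eqF.
rewrite lerD2l.
(* (b - a)(b + a) = 1 *)
have -> : b - a = (b + a)^-1.
  by apply: (mulfI (_ : b + a != 0)); [rewrite gt_eqF ?addr_gt0 | rewrite divff ?gt_eqF ?addr_gt0 // -ab1; ring].
rewrite -[leRHS]mulrA -invfM.
rewrite ler_pdivlMr ?mulr_gt0 ?addr_gt0 //.
rewrite mulrC ler_pdivrMr ?exprn_gt0 //.
have h1 : (b + a) * (a * b) <= (b + b) * (b * b).
  have a0' := ltW a0; have b0' := ltW b0.
  apply: ler_pM; [exact: addr_ge0|exact: mulr_ge0|by rewrite lerD2l|by rewrite ler_wpM2r].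
by move: h1; rewrite exprS expr2; lra.
Qed.

Lemma prod_1D_decay K M : 0 <= K ->
  \prod_(m < M) (1 + K * decay m) <= expR (3 * K).
Proof.
move=> K0; apply: (@le_trans _ _ (expR (\sum_(m < M) K * decay m))).
  elim: M => [|M IH]; first by rewrite !big_ord0 expR0.
  rewrite !big_ord_recr /= expRD ler_pM //; last exact: expR_ge1Dx.
    by apply: prodr_ge0 => i _; rewrite addr_ge0 // mulr_ge0 // (ltW (decay_gt0 _)).
  by rewrite addr_ge0 // mulr_ge0 // (ltW (decay_gt0 _)).
by rewrite ler_expR -mulr_sumr mulrC ler_wpM2r // sum_decay.
Qed.

Lemma decay_small K : exists m0, forall m, (m0 <= m)%N -> K * decay m <= 1 / 2.
Proof.
pose t := `|K| * 2 + 1; have t0 : 0 < t by rewrite ltr_wpDl // mulr_ge0.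
exists (Num.truncn (t ^+ 2)).+1 => m hm.
have tm : t <= Num.sqrt m.+1%:R.
  rewrite -[t]gtr0_norm // -sqrtr_sqr ler_sqrt ?ler0n //.
  apply: (le_trans (ltW (truncnS_gt _))); rewrite ler_nat; exact: leqW.
have s1 : 1 <= Num.sqrt m.+1%:R :> R.
  by rewrite -[leLHS]sqrtr1 ler_sqrt // ler1n.
apply: (@le_trans _ _ (`|K| * decay m)).
  by rewrite ler_wpM2r ?ler_norm // ltW // decay_gt0.
rewrite /decay ler_pdivrMr ?exprn_gt0 ?(lt_le_trans _ s1) //.
have : Num.sqrt m.+1%:R <= Num.sqrt m.+1%:R ^+ 3 :> R.
  by rewrite -[leLHS]expr1 ler_weXn2l.
by move: tm; rewrite /t; lra.
Qed.

(** Each factor is at least exp(- L * decay m), for a constant L that takes care of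
    the finitely many factors to which the lower bound does not apply. *)
Lemma prod_ge_decay (a : nat -> R) K : (forall m, 0 < a m) ->
  (forall m, 1 - K * decay m <= a m) ->
  exists c : R, 0 < c /\ forall M, c <= \prod_(m < M) a m.
Proof.
move=> a0 aK; have [m0 hm0] := decay_small `|K|.
pose L := 2 * `|K| + \sum_(i < m0) `|ln (a i)| / decay i.
have aL m : expR (- (L * decay m)) <= a m.
  have d0 := decay_gt0 m.
  have [mm0|m0m] := ltnP m m0.
    rewrite -[leRHS]lnK ?posrE // ler_expR lerNl.
    apply: (@le_trans _ _ `|ln (a m)|); first by rewrite -normrN ler_norm.
    rewrite -ler_pdivrMr // /L (bigD1 (Ordinal mm0)) //= addrA addrAC lerDr.
    rewrite addr_ge0 // ?mulr_ge0 //; apply: sumr_ge0 => i _.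
    by rewrite divr_ge0 // ltW // decay_gt0.
  apply: (@le_trans _ _ (1 - `|K| * decay m)); last first.
    apply: le_trans (aK m); rewrite lerD2l lerN2 ler_wpM2r ?ler_norm ?ltW //.
  set y := `|K| * decay m; have y0 : 0 <= y by rewrite mulr_ge0 // ltW.
  have y2 : y <= 1 / 2 by exact: hm0.
  apply: (@le_trans _ _ (expR (- (2 * y)))).
    rewrite ler_expR lerN2 /y mulrA ler_wpM2r ?(ltW d0) // /L lerDl.
    by apply: sumr_ge0 => i _; rewrite divr_ge0 // ltW // decay_gt0.
  rewrite expRN -[leRHS]invrK lef_pV2 ?posrE ?expR_gt0 ?invr_gt0 //; last lra.
  apply: (@le_trans _ _ (1 + 2 * y)); last exact: expR_ge1Dx.
  rewrite -[leLHS]mul1r ler_pdivrMr; nra.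
exists (expR (- (3 * L))); split; first exact: expR_gt0.
move=> M; apply: (@le_trans _ _ (expR (- \sum_(m < M) L * decay m))).
  rewrite ler_expR lerN2 -mulr_sumr mulrC ler_wpM2r ?sum_decay //.
  rewrite /L addr_ge0 ?mulr_ge0 //.
  by apply: sumr_ge0 => i _; rewrite divr_ge0 // ltW // decay_gt0.
elim: M => [|M IH]; first by rewrite !big_ord0 oppr0 expR0.
by rewrite !big_ord_recr /= opprD expRD ler_pM ?expR_ge0.
Qed.

End Products.

Section Spectrum.
Context {R : realType} {p q : nat}.
Local Notation V := 'M[R]_(p, q).
Local Arguments derive1n : simpl never.
Variables (X : set V) (d : nat) (B : R).
Implicit Types (x v : V) (f g F : V -> R) (cs : 'I_d -> R -> V) (M n N : nat).
Hypothesis closedX : closed X.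
Hypothesis boundedX : X `<=` cube B.
Hypothesis frame_ex : forall x, X x -> exists cs, frame X cs x.

Local Notation eig := (@eigenspace_LB R p q X d).

Lemma lap_sum (I : Type) (r : seq I) (a : I -> R) (g : I -> V -> R) (l : I -> V -> R) :
  (forall i, smooth_on X (g i)) ->
  (forall i x, X x -> laplace_beltrami X d (g i) x (l i x)) ->
  smooth_on X (fun x => \sum_(i <- r) a i * g i x) /\
  forall x, X x -> laplace_beltrami X d (fun x => \sum_(i <- r) a i * g i x) x
     (\sum_(i <- r) a i * l i x).
Proof.
move=> sg lg; elim: r => [|i r [sr lr]].
  under eq_fun do rewrite big_nil.
  split; first exact/Pol_smooth_on/(Pol_cst 0).
  move=> x Xx cs _ _ _; rewrite big_nil big1 // => j _.
  by rewrite (d2_derive2 (d2_cst 0)).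
have E x : \sum_(j <- i :: r) a j * g j x = a i * g i x + 1 * \sum_(j <- r) a j * g j x.
  by rewrite big_cons mul1r.
under eq_fun do rewrite E; split; first exact: smooth_on_lin.
move=> x Xx; rewrite big_cons -[X in _ + X]mul1r.
by apply: laplace_beltrami_lin => //; [exact: lg | exact: lr].
Qed.

Lemma eig_sum mu0 (I : Type) (r : seq I) (a : I -> R) (g : I -> V -> R) :
  (forall i, eig mu0 (g i)) -> eig mu0 (fun x => \sum_(i <- r) a i * g i x).
Proof.
move=> ge; have [|i x Xx|s l] := @lap_sum _ r a g (fun i x => - (mu0 * g i x)).
- by move=> i; case: (ge i).
- by case: (ge i) => _; apply.
split=> // x Xx; have := l x Xx; congr laplace_beltrami.
by rewrite mulr_sumr -sumrN; apply: eq_bigr => i _; ring.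
Qed.

Lemma eigZ mu0 (a : R) f : eig mu0 f -> eig mu0 (fun x => a * f x).
Proof.
move=> ef; have := eigenspace_lin a 0 ef ef.
by congr eigenspace_LB; apply/funext => x; rewrite mul0r addr0.
Qed.

Lemma max_principle f : smooth_on X f -> (exists x, X x) ->
  exists x0, [/\ X x0, forall x, X x -> f x <= f x0 &
    forall l, laplace_beltrami X d f x0 l -> l <= 0].
Proof.
move=> sf X0; have [F sF fF] := sf.
have cX : compact X by apply: subclosed_compact closedX (@compact_cube _ _ _ B) boundedX.
have cF : {within X, continuous F}.
  apply: continuous_subspaceT => x; apply: differentiable_continuous.
  exact: smooth_differentiable.
have [x0 Xx0 x0max] := compact_EVT_max X0 cX cF; rewrite inE in Xx0.
have fmax x : X x -> f x <= f x0.
  by move=> Xx; rewrite !fF //; apply: x0max; rewrite inE.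
exists x0; split=> // l lf; have [cs [gc c0 co]] := frame_ex Xx0.
rewrite -(lf cs) //; apply: sumr_le0 => a _.
have [u1 [u2 uP]] := smooth_on_d2 sf (gc a); rewrite (d2_derive2 uP).
by apply: (d2_at_max uP) => t /=; rewrite c0; apply: fmax; case: (gc a).
Qed.

Lemma eigenvalue_ge0 mu0 f x : eig mu0 f -> X x -> f x != 0 -> 0 <= mu0.
Proof.
move=> ef Xx fx; have [sf lf] := ef.
have [x0 [Xx0 x0max h0]] := max_principle sf (ex_intro _ x Xx).
have [f0|f0] := ltP 0 (f x0).
  by have := h0 _ (lf _ Xx0); rewrite oppr_le0 pmulr_lge0.
have [sg lg] := eigZ (-1) ef.
have [x1 [Xx1 x1max h1]] := max_principle sg (ex_intro _ x Xx).
have fx0 : f x < 0 by rewrite lt_neqAle fx (le_trans (x0max _ Xx)).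
have f1 : 0 < -1 * f x1 by apply: lt_le_trans (x1max _ Xx); lra.
by have := h1 _ (lg _ Xx1); rewrite oppr_le0 pmulr_lge0.
Qed.

(** The operator phi(- Laplacian) has norm at most C for the supremum norm on finite
    sums of eigenfunctions. *)
Definition mbound (phi : R -> R) (C : R) : Prop :=
  forall N (g : 'I_N -> V -> R) (nu : 'I_N -> R),
    (forall i, 0 <= nu i) -> (forall i, eig (nu i) (g i)) ->
  forall b : R, (forall x, X x -> `|\sum_i g i x| <= b) ->
  forall x, X x -> `|\sum_i phi (nu i) * g i x| <= C * b.

(** At a maximum x0 of G = sum g_i/(1 + delta nu_i) the Laplacian of G is
    nonpositive, so G(x0) <= G(x0) - delta Delta G(x0) = sum g_i(x0). *)
Lemma mbound_resolvent (delta : R) : 0 <= delta ->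
  mbound (fun s => (1 + delta * s)^-1) 1.
Proof.
move=> d0 N.
suff H (g : 'I_N -> V -> R) (nu : 'I_N -> R) : (forall i, 0 <= nu i) ->
    (forall i, eig (nu i) (g i)) ->
    forall b : R, (forall x, X x -> \sum_i g i x <= b) ->
    forall x, X x -> \sum_i (1 + delta * nu i)^-1 * g i x <= b.
  move=> g nu nu0 ge b gb x Xx; rewrite mul1r ler_norml; apply/andP; split; last first.
    by apply: (H g nu) => // y Xy; apply: le_trans (gb y Xy); exact: ler_norm.
  rewrite lerNl -sumrN.
  have := H (fun i y => -1 * g i y) nu nu0 (fun i => eigZ (-1) (ge i)) b _ x Xx.
  under eq_bigr do rewrite mulN1r mulrN; apply=> y Xy.
  rewrite -mulr_sumr mulN1r; apply: le_trans (gb y Xy).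
  by rewrite -normrN ler_norm.
move=> nu0 ge b gb x Xx.
have p0 i : 0 < 1 + delta * nu i by rewrite ltr_pwDl // mulr_ge0.
have [|i y Xy|s l] := @lap_sum _ (index_enum 'I_N) (fun i => (1 + delta * nu i)^-1) g
    (fun i y => - (nu i * g i y)).
- by move=> i; case: (ge i).
- by case: (ge i) => _; apply.
have [x0 [Xx0 x0max h0]] := max_principle s (ex_intro _ x Xx).
apply: le_trans (x0max x Xx) _; apply: le_trans (gb x0 Xx0).
have {}h0 := h0 _ (l _ Xx0).
have -> : \sum_i g i x0 = \sum_i (1 + delta * nu i)^-1 * g i x0
    - delta * \sum_i (1 + delta * nu i)^-1 * - (nu i * g i x0).
  rewrite mulr_sumr -sumrN -big_split /=; apply: eq_bigr => i _.
  by field; rewrite gt_eqF.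
by rewrite lerDl oppr_ge0 mulr_ge0_le0.
Qed.

Lemma mboundM phi psi (C D : R) : mbound phi C -> mbound psi D ->
  mbound (fun s => phi s * psi s) (C * D).
Proof.
move=> hp hq N g nu nu0 ge b gb x Xx.
under eq_bigr do rewrite -mulrA; rewrite -mulrA.
apply: (hp N (fun i y => psi (nu i) * g i y) nu nu0 (fun i => eigZ _ (ge i)) _ _ x Xx).
exact: hq.
Qed.

Lemma mbound_subr phi (C k : R) : 0 <= k -> mbound phi C -> mbound (fun s => phi s - k) (C + k).
Proof.
move=> k0 hp N g nu nu0 ge b gb x Xx; rewrite mulrDl.
under eq_bigr do rewrite mulrBl; rewrite sumrB -mulr_sumr.
apply: le_trans (ler_normB _ _) _; rewrite lerD ?hp //.
by rewrite normrM ger0_norm // ler_wpM2l // gb.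
Qed.

Lemma mbound1 : mbound (fun=> 1) 1.
Proof.
by move=> N g nu nu0 ge b gb x Xx; under eq_bigr do rewrite mul1r; rewrite mul1r gb.
Qed.

Lemma mbound_prod M (P : pred nat) (phi : nat -> R -> R) (C : nat -> R) :
  (forall m, 1 <= C m) -> (forall m, mbound (phi m) (C m)) ->
  mbound (fun s => \prod_(m < M | P m) phi m s) (\prod_(m < M) C m).
Proof.
move=> C1 hp; elim: M => [|M IH].
  rewrite big_ord0; under eq_fun do rewrite big_ord0; exact: mbound1.
rewrite big_ord_recr /=.
have -> : (fun s => \prod_(m < M.+1 | P m) phi m s) = (fun s =>
    (\prod_(m < M | P m) phi m s) * (if P M then phi M s else 1)).
  by apply/funext => s; rewrite big_mkcond big_ord_recr -big_mkcond.
apply: (mboundM IH (psi := fun s => if P M then phi M s else 1)).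
case: (P M) => //; move=> N g nu nu0 ge b gb x Xx; apply: le_trans (mbound1 nu0 ge gb Xx) _.
rewrite ler_wpM2r //; exact: le_trans (gb x Xx).
Qed.

Variable lam : R.
Hypothesis lam0 : 0 < lam.
Local Notation mu := (mu lam).

Lemma mu_ge0 n : 0 <= mu n.
Proof.
rewrite /mu; case: n => [|n]; rewrite ?mulr0 ?mul0r ?addr0 //.
by rewrite -natr1 addrK addr_ge0 ?mulr_ge0 // ltW.
Qed.


Lemma mu_quadratic : exists c : R, 0 < c /\
  forall m, (1 <= m)%N -> c * m.+1%:R ^+ 2 <= mu m.
Proof.
exists (Num.min (lam / 4) (1 / 9)); split.
  by rewrite lt_min !divr_gt0.
set c := Num.min _ _; have c1 : c <= lam / 4 by rewrite ge_min lexx.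
have c2 : c <= 1 / 9 by rewrite ge_min lexx orbT.
move=> [//|[|m]] _.
  by rewrite /mu; clearbody c; lra.
rewrite /mu -!natr1; have m0 : 0 <= m%:R :> R by [].
move: lam0 m0 c2 c1; set l := lam; set x := m%:R; clearbody c l x => l0 x0 c2 c1.
by nra.
Qed.

Definition qf m : R := (1 + decay m * mu m)^-1 ^+ 3.

(** A multiplier vanishing at mu m, of norm 1 + O(m^(-3/2)), and which is
    1 - O(m^(-3/2)) at any fixed point. *)
Definition phi m (s : R) : R := (1 + decay m * s)^-1 ^+ 3 - qf m.

Lemma decay_mu_ge0 m (s : R) : 0 <= s -> 0 < 1 + decay m * s.
Proof. by move=> s0; rewrite ltr_pwDl // mulr_ge0 // ltW // decay_gt0. Qed.

Lemma qf_ge0 m : 0 <= qf m.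
Proof. by rewrite exprn_ge0 // invr_ge0 ltW // decay_mu_ge0 // mu_ge0. Qed.

Lemma qf_le : exists K : R, 0 <= K /\ forall m, qf m <= K * decay m.
Proof.
have [c [c0 hc]] := mu_quadratic.
exists (Num.max 1 (c^-1 ^+ 3)); split; first by rewrite le_max ler01.
move=> [|m].
  rewrite /qf /mu /decay sqrtr1 expr1n invr1 !mulr0 mul0r addr0 mulr0 addr0 invr1 expr1n mulr1.
  by rewrite le_max lexx.
set s := Num.sqrt m.+2%:R : R; have s0 : 0 < s by rewrite sqrtr_gt0.
have s2 : m.+2%:R = s ^+ 2 :> R by rewrite sqr_sqrtr.
have h : c * s <= decay m.+1 * mu m.+1.
  rewrite [leRHS]mulrC /decay -/s ler_pdivlMr ?exprn_gt0 //.
  by apply: le_trans (hc m.+1 isT); rewrite s2 le_eqVlt; apply/orP; left; apply/eqP; ring.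
apply: (@le_trans _ _ (c^-1 ^+ 3 * decay m.+1)); last first.
  by rewrite ler_wpM2r ?le_max ?lexx ?orbT // ltW // decay_gt0.
have cs0 : 0 < c * s by rewrite mulr_gt0.
rewrite [X in _ <= _ * X]/decay -/s -exprVn -exprMn -invfM.
apply: lerXn2r; rewrite ?nnegrE ?invr_ge0 ?(ltW cs0) //.
  by rewrite ltW // decay_mu_ge0 // mu_ge0.
rewrite lef_pV2 ?posrE ?decay_mu_ge0 ?mu_ge0 //.
by apply: le_trans h _; rewrite lerDr.
Qed.

Lemma mbound_phi m : mbound (phi m) (1 + qf m).
Proof.
apply: mbound_subr; first exact: qf_ge0.
have h := mbound_resolvent (ltW (decay_gt0 m)).
have := mboundM h (mboundM h h); rewrite !mulr1.
by congr mbound; apply/funext => s; rewrite !exprS expr0 mulr1.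
Qed.

Lemma phi_ge m (s : R) : 0 <= s -> 1 - 3 * (decay m * s) - qf m <= phi m s.
Proof.
move=> s0; rewrite /phi lerD2r; have := decay_mu_ge0 m s0.
have : 0 <= decay m * s by rewrite mulr_ge0 // ltW // decay_gt0.
set t := decay m * s => t0 t1; set y := (1 + t)^-1.
have y0 : 0 < y by rewrite invr_gt0.
have yt : y * t = 1 - y.
  by rewrite -[X in X - y](mulVf (lt0r_neq0 t1)) -/y; ring.
rewrite -subr_ge0 -(pmulr_rge0 _ y0).
have -> : y * (y ^+ 3 - (1 - 3 * t)) = (y - 1) ^+ 2 * (y ^+ 2 + 2 * y + 3).
  have -> : y * (y ^+ 3 - (1 - 3 * t)) = y ^+ 4 - y + 3 * (y * t) by ring.
  by rewrite yt; ring.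
apply: mulr_ge0; first exact: sqr_ge0.
by have := sqr_ge0 y; lra.
Qed.

Lemma phi_mu m : phi m (mu m) = 0.
Proof. by rewrite /phi subrr. Qed.

Lemma phi_eq0 m (s : R) : 0 <= s -> phi m s = 0 -> s = mu m.
Proof.
move=> s0 /eqP; rewrite /phi /qf subr_eq0 eqrXn2 ?invr_ge0 ?ltW ?decay_mu_ge0 ?mu_ge0 //.
move=> /eqP/invr_inj/addrI/mulfI; apply; rewrite gt_eqF // decay_gt0 //.
Qed.

(** Kills the eigenvalues mu m with m < M, except s0; its norm and its value at s0
    are controlled uniformly in M because decay is summable. *)
Definition Phi M (s0 s : R) : R := \prod_(m < M | mu m != s0) phi m s.

Lemma mbound_Phi : exists C : R, forall M (s0 : R), mbound (Phi M s0) C.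
Proof.
have [K [K0 hK]] := qf_le; exists (expR (3 * K)) => M s0.
have h := @mbound_prod M (fun m => mu m != s0) phi (fun m => 1 + qf m) _ mbound_phi.
move=> N g nu nu0 ge b gb x Xx.
apply: le_trans (h _ N g nu nu0 ge b gb x Xx) _.
  by move=> m; rewrite lerDl qf_ge0.
rewrite ler_wpM2r ?(le_trans (normr_ge0 _) (gb x Xx)) //.
apply: le_trans (prod_1D_decay M K0).
by apply: ler_prod => m _; rewrite addr_ge0 ?qf_ge0 //= lerD2l hK.
Qed.

Lemma Phi_ge (s0 : R) : 0 <= s0 -> exists c : R, 0 < c /\ forall M, c <= `|Phi M s0 s0|.
Proof.
move=> s00; have [K [K0 hK]] := qf_le.
pose a m := if mu m != s0 then `|phi m s0| else 1.
have [||c [c0 hc]] := @prod_ge_decay R a (3 * s0 + K).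
- move=> m; rewrite /a; case: eqP => //= h; rewrite normr_gt0.
  by apply/eqP => /(phi_eq0 s00) e; apply: h.
- move=> m; rewrite /a; case: eqP => //= h.
    rewrite gerBl mulr_ge0 ?addr_ge0 ?mulr_ge0 //; exact/ltW/decay_gt0.
  apply: le_trans (ler_norm _); apply: le_trans (phi_ge m s00).
  by have := hK m; lra.
exists c; split=> // M; apply: le_trans (hc M) _.
by rewrite /Phi normr_prod [leRHS]big_mkcond.
Qed.

Lemma Phi_mu M (s0 : R) i : (i < M)%N -> mu i != s0 -> Phi M s0 (mu i) = 0.
Proof.
by move=> iM h; rewrite /Phi (bigD1 (Ordinal iM)) //= phi_mu mul0r.
Qed.

(** The multiplier Phi n s0 leaves only the term of eigenvalue s0. *)
Lemma eig_indep n f (g : nat -> V -> R) (s0 : R) : 0 <= s0 -> (forall i, (i < n)%N -> mu i != s0) ->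
  eig s0 f -> (forall i, eig (mu i) (g i)) ->
  (forall x, X x -> f x + \sum_(i < n) g i x = 0) -> forall x, X x -> f x = 0.
Proof.
move=> s00 hs ef eg fg x Xx; have [C hC] := mbound_Phi.
have [c [c0 hc]] := Phi_ge s00.
pose G (i : 'I_n.+1) := if unlift ord0 i is Some j then g j else f.
pose nu (i : 'I_n.+1) := if unlift ord0 i is Some j then mu j else s0.
have nu0 : nu ord0 = s0 by rewrite /nu unlift_none.
have nuS j : nu (lift ord0 j) = mu j by rewrite /nu liftK.
have G0 : G ord0 = f by rewrite /G unlift_none.
have GS j : G (lift ord0 j) = g j by rewrite /G liftK.
have h : `|\sum_i Phi n s0 (nu i) * G i x| <= C * 0.
  apply: (hC n s0) => //.
  - by move=> i; rewrite /nu; case: unliftP => // j _; exact: mu_ge0.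
  - by move=> i; rewrite /nu /G; case: unliftP => // j _.
  - by move=> y Xy; rewrite big_ord_recl G0; under eq_bigr do rewrite GS;
      rewrite fg // normr0.
move: h; rewrite mulr0 big_ord_recl nu0 G0 big1 ?addr0 => [h|j _]; last first.
  by rewrite nuS Phi_mu ?mul0r // hs.
apply/eqP; rewrite -normr_eq0 eq_le normr_ge0 andbT.
rewrite -(pmulr_rle0 _ c0).
by apply: le_trans (ler_wpM2r (normr_ge0 _) (hc n)) _; rewrite -normrM.
Qed.

Variables (z : V) (m : 'I_p -> 'I_q -> 'I_p -> 'I_q -> V -> R).
Hypothesis mP : forall i j k l, Pol 1 (m i j k l).
Hypothesis frame_gram : forall x cs, X x -> frame X cs x -> forall i j k l,
  \sum_a derive1 (cs a) 0 i j * derive1 (cs a) 0 k l = m i j k l x - x i j * x k l.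
Hypothesis frame_acc : forall x cs, X x -> frame X cs x -> forall i j,
  \sum_a derive1n 2 (cs a) 0 i j = - lam * x i j + z i j.

(** Applying a multiplier that kills every mu i != s0 to f - (a polynomial close
    to f) leaves f minus its component of eigenvalue s0. *)
Lemma eig_approx (s0 : R) f : 0 <= s0 -> eig s0 f -> forall e : R, 0 < e ->
  exists n (g : nat -> V -> R), [/\ forall i, Pol i (g i), forall i, eig (mu i) (g i) &
    forall x, X x -> `|f x - \sum_(i < n | mu i == s0) g i x| <= e].
Proof.
move=> s00 ef e e0; have [C hC] := mbound_Phi; have [c [c0 hc]] := Phi_ge s00.
have [[F sF fF] _] := ef.
have C0 : 0 < `|C| + 1 by rewrite ltr_wpDl.
have e1 : 0 < e * c / (`|C| + 1) by rewrite divr_gt0 // mulr_gt0.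
have [|P [n PP] FP] := Pol_approx (F := F) boundedX _ e1.
  by move=> x; apply: differentiable_continuous; exact: smooth_differentiable.
have [g [gP ge Pg]] := Pol_decomposition lam0 mP frame_gram frame_acc PP.
exists n.+1, g; split=> // x Xx.
pose G (i : 'I_n.+2) := if unlift ord0 i is Some j then (fun x => -1 * g j x) else f.
pose nu (i : 'I_n.+2) := if unlift ord0 i is Some j then mu j else s0.
have nu0 : nu ord0 = s0 by rewrite /nu unlift_none.
have nuS j : nu (lift ord0 j) = mu j by rewrite /nu liftK.
have G0 : G ord0 = f by rewrite /G unlift_none.
have GS j : G (lift ord0 j) = (fun x => -1 * g j x) by rewrite /G liftK.
have h : `|\sum_i Phi n.+1 s0 (nu i) * G i x| <= C * (e * c / (`|C| + 1)).
  apply: (hC n.+1 s0) => //.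
  - by move=> i; rewrite /nu; case: unliftP => // j _; exact: mu_ge0.
  - by move=> i; rewrite /nu /G; case: unliftP => // j _; exact: eigZ.
  - move=> y Xy; rewrite big_ord_recl G0; under eq_bigr do rewrite GS.
    by rewrite -mulr_sumr mulN1r -Pg // fF //; exact: FP.
have {}h : `|Phi n.+1 s0 s0| * `|f x - \sum_(i < n.+1 | mu i == s0) g i x| <= e * c.
  rewrite -normrM.
  have <- : \sum_i Phi n.+1 s0 (nu i) * G i x =
      Phi n.+1 s0 s0 * (f x - \sum_(i < n.+1 | mu i == s0) g i x).
    rewrite big_ord_recl nu0 G0 mulrBr; congr (_ + _).
    rewrite mulr_sumr -sumrN [RHS]big_mkcond /=; apply: eq_bigr => i _.
    rewrite nuS GS; case: eqP => [->|/eqP hi]; first by rewrite mulN1r mulrN.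
    by rewrite Phi_mu // mul0r.
  apply: le_trans h _; rewrite mulrA ler_pdivrMr // [leLHS]mulrC.
  apply: ler_wpM2l; first by rewrite mulr_ge0 // ltW.
  by apply: le_trans (ler_norm _) _; rewrite lerDl.
rewrite -(ler_pM2r c0) mulrC; apply: le_trans h; exact: ler_wpM2r.
Qed.

(** Otherwise the approximations of an eigenfunction given above would be empty
    sums. *)
Lemma eigenvalue_mu s0 : eigenvalue_LB X d s0 -> exists n, s0 = mu n.
Proof.
move=> [f ef [x Xx fx]]; apply: contrapT => nmu.
have s00 := eigenvalue_ge0 ef Xx fx.
move/eqP: fx; apply; apply/eqP; rewrite -normr_eq0 eq_le normr_ge0 andbT.
apply/ler_addgt0Pl => e e0; rewrite addr0.
have [n [g [_ _ h]]] := eig_approx s00 ef e0.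
have := h x Xx; rewrite big_pred0 ?subr0 // => i.
by apply/eqP => h0; apply: nmu; exists i.
Qed.

Lemma eig_Pol n f : eig (mu n) f -> forall e : R, 0 < e ->
  exists2 g, Pol n g /\ eig (mu n) g & forall x, X x -> `|f x - g x| <= e.
Proof.
move=> ef e e0; have [N [g [gP ge h]]] := eig_approx (mu_ge0 n) ef e0.
have muE i : (mu i == mu n) = (i == n).
  by apply/eqP/eqP => [/(mu_inj lam0)|->].
have [nN|Nn] := ltnP n N.
  exists (g n) => // x Xx; have := h x Xx.
  under eq_bigl do rewrite muE.
  by rewrite (big_pred1 (Ordinal nN)).
exists (fun=> 0).
  split; first exact: Pol_cst.
  have := eigZ 0 ef; by congr eigenspace_LB; apply/funext => x; rewrite mul0r.
move=> x Xx; have := h x Xx; rewrite big_pred0 // => i.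
by rewrite muE ltn_eqF // (leq_trans (ltn_ord i)).
Qed.

(** * Multiplicities as increments of the Hilbert function *)

Definition gens : seq (V -> R) :=
  (fun=> 1) :: [seq (fun x : V => x a.1 a.2) | a <- enum {: 'I_p * 'I_q}].

Local Notation hil := (hilbert X gens).

Lemma nth_gens i : (i < size gens)%N -> Pol 1 (nth (cst 0) gens i).
Proof.
case: i => [|i] /=; first by move=> _; exact: Pol_cst.
rewrite ltnS size_map => h.
have [a _] : exists a : 'I_p * 'I_q, True.
  by case: (enum _) h => // a; exists a.
by rewrite (nth_map a) //; exact: Pol_coord1.
Qed.

Lemma Pol_mon (ys : seq (V -> R)) (s : seq nat) : size s = size ys ->
  (forall i, (i < size ys)%N -> Pol 1 (nth (cst 0) ys i)) -> Pol (sumn s) (mon ys s).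
Proof.
elim: ys s => [|y ys IH] [|k s] //=; first by move=> _ _; exact: Pol_cst.
move=> [ss] h; apply: PolM; last by apply: IH => // i; exact: (h i.+1).
have y1 : Pol 1 y := h 0%N isT.
elim: k => [|k IHk]; first by under eq_fun do rewrite expr0; exact: Pol_cst.
by under eq_fun do rewrite exprS; rewrite -add1n; exact: PolM.
Qed.

Lemma Pol_std_mon n i : Pol n (@std_mon _ _ X gens n i).
Proof.
have [ss sn _] := standardP (mem_nth [::] (ltn_ord i)).
by rewrite -[X in Pol X]sn; apply: Pol_mon => //; exact: nth_gens.
Qed.

Lemma Pol_span n f : Pol n f -> span_on X (@std_mon _ _ X gens n) f.
Proof.
move=> fP; suff [l [lP lE]] : homspan X gens n f.
  have h p0 : span_on X (@std_mon _ _ X gens n)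
      (if p0 \in l then mon gens p0.2 else cst 0).
    case: ifP => [/(allP lP)|_]; first exact: std_mon_span.
    by exists (fun=> 0) => x _; rewrite big1 // => i _; rewrite mul0r.
  apply: (span_on_sum (r := l) (c := fst) h) => x Xx.
  by rewrite lE // /lincomb !big_seq; apply: eq_bigr => p0 ->.
have h1 k : homspan X gens k (fun=> 1).
  elim: k => [|k IH]; first exact: homspan0.
  rewrite -add1n; apply: eq_homspan (homspanM (@homspan_gen _ _ X gens 0 isT) IH).
  by move=> x _ /=; rewrite mulr1.
elim: n f / fP => [k a|k f g _ h _ h'|k a f _ h|k i j f _ h|k f _ h].
- by apply: eq_homspan (homspanZ a (h1 k)) => x _; rewrite mulr1.
- exact: homspanD.
- exact: homspanZ.
- rewrite -add1n; have ij : (i, j) \in enum {: 'I_p * 'I_q} by rewrite mem_enum.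
  have hi : ((index (i, j) (enum {: 'I_p * 'I_q})).+1 < size gens)%N.
    by rewrite /= ltnS size_map index_mem.
  apply: eq_homspan (homspanM (homspan_gen X hi) h) => x _ /=.
  by rewrite (nth_map (i, j)) ?index_mem // nth_index.
- rewrite -add1n; apply: eq_homspan (homspanM (@homspan_gen _ _ X gens 0 isT) h).
  by move=> x _ /=; rewrite mul1r.
Qed.

Lemma eig_span n f : eig (mu n) f -> span_on X (@std_mon _ _ X gens n) f.
Proof.
move=> ef; apply: span_on_closed; first exact: indep_std_mon.
move=> e e0; have [g [gP _] fg] := eig_Pol ef e0.
by exists g => //; exact: Pol_span.
Qed.

Lemma eig_finite_dim n : exists k, has_dim_on X (eig (mu n)) k.
Proof.
have [k [e [eW ei es]]] := exists_basis_on (@eig_span n).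
by exists k, e; split.
Qed.

Lemma eig_dim n k : has_dim_on X (eig (mu n.+1)) k -> (k + hil n = hil n.+1)%N.
Proof.
move=> [e [eE ei es]].
pose u (i : 'I_(k + hil n)) := match fintype.split i with
  | inl j => e j | inr j => @std_mon _ _ X gens n j end.
have big_u (a : 'I_(k + hil n) -> R) x : \sum_i a i * u i x =
    \sum_i a (lshift _ i) * e i x + \sum_i a (rshift _ i) * std_mon i x.
  rewrite big_split_ord /=; congr (_ + _); apply: eq_bigr => i _; congr (_ * _).
    by rewrite /u (unsplitK (inl i)).
  by rewrite /u (unsplitK (inr i)).
have Pn_span f : Pol n.+1 f -> span_on X u f.
  move=> /(Pol_decomposition lam0 mP frame_gram frame_acc) [g [gP ge fg]].
  have [a ha] := es _ (ge n.+1).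
  have [b hb] : span_on X (@std_mon _ _ X gens n) (fun x => \sum_(i < n.+1) g i x).
    by apply/Pol_span/Pol_sum => i; apply: Pol_leq (gP i); rewrite -ltnS.
  exists (fun i => match fintype.split i with inl j => a j | inr j => b j end) => x Xx.
  rewrite fg // big_ord_recr /= hb // ha // big_u addrC; congr (_ + _).
    by apply: eq_bigr => i _; rewrite (unsplitK (inl i)).
  by apply: eq_bigr => i _; rewrite (unsplitK (inr i)).
have ui : indep_on X u.
  move=> a a0.
  pose f x := \sum_i a (lshift _ i) * e i x.
  pose P x := \sum_i a (rshift _ i) * @std_mon _ _ X gens n i x.
  have PP : Pol n P by apply: Pol_sum => i; apply/Pol_scale/Pol_std_mon.
  have [g [gP ge Pg]] := Pol_decomposition lam0 mP frame_gram frame_acc PP.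
  have f0 x : X x -> f x = 0.
    apply: (@eig_indep n.+1 f g (mu n.+1)) => //.
    - exact: mu_ge0.
    - by move=> i hi; rewrite lt_eqF // mu_homo.
    - exact: eig_sum.
    - by move=> y Xy; rewrite -Pg // -(a0 y Xy) big_u.
  have al : forall i, a (lshift _ i) = 0.
    by apply: ei => x Xx; exact: f0.
  have ar : forall i, a (rshift _ i) = 0.
    apply: (@indep_std_mon _ _ X gens n) => x Xx.
    by have := a0 x Xx; rewrite big_u -[X in X + _]/(f x) f0 // add0r.
  by move=> i; case: (fintype.splitP i) => j ij;
    [rewrite -(al j) | rewrite -(ar j)]; congr (a _); exact: val_inj.
apply/eqP; rewrite eqn_leq; apply/andP; split.
  apply: (indep_le_span ui) => i; rewrite /u; case: (fintype.split i) => j.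
    exact: eig_span.
  by apply: Pol_span; apply: Pol_weak; exact: Pol_std_mon.
apply: (indep_le_span (@indep_std_mon _ _ X gens n.+1)) => i.
exact/Pn_span/Pol_std_mon.
Qed.

(** If some mu n is not an eigenvalue then polynomials of degree n reduce to
    lower degree on X, hence so do all polynomials, and no mu m with m >= n is. *)
Lemma mu_eigenvalue_down n N : (n <= N)%N ->
  eigenvalue_LB X d (mu N) -> eigenvalue_LB X d (mu n).
Proof.
move=> nN eN; apply: contrapT => nen.
have z0 f : eig (mu n) f -> forall x, X x -> f x = 0.
  move=> ef x Xx; apply: contrapT => /eqP fx; apply: nen; exists f => //; by exists x.
have red f : Pol n f -> exists2 g, Pol_lt n g & forall x, X x -> f x = g x.
  move=> fP; have [g [gP ge fg]] := Pol_decomposition lam0 mP frame_gram frame_acc fP.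
  exists (fun x => \sum_(i < n) g i x).
    case: n {nN nen z0 fP fg} => [|n] /=; first by apply/funext => x; rewrite big_ord0.
    by apply: Pol_sum => i; apply: Pol_leq (gP i); rewrite -ltnS.
  by move=> x Xx; rewrite fg // big_ord_recr /= (z0 _ (ge n)) // addr0.
have lt_coord g i j : Pol_lt n g -> Pol n (fun x => x i j * g x).
  case: n {nN nen z0 red} => [->|n] /=; last exact: Pol_coord.
  by under eq_fun do rewrite mulr0; exact: Pol_cst.
have lt_add g h (a b : R) : Pol_lt n g -> Pol_lt n h -> Pol_lt n (fun x => a * g x + b * h x).
  case: n {nN nen z0 red lt_coord} => [-> ->|n] /=; last exact: Pol_lin.
  by apply/funext => x; rewrite !mulr0 addr0.
have redN k f : Pol k f -> exists2 g, Pol_lt n g & forall x, X x -> f x = g x.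
  move=> fP; elim: k f / fP => [k a|k f g _ [f' fL fE] _ [g' gL gE]|k a f _ [f' fL fE]
      |k i j f _ [f' fL fE]|k f _ //].
  - by apply: red; exact: Pol_cst.
  - exists (fun x => 1 * f' x + 1 * g' x); first exact: lt_add.
    by move=> x Xx; rewrite !mul1r fE ?gE.
  - exists (fun x => a * f' x + 0 * f' x); first exact: lt_add.
    by move=> x Xx; rewrite mul0r addr0 fE.
  - have [g gL gE] := red _ (lt_coord _ i j fL).
    by exists g => // x Xx; rewrite fE // gE.
have [f ef [x Xx /eqP fx]] := eN; apply: fx.
apply/eqP; rewrite -normr_eq0 eq_le normr_ge0 andbT.
apply/ler_addgt0Pl => e e0; rewrite addr0.
have [g [gP ge] fg] := eig_Pol ef e0.
suff g0 : g x = 0 by have := fg x Xx; rewrite g0 subr0.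
have [h hL gh] := redN _ _ gP.
have [h' [_ h'i hE]] := Pol_lt_decomposition lam0 mP frame_gram frame_acc hL.
apply: (@eig_indep n g (fun i x => -1 * h' i x) (mu N)) => //.
- exact: mu_ge0.
- by move=> i hin; rewrite lt_eqF // mu_homo // (leq_trans hin).
- by move=> i; exact: eigZ.
- by move=> y Xy; rewrite -mulr_sumr mulN1r -hE // gh // subrr.
Qed.

Lemma enumeration_mu (l : nat -> R) : {homo l : i j / (i < j)%N >-> i < j} ->
  eigenvalue_LB X d = range l -> l = mu.
Proof.
move=> lmono lE.
have lmu j : exists n, l j = mu n.
  by apply: eigenvalue_mu; rewrite lE; exists j.
have [i iE] := choice lmu.
have imono : {homo i : j k / (j < k)%N >-> (j < k)%N}.
  move=> j k jk; rewrite ltnNge; apply/negP => kj.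
  have : l k <= l j.
    rewrite !iE; move: kj; rewrite leq_eqVlt => /orP[/eqP -> //|]; by move/(mu_homo lam0)/ltW.
  by rewrite leNgt lmono.
have i_ge j : (j <= i j)%N.
  by elim: j => // j IH; apply: leq_ltn_trans IH (imono _ _ _).
have muE n : exists j, l j = mu n.
  have : eigenvalue_LB X d (mu n).
    apply: (mu_eigenvalue_down (i_ge n)); rewrite -iE lE; by exists n.
  by rewrite lE => -[j _ h]; exists j.
apply/funext => n; rewrite iE; congr mu; apply/eqP; rewrite eqn_leq i_ge andbT.
elim/ltn_ind: n => n IH.
have [j jE] := muE n; have ijn : i j = n by apply: (mu_inj lam0); rewrite -iE.
have [jn|nj] := ltnP j n; last first.
  rewrite -[leqRHS]ijn; move: nj; rewrite leq_eqVlt => /orP[/eqP -> //|]; by move/imono/ltnW.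
by have := IH j jn; rewrite ijn leqNgt jn.
Qed.

(** An increasing enumeration of the spectrum can only be mu.  If there is none, as
    happens for a finite or empty spectrum, then eigdim takes its default value. *)
Theorem eigdim_hilbert : (forall n, eigdim X d n = 0%N) \/
  (forall n, eigdim X d n.+1 + hil n = hil n.+1)%N.
Proof.
have [[l [lmono lE]]|nl] := pselect (exists l : nat -> R,
    {homo l : i j / (i < j)%N >-> i < j} /\ eigenvalue_LB X d = range l); last first.
  left=> n; rewrite /eigdim; case: xgetP => // k _ [l [h1 h2 _]].
  by exfalso; apply: nl; exists l.
right=> n; apply: eig_dim.
have [k kP] := eig_finite_dim n.+1.
have lmu := enumeration_mu lmono lE.
have : is_eigdim X d n.+1 (eigdim X d n.+1).
  rewrite /eigdim; apply: (@xgetPex _ 0%N [set k | is_eigdim X d n.+1 k]).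
  by exists k, l; split=> //; rewrite lmu.
by move=> [l' [h1 h2]]; rewrite (enumeration_mu h1 h2).
Qed.

End Spectrum.

(** * Embedded manifolds with an explicit tangent projection *)

Section DotProduct.
Context {R : realType} {p q : nat}.
Local Notation V := 'M[R]_(p, q).
Implicit Types (u v w : V) (a : R).

Lemma dotC u v : dot u v = dot v u.
Proof. by apply: eq_bigr => i _; apply: eq_bigr => j _; exact: mulrC. Qed.

Lemma dotDl u v w : dot (u + v) w = dot u w + dot v w.
Proof.
rewrite /dot -big_split; apply: eq_bigr => i _ /=.
by rewrite -big_split; apply: eq_bigr => j _ /=; rewrite mxE mulrDl.
Qed.

Lemma dotZl a u v : dot (a *: u) v = a * dot u v.
Proof.
rewrite /dot mulr_sumr; apply: eq_bigr => i _.
by rewrite mulr_sumr; apply: eq_bigr => j _; rewrite mxE mulrA.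
Qed.

Lemma dotDr u v w : dot w (u + v) = dot w u + dot w v.
Proof. by rewrite dotC dotDl !(dotC w). Qed.

Lemma dotZr a u v : dot v (a *: u) = a * dot v u.
Proof. by rewrite dotC dotZl (dotC v). Qed.

Lemma dotNl u v : dot (- u) v = - dot u v.
Proof. by rewrite -scaleN1r dotZl mulN1r. Qed.

Lemma dotNr u v : dot v (- u) = - dot v u.
Proof. by rewrite dotC dotNl (dotC v). Qed.

Lemma dotBl u v w : dot (u - v) w = dot u w - dot v w.
Proof. by rewrite dotDl dotNl. Qed.

Lemma dotBr u v w : dot w (u - v) = dot w u - dot w v.
Proof. by rewrite dotDr dotNr. Qed.

Lemma dot0l v : dot 0 v = 0.
Proof. by rewrite -(scale0r (0 : V)) dotZl mul0r. Qed.

Lemma dot0r v : dot v 0 = 0.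
Proof. by rewrite dotC dot0l. Qed.

Lemma dot_suml (I : Type) (r : seq I) (P : pred I) (u : I -> V) v :
  dot (\sum_(i <- r | P i) u i) v = \sum_(i <- r | P i) dot (u i) v.
Proof.
elim: r => [|i r IH]; first by rewrite !big_nil dot0l.
by rewrite !big_cons; case: (P i); rewrite // dotDl IH.
Qed.

Lemma dot_sumr (I : Type) (r : seq I) (P : pred I) (u : I -> V) v :
  dot v (\sum_(i <- r | P i) u i) = \sum_(i <- r | P i) dot v (u i).
Proof. by rewrite dotC dot_suml; apply: eq_bigr => i _; exact: dotC. Qed.

Lemma dot_ge0 u : 0 <= dot u u.
Proof. by apply: sumr_ge0 => i _; apply: sumr_ge0 => j _; rewrite -expr2 sqr_ge0. Qed.

Lemma dot_eq0 u : dot u u = 0 -> u = 0.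
Proof.
move=> /eqP; rewrite psumr_eq0 => [/allP h|i _]; last first.
  by apply: sumr_ge0 => j _; rewrite -expr2 sqr_ge0.
apply/matrixP => i j; have := h i (mem_index_enum _); rewrite psumr_eq0 /= => [/allP k|l _]; last first.
  by rewrite -expr2 sqr_ge0.
by have := k j (mem_index_enum _); rewrite /= mulf_eq0 orbb mxE => /eqP.
Qed.

Definition unit_vec (a : 'I_p * 'I_q) : V := delta_mx a.1 a.2.

Lemma dot_unit u (a : 'I_p * 'I_q) : dot u (unit_vec a) = u a.1 a.2.
Proof.
rewrite /dot (bigD1 a.1) //= (bigD1 a.2) //= mxE !eqxx mulr1 !big1 ?addr0 //.
  by move=> i /negbTE ia; apply: big1 => j _; rewrite mxE ia mulr0.
by move=> j /negbTE ja; rewrite mxE ja andbF mulr0.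
Qed.

Lemma sum_unit u : u = \sum_a dot u (unit_vec a) *: unit_vec a.
Proof.
rewrite {1}[u]matrix_sum_delta pair_big; apply: eq_bigr => a _.
by rewrite dot_unit.
Qed.

Lemma dot_sum_unit u v : \sum_a dot u (unit_vec a) * dot v (unit_vec a) = dot u v.
Proof.
rewrite [in RHS](sum_unit v) dot_sumr; apply: eq_bigr => a _.
by rewrite dotZr mulrC.
Qed.

Lemma dot_inj u v : (forall w, dot u w = dot v w) -> u = v.
Proof.
move=> h; apply/eqP; rewrite -subr_eq0; apply/eqP/dot_eq0.
by rewrite dotBl h subrr.
Qed.

End DotProduct.

Section TangentProjection.
Context {R : realType} {p q : nat}.
Local Notation V := 'M[R]_(p, q).
Local Arguments derive1n : simpl never.
Variables (X : set V) (d : nat) (P : V -> V -> V).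
Implicit Types (x v w y : V) (cs : 'I_d -> R -> V).
Local Notation e_ := (@unit_vec R p q).

Hypothesis PD : forall x v w, P x (v + w) = P x v + P x w.
Hypothesis PZ : forall x (a : R) v, P x (a *: v) = a *: P x v.
Hypothesis Psym : forall x v w, X x -> dot (P x v) w = dot v (P x w).
Hypothesis Pidem : forall x v, X x -> P x (P x v) = P x v.
Hypothesis Ptr : forall x, X x -> \sum_a dot (P x (e_ a)) (e_ a) = d%:R.
Hypothesis Ptan : forall x v, X x -> tangent X x v -> P x v = v.
Hypothesis Pgeo : forall x v, X x -> P x v = v -> dot v v = 1 ->
  exists c, [/\ geodesic X c, c 0 = x & derive1 c 0 = v].

Lemma P_lin x : linear (P x).
Proof. by move=> a v w; rewrite PD PZ. Qed.

Definition orthonormal k (v : 'I_k -> V) : Prop :=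
  forall i j, dot (v i) (v j) = (i == j)%:R.

Definition span_proj k (v : 'I_k -> V) y : V := \sum_i dot (v i) y *: v i.

Lemma dot_span_proj k (v : 'I_k -> V) i y : orthonormal v ->
  dot (v i) (span_proj v y) = dot (v i) y.
Proof.
move=> ov; rewrite dot_sumr (bigD1 i) //= dotZr ov eqxx mulr1 big1 ?addr0 //.
by move=> j ji; rewrite dotZr ov eq_sym (negbTE ji) mulr0.
Qed.

Lemma P_span_proj k (v : 'I_k -> V) x y : (forall i, P x (v i) = v i) ->
  P x (span_proj v y) = span_proj v y.
Proof.
move=> Pv; rewrite /span_proj.
have H (r : seq 'I_k) : P x (\sum_(i <- r) dot (v i) y *: v i) = \sum_(i <- r) dot (v i) y *: v i.
  elim: r => [|i r IH]; last by rewrite !big_cons PD PZ Pv IH.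
  by rewrite !big_nil -(scale0r (0 : V)) PZ !scale0r.
exact: H.
Qed.

Lemma trace_span_proj k (v : 'I_k -> V) : orthonormal v ->
  \sum_a dot (span_proj v (e_ a)) (e_ a) = k%:R.
Proof.
move=> ov; under eq_bigr do rewrite dot_suml; rewrite exchange_big /=.
rewrite (eq_bigr (fun=> 1)) ?sumr_const ?card_ord // => i _.
under eq_bigr do rewrite dotZl.
by rewrite dot_sum_unit ov eqxx.
Qed.

(** An incomplete orthonormal family of tangent vectors is extended by a nonzero
    residue of the projection of a basis vector. *)
Lemma exists_orthonormal x k : X x -> (k <= d)%N ->
  exists v : 'I_k -> V, orthonormal v /\ forall i, P x (v i) = v i.
Proof.
move=> Xx; elim: k => [|k IH] kd; first by exists (fun=> 0); split=> [[]|[]].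
have [v [ov Pv]] := IH (ltnW kd).
pose E y := P x y - span_proj v y.
have trE : \sum_a dot (E (e_ a)) (e_ a) = d%:R - k%:R.
  under eq_bigr do rewrite dotBl; by rewrite sumrB Ptr // trace_span_proj.
have [a Ea] : exists a, dot (E (e_ a)) (e_ a) != 0.
  apply: contrapT => nE; have : d%:R - k%:R = 0 :> R.
    rewrite -trE big1 // => a _; apply/eqP; apply: contrapT => /negP h; apply: nE; by exists a.
  by move=> /eqP; rewrite subr_eq0 eqr_nat gtn_eqF.
set w := E (e_ a) in Ea.
have w0 : 0 < dot w w.
  rewrite lt_def dot_ge0 andbT; apply/eqP => /dot_eq0 w0.
  by rewrite w0 dot0l eqxx in Ea.
have Pw : P x w = w.
  by rewrite /w /E PD -scaleN1r PZ Pidem // P_span_proj // scaleN1r.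
have vw i : dot (v i) w = 0.
  by rewrite /w /E dotBr dot_span_proj // -Psym // Pv subrr.
pose s := (Num.sqrt (dot w w))^-1.
have sw : s * (s * dot w w) = 1.
  rewrite mulrA -expr2 /s exprVn sqr_sqrtr ?dot_ge0 // mulVf // gt_eqF //.
exists (fun i => if unlift ord_max i is Some j then v j else s *: w); split.
  move=> i j; case: (unliftP ord_max i) => [i' ->|->]; case: (unliftP ord_max j) => [j' ->|->].
  - by rewrite ov (inj_eq lift_inj).
  - by rewrite dotZr vw mulr0 eq_sym (negbTE (neq_lift _ _)).
  - by rewrite dotZl dotC vw mulr0 (negbTE (neq_lift _ _)).
  - by rewrite dotZl dotZr sw eqxx.
by move=> i; case: unliftP => // _; rewrite PZ Pw.
Qed.

Lemma frame_exists x : X x -> exists cs, frame X cs x.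
Proof.
move=> Xx; have [v [ov Pv]] := exists_orthonormal Xx (leqnn d).
have H i : exists c, [/\ geodesic X c, c 0 = x & derive1 c 0 = v i].
  by apply: Pgeo => //; rewrite ov eqxx.
have [cs h] := choice H; exists cs; split=> [i|i|i j].
- by case: (h i).
- by case: (h i).
- by have [_ _ ->] := h i; have [_ _ ->] := h j.
Qed.

Lemma frame_tangent x cs a : X x -> frame X cs x -> P x (derive1 (cs a) 0) = derive1 (cs a) 0.
Proof.
move=> Xx [gc c0 _]; apply: Ptan => //; exists (cs a).
by have [? h _ _] := gc a; split.
Qed.

(** The acceleration of a geodesic is normal: test it against the unit vector in
    the direction of its own tangential part. *)
Lemma geodesic_normal c t : geodesic X c -> P (c t) (derive1n 2 c t) = 0.
Proof.
move=> [cX _ _ cN]; set w := P _ _; apply: dot_eq0; apply: contrapT => /eqP w0.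
have wp : 0 < dot w w by rewrite lt_def w0 dot_ge0.
pose s := (Num.sqrt (dot w w))^-1.
have s0 : s != 0 by rewrite invr_eq0 gt_eqF // sqrtr_gt0.
have Pw : P (c t) w = w by exact: Pidem.
have [||g [[gX g1 _ _] g0 gv]] := @Pgeo (c t) (s *: w) (cX t) _ _.
- by rewrite PZ Pw.
- by rewrite dotZl dotZr mulrA -expr2 /s exprVn sqr_sqrtr ?dot_ge0 // mulVf //.
have : dot (derive1n 2 c t) (s *: w) = 0 by apply: cN; exists g; split.
rewrite dotZr => /eqP; rewrite mulf_eq0 (negbTE s0) /= => /eqP h.
by move/eqP: w0; apply; rewrite {1}/w Psym // Pw.
Qed.

(** The difference of P and the projection on a full orthonormal family is a
    symmetric idempotent of trace zero. *)
Lemma frame_proj x cs y : X x -> frame X cs x ->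
  \sum_a dot (derive1 (cs a) 0) y *: derive1 (cs a) 0 = P x y.
Proof.
move=> Xx fr; have [_ _ ov] := fr.
pose v a := derive1 (cs a) 0.
have Pv a : P x (v a) = v a by exact: frame_tangent.
rewrite -[LHS]/(span_proj v y).
pose E y := P x y - span_proj v y.
have EE w : dot (E w) (E w) = dot (E w) w.
  have h1 : dot (E w) (P x w) = dot (E w) w.
    rewrite -Psym //; congr dot.
    by rewrite /E PD -scaleN1r PZ Pidem // P_span_proj // scaleN1r.
  have h2 : dot (E w) (span_proj v w) = 0.
    rewrite dot_sumr big1 // => a _; rewrite dotZr [dot (E w) _]dotC /E dotBr dot_span_proj //.
    by rewrite -Psym // Pv subrr mulr0.
  by rewrite {2}/E dotBr h1 h2 subr0.
have trE : \sum_a dot (E (e_ a)) (E (e_ a)) = 0.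
  under eq_bigr do rewrite EE dotBl.
  by rewrite sumrB Ptr // trace_span_proj // subrr.
have Ee a : E (e_ a) = 0.
  apply: dot_eq0; have /eqP := trE; rewrite psumr_eq0; last by move=> b _; exact: dot_ge0.
  by move=> /allP/(_ a (mem_index_enum _))/eqP.
have PE a : P x (e_ a) = span_proj v (e_ a) by apply/eqP; rewrite -subr_eq0 -[_ - _]/(E _) Ee.
have sp_sym w w' : dot (span_proj v w) w' = dot w (span_proj v w').
  rewrite dot_suml dot_sumr; apply: eq_bigr => a _.
  by rewrite dotZl dotZr [dot w _]dotC mulrC.
apply/matrixP => i j; rewrite -!(dot_unit _ (i, j)) Psym // PE.
exact: sp_sym.
Qed.

Lemma frame_gram_proj x cs i j k l : X x -> frame X cs x ->
  \sum_a derive1 (cs a) 0 i j * derive1 (cs a) 0 k l = P x (delta_mx k l) i j.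
Proof.
move=> Xx fr; rewrite -(frame_proj (delta_mx k l) Xx fr) summxE.
by apply: eq_bigr => a _; rewrite mxE mulrC (dot_unit _ (k, l)).
Qed.

(** The trace of a quadratic map over the frame becomes a trace over the standard
    basis of the ambient space, which can be computed entry by entry. *)
Lemma frame_contract x cs (f : V -> V -> V) : X x -> frame X cs x ->
  (forall y, linear (f y)) -> (forall y, linear (f^~ y)) ->
  \sum_a f (derive1 (cs a) 0) (derive1 (cs a) 0) = \sum_b f (P x (e_ b)) (e_ b).
Proof.
move=> Xx fr fr_lin fl_lin.
pose FR y : {linear V -> V} := HB.pack (f y) (GRing.isLinear.Build _ _ _ _ _ (fr_lin y)).
pose FL y : {linear V -> V} := HB.pack (f^~ y) (GRing.isLinear.Build _ _ _ _ _ (fl_lin y)).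
under eq_bigr => a _.
  rewrite {2}(sum_unit (derive1 (cs a) 0)).
  rewrite -[f _ _]/(FR (derive1 (cs a) 0) _) linear_sum /=; over.
rewrite exchange_big /=; apply: eq_bigr => b _.
rewrite -(frame_proj (e_ b) Xx fr) -[RHS]/(FL (e_ b) _) linear_sum /=.
apply: eq_bigr => a _.
rewrite -[f _ _ in LHS]/(FR (derive1 (cs a) 0) _) -[f _ _ in RHS]/(FL (e_ b) _) !linearZ.
by [].
Qed.

End TangentProjection.

Section EigenspaceDimensions.
Context {R : realType} {p q : nat}.
Local Notation V := 'M[R]_(p, q).
Local Arguments derive1n : simpl never.
Variables (X : set V) (d : nat) (B : R) (lam : R) (z : V).
Variable m : 'I_p -> 'I_q -> 'I_p -> 'I_q -> V -> R.
Hypothesis d2 : (2 <= d)%N.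
Hypothesis closedX : closed X.
Hypothesis boundedX : X `<=` cube B.
Hypothesis frame_ex : forall x, X x -> exists cs : 'I_d -> R -> V, frame X cs x.
Hypothesis lam0 : 0 < lam.
Hypothesis mP : forall i j k l, Pol 1 (m i j k l).
Hypothesis frame_gram : forall x (cs : 'I_d -> R -> V), X x -> frame X cs x -> forall i j k l,
  \sum_a derive1 (cs a) 0 i j * derive1 (cs a) 0 k l = m i j k l x - x i j * x k l.
Hypothesis frame_acc : forall x (cs : 'I_d -> R -> V), X x -> frame X cs x -> forall i j,
  \sum_a derive1n 2 (cs a) 0 i j = - lam * x i j + z i j.

Variables (I : finType) (f : I -> V -> R) (zs : I -> seq (V -> R)).
Hypothesis f_cover : forall x, X x -> exists i, f i x != 0.
Hypothesis size_zs : forall i, size (zs i) = d.+1.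
Hypothesis f_quad : forall i, homspan X (zs i) 2 (f i).
Hypothesis fx_quad : forall i k l, homspan X (zs i) 2 (fun x => f i x * x k l).

(** The multiplicities are increments of the Hilbert function, so that their own
    increments are its second differences. *)
Theorem eigdim_diff_le : exists C : R, forall n, (1 <= n)%N ->
  `|(eigdim X d n)%:R - (eigdim X d n.-1)%:R| <= C * n%:R ^+ (d - 2).
Proof.
have [h0|hD] := eigdim_hilbert closedX boundedX frame_ex lam0 mP frame_gram frame_acc.
  by exists 0 => n _; rewrite !h0 subrr normr0 mul0r.
have [|C hC] := @hilbert_diff2_le R V X (gens (p := p) (q := q)) d I f zs d2 f_cover size_zs.
  move=> i [|j] jg.
    by apply: eq_homspan (f_quad i) => x _ /=; rewrite mulr1.
  have [a _] : exists a : 'I_p * 'I_q, True.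
    by move: jg; rewrite /= ltnS size_map; case: (enum _) => // a; exists a.
  move: jg; rewrite /= ltnS size_map => jg.
  by under eq_fun do rewrite (nth_map a) //.
pose D1 := `|(eigdim X d 1)%:R - (eigdim X d 0)%:R : R|.
have C0 : 0 <= C by have := hC 0%N; rewrite expr1n mulr1; apply: le_trans.
exists (C + D1) => -[//|[|n]] _ /=.
  by rewrite expr1n mulr1 lerDr.
have hE k : (eigdim X d k.+1)%:R = (hilbert X gens k.+1)%:R - (hilbert X gens k)%:R :> R.
  by rewrite -(hD k) natrD addrK.
rewrite !hE; apply: (@le_trans _ _ (C * n.+1%:R ^+ (d - 2))).
  apply: le_trans (hC n); rewrite le_eqVlt; apply/orP; left; apply/eqP.
  by congr `|_|; ring.
apply: ler_pM => //.
  by rewrite lerDl normr_ge0.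
by rewrite lerXn2r ?nnegrE // ler_nat.
Qed.

End EigenspaceDimensions.

(** * Curves on a quadric *)

Section BilinearDerivatives.
Context {R : realType} {p q : nat}.
Local Notation V := 'M[R]_(p, q).
Local Arguments derive1n : simpl never.
Implicit Types (b c : R -> V) (u v w : V).

Definition bilin (f : V -> V -> R) : Prop :=
  [/\ forall u v w, f (u + v) w = f u w + f v w,
      forall (a : R) u w, f (a *: u) w = a * f u w,
      forall u v w, f w (u + v) = f w u + f w v &
      forall (a : R) u w, f w (a *: u) = a * f w u].

Lemma bilin_dot : bilin (@dot R p q).
Proof.
by split=> *; [exact: dotDl | exact: dotZl | exact: dotDr | exact: dotZr].
Qed.

Lemma bilin_expand f u v : bilin f ->
  f u v = \sum_a \sum_b (u a.1 a.2 * v b.1 b.2) * f (unit_vec a) (unit_vec b).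
Proof.
move=> [Dl Zl Dr Zr].
have sl (r : seq ('I_p * 'I_q)) (g : 'I_p * 'I_q -> V) w :
    f (\sum_(a <- r) g a) w = \sum_(a <- r) f (g a) w.
  elim: r => [|a r IH]; last by rewrite !big_cons Dl IH.
  by rewrite !big_nil -(scale0r (0 : V)) Zl mul0r.
have sr (r : seq ('I_p * 'I_q)) (g : 'I_p * 'I_q -> V) w :
    f w (\sum_(a <- r) g a) = \sum_(a <- r) f w (g a).
  elim: r => [|a r IH]; last by rewrite !big_cons Dr IH.
  by rewrite !big_nil -(scale0r (0 : V)) Zr mul0r.
rewrite {1}(sum_unit u) sl; apply: eq_bigr => a _.
rewrite {1}(sum_unit v) sr; apply: eq_bigr => b _.
by rewrite Zl Zr !dot_unit; ring.
Qed.

Lemma is_derive_entry c t i j : derivable c t 1 ->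
  is_derive t 1 (fun s => c s i j) (derive1 c t i j).
Proof.
move=> dc; apply: DeriveDef; first by have /derivable_mxP := dc.
by rewrite derive1E derive_mx // mxE.
Qed.

Lemma is_derive_bilin f b c t : bilin f -> derivable b t 1 -> derivable c t 1 ->
  is_derive t 1 (fun s => f (b s) (c s)) (f (derive1 b t) (c t) + f (b t) (derive1 c t)).
Proof.
move=> bf db dc.
under eq_fun do rewrite bilin_expand //.
rewrite (bilin_expand (derive1 b t) (c t) bf) (bilin_expand (b t) (derive1 c t) bf).
rewrite -big_split /=.
apply: is_derive_bigsum => k; rewrite -big_split /=.
apply: is_derive_bigsum => l; rewrite -mulrDl.
have h := is_deriveM' (is_derive_entry k.1 k.2 db) (is_derive_entry l.1 l.2 dc).
have := is_deriveM' h (is_derive_cst (f (unit_vec k) (unit_vec l)) t 1).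
by rewrite mulr0 addr0.
Qed.

Lemma is_derive_dotr (u : V) c t : derivable c t 1 ->
  is_derive t 1 (fun s => dot u (c s)) (dot u (derive1 c t)).
Proof.
move=> dc; apply: is_derive_bigsum => i; apply: is_derive_bigsum => j.
have := is_deriveM' (is_derive_cst (u i j) t 1) (is_derive_entry i j dc).
by rewrite mul0r add0r.
Qed.

(** Applied to the quadratic equations of X, the two derivatives give the linear
    equations of the tangent space and those of the acceleration of a geodesic. *)
Lemma quadric_derive1 (X : set V) f (u : V) c v : bilin f ->
  (forall x, X x -> f x x = dot u x) -> (forall s, X (c s)) ->
  derivable c 0 1 -> derive1 c 0 = v ->
  f v (c 0) + f (c 0) v = dot u v.
Proof.
move=> bf fX cX dc <-.
have h1 := is_derive_bilin bf dc dc.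
have h2 := is_derive_dotr u dc.
have E : (fun s => f (c s) (c s)) = (fun s => dot u (c s)).
  by apply/funext => s; rewrite fX.
by rewrite E in h1; have [_ <-] := h1; have [_ ->] := h2.
Qed.

Lemma quadric_derive2 (X : set V) f (u : V) c : bilin f ->
  (forall x, X x -> f x x = dot u x) -> geodesic X c ->
  f (derive1n 2 c 0) (c 0) + 2 * f (derive1 c 0) (derive1 c 0) + f (c 0) (derive1n 2 c 0)
  = dot u (derive1n 2 c 0).
Proof.
move=> bf fX [cX c1 c2 _].
have E : (fun s => f (derive1 c s) (c s) + f (c s) (derive1 c s)) =
    (fun s => dot u (derive1 c s)).
  apply/funext => s; have h1 := is_derive_bilin bf (c1 s) (c1 s).
  have h2 := is_derive_dotr u (c1 s).
  have E : (fun s => f (c s) (c s)) = (fun s => dot u (c s)).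
    by apply/funext => s'; rewrite fX.
  by rewrite E in h1; have [_ <-] := h1; have [_ ->] := h2.
have h1 := is_deriveD (is_derive_bilin bf (c2 0) (c1 0)) (is_derive_bilin bf (c1 0) (c2 0)).
have h2 := is_derive_dotr u (c2 0).
have [_ e2] := h2; have [_ e1] := h1.
move: e1; rewrite (_ : _ + _ = (fun s => dot u (derive1 c s))) //.
by rewrite e2 -[derive1n 2 c 0]/(derive1 (derive1 c) 0) => ->; ring.
Qed.

Lemma trig_curve (a b v : V) : let c : R -> V := fun t => a + (cos t *: b + sin t *: v) in
  [/\ forall t, derivable c t 1, forall t, derivable (derive1 c) t 1,
   derive1 c = (fun t => cos t *: v - sin t *: b) &
   derive1n 2 c = (fun t => - (cos t *: b + sin t *: v))].
Proof.
have H (u0 v0 w0 : V) (g h g' h' : R -> R) (t : R) : is_derive t 1 g (g' t) -> is_derive t 1 h (h' t) ->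
    is_derive t 1 (fun s => w0 + (g s *: u0 + h s *: v0)) (g' t *: u0 + h' t *: v0).
  move=> dg dh.
  have E i j : is_derive t 1 (fun s => (w0 + (g s *: u0 + h s *: v0)) i j)
      ((g' t *: u0 + h' t *: v0) i j).
    have := is_deriveD (is_derive_cst (w0 i j) t 1) (is_deriveD
      (is_deriveM' dg (is_derive_cst (u0 i j) t 1))
      (is_deriveM' dh (is_derive_cst (v0 i j) t 1))).
    rewrite !mulr0 !addr0 add0r; congr (is_derive _ _ _ _); last by rewrite !mxE.
    by apply/funext => s; rewrite !mxE.
  have D : derivable (fun s => w0 + (g s *: u0 + h s *: v0)) t 1.
    by apply/derivable_mxP => i j; case: (E i j).
  apply: DeriveDef => //; rewrite derive_mx //.
  by apply/matrixP => i j; rewrite mxE; case: (E i j).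
move=> c.
have h1 (t : R) : is_derive t 1 (c : R -> V) (- sin t *: b + cos t *: v).
  by apply: (H b v a cos sin (fun t => - sin t) cos).
have c1 : derive1 c = (fun t => cos t *: v - sin t *: b).
  apply/funext => t; rewrite derive1E; have [_ ->] := h1 t.
  by rewrite scaleNr addrC.
have h2 (t : R) : is_derive t 1 (derive1 c : R -> V) (- (cos t *: b + sin t *: v)).
  have -> : derive1 c = (fun s => 0 + ((- sin s) *: b + cos s *: v)).
    by rewrite c1; apply/funext => s; rewrite scaleNr add0r addrC.
  have -> : - (cos t *: b + sin t *: v) = (- cos t) *: b + (- sin t) *: v.
    by rewrite opprD !scaleNr.
  apply: (H b v 0 (fun s => - sin s) cos (fun t => - cos t) (fun t => - sin t)).
split=> //.
by apply/funext => t; rewrite -[derive1n 2 c]/(derive1 (derive1 c)) derive1E; case: (h2 t).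
Qed.

(** The acceleration of the circle points to its center a, so that it is enough that
    the tangent projection kills the radius. *)
Lemma trig_geodesic (X : set V) (P : V -> V -> V) (a b v : V) :
  (forall x v w, X x -> dot (P x v) w = dot v (P x w)) ->
  (forall x v, X x -> tangent X x v -> P x v = v) ->
  (forall t, X (a + (cos t *: b + sin t *: v))) ->
  (forall t, P (a + (cos t *: b + sin t *: v)) (cos t *: b + sin t *: v) = 0) ->
  exists c, [/\ geodesic X c, c 0 = a + b & derive1 c 0 = v].
Proof.
move=> Psym Ptan cX cN; have := trig_curve a b v; set c := (fun t => _) => -[d1 d2 e1 e2].
exists c; split.
- split=> // t w tw; rewrite e2 dotNl.
  rewrite -(Ptan _ _ (cX t) tw) -(Psym _ _ _ (cX t)) cN dot0l oppr0 //.
- by rewrite /c cos0 sin0 scale1r scale0r addr0.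
- by rewrite e1 cos0 sin0 scale1r scale0r subr0.
Qed.

Lemma Pol_dot : Pol 2 (fun x : V => dot x x).
Proof. by apply: Pol_sum => i; apply: Pol_sum => j; exact: (Pol_coord i j (Pol_coord1 i j)). Qed.

Lemma closed_Pol n (f : V -> R) (a : R) : Pol n f -> closed [set x | f x = a].
Proof.
move=> fP; rewrite (_ : [set x | _] = f @^-1` [set y | y = a]) //.
apply: closed_comp; last exact: closed_eq.
by move=> x _; apply: differentiable_continuous; exact: Pol_differentiable fP.
Qed.

Lemma cube_dot (B : R) : 0 <= B -> [set x : V | dot x x <= B ^+ 2] `<=` cube B.
Proof.
move=> B0 x /= xB i j; rewrite -ler_sqr ?nnegrE // real_normK ?num_real //.
apply: le_trans xB; rewrite -(dot_sum_unit x x) (bigD1 (i, j)) //= !dot_unit /=.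
rewrite -expr2 lerDl; apply: sumr_ge0 => a _; rewrite -expr2; exact: sqr_ge0.
Qed.

End BilinearDerivatives.

(** * The sphere *)

Section Sphere.
Context {R : realType} (d : nat).
Local Notation V := 'rV[R]_d.+1.
Local Arguments derive1n : simpl never.
Local Notation X := (@unit_sphere R d).
Implicit Types (x v w : V).

Definition sphere_proj x v : V := v - dot x v *: x.
Local Notation P := sphere_proj.

Lemma sphere_projD x v w : P x (v + w) = P x v + P x w.
Proof. by rewrite /P dotDr scalerDl opprD addrACA. Qed.

Lemma sphere_projZ x (a : R) v : P x (a *: v) = a *: P x v.
Proof. by rewrite /P dotZr scalerBr scalerA. Qed.

Lemma sphere_proj_sym x v w : X x -> dot (P x v) w = dot v (P x w).
Proof. by move=> _; rewrite /P dotBl dotBr dotZl dotZr (dotC v x) mulrC. Qed.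

Lemma sphere_proj_idem x v : X x -> P x (P x v) = P x v.
Proof. by move=> Xx; rewrite {1}/P {2}/P dotBr dotZr Xx mulr1 subrr scale0r subr0. Qed.

Lemma sphere_proj_tr x : X x -> \sum_a dot (P x (unit_vec a)) (unit_vec a) = d%:R.
Proof.
move=> Xx; under eq_bigr do rewrite /P dotBl dotZl.
rewrite sumrB dot_sum_unit Xx.
rewrite (eq_bigr (fun=> 1)) => [|a _]; last by rewrite dot_unit mxE !eqxx.
by rewrite sumr_const card_prod !card_ord mul1n -natr1 addrK.
Qed.

Lemma sphere_tangent x v : X x -> tangent X x v -> P x v = v.
Proof.
move=> Xx [c [cX c0 dc cv]].
have h1 := is_derive_bilin bilin_dot dc dc.
have E : (fun s => dot (c s) (c s)) = cst 1 by apply/funext => s; exact: cX.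
rewrite E in h1; have [_ e1] := h1; move: e1; rewrite derive_cst c0 cv dotC => /esym e.
have {}e : dot x v = 0 by move: e; lra.
by rewrite /P e scale0r subr0.
Qed.

Lemma sphere_geodesic x v : X x -> P x v = v -> dot v v = 1 ->
  exists c, [/\ geodesic X c, c 0 = x & derive1 c 0 = v].
Proof.
move=> Xx Pv v1.
have xv : dot x v = 0 by rewrite -Pv /P dotBr dotZr Xx mulr1 subrr.
rewrite -[x]add0r.
have cX t : X (0 + (cos t *: x + sin t *: v)).
  rewrite add0r /unit_sphere /= !dotDl !dotDr !dotZl !dotZr Xx v1 xv (dotC v x) xv.
  by rewrite -[RHS](cos2Dsin2 t); ring.
apply: (trig_geodesic sphere_proj_sym sphere_tangent cX) => t.
have := cX t; rewrite add0r /unit_sphere /= => e.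
by rewrite /P e scale1r subrr.
Qed.

Lemma sphere_acc c : geodesic X c -> dot (derive1 c 0) (derive1 c 0) = 1 ->
  derive1n 2 c 0 = - c 0.
Proof.
move=> gc v1; have [cX c1 c2 _] := gc.
have := geodesic_normal sphere_projZ sphere_proj_sym sphere_proj_idem sphere_geodesic 0 gc.
rewrite /P => /eqP; rewrite subr_eq0 => /eqP ->.
suff -> : dot (c 0) (derive1n 2 c 0) = - 1 by rewrite scaleN1r.
have E : (fun s => dot (derive1 c s) (c s)) = cst 0.
  apply/funext => s; have h1 := is_derive_bilin bilin_dot (c1 s) (c1 s).
  have E : (fun s => dot (c s) (c s)) = cst 1 by apply/funext => r; exact: cX.
  rewrite E in h1; have [_ e1] := h1; move: e1; rewrite derive_cst (dotC (c s)).
  by rewrite /cst; lra.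
have h1 := is_derive_bilin bilin_dot (c2 0) (c1 0).
rewrite E in h1; have [_ e1] := h1; move: e1; rewrite derive_cst v1 (dotC _ (c 0)).
rewrite -[derive1n 2 c 0]/(derive1 (derive1 c) 0); set y := dot (c 0) _; lra.
Qed.

Theorem sphere_eigdim_diff_le : (2 <= d)%N -> exists C : R, forall n, (1 <= n)%N ->
  `|(eigdim X d n)%:R - (eigdim X d n.-1)%:R| <= C * n%:R ^+ (d - 2).
Proof.
move=> d2.
have fex := @frame_exists R 1 d.+1 X d P sphere_projD sphere_projZ sphere_proj_sym
  sphere_proj_idem sphere_proj_tr sphere_geodesic.
pose m (i : 'I_1) (j : 'I_d.+1) k l := fun _ : V => (delta_mx k l : V) i j.
pose f (b : bool) (x : V) : R := 1 + (-1) ^+ b * x 0 0.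
pose zs b := f b :: [seq (fun x : V => x 0 (lift ord0 i)) | i <- enum 'I_d].
have zP (b : bool) : homspan X (zs b) 1 (f b) := @homspan_gen _ _ X (zs b) 0 isT.
have zP' b i : homspan X (zs b) 1 (fun x : V => x 0 (lift ord0 i)).
  have h : (i.+1 < size (zs b))%N by rewrite /= size_map size_enum_ord ltnS.
  by have := homspan_gen X h; rewrite /= (nth_map i) ?size_enum_ord // nth_ord_enum.
have dotX x : X x -> x 0 0 ^+ 2 + \sum_(i < d) x 0 (lift ord0 i) ^+ 2 = 1.
  by move=> <-; rewrite /dot big_ord_recl big_ord0 addr0 big_ord_recl expr2.
have sgn2 (b : bool) : ((-1) ^+ b : R) ^+ 2 = 1 by rewrite sqrr_sign.
have sq b : homspan X (zs b) 2 (fun x : V => \sum_(i < d) x 0 (lift ord0 i) ^+ 2).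
  apply: homspan_sum => i; exact: (homspanM (zP' b i) (zP' b i)).
have ff b := homspanM (zP b) (zP b).
apply: (@eigdim_diff_le R 1 d.+1 X d 1 d%:R 0 m d2 _ _ fex _ _ _ _ bool f zs).
- exact: (@closed_Pol R 1 d.+1 2 _ 1 Pol_dot).
- by move=> x Xx; apply: cube_dot => //=; rewrite Xx expr1n.
- by rewrite ltr0n; apply: leq_trans d2.
- by move=> *; exact: Pol_cst.
- move=> x cs Xx fr i j k l.
  rewrite (@frame_gram_proj R 1 d.+1 X d P sphere_projD sphere_projZ sphere_proj_sym
    sphere_proj_idem sphere_proj_tr sphere_tangent x cs) //.
  rewrite /P /m !mxE (dot_unit _ (k, l)) /=; ring.
- move=> x cs Xx [gc c0 co] i j.
  rewrite (eq_bigr (fun=> - x i j)) => [|a _]; last first.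
    by rewrite sphere_acc // ?co ?eqxx // c0 mxE.
  by rewrite sumr_const card_ord mxE addr0 -[LHS]mulr_natl; ring.
- move=> x Xx; have [e|e] := eqVneq (f false x) 0; last by exists false.
  by exists true; move: e; rewrite /f expr0 expr1 => e; apply/eqP; move: e; lra.
- by move=> b; rewrite /= size_map size_enum_ord.
- move=> b; apply: eq_homspan (homspanD (homspanZ (1 / 2) (ff b)) (homspanZ (1 / 2) (sq b))) => x Xx.
  have := dotX x Xx; rewrite /f; move: (sgn2 b); set s := _ ^+ b; set u := x 0 0.
  by set S := \sum_(i < d) _ => s2 h; nra.
- move=> b k l; rewrite [k]ord1.
  case: (unliftP ord0 l) => [l' ->|->]; first exact: (homspanM (zP b) (zP' b l')).
  apply: eq_homspan (homspanD (homspanZ ((-1) ^+ b / 2) (ff b)) (homspanZ (- ((-1) ^+ b / 2)) (sq b))) => x Xx.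
  have := dotX x Xx; rewrite /f; case: b; rewrite ?expr1 ?expr0; set u := x 0 0;
  by set S := \sum_(i < d) _ => h; nra.
Qed.

End Sphere.

(** * Cayley-Dickson algebras *)

(* Solves linear identities between Cayley-Dickson products, which are treated as
   unknowns. *)
Ltac additive :=
  repeat match goal with |- context [cdmul ?u ?v] => generalize (cdmul u v); intro end;
  apply/matrixP => ? ?; rewrite !mxE; ring.

Section CayleyDicksonAlgebra.
Context {R : realType}.
Local Notation CD k := 'rV[R]_(cddim k).
Implicit Types (k : nat) (a b c : R).

Lemma cdP k (x : CD k.+1) : exists y z : CD k, x = row_mx y z.
Proof. by exists (lsubmx x), (rsubmx x); rewrite hsubmxK. Qed.

Lemma cdpairD k (x y z w : CD k) :
  (row_mx x y : CD k.+1) + row_mx z w = row_mx (x + z) (y + w).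
Proof. exact: add_row_mx. Qed.

Lemma cdpairZ k a (x y : CD k) : a *: (row_mx x y : CD k.+1) = row_mx (a *: x) (a *: y).
Proof. exact: scale_row_mx. Qed.

Lemma cdpairN k (x y : CD k) : - (row_mx x y : CD k.+1) = row_mx (- x) (- y).
Proof. exact: opp_row_mx. Qed.

Lemma cdmul_pair k (x y z w : CD k) :
  @cdmul R k.+1 (row_mx x y) (row_mx z w) =
  row_mx (cdmul x z - cdmul (cdconj w) y) (cdmul w x + cdmul y (cdconj z)).
Proof. by rewrite /= !row_mxKl !row_mxKr. Qed.

Lemma cdconj_pair k (x y : CD k) : @cdconj R k.+1 (row_mx x y) = row_mx (cdconj x) (- y).
Proof. by rewrite /= !row_mxKl !row_mxKr. Qed.

Lemma cd1_pair k : @cd1 R k.+1 = row_mx (cd1 k) 0.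
Proof. by []. Qed.

Local Arguments cdmul : simpl never.
Local Arguments cdconj : simpl never.
Local Arguments cd1 : simpl never.

Lemma dot_row_mx n m (x z : 'rV[R]_n) (y w : 'rV[R]_m) :
  dot (row_mx x y) (row_mx z w) = dot x z + dot y w.
Proof.
rewrite /dot !big_ord1 big_split_ord /=; congr (_ + _); apply: eq_bigr => i _.
  by rewrite !row_mxEl.
by rewrite !row_mxEr.
Qed.

Lemma dot_pair k (x y z w : CD k) :
  dot (row_mx x y : CD k.+1) (row_mx z w) = dot x z + dot y w.
Proof. exact: dot_row_mx. Qed.

Lemma cdconjD k (x y : CD k) : cdconj (x + y) = cdconj x + cdconj y.
Proof.
elim: k x y => [//|k IH] x y; have [a [b ->]] := cdP x; have [c [d ->]] := cdP y.
by rewrite cdpairD !cdconj_pair IH opprD cdpairD.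
Qed.

Lemma cdconjZ k a (x : CD k) : cdconj (a *: x) = a *: cdconj x.
Proof.
elim: k x => [//|k IH] x; have [b [c ->]] := cdP x.
by rewrite cdpairZ !cdconj_pair IH cdpairZ scalerN.
Qed.

Lemma cdconjN k (x : CD k) : cdconj (- x) = - cdconj x.
Proof. by rewrite -scaleN1r cdconjZ scaleN1r. Qed.

Lemma cdconjK k (x : CD k) : cdconj (cdconj x) = x.
Proof.
elim: k x => [//|k IH] x; have [b [c ->]] := cdP x.
by rewrite !cdconj_pair IH opprK.
Qed.

Lemma cdconj1 k : cdconj (cd1 k : CD k) = cd1 k.
Proof. by elim: k => [//|k IH]; rewrite cd1_pair cdconj_pair IH oppr0. Qed.

Lemma dot_cdconj k (x y : CD k) : dot (cdconj x) (cdconj y) = dot x y.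
Proof.
elim: k x y => [//|k IH] x y; have [a [b ->]] := cdP x; have [c [d ->]] := cdP y.
by rewrite !cdconj_pair !dot_pair IH dotNl dotNr opprK.
Qed.

Lemma dot_cdconjl k (x y : CD k) : dot (cdconj x) y = dot x (cdconj y).
Proof. by rewrite -dot_cdconj cdconjK. Qed.

Lemma cdmulD k (x y z : CD k) :
  cdmul (x + y) z = cdmul x z + cdmul y z /\ cdmul z (x + y) = cdmul z x + cdmul z y.
Proof.
elim: k x y z => [|k IH] x y z.
  by rewrite /cdmul /= mulmxDl mulmxDr.
have [a [b ->]] := cdP x; have [c [d ->]] := cdP y; have [e [f ->]] := cdP z.
rewrite cdpairD !cdmul_pair !cdpairD !cdconjD.
rewrite !(fun u v w => (IH u v w).1) !(fun u v w => (IH u v w).2) !opprD.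
by split; congr row_mx; rewrite addrACA.
Qed.

Lemma cdmulDl k (x y z : CD k) : cdmul (x + y) z = cdmul x z + cdmul y z.
Proof. by case: (cdmulD x y z). Qed.

Lemma cdmulDr k (x y z : CD k) : cdmul z (x + y) = cdmul z x + cdmul z y.
Proof. by case: (cdmulD x y z). Qed.

Lemma cdmulZ k a (x y : CD k) :
  cdmul (a *: x) y = a *: cdmul x y /\ cdmul x (a *: y) = a *: cdmul x y.
Proof.
elim: k x y => [|k IH] x y.
  by rewrite /cdmul /= -scalemxAl -scalemxAr.
have [b [c ->]] := cdP x; have [d [e ->]] := cdP y.
rewrite !cdmul_pair !cdpairZ !cdmul_pair !cdconjZ.
rewrite !(fun u v => (IH u v).1) !(fun u v => (IH u v).2).
by rewrite -!scalerBr -!scalerDr.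
Qed.

Lemma cdmulZl k a (x y : CD k) : cdmul (a *: x) y = a *: cdmul x y.
Proof. by case: (cdmulZ a x y). Qed.

Lemma cdmulZr k a (x y : CD k) : cdmul x (a *: y) = a *: cdmul x y.
Proof. by case: (cdmulZ a x y). Qed.

Lemma cdmulNl k (x y : CD k) : cdmul (- x) y = - cdmul x y.
Proof. by rewrite -scaleN1r cdmulZl scaleN1r. Qed.

Lemma cdmulNr k (x y : CD k) : cdmul x (- y) = - cdmul x y.
Proof. by rewrite -scaleN1r cdmulZr scaleN1r. Qed.

Lemma cdmul0l k (x : CD k) : cdmul 0 x = 0.
Proof. by rewrite -(scale0r (0 : CD k)) cdmulZl !scale0r. Qed.

Lemma cdmul0r k (x : CD k) : cdmul x 0 = 0.
Proof. by rewrite -(scale0r (0 : CD k)) cdmulZr !scale0r. Qed.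

Lemma cdconj0 k : cdconj (0 : CD k) = 0.
Proof. by rewrite -(scale0r (0 : CD k)) cdconjZ !scale0r. Qed.

Lemma cdmul1 k (x : CD k) : cdmul (cd1 k) x = x /\ cdmul x (cd1 k) = x.
Proof.
elim: k x => [|k IH] x.
  by rewrite /cdmul /cd1 /= mul1mx mulmx1.
have [b [c ->]] := cdP x; rewrite cd1_pair !cdmul_pair.
by rewrite !(cdmul0r, cdconj0, cdmul0l, cdconj1) !(fun u => (IH u).1)
  !(fun u => (IH u).2) !(subr0, addr0, add0r).
Qed.

Lemma cdmul1l k (x : CD k) : cdmul (cd1 k) x = x.
Proof. by case: (cdmul1 x). Qed.

Lemma cdmul1r k (x : CD k) : cdmul x (cd1 k) = x.
Proof. by case: (cdmul1 x). Qed.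

Lemma cdconjM k (x y : CD k) : cdconj (cdmul x y) = cdmul (cdconj y) (cdconj x).
Proof.
elim: k x y => [|k IH] x y.
  rewrite /cdconj /cdmul /=; apply/matrixP => i j; rewrite !mxE !big_ord1 !ord1.
  exact: mulrC.
have [a [b ->]] := cdP x; have [c [d ->]] := cdP y.
rewrite !(cdmul_pair, cdconj_pair) !cdconjK cdconjN !cdmulNl !cdmulNr opprK.
by rewrite cdconjD cdconjN !IH cdconjK opprD addrC [- _ - _]addrC.
Qed.

Lemma dot11 k : dot (cd1 k : CD k) (cd1 k) = 1.
Proof.
elim: k => [|k IH]; last by rewrite cd1_pair dot_pair IH dot0l addr0.
by rewrite /dot /cd1 /= !big_ord1 mxE mulr1.
Qed.

(** The real part of x is its scalar product with the unit. *)
Lemma cdconjE k (x : CD k) : cdconj x = (2 * dot x (cd1 k)) *: cd1 k - x.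
Proof.
elim: k x => [|k IH] x.
  rewrite /cdconj /=; apply/matrixP => i j; rewrite !mxE !ord1.
  by rewrite /dot /cd1 /= !big_ord1 mxE /= mulr1; ring.
have [b [c ->]] := cdP x; rewrite cdconj_pair cd1_pair dot_pair dot0r addr0 IH.
by rewrite cdpairZ cdpairN cdpairD scaler0 add0r.
Qed.

Lemma cd_real k (x : CD k) : cdconj x = x -> x = dot x (cd1 k) *: cd1 k.
Proof.
move=> xr; have := cdconjE x; rewrite xr => /eqP; rewrite -subr_eq0 opprB addrA => /eqP e.
have {}e : 2 *: x = 2 *: (dot x (cd1 k) *: cd1 k).
  by rewrite scalerA; apply/eqP; rewrite -subr_eq0 scaler_nat mulr2n; apply/eqP.
by apply: (scalerI (a := 2)) e; rewrite pnatr_eq0.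
Qed.

Lemma dot_cdmul k (x y z : CD k) : dot (cdmul x y) z = dot y (cdmul (cdconj x) z).
Proof.
elim: k x y z => [|k IH] x y z.
  rewrite /dot /cdmul /cdconj /= !big_ord1 !mxE !big_ord1; ring.
have IH' (u v w : CD k) : dot (cdmul u v) w = dot u (cdmul w (cdconj v)).
  rewrite -dot_cdconj cdconjM IH cdconjK -[RHS]dot_cdconj cdconjM cdconjK.
  by [].
have [a [b ->]] := cdP x; have [c [d ->]] := cdP y; have [e [f ->]] := cdP z.
rewrite cdconj_pair !cdmul_pair !dot_pair cdmulNl cdmulNr opprK.
rewrite !dotBl !dotDl !dotDr !dotNr.
have h1 : dot (cdmul a c) e = dot c (cdmul (cdconj a) e) by rewrite IH.
have h2 : dot (cdmul (cdconj d) b) e = dot d (cdmul b (cdconj e)).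
  by rewrite IH' dot_cdconjl cdconjM cdconjK.
have h3 : dot (cdmul d a) f = dot d (cdmul f (cdconj a)) by rewrite IH'.
have h4 : dot (cdmul b (cdconj c)) f = dot c (cdmul (cdconj f) b).
  by rewrite IH dot_cdconjl cdconjM cdconjK.
rewrite h1 h2 h3 h4; ring.
Qed.

Lemma dot_cdmulr k (x y z : CD k) : dot (cdmul x y) z = dot x (cdmul z (cdconj y)).
Proof.
by rewrite -dot_cdconj cdconjM dot_cdmul cdconjK -[RHS]dot_cdconj cdconjM cdconjK.
Qed.

Lemma cdmul_conjl k (x : CD k) : cdmul (cdconj x) x = dot x x *: cd1 k.
Proof.
rewrite [LHS]cd_real; last by rewrite cdconjM cdconjK.
by rewrite dot_cdmulr cdmul1l dot_cdconj.
Qed.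

Lemma cdmul_conjr k (x : CD k) : cdmul x (cdconj x) = dot x x *: cd1 k.
Proof. by rewrite -{1}(cdconjK x) cdmul_conjl dot_cdconj. Qed.

(** Doubling preserves commutativity once, associativity twice and alternativity
    three times. *)
Lemma cdmulC k (x y : CD k) : (k <= 1)%N -> cdmul x y = cdmul y x.
Proof.
have C0 (u v : CD 0) : cdmul u v = cdmul v u.
  rewrite /cdmul /=; apply/matrixP => i j; rewrite !mxE !big_ord1 !ord1; exact: mulrC.
case: k x y => [|[|//]] x y _; first exact: C0.
have [a [b ->]] := cdP x; have [c [d ->]] := cdP y; rewrite !cdmul_pair.
by congr row_mx; rewrite /cdconj ?[cdmul b _]C0 ?(C0 c a) ?(C0 d b) ?(C0 d a) // addrC (C0 c b).
Qed.

Lemma cdmulA k (x y z : CD k) : (k <= 2)%N -> cdmul x (cdmul y z) = cdmul (cdmul x y) z.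
Proof.
elim: k x y z => [|k IH] x y z hk; first by rewrite /cdmul /= mulmxA.
have [a [b ->]] := cdP x; have [c [d ->]] := cdP y; have [e [f ->]] := cdP z.
have A (u v w : CD k) : cdmul u (cdmul v w) = cdmul (cdmul u v) w by apply: IH; exact: ltnW.
have C (u v : CD k) : cdmul u v = cdmul v u by exact: cdmulC.
have rot (u v w : CD k) : cdmul u (cdmul v w) = cdmul v (cdmul w u) by rewrite A C A C A.
rewrite !cdmul_pair !(cdconjD, cdconjN, cdconjM, cdconjK).
rewrite !(cdmulDl, cdmulDr, cdmulNl, cdmulNr).
congr row_mx.
  rewrite A (rot a) -(A _ _ b) (rot (cdconj c)) -(A _ _ b) (rot e) (A (cdconj d)).
  by rewrite !opprD !addrA addrAC; congr (_ + _); rewrite addrAC.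
rewrite -(A f) (C c a) -(A d) (rot d (cdconj e)) (A (cdconj e)) (C (cdconj e)) -(A d).
rewrite (C _ d) (C (cdconj e) (cdconj c)) (A b) (rot b (cdconj d)) (rot (cdconj d)) (C b (cdconj d)).
by rewrite -!addrA; congr (_ + _); rewrite addrA addrC.
Qed.

Lemma cdmul_conjr_polar k (u v : CD k) :
  cdmul u (cdconj v) + cdmul v (cdconj u) = (2 * dot u v) *: cd1 k.
Proof.
have := cdmul_conjr (u + v); rewrite cdconjD cdmulDl !cdmulDr !cdmul_conjr.
rewrite dotDl !dotDr (dotC v u) => e; apply: (addrI (dot u u *: cd1 k)).
apply: (addIr (dot v v *: cd1 k)); rewrite -!addrA in e *; rewrite e -!scalerDl.
by congr (_ *: _); ring.
Qed.

Lemma cdmul_conjl_polar k (u v : CD k) :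
  cdmul (cdconj u) v + cdmul (cdconj v) u = (2 * dot u v) *: cd1 k.
Proof.
by have := cdmul_conjr_polar (cdconj u) (cdconj v); rewrite !cdconjK dot_cdconj.
Qed.

(** Alternativity in its polarised form: doubling produces it from
    associativity. *)
Lemma cdmul_alt k (x y z : CD k) : (k <= 3)%N ->
  cdmul x (cdmul (cdconj y) z) + cdmul y (cdmul (cdconj x) z) = (2 * dot x y) *: z.
Proof.
case: k x y z => [|k] x y z k3.
  by rewrite !cdmulA // -cdmulDl cdmul_conjr_polar cdmulZl cdmul1l.
have A (u v w : CD k) : cdmul u (cdmul v w) = cdmul (cdmul u v) w by apply: cdmulA.
have [a [b ->]] := cdP x; have [c [d ->]] := cdP y; have [e [f ->]] := cdP z.
rewrite !cdconj_pair !cdmul_pair !dot_pair cdpairD cdpairZ.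
rewrite !(cdconjD, cdconjN, cdconjM, cdconjK).
rewrite !(cdmulDl, cdmulDr, cdmulNl, cdmulNr) !opprK.
have r1 : cdmul (cdmul a (cdconj c)) e + cdmul (cdmul c (cdconj a)) e = (2 * dot a c) *: e.
  by rewrite -cdmulDl cdmul_conjr_polar cdmulZl cdmul1l.
have r2 : cdmul e (cdmul (cdconj d) b) + cdmul e (cdmul (cdconj b) d) = (2 * dot b d) *: e.
  by rewrite -cdmulDr cdmul_conjl_polar cdmulZr cdmul1r (dotC d).
have r3 : cdmul f (cdmul (cdconj c) a) + cdmul f (cdmul (cdconj a) c) = (2 * dot a c) *: f.
  by rewrite -cdmulDr cdmul_conjl_polar cdmulZr cdmul1r (dotC c).
have r4 : cdmul (cdmul b (cdconj d)) f + cdmul (cdmul d (cdconj b)) f = (2 * dot b d) *: f.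
  by rewrite -cdmulDl cdmul_conjr_polar cdmulZl cdmul1l.
rewrite mulrDr; congr row_mx; rewrite scalerDl.
  rewrite -r1 -r2 -!A.
  by additive.
by rewrite -r3 -r4 -!A; additive.
Qed.

Lemma cdmul_altr k (x y z : CD k) : (k <= 3)%N ->
  cdmul (cdmul z (cdconj y)) x + cdmul (cdmul z (cdconj x)) y = (2 * dot x y) *: z.
Proof.
move=> k3; rewrite -[LHS]cdconjK cdconjD 4!cdconjM !cdconjK.
have := cdmul_alt (cdconj x) (cdconj y) (cdconj z) k3.
by rewrite !cdconjK dot_cdconj => ->; rewrite cdconjZ cdconjK.
Qed.

(** The sums below over the standard basis are the partial traces from which the
    tangent projection of a projective space gets its trace and its Laplacian. *)
Definition cdbase k (m : 'I_(cddim k)) : CD k := delta_mx 0 m.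

Lemma dot_cdbase k (x : CD k) m : dot x (cdbase m) = x 0 m.
Proof. exact: (dot_unit x (0, m)). Qed.

Lemma dot_cdbase1 k m : dot (@cdbase k m) (cdbase m) = 1.
Proof. by rewrite dot_cdbase mxE !eqxx. Qed.

Lemma sum_cdbase k (x : CD k) : \sum_m dot (cdbase m) x *: cdbase m = x.
Proof. by rewrite [RHS]row_sum_delta; apply: eq_bigr => m _; rewrite dotC dot_cdbase. Qed.

Lemma cdmul_suml k (I : Type) (r : seq I) (x : I -> CD k) (y : CD k) :
  cdmul (\sum_(i <- r) x i) y = \sum_(i <- r) cdmul (x i) y.
Proof.
elim: r => [|i r IH]; first by rewrite !big_nil cdmul0l.
by rewrite !big_cons cdmulDl IH.
Qed.

Lemma cdmul_sumr k (I : Type) (r : seq I) (x : I -> CD k) (y : CD k) :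
  cdmul y (\sum_(i <- r) x i) = \sum_(i <- r) cdmul y (x i).
Proof.
elim: r => [|i r IH]; first by rewrite !big_nil cdmul0r.
by rewrite !big_cons cdmulDr IH.
Qed.

Lemma cdconj_sum k (I : Type) (r : seq I) (x : I -> CD k) :
  cdconj (\sum_(i <- r) x i) = \sum_(i <- r) cdconj (x i).
Proof.
elim: r => [|i r IH]; first by rewrite !big_nil cdconj0.
by rewrite !big_cons cdconjD IH.
Qed.

Lemma cdmulKr k (x e : CD k) : (k <= 3)%N ->
  cdmul (cdmul x e) (cdconj e) = dot e e *: x.
Proof.
move=> k3; have := cdmul_altr (cdconj e) (cdconj e) x k3.
rewrite cdconjK dot_cdconj -mulr2n -scaler_nat -scalerA => h.
by apply: (scalerI (a := 2)) h; rewrite pnatr_eq0.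
Qed.

Lemma sum_cdmulK k (x : CD k) : (k <= 3)%N ->
  \sum_m cdmul (cdmul x (cdbase m)) (cdconj (cdbase m)) = (cddim k)%:R *: x.
Proof.
move=> k3; under eq_bigr do rewrite cdmulKr // dot_cdbase1 scale1r.
by rewrite sumr_const card_ord scaler_nat.
Qed.

Lemma sum_cdmul_conj k (x : CD k) : (k <= 3)%N ->
  \sum_m cdmul (cdmul x (cdconj (cdbase m))) (cdconj (cdbase m)) = (2 - (cddim k)%:R) *: x.
Proof.
move=> k3.
have E m : cdmul (cdmul x (cdconj (cdbase m))) (cdconj (cdbase m)) =
    2 *: cdmul x (cdconj (dot (cdbase m) (cd1 k) *: cdbase m)) - x.
  rewrite {1}(cdconjE (cdbase m)) cdmulDr cdmulNr cdmulDl cdmulNl cdmulKr // dot_cdbase1 scale1r.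
  by rewrite cdmulZr cdmul1r cdmulZl cdconjZ cdmulZr scalerA.
under eq_bigr do rewrite E.
rewrite sumrB -scaler_sumr -cdmul_sumr -cdconj_sum.
have -> : \sum_m dot (cdbase m) (cd1 k) *: cdbase m = cd1 k by exact: sum_cdbase.
by rewrite cdconj1 cdmul1r sumr_const card_ord scalerBl !scaler_nat.
Qed.

Lemma sum_cdmul_flip k (x : CD k) : (k <= 3)%N ->
  \sum_m cdmul (cdmul (cdconj (cdbase m)) x) (cdconj (cdbase m)) =
  (2 - (cddim k)%:R) *: cdconj x.
Proof.
move=> k3; rewrite -{1}(cdconjK x); set y := cdconj x.
have E m : cdmul (cdmul (cdconj (cdbase m)) (cdconj y)) (cdconj (cdbase m)) =
    2 *: cdconj (dot (cdbase m) (cdconj y) *: cdbase m) - y.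
  rewrite -cdconjM cdconjE cdmulDl cdmulNl cdmulKr // dot_cdbase1 scale1r.
  by rewrite cdmulZl cdmul1l cdconjZ scalerA dot_cdmul cdmul1r dotC dot_cdconjl dotC dot_cdconjl.
under eq_bigr do rewrite E.
rewrite sumrB -scaler_sumr -cdconj_sum sum_cdbase cdconjK.
by rewrite sumr_const card_ord scalerBl !scaler_nat.
Qed.

End CayleyDicksonAlgebra.

(** * Matrices over a Cayley-Dickson algebra *)

Section CayleyDicksonMatrices.
Context {R : realType} (k r : nat).
Local Notation CD := 'rV[R]_(cddim k).
Local Notation V := 'M[R]_(r.+1 * r.+1, cddim k).
Local Arguments cdmul : simpl never.
Local Arguments cdconj : simpl never.
Local Arguments cd1 : simpl never.
Implicit Types (x y z : V) (i j l : 'I_r.+1).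

Definition of_entries (g : 'I_r.+1 -> 'I_r.+1 -> CD) : V :=
  \matrix_(a, b) mxvec (\matrix_(i, j) g i j 0 b) 0 a.

Lemma entry_of_entries g i j : entry (of_entries g) i j = g i j.
Proof. by apply/rowP => b; rewrite !mxE mxvecE mxE. Qed.

Lemma entryP x y : (forall i j, entry x i j = entry y i j) -> x = y.
Proof.
move=> h; apply/matrixP => a b; case/mxvec_indexP: a => i j.
by have /rowP/(_ b) := h i j; rewrite !mxE.
Qed.

Lemma entryD x y i j : entry (x + y) i j = entry x i j + entry y i j.
Proof. by apply/rowP => b; rewrite !mxE. Qed.

Lemma entryZ (a : R) x i j : entry (a *: x) i j = a *: entry x i j.
Proof. by apply/rowP => b; rewrite !mxE. Qed.

Lemma entryN x i j : entry (- x) i j = - entry x i j.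
Proof. by apply/rowP => b; rewrite !mxE. Qed.

Lemma entry_sum (I : Type) (s : seq I) (x : I -> V) i j :
  entry (\sum_(a <- s) x a) i j = \sum_(a <- s) entry (x a) i j.
Proof.
elim: s => [|a s IH]; last by rewrite !big_cons entryD IH.
by rewrite !big_nil; apply/rowP => b; rewrite !mxE.
Qed.

Lemma sum_mxvec_index (W : nmodType) (F : 'I_(r.+1 * r.+1) -> W) :
  \sum_a F a = \sum_i \sum_j F (mxvec_index i j).
Proof. by rewrite (reindex _ (curry_mxvec_bij _ _)) /= pair_bigA /=; apply: eq_bigr => -[]. Qed.

Lemma dot_entry x y : dot x y = \sum_i \sum_j dot (entry x i j) (entry y i j).
Proof.
rewrite {1}/dot sum_mxvec_index; apply: eq_bigr => i _; apply: eq_bigr => j _.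
by rewrite /dot big_ord1; apply: eq_bigr => b _; rewrite !mxE.
Qed.

Definition hmul x y : V := of_entries (fun i j => \sum_l cdmul (entry x i l) (entry y l j)).
Definition star x : V := of_entries (fun i j => cdconj (entry x j i)).
Definition hone : V := of_entries (fun i j => (i == j)%:R *: cd1 k).
Lemma entry_mul x y i j : entry (hmul x y) i j = \sum_l cdmul (entry x i l) (entry y l j).
Proof. exact: entry_of_entries. Qed.

Lemma entry_star x i j : entry (star x) i j = cdconj (entry x j i).
Proof. exact: entry_of_entries. Qed.

Lemma entry_one i j : entry hone i j = (i == j)%:R *: cd1 k.
Proof. exact: entry_of_entries. Qed.

Lemma hmulDl x y z : hmul (x + y) z = hmul x z + hmul y z.
Proof.
apply: entryP => i j; rewrite entryD !entry_mul -big_split /=.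
by apply: eq_bigr => l _; rewrite entryD cdmulDl.
Qed.

Lemma hmulDr x y z : hmul x (y + z) = hmul x y + hmul x z.
Proof.
apply: entryP => i j; rewrite entryD !entry_mul -big_split /=.
by apply: eq_bigr => l _; rewrite entryD cdmulDr.
Qed.

Lemma hmulZl (a : R) x y : hmul (a *: x) y = a *: hmul x y.
Proof.
apply: entryP => i j; rewrite entryZ !entry_mul scaler_sumr.
by apply: eq_bigr => l _; rewrite entryZ cdmulZl.
Qed.

Lemma hmulZr (a : R) x y : hmul x (a *: y) = a *: hmul x y.
Proof.
apply: entryP => i j; rewrite entryZ !entry_mul scaler_sumr.
by apply: eq_bigr => l _; rewrite entryZ cdmulZr.
Qed.

Lemma hmulNl x y : hmul (- x) y = - hmul x y.
Proof. by rewrite -scaleN1r hmulZl scaleN1r. Qed.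

Lemma hmulNr x y : hmul x (- y) = - hmul x y.
Proof. by rewrite -scaleN1r hmulZr scaleN1r. Qed.

Lemma hmul1l x : hmul hone x = x.
Proof.
apply: entryP => i j; rewrite entry_mul (bigD1 i) //= entry_one eqxx scale1r cdmul1l.
rewrite big1 ?addr0 // => l li.
by rewrite entry_one eq_sym (negbTE li) scale0r cdmul0l.
Qed.

Lemma hmul1r x : hmul x hone = x.
Proof.
apply: entryP => i j; rewrite entry_mul (bigD1 j) //= entry_one eqxx scale1r cdmul1r.
rewrite big1 ?addr0 // => l li.
by rewrite entry_one (negbTE li) scale0r cdmul0r.
Qed.

Lemma starD x y : star (x + y) = star x + star y.
Proof. by apply: entryP => i j; rewrite !(entryD, entry_star) cdconjD. Qed.

Lemma starZ (a : R) x : star (a *: x) = a *: star x.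
Proof. by apply: entryP => i j; rewrite !(entryZ, entry_star) cdconjZ. Qed.

Lemma starN x : star (- x) = - star x.
Proof. by rewrite -scaleN1r starZ scaleN1r. Qed.

Lemma starK x : star (star x) = x.
Proof. by apply: entryP => i j; rewrite !entry_star cdconjK. Qed.

Lemma star1 : star hone = hone.
Proof. by apply: entryP => i j; rewrite entry_star !entry_one cdconjZ cdconj1 eq_sym. Qed.

Lemma star_mul x y : star (hmul x y) = hmul (star y) (star x).
Proof.
apply: entryP => i j; rewrite entry_star !entry_mul cdconj_sum.
by apply: eq_bigr => l _; rewrite cdconjM !entry_star.
Qed.

Lemma hmul_sumr (I : Type) (s : seq I) (y : I -> V) x :
  hmul x (\sum_(a <- s) y a) = \sum_(a <- s) hmul x (y a).
Proof.
elim: s => [|a s IH]; last by rewrite !big_cons hmulDr IH.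
by rewrite !big_nil -(scale0r (0 : V)) hmulZr !scale0r.
Qed.

Lemma star_sum (I : Type) (s : seq I) (y : I -> V) :
  star (\sum_(a <- s) y a) = \sum_(a <- s) star (y a).
Proof.
elim: s => [|a s IH]; last by rewrite !big_cons starD IH.
by rewrite !big_nil -(scale0r (0 : V)) starZ !scale0r.
Qed.

Lemma dot_star x y : dot (star x) (star y) = dot x y.
Proof.
rewrite !dot_entry exchange_big /=; apply: eq_bigr => i _; apply: eq_bigr => j _.
by rewrite !entry_star dot_cdconj.
Qed.

Lemma dot_mull x y z : dot (hmul x y) z = dot y (hmul (star x) z).
Proof.
rewrite !dot_entry.
under eq_bigr => i _ do under eq_bigr => j _ do rewrite entry_mul dot_suml.
under [RHS]eq_bigr => i _ do under eq_bigr => j _ do rewrite entry_mul dot_sumr.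
rewrite (eq_bigr (fun i => \sum_l \sum_j dot (cdmul (entry x i l) (entry y l j)) (entry z i j))).
  rewrite exchange_big /=; apply: eq_bigr => l _; rewrite exchange_big /=.
  apply: eq_bigr => j _; apply: eq_bigr => i _.
  by rewrite entry_star dot_cdmul.
by move=> i _; rewrite exchange_big.
Qed.

Lemma dot_mulr x y z : dot (hmul x y) z = dot x (hmul z (star y)).
Proof. by rewrite -dot_star star_mul dot_mull starK -[RHS]dot_star star_mul starK. Qed.

Lemma dot_one x : dot x hone = \sum_i dot (entry x i i) (cd1 k).
Proof.
rewrite dot_entry; apply: eq_bigr => i _; rewrite (bigD1 i) //= entry_one eqxx scale1r.
rewrite big1 ?addr0 // => j ji; by rewrite entry_one eq_sym (negbTE ji) scale0r dot0r.
Qed.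

Lemma dot_one_one : dot hone hone = r.+1%:R.
Proof.
rewrite dot_one (eq_bigr (fun=> 1)) ?sumr_const ?card_ord // => i _.
by rewrite entry_one eqxx scale1r dot11.
Qed.

Lemma star_diag x i : star x = x -> entry x i i = dot (entry x i i) (cd1 k) *: cd1 k.
Proof. by move=> sx; apply: cd_real; rewrite -{2}sx entry_star. Qed.

Definition jord x y := hmul x y + hmul y x.

Lemma jordC x y : jord x y = jord y x. Proof. exact: addrC. Qed.

Lemma jordDr x y z : jord x (y + z) = jord x y + jord x z.
Proof. by rewrite /jord hmulDl hmulDr addrACA. Qed.

Lemma jordZr (a : R) x y : jord x (a *: y) = a *: jord x y.
Proof. by rewrite /jord hmulZl hmulZr scalerDr. Qed.

Lemma jordDl x y z : jord (x + y) z = jord x z + jord y z.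
Proof. by rewrite jordC jordDr !(jordC z). Qed.

Lemma jordZl (a : R) x y : jord (a *: x) y = a *: jord x y.
Proof. by rewrite jordC jordZr jordC. Qed.

Lemma jordNr x y : jord x (- y) = - jord x y.
Proof. by rewrite -scaleN1r jordZr scaleN1r. Qed.

Lemma jord1 x : jord x hone = 2 *: x.
Proof. by rewrite /jord hmul1l hmul1r scaler_nat mulr2n. Qed.

Lemma star_J x y : star x = x -> star y = y -> star (jord x y) = jord x y.
Proof. by move=> sx sy; rewrite /jord starD !star_mul sx sy addrC. Qed.

Lemma dot_J x y z : star x = x -> dot (jord x y) z = dot y (jord x z).
Proof. by move=> sx; rewrite /jord dotDl dotDr dot_mull dot_mulr sx. Qed.

Lemma dot_mul1 x y : star x = x -> dot (hmul x y) hone = dot x y.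
Proof. by move=> sx; rewrite dot_mull sx hmul1r dotC. Qed.

Lemma entry_unit (a : 'I_(r.+1 * r.+1) * 'I_(cddim k)) i j :
  entry (unit_vec a : V) i j = (mxvec_index i j == a.1)%:R *: cdbase a.2.
Proof. by apply/rowP => b; rewrite !mxE /= -natrM mulnb. Qed.

Lemma sum_unit_index (F : 'I_(r.+1 * r.+1) * 'I_(cddim k) -> V) :
  \sum_a F a = \sum_i \sum_j \sum_m F (mxvec_index i j, m).
Proof.
rewrite (eq_bigr (fun a => F (a.1, a.2))) => [|[]//].
by rewrite -(pair_bigA _ (fun u v => F (u, v))) sum_mxvec_index.
Qed.

Lemma eq_mxvec_index i j i' j' : (mxvec_index i j == mxvec_index i' j') = (i == i') && (j == j').
Proof.
apply/eqP/andP => [h|[/eqP-> /eqP->]//].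
have := congr1 (fun u => vec_mx (delta_mx 0 u : 'rV[R]_(_ * _)) i j) h.
rewrite !vec_mx_delta !mxE !eqxx /=; case: (i == i'); case: (j == j') => //= /eqP.
all: by rewrite oner_eq0.
Qed.


(* A product with a matrix unit moves one column or one row. *)
Lemma entry_mul_unit x (i j : 'I_r.+1) m a b :
  entry (hmul x (unit_vec (mxvec_index i j, m))) a b = (b == j)%:R *: cdmul (entry x a i) (cdbase m).
Proof.
rewrite entry_mul (bigD1 i) //= entry_unit eq_mxvec_index eqxx cdmulZr big1 ?addr0 // => l li.
by rewrite entry_unit eq_mxvec_index (negbTE li) scale0r cdmul0r.
Qed.

Lemma entry_mul_star_unit x (i j : 'I_r.+1) m a b :
  entry (hmul x (star (unit_vec (mxvec_index i j, m)))) a b =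
  (b == i)%:R *: cdmul (entry x a j) (cdconj (cdbase m)).
Proof.
rewrite entry_mul (bigD1 j) //= entry_star entry_unit eq_mxvec_index eqxx andbT cdconjZ cdmulZr.
rewrite big1 ?addr0 // => l lj.
by rewrite entry_star entry_unit eq_mxvec_index (negbTE lj) andbF scale0r cdconj0 cdmul0r.
Qed.

Lemma entry_unit_mul x (i j : 'I_r.+1) m a b :
  entry (hmul (unit_vec (mxvec_index i j, m)) x) a b = (a == i)%:R *: cdmul (cdbase m) (entry x j b).
Proof.
rewrite entry_mul (bigD1 j) //= entry_unit eq_mxvec_index eqxx andbT cdmulZl.
rewrite big1 ?addr0 // => l lj.
by rewrite entry_unit eq_mxvec_index (negbTE lj) andbF scale0r cdmul0l.
Qed.

Lemma entry_star_unit_mul x (i j : 'I_r.+1) m a b :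
  entry (hmul (star (unit_vec (mxvec_index i j, m))) x) a b =
  (a == j)%:R *: cdmul (cdconj (cdbase m)) (entry x i b).
Proof.
rewrite entry_mul (bigD1 i) //= entry_star entry_unit eq_mxvec_index eqxx cdconjZ cdmulZl.
rewrite big1 ?addr0 // => l li.
by rewrite entry_star entry_unit eq_mxvec_index (negbTE li) scale0r cdconj0 cdmul0l.
Qed.

Lemma sum_delta (W : lmodType R) (F : 'I_r.+1 -> W) b : \sum_i (b == i)%:R *: F i = F b.
Proof.
rewrite (bigD1 b) //= eqxx scale1r big1 ?addr0 // => i ib.
by rewrite eq_sym (negbTE ib) scale0r.
Qed.

Hypothesis k3 : (k <= 3)%N.

Lemma sum_mul_unit_star x : \sum_e hmul (hmul x (unit_vec e)) (star (unit_vec e)) =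
  ((cddim k)%:R * r.+1%:R) *: x.
Proof.
apply: entryP => a b; rewrite sum_unit_index !entry_sum.
rewrite (eq_bigr (fun i => (b == i)%:R *: (((cddim k)%:R * r.+1%:R) *: entry x a i))).
  by rewrite sum_delta entryZ.
move=> i _; rewrite entry_sum.
rewrite (eq_bigr (fun j => (b == i)%:R *: ((cddim k)%:R *: entry x a i))).
  by rewrite sumr_const card_ord -scaler_nat !scalerA; congr (_ *: _); ring.
move=> j _; rewrite entry_sum -(sum_cdmulK _ k3) scaler_sumr; apply: eq_bigr => m _.
by rewrite entry_mul_star_unit entry_mul_unit eqxx scale1r.
Qed.

Lemma sum_mul_star_star x : \sum_e hmul (hmul x (star (unit_vec e))) (star (unit_vec e)) =
  (2 - (cddim k)%:R) *: x.
Proof.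
apply: entryP => a b; rewrite sum_unit_index !entry_sum.
rewrite (eq_bigr (fun i => (b == i)%:R *: ((2 - (cddim k)%:R) *: entry x a i))).
  by rewrite sum_delta entryZ.
move=> i _; rewrite entry_sum.
rewrite (eq_bigr (fun j => (i == j)%:R *: ((b == i)%:R *: ((2 - (cddim k)%:R) *: entry x a j)))).
  by rewrite sum_delta.
move=> j _; rewrite entry_sum -(sum_cdmul_conj _ k3) !scaler_sumr; apply: eq_bigr => m _.
rewrite entry_mul_star_unit entry_mul_star_unit cdmulZl scalerA [RHS]scalerA.
by rewrite mulrC (eq_sym j).
Qed.

Lemma sum_unit_mul_star x : (forall i, entry x i i = dot (entry x i i) (cd1 k) *: cd1 k) ->
  \sum_e hmul (hmul (unit_vec e) x) (star (unit_vec e)) = ((cddim k)%:R * dot x hone) *: hone.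
Proof.
move=> xd; apply: entryP => a b; rewrite sum_unit_index !entry_sum entryZ entry_one.
rewrite (eq_bigr (fun i => (b == i)%:R *: ((a == i)%:R *: (((cddim k)%:R * dot x hone) *: cd1 k)))).
  by rewrite sum_delta !scalerA mulrC.
move=> i _; rewrite entry_sum dot_one mulr_sumr scaler_suml !scaler_sumr; apply: eq_bigr => j _.
rewrite entry_sum -scalerA -xd -(sum_cdmulK _ k3) !scaler_sumr; apply: eq_bigr => m _.
rewrite entry_mul_star_unit entry_unit_mul cdmulZl (xd j) cdmulZr cdmul1r.
by rewrite (cdmulZl _ (cd1 k)) cdmul1l.
Qed.

Lemma sum_star_mul_star x : star x = x ->
  \sum_e hmul (hmul (star (unit_vec e)) x) (star (unit_vec e)) = (2 - (cddim k)%:R) *: x.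
Proof.
move=> sx; apply: entryP => a b; rewrite sum_unit_index !entry_sum.
rewrite (eq_bigr (fun i => (b == i)%:R *: ((2 - (cddim k)%:R) *: entry x a i))).
  by rewrite sum_delta entryZ.
move=> i _; rewrite entry_sum.
rewrite (eq_bigr (fun j => (a == j)%:R *: ((b == i)%:R *: ((2 - (cddim k)%:R) *: entry x j i)))).
  by rewrite sum_delta.
move=> j _; rewrite entry_sum -[in RHS]sx entry_star -(sum_cdmul_flip _ k3) !scaler_sumr.
apply: eq_bigr => m _.
rewrite entry_mul_star_unit entry_star_unit_mul cdmulZl scalerA [RHS]scalerA mulrC //.
Qed.

End CayleyDicksonMatrices.

(** * Geometry of the projective spaces *)

(* Solves linear identities between matrix products, which are treated as
   unknowns. *)
Tactic Notation "linear_mx" tactic(t) :=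
  repeat match goal with
    | |- context [@jord ?R ?k ?r ?u ?v] => generalize (@jord R k r u v); intro
    | |- context [@hmul ?R ?k ?r ?u ?v] => generalize (@hmul R k r u v); intro
    | |- context [@hone ?R ?k ?r] => generalize (@hone R k r); intro end;
  apply/matrixP => ? ?; rewrite !mxE; t.

Section ProjectiveSpace.
Context {R : realType} (k r : nat).
Local Notation CD := 'rV[R]_(cddim k).
Local Notation V := 'M[R]_(r.+1 * r.+1, cddim k).
Local Notation X := (@projective_space R k r).
Local Notation D := ((cddim k)%:R : R).
Local Arguments cdmul : simpl never.
Local Arguments cdconj : simpl never.
Local Arguments cd1 : simpl never.
Local Arguments derive1n : simpl never.
Implicit Types (x y z v w : V) (i j l : 'I_r.+1).

Local Notation s2 := (Num.sqrt 2 : R).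

Lemma s2_gt0 : 0 < s2. Proof. by rewrite sqrtr_gt0. Qed.
Lemma s2_neq0 : s2 != 0. Proof. by rewrite gt_eqF // s2_gt0. Qed.
Lemma s2M : s2 * s2 = 2. Proof. by rewrite -expr2 sqr_sqrtr. Qed.

Lemma projP x : X x <-> [/\ star x = x, hmul x x = s2 *: x & dot x (hone k r) = s2].
Proof.
split=> [[xs xx x1]|[xs xx x1]].
  have sx : star x = x by apply: entryP => i j; rewrite entry_star [RHS]xs.
  split=> //; first by apply: entryP => i j; rewrite entry_mul entryZ xx.
  by rewrite dot_one -dot_suml x1 dotZl dot11 mulr1.
split.
- by move=> i j; rewrite -entry_star xs.
- by move=> i j; rewrite -entry_mul xx entryZ.
- rewrite (eq_bigr _ (fun i _ => star_diag i xs)) -scaler_suml; congr (_ *: _).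
  by rewrite -dot_one.
Qed.

Lemma proj_dot x : X x -> dot x x = 2.
Proof. by move=> /projP[sx xx x1]; rewrite -dot_mul1 // xx dotZl x1 s2M. Qed.

Lemma Pol_dotl w : Pol 1 (fun x : V => dot x w).
Proof.
apply: Pol_sum => i; apply: Pol_sum => j.
under eq_fun do rewrite mulrC; apply: Pol_scale; exact: Pol_coord1.
Qed.

Lemma bilin_mul w : bilin (fun x y => dot (hmul x y) w).
Proof.
by split=> *; rewrite ?hmulDl ?hmulDr ?hmulZl ?hmulZr ?dotDl ?dotZl.
Qed.

Lemma closed_proj : closed X.
Proof.
pose A : Type := (V + V + unit)%type.
pose F (a : A) x : R := match a with
  | inl (inl w) => dot (star x) w - dot x w
  | inl (inr w) => dot (hmul x x) w - s2 * dot x w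
  | inr _ => dot x (hone k r) - s2 end.
have -> : X = \bigcap_a [set x | F a x = 0].
  apply/seteqP; split=> x.
    by move=> /projP[sx xx x1] [[w|w]|u] _ /=; rewrite ?sx ?xx ?x1 ?dotZl subrr.
  move=> h; apply/projP; split.
  - by apply: dot_inj => w; have := h (inl (inl w)) I; rewrite /= => /eqP; rewrite subr_eq0 => /eqP.
  - apply: dot_inj => w; rewrite dotZl.
    by have := h (inl (inr w)) I; rewrite /= => /eqP; rewrite subr_eq0 => /eqP.
  - by have := h (inr tt) I; rewrite /= => /eqP; rewrite subr_eq0 => /eqP.
apply: closed_bigI => -[[w|w]|u] _ /=.
- apply: (@closed_Pol R _ _ 1); under eq_fun do rewrite -dot_star starK.
  have := Pol_lin 1 (-1) (Pol_dotl (star w)) (Pol_dotl w).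
  by under eq_fun do rewrite mul1r mulN1r.
- apply: (@closed_Pol R _ _ 2).
  have h : Pol 2 (fun x => dot (hmul x x) w).
    under eq_fun do rewrite (bilin_expand _ _ (bilin_mul w)).
    apply: Pol_sum => a; apply: Pol_sum => b; under eq_fun do rewrite mulrC.
    by apply: Pol_scale; apply: Pol_coord; exact: Pol_coord1.
  have := Pol_lin 1 (- s2) h (Pol_leq (isT : 1 <= 2)%N (Pol_dotl w)).
  by under eq_fun do rewrite mul1r mulNr.
- apply: (@closed_Pol R _ _ 1).
  have := Pol_lin 1 1 (Pol_dotl (hone k r)) (@Pol_cst R _ _ 1 (- s2)).
  by under eq_fun do rewrite !mul1r.
Qed.

(** The tangent vectors at x are the Hermitian v with jord x v = s2 *: v and trace
    zero.  On Hermitian matrices jord x has the eigenvalues 0, s2 and 2 s2, the last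
    one on the line of x only, which the second term removes. *)
Definition proj_tan x y : V := (2 * s2)^-1 *: jord x (y + star y) - dot x y *: x.
Local Notation P := proj_tan.

Lemma proj_tanD x v w : P x (v + w) = P x v + P x w.
Proof.
rewrite /P starD dotDr scalerDl [v + w + _]addrACA (jordDr x (v + star v)) scalerDr opprD.
exact: addrACA.
Qed.

Lemma proj_tanZ x (a : R) v : P x (a *: v) = a *: P x v.
Proof.
by rewrite /P starZ dotZr -scalerDr jordZr scalerBr !scalerA; congr (_ *: _ - _); rewrite mulrC.
Qed.

Lemma proj_tan_herm x y : star y = y -> P x y = s2^-1 *: jord x y - dot x y *: x.
Proof.
move=> sy; rewrite /P sy (_ : y + y = 2 *: y); last by rewrite scaler_nat mulr2n.
rewrite jordZr scalerA; congr (_ *: _ - _).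
by rewrite invfM mulrAC mulVf ?mul1r // pnatr_eq0.
Qed.

Lemma star_proj_tan x y : star x = x -> star (P x y) = P x y.
Proof.
move=> sx; rewrite /P starD starN !starZ sx star_J ?starD ?starK //.
by rewrite addrC.
Qed.

Lemma proj_tan_sym x v w : X x -> dot (P x v) w = dot v (P x w).
Proof.
move=> /projP[sx _ _]; rewrite /P dotBl dotBr !dotZl !dotZr (dotC v x) (mulrC (dot x v)).
congr (_ * _ - _).
have h y z : star y = y -> dot y (z + star z) = 2 * dot y z.
  by move=> sy; rewrite dotDr -{2}sy dot_star; ring.
have ss y : star (y + star y) = y + star y by rewrite starD starK addrC.
have : 2 * dot (jord x (v + star v)) w = 2 * dot v (jord x (w + star w)).
  rewrite -h; last by rewrite star_J.
  rewrite [X in _ = _ * X]dotC -h; last by rewrite star_J.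
  by rewrite dot_J // dotC.
by move=> /(mulfI _); apply; rewrite pnatr_eq0.
Qed.

Lemma proj_tan_trace x : (k <= 3)%N -> X x ->
  \sum_a dot (P x (unit_vec a)) (unit_vec a) = D * r%:R.
Proof.
move=> k3 Xx; have [sx xx x1] := (projP x).1 Xx.
under eq_bigr do rewrite /P dotBl !dotZl.
rewrite sumrB dot_sum_unit proj_dot // -mulr_sumr.
have e1 (a : V) : dot (jord x (a + star a)) a =
   dot (hmul (hmul x a) (star a)) (hone k r) + dot (hmul (hmul a x) (star a)) (hone k r)
   + (dot (hmul (hmul x (star a)) (star a)) (hone k r)
   + dot (hmul (hmul (star a) x) (star a)) (hone k r)).
  have t y : dot (hmul y (star a)) (hone k r) = dot y a by rewrite dot_mulr starK hmul1l.
  by rewrite !t /jord hmulDr hmulDl !dotDl; ring.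
under eq_bigr do rewrite e1.
rewrite !big_split /= -!dot_suml sum_mul_unit_star // (sum_unit_mul_star k3) => [|i]; last exact: star_diag.
rewrite sum_mul_star_star // sum_star_mul_star // !dotZl dot_one_one x1.
rewrite -natr1; set t := s2; have t0 := s2_neq0; have tt := s2M; rewrite -/t in t0 tt.
by field.
Qed.

Lemma tangent_linear x v u (b : R) : (forall y, X y -> dot u y = b) -> tangent X x v -> dot u v = 0.
Proof.
move=> h [c [cX c0 dc <-]]; have := is_derive_dotr u dc.
rewrite (_ : (fun s => _) = cst b) => [|]; last by apply/funext => s; rewrite h.
by move=> [_ <-]; rewrite derive_cst.
Qed.

Lemma geodesic_linear c u (b : R) : (forall y, X y -> dot u y = b) -> geodesic X c ->
  dot u (derive1n 2 c 0) = 0.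
Proof.
move=> h [cX c1 c2 _].
have E : (fun s => dot u (derive1 c s)) = cst 0.
  apply/funext => s; have := is_derive_dotr u (c1 s).
  rewrite (_ : (fun s => _) = cst b) => [|]; last by apply/funext => s'; rewrite h.
  by move=> [_ <-]; rewrite derive_cst.
rewrite -[derive1n 2 c 0]/(derive1 (derive1 c) 0).
by have := is_derive_dotr u (c2 0); rewrite E => -[_ <-]; rewrite derive_cst.
Qed.

Lemma proj_anti w y : X y -> dot (w - star w) y = 0.
Proof. by move=> /projP[sy _ _]; rewrite dotBl -(dot_star (star w)) starK sy subrr. Qed.

Lemma star_of_anti y : (forall w, dot (w - star w) y = 0) -> star y = y.
Proof.
move=> h; apply: dot_inj => w; have := h w; rewrite dotBl => /eqP; rewrite subr_eq0 => /eqP e.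
by rewrite [RHS]dotC e -dot_star starK dotC.
Qed.

Lemma proj_quadric w x : X x -> dot (hmul x x) w = dot (s2 *: w) x.
Proof. by move=> /projP[_ -> _]; rewrite !dotZl dotC. Qed.

Lemma proj_tangentP x v : X x -> tangent X x v ->
  [/\ star v = v, jord x v = s2 *: v & dot v (hone k r) = 0].
Proof.
move=> Xx tv; split.
- by apply: star_of_anti => w; apply: tangent_linear tv => y; exact: proj_anti.
- apply: dot_inj => w; have [c [cX c0 dc cv]] := tv.
  have := quadric_derive1 (bilin_mul w) (@proj_quadric w) cX dc cv.
  by rewrite c0 -dotDl addrC -/(jord _ _) => ->; rewrite !dotZl dotC.
- rewrite dotC; apply: (tangent_linear _ tv) => y /projP[_ _]; rewrite dotC => ->; reflexivity.
Qed.

Lemma dot_proj_jord x v : star x = x -> star v = v -> 2 * dot x v = dot (jord x v) (hone k r).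
Proof. by move=> sx sv; rewrite dotDl !dot_mul1 // (dotC v); ring. Qed.

Lemma proj_tan_fix x v : X x -> star v = v -> jord x v = s2 *: v -> dot v (hone k r) = 0 -> P x v = v.
Proof.
move=> Xx sv jv v1; have [sx _ _] := (projP x).1 Xx.
have xv : dot x v = 0.
  by apply: (mulfI (_ : 2 != 0)); rewrite ?pnatr_eq0 // dot_proj_jord // jv dotZl v1 !mulr0.
by rewrite proj_tan_herm // xv scale0r subr0 jv scalerA mulVf ?scale1r // s2_neq0.
Qed.

Lemma proj_tangent x v : X x -> tangent X x v -> P x v = v.
Proof. by move=> Xx /(proj_tangentP Xx)[sv jv v1]; apply: proj_tan_fix. Qed.

Lemma proj_jord_self x : X x -> jord x x = (2 * s2) *: x.
Proof. by move=> /projP[_ xx _]; rewrite /jord xx -scalerDl; congr (_ *: _); ring. Qed.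

Lemma proj_fixP x v : X x -> P x v = v ->
  [/\ star v = v, dot x v = 0, jord x v = s2 *: v & dot v (hone k r) = 0].
Proof.
move=> Xx Pv; have [sx xx x1] := (projP x).1 Xx.
have sv : star v = v by rewrite -Pv star_proj_tan.
have Px : P x x = 0.
  rewrite proj_tan_herm // proj_jord_self // proj_dot // scalerA mulrCA mulVf ?s2_neq0 //.
  by rewrite mulr1 subrr.
have xv : dot x v = 0 by rewrite -Pv -proj_tan_sym // Px dot0l.
have jv : jord x v = s2 *: v.
  by rewrite -[in RHS]Pv proj_tan_herm // xv scale0r subr0 scalerA mulfV ?scale1r // s2_neq0.
split=> //; apply: (mulfI s2_neq0); rewrite mulr0 -dotZl -jv -dot_proj_jord // xv mulr0 //.
Qed.

(** These identities depend on the associativity of the coefficients or on the size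
    of the matrices; they say that X consists of projectors of rank one. *)
Hypothesis k3 : (k <= 3)%N.
Hypothesis peirce : forall x y, X x -> star y = y ->
  jord x (jord x y) = s2 *: jord x y + (2 * dot x y) *: x.
Hypothesis tangent_square : forall x v, X x -> star v = v -> jord x v = s2 *: v ->
  dot x v = 0 -> dot v (hone k r) = 0 ->
  [/\ jord x (hmul v v) = dot v v *: x, jord v (hmul v v) = dot v v *: v &
     hmul (hmul v v) (hmul v v) = (dot v v / 2) *: hmul v v].
Hypothesis rank_one : forall x i j l, X x ->
  cdmul (entry x i l) (entry x l j) = dot (entry x l l) (cd1 k) *: entry x i j.

Lemma proj_tan_idem x v : X x -> P x (P x v) = P x v.
Proof.
move=> Xx; have [sx xx x1] := (projP x).1 Xx.
have sP := star_proj_tan v sx.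
have Px : P x x = 0.
  rewrite proj_tan_herm // proj_jord_self // proj_dot // scalerA mulrCA mulVf ?s2_neq0 //.
  by rewrite mulr1 subrr.
rewrite [LHS]proj_tan_herm // -proj_tan_sym // Px dot0l scale0r subr0.
have hE : P x v = (2 * s2)^-1 *: jord x (v + star v) + (- dot x v) *: x by rewrite /P scaleNr.
have sh : star (v + star v) = v + star v by rewrite starD starK addrC.
have xh : dot x (v + star v) = 2 * dot x v by rewrite dotDr -{2}sx dot_star; ring.
rewrite {}hE; move: (v + star v) sh xh => h sh xh.
rewrite jordDr !jordZr proj_jord_self // peirce // xh.
have t0 := s2_neq0; have tt := s2M; move: (jord x h) => Jh.
rewrite !(scalerDr, scalerA) -addrA -scalerDl.
by congr (_ *: _ + _ *: _); first [field | field: tt].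
Qed.

(** The geodesic is the circle with center s2 v^2 through x; the identities of
    tangent_square say that it stays in X. *)
Lemma proj_geodesic x v : X x -> P x v = v -> dot v v = 1 ->
  exists c, [/\ geodesic X c, c 0 = x & derive1 c 0 = v].
Proof.
move=> Xx Pv v1; have [sx xx x1] := (projP x).1 Xx.
have [sv xv jv v0] := proj_fixP Xx Pv.
have [g1 g3 g2] := tangent_square Xx sv jv xv v0.
rewrite v1 !scale1r in g1 g3; rewrite v1 in g2.
have t0 := s2_neq0; have tt := s2M.
pose w := s2 *: hmul v v.
have vv : hmul v v = s2^-1 *: w by rewrite /w scalerA mulVf ?scale1r.
have sw : star w = w by rewrite /w starZ star_mul sv.
have ww : hmul w w = s2^-1 *: w.
  rewrite {1 2}/w hmulZl hmulZr g2 /w !scalerA; congr (_ *: _).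
  by field: tt.
have xw : jord x w = s2 *: x by rewrite /w jordZr g1.
have vw : jord v w = s2 *: v by rewrite /w jordZr g3.
have w1 : dot w (hone k r) = s2 by rewrite /w dotZl dot_mul1 // v1 mulr1.
clearbody w; pose c t := w + (cos t *: (x - w) + sin t *: v).
have cE (t : R) : c t = (1 - cos t) *: w + (cos t *: x + sin t *: v).
  by rewrite /c; linear_mx ring.
have cX t : X (c t).
  apply/projP; split.
  - by rewrite cE !(starD, starZ) sw sx sv.
  - rewrite cE; have := cos2Dsin2 t; set C := cos t; set S := sin t => CS.
    have e1 : hmul ((1 - C) *: w + (C *: x + S *: v)) ((1 - C) *: w + (C *: x + S *: v)) =
      (1 - C) ^+ 2 *: hmul w w + C ^+ 2 *: hmul x x + S ^+ 2 *: hmul v v +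
      ((1 - C) * C) *: jord x w + ((1 - C) * S) *: jord v w + (C * S) *: jord x v.
      rewrite /jord !(hmulDl, hmulDr, hmulZl, hmulZr) !(scalerDr, scalerA).
      by linear_mx ring.
    rewrite e1 ww xx vv xw vw jv; move: CS => /(canRL (addKr _)) ->.
    by linear_mx (field: tt).
  - by rewrite cE !(dotDl, dotZl) w1 x1 v0; ring.
have cu t : P (c t) (cos t *: (x - w) + sin t *: v) = 0.
  have [sc cc c1] := (projP _).1 (cX t).
  have -> : cos t *: (x - w) + sin t *: v = c t - w by rewrite /c; linear_mx ring.
  have jcw : jord (c t) w = s2 *: c t.
    rewrite {1}cE !(jordDl, jordZl) xw vw {1}/jord ww cE.
    by linear_mx (field: tt).
  have dcw : dot (c t) w = 1.
    by apply: (mulfI (_ : 2 != 0)); rewrite ?pnatr_eq0 // dot_proj_jord // jcw dotZl c1 mulr1.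
  rewrite proj_tan_herm; last by rewrite starD starN sc sw.
  rewrite jordDr jordNr jcw proj_jord_self ?cX // dotBr proj_dot ?cX // dcw.
  by linear_mx (field: tt).
have [g [gg g0 g1']] := @trig_geodesic R _ _ X P w (x - w) v proj_tan_sym proj_tangent cX cu.
by exists g; split => //; rewrite g0 addrC subrK.
Qed.

Lemma proj_acc c : geodesic X c -> dot (derive1 c 0) (derive1 c 0) = 1 ->
  derive1n 2 c 0 = s2 *: hmul (derive1 c 0) (derive1 c 0) - c 0.
Proof.
move=> gc v1; have [cX c1 c2 _] := gc.
have [sx xx x1] := (projP _).1 (cX 0).
have tv : tangent X (c 0) (derive1 c 0) by exists c; split.
have [sv jv v0] := proj_tangentP (cX 0) tv.
set v := derive1 c 0 in v1 sv jv v0 tv *; set y := derive1n 2 c 0.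
have sy : star y = y by apply: star_of_anti => w; apply: (geodesic_linear _ gc) => z; exact: proj_anti.
have y1 : dot y (hone k r) = 0.
  by rewrite dotC; apply: (geodesic_linear (b := s2) _ gc) => z /projP[_ _]; rewrite dotC.
have jy : jord (c 0) y + 2 *: hmul v v = s2 *: y.
  apply: dot_inj => w; have := quadric_derive2 (bilin_mul w) (@proj_quadric w) gc.
  rewrite (dotZl s2 w) (dotC w) => e; rewrite [RHS]dotZl /y -[RHS]e /jord !dotDl dotZl /v.
  by rewrite -addrA addrC.
have xy : dot (c 0) y = - 1.
  apply: (mulfI (_ : 2 != 0)); rewrite ?pnatr_eq0 // dot_proj_jord //.
  have -> : jord (c 0) y = s2 *: y - 2 *: hmul v v by rewrite -jy addrK.
  by rewrite dotBl !dotZl y1 dot_mul1 // v1; ring.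
have := geodesic_normal proj_tanZ proj_tan_sym proj_tan_idem proj_geodesic 0 gc.
rewrite -/y proj_tan_herm // xy => /eqP; rewrite subr_eq0 => /eqP e.
have t0 := s2_neq0; have tt := s2M.
have {}e : jord (c 0) y = - s2 *: c 0.
  have := congr1 (fun u => s2 *: u) e; rewrite /= !scalerA mulfV // scale1r => ->.
  by rewrite mulrN1.
apply: (scalerI t0); rewrite -jy e.
by linear_mx (field: tt).
Qed.

(** The partial traces over the standard basis turn the sum of the squares of a
    tangent frame into an affine function of x. *)
Lemma sum_frame_square x (cs : 'I_(cddim k * r) -> R -> V) : X x -> frame X cs x ->
  \sum_a hmul (derive1 (cs a) 0) (derive1 (cs a) 0) =
  (2 * s2)^-1 *: ((D * r.+1%:R) *: x + (D * s2) *: hone k r + (2 * (2 - D)) *: x) - s2 *: x.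
Proof.
move=> Xx fr; have [sx xx x1] := (projP _).1 Xx.
have trP y : X y -> \sum_a dot (P y (unit_vec a)) (unit_vec a) = (cddim k * r)%:R.
  by move=> Xy; rewrite proj_tan_trace // natrM.
have Pl y : linear (P y) by exact: (P_lin proj_tanD proj_tanZ).
have := frame_contract (P := P) proj_tanD proj_tanZ proj_tan_sym proj_tan_idem trP
  proj_tangent (f := fun u w => hmul u (star w)) Xx fr.
rewrite (eq_bigr (fun a => hmul (derive1 (cs a) 0) (derive1 (cs a) 0))) => [->|a _]; first last.
  have ta : tangent X x (derive1 (cs a) 0).
    have [gc c0 _] := fr; exists (cs a); have [? h _ _] := gc a; split=> //.
  by have [-> _ _] := proj_tangentP Xx ta.
- by move=> y a u w; rewrite hmulDl hmulZl.
- by move=> y a u w; rewrite starD starZ hmulDr hmulZr.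
have e1 (a : V) : hmul (P x a) (star a) = (2 * s2)^-1 *:
   (hmul (hmul x a) (star a) + hmul (hmul a x) (star a) + (hmul (hmul x (star a)) (star a)
   + hmul (hmul (star a) x) (star a))) - dot x a *: hmul x (star a).
  rewrite /P hmulDl hmulNl !hmulZl; congr (_ *: _ - _).
  by rewrite /jord hmulDr hmulDl !hmulDl -!addrA; congr (_ + _); rewrite addrCA.
under eq_bigr do rewrite e1.
rewrite sumrB -scaler_sumr !big_split /= sum_mul_unit_star // (sum_unit_mul_star k3) => [|i]; last exact: star_diag.
rewrite (sum_mul_star_star k3) (sum_star_mul_star k3) // x1.
have -> : \sum_a dot x (unit_vec a) *: hmul x (star (unit_vec a)) = s2 *: x.
  transitivity (hmul x (star x)); last by rewrite sx.
  rewrite [in star x](sum_unit x) star_sum hmul_sumr.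
  by apply: eq_bigr => a _; rewrite starZ hmulZr.
by congr (_ *: _ - _); linear_mx ring.
Qed.

(** Where the i-th diagonal entry of x does not vanish, the i-th column of x consists
    of homogeneous coordinates: by rank_one its products give all the entries of x,
    multiplied by the diagonal entry. *)
Theorem proj_eigdim_diff_le : (2 <= cddim k * r)%N -> exists C : R, forall n, (1 <= n)%N ->
  `|(eigdim X (cddim k * r) n)%:R - (eigdim X (cddim k * r) n.-1)%:R|
    <= C * n%:R ^+ (cddim k * r - 2).
Proof.
move=> d2; have t0 := s2_neq0; have tt := s2M.
have trP y : X y -> \sum_a dot (P y (unit_vec a)) (unit_vec a) = (cddim k * r)%:R.
  by move=> Xy; rewrite proj_tan_trace // natrM.
have fex := frame_exists proj_tanD proj_tanZ proj_tan_sym proj_tan_idem trP proj_geodesic.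
pose m (i : 'I_(r.+1 * r.+1)) (j : 'I_(cddim k)) (a : 'I_(r.+1 * r.+1)) (b : 'I_(cddim k))
    (x : V) : R := ((2 * s2)^-1 *: jord x (delta_mx a b + star (delta_mx a b))) i j.
pose f i x : R := dot (entry x i i) (cd1 k).
pose zs i := f i :: [seq (fun x : V => entry x (lift i a.1) i 0 a.2) | a <- enum {: 'I_r * 'I_(cddim k)}].
have szs i : size (zs i) = (cddim k * r).+1.
  by rewrite /= size_map -cardE card_prod !card_ord mulnC.
have zP i : homspan X (zs i) 1 (f i) := @homspan_gen _ _ X (zs i) 0 isT.
have zP' i j b : homspan X (zs i) 1 (fun x : V => entry x j i 0 b).
  case: (unliftP i j) => [j' ->|->].
    pose a : 'I_r * 'I_(cddim k) := (j', b).
    have h : ((index a (enum {: 'I_r * 'I_(cddim k)})).+1 < size (zs i))%N.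
      by rewrite /= size_map ltnS index_mem mem_enum.
    have := homspan_gen X h; rewrite /= (nth_map a) ?index_mem ?mem_enum //.
    by rewrite nth_index ?mem_enum.
  apply: eq_homspan (homspanZ (cd1 k 0 b) (zP i)) => x /projP[sx _ _].
  by rewrite {1}(star_diag i sx) mxE mulrC.
have sub x i j : X x -> entry x i j = cdconj (entry x j i).
  by move=> /projP[sx _ _]; rewrite -entry_star sx.
apply: (@eigdim_diff_le R _ _ X (cddim k * r) s2 (D * r.+1%:R / 2) ((D / s2) *: hone k r) m d2
  closed_proj _ fex _ _ _ _ 'I_r.+1 f zs).
- move=> x Xx; apply: cube_dot; first exact: ltW s2_gt0.
  by rewrite /= proj_dot // expr2 tt.
- rewrite divr_gt0 // mulr_gt0 // ltr0n //.
  by move: d2; case: (cddim k).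
- move=> i j a b; rewrite /m; set u := delta_mx a b + _.
  have -> : (fun x => ((2 * s2)^-1 *: jord x u) i j) = fun x => (2 * s2)^-1 *
      (1 * dot x (hmul (unit_vec (i, j)) (star u)) + 1 * dot x (hmul (star u) (unit_vec (i, j)))).
    by apply/funext => x; rewrite mxE -(dot_unit _ (i, j)) /jord dotDl dot_mulr (dot_mull u) !mul1r.
  by apply: Pol_scale; apply: Pol_lin; exact: Pol_dotl.
- move=> x cs Xx fr i j a b.
  rewrite (frame_gram_proj proj_tanD proj_tanZ proj_tan_sym proj_tan_idem trP proj_tangent i j a b Xx fr).
  rewrite /m /P -[dot x _]/(dot x (unit_vec (a, b))) dot_unit.
  by move: (jord x _) => y; rewrite !mxE /= (mulrC (x a b)).
- move=> x cs Xx fr i j; have [gc c0 co] := fr.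
  transitivity ((\sum_a derive1n 2 (cs a) 0) i j); first by rewrite summxE.
  rewrite (eq_bigr (fun a => s2 *: hmul (derive1 (cs a) 0) (derive1 (cs a) 0) - x)); last first.
    by move=> a _; rewrite proj_acc // ?c0 // co eqxx.
  rewrite sumrB -scaler_sumr (sum_frame_square Xx fr) sumr_const card_ord.
  rewrite -(scaler_nat (cddim k * r)) natrM; move: (hone k r) => o; rewrite !mxE.
  by rewrite -natr1; field: tt.
- move=> x /projP[sx xx x1]; apply: contrapT => h.
  have := x1; rewrite dot_one big1 => [/eqP|i _]; first by rewrite eq_sym (negbTE t0).
  by apply: contrapT => /eqP fi; apply: h; exists i.
- exact: szs.
- move=> i; have h := homspan_sum (index_enum 'I_r.+1) (fun l =>
    homspan_sum (index_enum 'I_(cddim k)) (fun b => homspanM (zP' i l b) (zP' i l b))).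
  apply: eq_homspan (homspanZ s2^-1 h) => x Xx; have [sx xx x1] := (projP x).1 Xx.
  apply: (mulfI t0); rewrite mulrA mulfV // mul1r /f -dotZl -entryZ -xx entry_mul dot_suml.
  apply: eq_bigr => l _; rewrite (sub x i l Xx) dot_cdmulr cdmul1l dot_cdconj.
  by rewrite /dot big_ord1.
- move=> i a b; case/mxvec_indexP: a => j l.
  have bl : bilin (fun u v : CD => dot (cdmul u (cdconj v)) (cdbase b)).
    by split=> *; rewrite ?cdconjD ?cdconjZ ?cdmulDl ?cdmulDr ?cdmulZl ?cdmulZr ?dotDl ?dotZl.
  have h := homspan_sum (index_enum {: 'I_1 * 'I_(cddim k)}) (fun a1 =>
    homspan_sum (index_enum {: 'I_1 * 'I_(cddim k)}) (fun a2 =>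
    homspanZ (dot (cdmul (unit_vec a1) (cdconj (unit_vec a2))) (cdbase b))
    (homspanM (zP' i j a1.2) (zP' i l a2.2)))).
  apply: eq_homspan h => x Xx.
  have -> : x (mxvec_index j l) b = entry x j l 0 b by rewrite mxE.
  transitivity (dot (cdmul (entry x j i) (cdconj (entry x l i))) (cdbase b)); last first.
    rewrite (bilin_expand _ _ bl); apply: eq_bigr => -[a1 a1'] _; apply: eq_bigr => -[a2 a2'] _ /=.
    by rewrite !ord1 mulrC.
  by rewrite -sub // rank_one // dot_cdbase [RHS]mxE.
Qed.

End ProjectiveSpace.

(** * Projective spaces over an associative algebra *)

Section AssociativeProjective.
Context {R : realType} (k r : nat).
Local Notation V := 'M[R]_(r.+1 * r.+1, cddim k).
Local Notation X := (@projective_space R k r).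
Local Notation s2 := (Num.sqrt 2 : R).
Local Arguments cdmul : simpl never.
Local Arguments cdconj : simpl never.
Local Arguments cd1 : simpl never.
Implicit Types (x y z v w : V) (i j l : 'I_r.+1).
Hypothesis k2 : (k <= 2)%N.

Lemma hmulA x y z : hmul x (hmul y z) = hmul (hmul x y) z.
Proof.
apply: entryP => i j; rewrite !entry_mul.
under eq_bigr do rewrite entry_mul cdmul_sumr.
under [RHS]eq_bigr do rewrite entry_mul cdmul_suml.
rewrite exchange_big /=; apply: eq_bigr => l _; apply: eq_bigr => m _.
exact: cdmulA.
Qed.

Definition corner i : V := of_entries (fun a b => ((a == i) && (b == i))%:R *: cd1 k).

Lemma entry_corner i a b : entry (corner i) a b = ((a == i) && (b == i))%:R *: cd1 k.
Proof. exact: entry_of_entries. Qed.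

Lemma star_corner i : star (corner i) = corner i.
Proof. by apply: entryP => a b; rewrite entry_star !entry_corner cdconjZ cdconj1 andbC. Qed.

Lemma dot_corner i x : dot (corner i) x = dot (entry x i i) (cd1 k).
Proof.
rewrite dot_entry (bigD1 i) //= [X in _ + X]big1 => [|a ai]; last first.
  by apply: big1 => b _; rewrite entry_corner (negbTE ai) scale0r dot0l.
rewrite addr0 (bigD1 i) //= big1 => [|b bi]; last first.
  by rewrite entry_corner (negbTE bi) andbF scale0r dot0l.
by rewrite addr0 entry_corner eqxx scale1r dotC.
Qed.

Lemma entry_mul_corner x i a b : entry (hmul x (corner i)) a b = (b == i)%:R *: entry x a i.
Proof.
rewrite entry_mul (bigD1 i) //= big1 => [|l li]; last first.
  by rewrite entry_corner (negbTE li) scale0r cdmul0r.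
by rewrite addr0 entry_corner eqxx cdmulZr cdmul1r.
Qed.

Lemma entry_corner_mul x i a b : entry (hmul (corner i) x) a b = (a == i)%:R *: entry x i b.
Proof.
rewrite entry_mul (bigD1 i) //= big1 => [|l li]; last first.
  by rewrite entry_corner (negbTE li) andbF scale0r cdmul0l.
by rewrite addr0 entry_corner eqxx andbT cdmulZl cdmul1l.
Qed.

Lemma corner_sandwich i x : star x = x ->
  hmul (hmul (corner i) x) (corner i) = dot (corner i) x *: corner i.
Proof.
move=> sx; apply: entryP => a b; rewrite entry_mul_corner entry_corner_mul entryZ entry_corner.
rewrite dot_corner {1}(star_diag i sx) !scalerA; congr (_ *: _).
by rewrite -natrM mulnb andbC mulrC.
Qed.

(** The defect of the rank one relation is a Hermitian matrix of trace zero
    whose square is a multiple of itself. *)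
Lemma proj_corner x i : X x -> hmul (hmul x (corner i)) x = dot (corner i) x *: x.
Proof.
move=> /projP[sx xx x1]; set q := dot _ x; set w := hmul _ x.
have xw : hmul x w = s2 *: w by rewrite /w !hmulA xx !hmulZl.
have wx : hmul w x = s2 *: w by rewrite /w -hmulA xx hmulZr.
have ww : hmul w w = (s2 * q) *: w.
  have -> : hmul w w = s2 *: hmul (hmul x (hmul (hmul (corner i) x) (corner i))) x.
    by rewrite {1}/w -hmulA xw hmulZr /w !hmulA.
  by rewrite corner_sandwich // -/q hmulZr hmulZl scalerA.
pose y := q *: x - w.
have yy : hmul y y = (s2 * q) *: y.
  rewrite {1 2}/y hmulDl !hmulDr !(hmulNl, hmulNr, hmulZl, hmulZr) xx xw wx ww /y.
  by linear_mx ring.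
have sy : star y = y by rewrite /y starD starN starZ sx /w !star_mul sx star_corner hmulA.
have y1 : dot y (hone k r) = 0.
  rewrite /y dotBl dotZl x1 /w dot_mulr sx hmul1l dot_mull sx xx dotZr -/q; ring.
have : dot y y = 0 by rewrite -dot_mul1 // yy dotZl y1 mulr0.
by move=> /dot_eq0/eqP; rewrite subr_eq0 => /eqP <-.
Qed.

Lemma proj_corner_neq0 x : X x -> exists i, dot (corner i) x != 0.
Proof.
move=> /projP[_ _ x1]; apply: contrapT => h.
have := x1; rewrite dot_one big1 => [/eqP|i _]; first by rewrite eq_sym gt_eqF // s2_gt0.
by rewrite -dot_corner; apply: contrapT => /eqP fi; apply: h; exists i.
Qed.

Lemma proj_sandwich x z : X x -> star z = z -> hmul (hmul x z) x = dot x z *: x.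
Proof.
move=> Xx sz; have [sx xx x1] := (projP x).1 Xx.
have [i q0] := proj_corner_neq0 Xx; have xex := proj_corner i Xx.
set h := hmul _ x; set q := dot (corner i) x in q0 xex; set e := corner i in xex.
have sh : star h = h by rewrite /h !star_mul sx sz hmulA.
have hE : (q ^+ 2) *: h = (dot e h * q) *: x.
  have -> : q ^+ 2 *: h = hmul (hmul (hmul (hmul x e) x) z) (hmul (hmul x e) x).
    by rewrite xex !hmulZl !hmulZr scalerA -expr2.
  have -> : hmul (hmul (hmul (hmul x e) x) z) (hmul (hmul x e) x) =
      hmul (hmul x (hmul (hmul e h) e)) x by rewrite /h !hmulA.
  by rewrite corner_sandwich // hmulZr hmulZl xex scalerA.
have {}hE : h = (dot e h / q) *: x.
  have : (q ^+ 2)^-1 *: (q ^+ 2 *: h) = (q ^+ 2)^-1 *: ((dot e h * q) *: x) by rewrite hE.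
  rewrite !scalerA mulVf ?scale1r ?expf_neq0 // => {1}->; congr (_ *: _).
  by field.
have h1 : dot h (hone k r) = s2 * dot x z.
  by rewrite /h dot_mulr sx hmul1l dot_mull sx xx dotZr dotC.
rewrite hE; congr (_ *: _); apply: (mulfI (s2_neq0 (R := R))).
by rewrite -h1 {2}hE dotZl x1 mulrC.
Qed.

Lemma proj_peirce x y : X x -> star y = y ->
  jord x (jord x y) = s2 *: jord x y + (2 * dot x y) *: x.
Proof.
move=> Xx sy; have [sx xx x1] := (projP x).1 Xx.
have E := proj_sandwich Xx sy.
rewrite /jord hmulDl hmulDr !hmulA xx -(hmulA y) xx hmulZl hmulZr E.
by linear_mx ring.
Qed.

Lemma dot_tangent_square x v : star x = x -> star v = v -> jord x v = s2 *: v ->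
  dot x (hmul v v) = s2 / 2 * dot v v.
Proof.
move=> sx sv jv; have : dot (jord x v) v = s2 * dot v v by rewrite jv dotZl.
by rewrite dotDl dot_mulr dot_mull sv => e; lra.
Qed.

Lemma proj_tangent_square x v : X x -> star v = v -> jord x v = s2 *: v ->
  dot x v = 0 ->
  [/\ jord x (hmul v v) = dot v v *: x, jord v (hmul v v) = dot v v *: v &
     hmul (hmul v v) (hmul v v) = (dot v v / 2) *: hmul v v].
Proof.
move=> Xx sv jv xv; have [sx xx x1] := (projP x).1 Xx.
have t0 := s2_neq0 (R := R).
have xvx : hmul (hmul x v) x = 0 by rewrite proj_sandwich // xv scale0r.
have vx : hmul v x = s2 *: v - hmul x v by rewrite -jv /jord addrC addKr.
have svv : star (hmul v v) = hmul v v by rewrite star_mul sv.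
have xvv : hmul x (hmul v v) = (dot v v / 2) *: x.
  apply: (scalerI t0); rewrite scalerA.
  have := proj_sandwich Xx svv; rewrite dot_tangent_square // hmulA -(hmulA _ v x) vx.
  rewrite hmulDr hmulNr hmulZr (hmulA (hmul x v)) xvx (_ : hmul 0 v = 0); last first.
    by rewrite -(scale0r x) hmulZl !scale0r.
  by rewrite subr0 -hmulA => ->; congr (_ *: _); field.
have vvx : hmul (hmul v v) x = (dot v v / 2) *: x.
  by rewrite -[LHS]starK star_mul svv sx xvv starZ sx.
have vvv : hmul v (hmul v v) = (dot v v / 2) *: v.
  apply: (scalerI t0); rewrite -hmulZl -jv /jord hmulDl -hmulA (hmulA v v v) (hmulA x) xvv.
  by rewrite -(hmulA v x) xvv hmulZl hmulZr -scalerDr -/(jord x v) jv !scalerA mulrC.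
split.
- by rewrite /jord xvv vvx -scalerDl; congr (_ *: _); field.
- by rewrite /jord -hmulA vvv -scalerDl; congr (_ *: _); field.
- by rewrite -hmulA vvv hmulZr.
Qed.

Lemma proj_rank_one x i j l : X x ->
  cdmul (entry x i l) (entry x l j) = dot (entry x l l) (cd1 k) *: entry x i j.
Proof.
move=> Xx; rewrite -dot_corner -entryZ -proj_corner // entry_mul (bigD1 l) //= big1 => [|m ml].
  by rewrite addr0 entry_mul_corner eqxx scale1r.
by rewrite entry_mul_corner (negbTE ml) scale0r cdmul0l.
Qed.

Theorem assoc_proj_eigdim_diff_le : (2 <= cddim k * r)%N -> exists C : R, forall n, (1 <= n)%N ->
  `|(eigdim X (cddim k * r) n)%:R - (eigdim X (cddim k * r) n.-1)%:R|
    <= C * n%:R ^+ (cddim k * r - 2).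
Proof.
apply: proj_eigdim_diff_le.
- exact: leq_trans k2 _.
- exact: proj_peirce.
- by move=> x v Xx sv jv xv _; apply: (@proj_tangent_square x).
- exact: proj_rank_one.
Qed.

End AssociativeProjective.

(** * The plane over an alternative algebra *)

Section AlternativePlane.
Context {R : realType} (k : nat).
Local Notation V := 'M[R]_(3 * 3, cddim k).
Local Notation X := (@projective_space R k 2).
Local Notation s2 := (Num.sqrt 2 : R).
Local Notation one := (hone k 2).
Local Arguments cdmul : simpl never.
Local Arguments cdconj : simpl never.
Local Arguments cd1 : simpl never.
Implicit Types (x y z v w : V) (i j l : 'I_3).
Hypothesis k3 : (k <= 3)%N.

Lemma cdmul_conjK (u w : 'rV[R]_(cddim k)) : cdmul u (cdmul (cdconj u) w) = dot u u *: w.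
Proof.
have := cdmul_alt u u w k3; rewrite -mulr2n -scaler_nat -scalerA => h.
by apply: (scalerI (a := 2)) h; rewrite pnatr_eq0.
Qed.

Lemma sum3 (W : nmodType) (F : 'I_3 -> W) i j l : uniq [:: i; j; l] ->
  \sum_m F m = F i + F j + F l.
Proof.
rewrite /= !inE !andbT negb_or => /andP[/andP[ij il] jl].
rewrite (bigD1 i) //= (bigD1 j) /=; last by rewrite eq_sym.
rewrite (bigD1 l) /=; last by rewrite (eq_sym l) il (eq_sym l).
rewrite big1 ?addr0 ?addrA // => m /andP[/andP[mi mj] ml].
exfalso; move: ij il jl mi mj ml; rewrite -!val_eqE /=.
by have := ltn_ord i; have := ltn_ord j; have := ltn_ord l; have := ltn_ord m; lia.
Qed.

Lemma uniq3 i j l : i != j -> i != l -> j != l -> uniq [:: i; j; l].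
Proof. by move=> ij il jl; rewrite /= !inE negb_or ij il jl. Qed.

Lemma third i j : i != j -> exists l, uniq [:: i; j; l].
Proof.
move=> ij; have lt : (3 - i - j < 3)%N.
  by move: ij; rewrite -val_eqE /=; have := ltn_ord i; have := ltn_ord j; lia.
exists (Ordinal lt); move: ij; rewrite /= !inE !andbT negb_or -!val_eqE /=.
by have := ltn_ord i; have := ltn_ord j; lia.
Qed.

(** The quadratic adjoint of a Hermitian matrix. *)
Definition sharp y : V := hmul y y - dot y one *: y
  + ((dot y one ^+ 2 - dot y y) / 2) *: one.

Definition cross y z : V := jord y z - dot y one *: z - dot z one *: y
  + (dot y one * dot z one - dot y z) *: one.

Local Notation di y i := (dot (entry y i i) (cd1 k)).
Local Notation nn u := (dot u u).

Lemma star_entry y i j : star y = y -> entry y j i = cdconj (entry y i j).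
Proof. by move=> sy; rewrite -entry_star sy. Qed.

Lemma star_sharp y : star y = y -> star (sharp y) = sharp y.
Proof.
by move=> sy; rewrite /sharp !starD starN !starZ star_mul sy star1.
Qed.

Lemma dot_sharp_aux y i j l : star y = y -> uniq [:: i; j; l] ->
  dot y one = di y i + di y j + di y l /\
  dot y y = di y i ^+ 2 + di y j ^+ 2 + di y l ^+ 2 +
    2 * (nn (entry y i j) + nn (entry y j l) + nn (entry y i l)).
Proof.
move=> sy u3; split; first by rewrite dot_one (sum3 _ u3).
have dd m : nn (entry y m m) = di y m ^+ 2.
  by rewrite {1 2}(star_diag m sy) dotZl dotZr dot11 mulr1.
have ss m n : nn (entry y n m) = nn (entry y m n) by rewrite (star_entry m n sy) dot_cdconj.
rewrite dot_entry (sum3 _ u3) !(sum3 _ u3) !dd (ss i j) (ss j l) (ss i l); ring.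
Qed.

Lemma entry_sharp_diag y i j l : star y = y -> uniq [:: i; j; l] ->
  entry (sharp y) i i = (di y j * di y l - nn (entry y j l)) *: cd1 k.
Proof.
move=> sy u3; have [e1 e2] := dot_sharp_aux sy u3.
rewrite /sharp !(entryD, entryN, entryZ) entry_mul (sum3 _ u3) entry_one eqxx scale1r e1 e2.
rewrite (star_entry i j sy) (star_entry i l sy) !cdmul_conjr.
rewrite (star_diag i sy) cdmulZl cdmul1l dotZl dot11 mulr1 !scalerA -!scalerDl -scalerBl -scalerDl.
by congr (_ *: _); field.
Qed.

Lemma entry_sharp_off y i j l : star y = y -> uniq [:: i; j; l] ->
  entry (sharp y) i j = cdmul (entry y i l) (entry y l j) - di y l *: entry y i j.
Proof.
move=> sy u3; have [e1 e2] := dot_sharp_aux sy u3.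
have ij : (i == j) = false by move: u3; rewrite /= !inE !andbT negb_or => /andP[/andP[/negbTE]].
rewrite /sharp !(entryD, entryN, entryZ) entry_mul (sum3 _ u3) entry_one ij scale0r scaler0 addr0 e1.
rewrite (star_diag i sy) (star_diag j sy) cdmulZl cdmul1l cdmulZr cdmul1r !dotZl dot11 !mulr1.
by apply/rowP => b; move: (cdmul _ _) => u; move: (entry y i j) => y'; rewrite !mxE; ring.
Qed.

Definition norm3 y i j l : R := di y i * di y j * di y l - di y i * nn (entry y j l)
  - di y l * nn (entry y i j) - di y j * nn (entry y i l)
  + 2 * dot (entry y j i) (cdmul (entry y j l) (entry y l i)).

Lemma norm3_rot y i j l : star y = y -> norm3 y i j l = norm3 y j l i.
Proof.
move=> sy; rewrite /norm3.
have -> : dot (entry y j i) (cdmul (entry y j l) (entry y l i)) =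
          dot (entry y l j) (cdmul (entry y l i) (entry y i j)).
  rewrite [RHS]dotC dot_cdmulr -(star_entry _ _ sy) dotC dot_cdmul -(star_entry _ _ sy) //.
rewrite (star_entry i j sy) (star_entry i l sy) !dot_cdconj; ring.
Qed.

(** The Cayley-Hamilton theorem: only alternativity is used, once for each pair
    of distinct indices. *)
Lemma jord_sharp_entry y i j l : star y = y -> uniq [:: i; j; l] ->
  entry (hmul y (sharp y)) i j = 0 /\
  dot (entry (hmul y (sharp y)) i i) (cd1 k) = norm3 y i j l.
Proof.
move=> sy u3.
have [ij il jl] : [/\ i != j, i != l & j != l].
  by move: u3; rewrite /= !inE !negb_or !andbT => /andP[/andP[-> ->] ->].
have [ji li lj] : [/\ j != i, l != i & l != j] by rewrite !(eq_sym l) (eq_sym j).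
have c m n : cdconj (entry y m n) = entry y n m by rewrite -star_entry.
have sij := entry_sharp_off sy u3.
have sjj := entry_sharp_diag sy (uniq3 ji jl il).
have slj := entry_sharp_off sy (uniq3 lj li ji).
have sii := entry_sharp_diag sy u3.
have sji := entry_sharp_off sy (uniq3 ji jl il).
have sli := entry_sharp_off sy (uniq3 li lj ij).
split; rewrite entry_mul (sum3 _ u3) (star_diag i sy).
  rewrite sij sjj slj cdmulZl cdmul1l cdmulZr cdmul1r cdmulDr cdmulNr cdmulZr.
  rewrite -(c i l) cdmul_conjK.
  by move: (cdmul _ _) => u; apply/rowP => b; rewrite !mxE; ring.
rewrite !dotDl cdmulZl cdmul1l dotZl !dot_cdmul !cdmul1r !c sii dotZl dot11 sji sli !dotDl !dotNl !dotZl.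
rewrite (dot_cdmul (entry y l j)) c (dotC (cdmul _ _)) /norm3.
rewrite -(c i j) -(c i l) !dot_cdconj !c; ring.
Qed.

Lemma cayley_hamilton y : star y = y ->
  jord y (sharp y) = (2 / 3 * dot y (sharp y)) *: one.
Proof.
move=> sy.
pose p : 'I_3 -> 'I_3 := @ordS 3.
have up i : uniq [:: i; p i; p (p i)] by case: i => [[|[|[|]]]].
have pK i : p (p (p i)) = i by apply: val_inj; case: i => [[|[|[|]]]].
pose N i := norm3 y i (p i) (p (p i)).
have NS i : N (p i) = N i by rewrite /N pK -norm3_rot.
have N0 i : N i = N ord0.
  have : i \in [:: ord0; p ord0; p (p ord0)] by case: i => [[|[|[|]]]].
  by rewrite !inE => /or3P[] /eqP->; rewrite ?NS.
have E : jord y (sharp y) = (2 * N ord0) *: one.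
  apply: entryP => i j; rewrite entryD entryZ entry_one.
  have sys : hmul (sharp y) y = star (hmul y (sharp y)) by rewrite star_mul star_sharp // sy.
  rewrite sys entry_star; have [->|ij] := eqVneq i j.
    rewrite cdconjE addrC subrK (jord_sharp_entry sy (up j)).2 -/(N j) N0 scale1r //.
  have [l u3] := third ij; have [m u3'] : exists l, uniq [:: j; i; l] by apply: third; rewrite eq_sym.
  by rewrite (jord_sharp_entry sy u3).1 (jord_sharp_entry sy u3').1 cdconj0 addr0 scale0r scaler0.
have : dot (jord y (sharp y)) one = 2 * dot y (sharp y).
  by rewrite dot_proj_jord // star_sharp.
by rewrite E dotZl dot_one_one => e; congr (_ *: _); lra.
Qed.

Lemma dot_cross y z : star y = y -> star z = z -> dot y (cross y z) = 2 * dot z (sharp y).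
Proof.
move=> sy sz; rewrite /cross /sharp !(dotDr, dotNr, dotZr).
have -> : dot y (hmul y z) + dot y (hmul z y) = 2 * dot z (hmul y y).
  by rewrite -dotDr -/(jord _ _) dotC dot_J // /jord dotDr; ring.
by rewrite (dotC z y); field.
Qed.

Lemma sharpD y z (e : R) : sharp (y + e *: z) = sharp y + e *: cross y z + e ^+ 2 *: sharp z.
Proof.
rewrite /sharp /cross /jord !(hmulDl, hmulDr, hmulZl, hmulZr) !(dotDl, dotDr, dotZl, dotZr).
rewrite (dotC z y); by move: one => o; linear_mx field.
Qed.

(** The part of the Cayley-Hamilton theorem that is linear in z. *)
Lemma cayley_hamilton_polar y z : star y = y -> star z = z ->
  jord y (cross y z) + jord z (sharp y) = (2 * dot z (sharp y)) *: one.
Proof.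
move=> sy sz.
have CH (e : R) : jord (y + e *: z) (sharp y + e *: cross y z + e ^+ 2 *: sharp z) =
    (2 / 3 * dot (y + e *: z) (sharp y + e *: cross y z + e ^+ 2 *: sharp z)) *: one.
  by rewrite -sharpD cayley_hamilton // starD starZ sy sz.
have e3 := cayley_hamilton sz; have := dot_cross sy sz.
move: (sharp y) (cross y z) (sharp z) CH e3 => Y C Z CH e3 yC.
have e1 := CH 1; have e2 := CH (- 1).
apply: (scalerI (a := 2)); first by rewrite pnatr_eq0.
rewrite !(jordDl, jordDr, jordZl, jordZr) !(dotDl, dotDr, dotZl, dotZr) yC in e1 e2.
move: e1; set L1 := (X in X = _ -> _) => e1; move: e2; set L2 := (X in X = _ -> _) => e2.
have -> : 2 *: (jord y C + jord z Y) = L1 - L2 - 2 *: jord z Z by rewrite /L1 /L2; linear_mx ring.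
by rewrite e1 e2 e3; linear_mx field.
Qed.

Lemma jord0r y : jord y 0 = 0.
Proof. by rewrite -(scale0r (0 : V)) jordZr !scale0r. Qed.

(** The adjoint of a matrix of rank one vanishes. *)
Lemma sharp_proj x : X x -> sharp x = 0.
Proof.
move=> Xx; have [sx xx x1] := (projP x).1 Xx.
rewrite /sharp xx x1 proj_dot // (_ : s2 ^+ 2 = 2); last by rewrite expr2 s2M.
by rewrite !subrr mul0r scale0r addr0.
Qed.

(** As the adjoint of x vanishes, the polarised Cayley-Hamilton identity reduces to
    jord x (cross x y) = 0. *)
Lemma plane_peirce x y : X x -> star y = y ->
  jord x (jord x y) = s2 *: jord x y + (2 * dot x y) *: x.
Proof.
move=> Xx sy; have [sx xx x1] := (projP x).1 Xx; have tt := s2M (R := R).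
have := cayley_hamilton_polar sx sy; rewrite sharp_proj // dot0r mulr0 scale0r.
rewrite jord0r addr0.
rewrite /cross x1; move e: (jord x y) => j.
rewrite jordDr jordDr jordDr !jordNr !jordZr proj_jord_self // (jord1 x) e => h.
by apply/eqP; rewrite -subr_eq0 -h; apply/eqP; linear_mx ring.
Qed.

Lemma plane_tangent_square x v : X x -> star v = v -> jord x v = s2 *: v ->
  dot x v = 0 -> dot v one = 0 ->
  [/\ jord x (hmul v v) = dot v v *: x, jord v (hmul v v) = dot v v *: v &
     hmul (hmul v v) (hmul v v) = (dot v v / 2) *: hmul v v].
Proof.
move=> Xx sv jv xv v1; have [sx xx x1] := (projP x).1 Xx; have tt := s2M (R := R).
have t0 := s2_neq0 (R := R).
have svv : star (hmul v v) = hmul v v by rewrite star_mul sv.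
have shv : sharp v = hmul v v - (dot v v / 2) *: one.
  by rewrite /sharp v1 expr0n /= scale0r subr0 sub0r mulNr scaleNr.
have xvv := dot_tangent_square sx sv jv.
have cvx : cross v x = 0.
  by rewrite /cross (jordC v) jv v1 x1 mul0r (dotC v) xv scale0r !subr0 subrr scale0r addr0.
have g1 : jord x (hmul v v) = dot v v *: x.
  have := cayley_hamilton_polar sv sx; rewrite cvx jord0r add0r shv jordDr jordNr jordZr (jord1 x).
  rewrite dotBr dotZr x1 xvv (_ : 2 * _ = 0) ?scale0r; last by field.
  by move=> /eqP; rewrite subr_eq0 scalerA => /eqP ->; congr (_ *: _); field.
have vvv : dot v (hmul v v) = 0.
  apply: (mulfI t0); rewrite mulr0 -dotZl -jv dot_J // g1 dotZr (dotC v) xv mulr0 //.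
have g3 : jord v (hmul v v) = dot v v *: v.
  have := cayley_hamilton sv; rewrite shv jordDr jordNr jordZr (jord1 v) dotBr dotZr v1 vvv.
  rewrite mulr0 subrr mulr0 scale0r => /eqP; rewrite subr_eq0 scalerA => /eqP ->.
  by congr (_ *: _); field.
split=> //.
have vv1 : dot (hmul v v) one = dot v v by rewrite dot_mul1.
have vv2 : dot (hmul v v) (hmul v v) = dot v v ^+ 2 / 2.
  have : dot v (jord v (hmul v v)) = dot v v ^+ 2 by rewrite g3 dotZr expr2.
  by rewrite -dot_J // /jord !dotDl !dot_mulr !sv => e; lra.
have cv : cross v (hmul v v) = 0 by rewrite /cross g3 v1 vv1 vvv; linear_mx ring.
have := cayley_hamilton_polar sv svv; rewrite shv cv jord0r add0r.
rewrite jordDr jordNr jordZr (jord1 (hmul v v)) dotBr dotZr vv1 vv2.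
rewrite (_ : 2 * _ = 0) ?scale0r => [h|]; last by field.
apply: (scalerI (a := 2)); first by rewrite pnatr_eq0.
by apply/eqP; rewrite -subr_eq0 -h /jord; apply/eqP; linear_mx field.
Qed.

(** The entries of the vanishing adjoint of x. *)
Lemma plane_rank_one x i j l : X x ->
  cdmul (entry x i l) (entry x l j) = dot (entry x l l) (cd1 k) *: entry x i j.
Proof.
move=> Xx; have [sx xx x1] := (projP x).1 Xx; have sh0 := sharp_proj Xx.
have e0 a b : entry (0 : V) a b = 0 by apply/rowP => c; rewrite !mxE.
have [->|li] := eqVneq i l; first by rewrite {1}(star_diag l sx) cdmulZl cdmul1l.
have [->|lj] := eqVneq j l; first by rewrite {1}(star_diag l sx) cdmulZr cdmul1r.
have [->|ij] := eqVneq i j.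
  have [m u3] : exists m, uniq [:: m; j; l] by have [m] := third lj; exists m; rewrite -(rot_uniq 1).
  have := entry_sharp_diag sx u3; rewrite sh0 e0 => /esym/eqP.
  rewrite scaler_eq0 => /orP[|/eqP c1]; last first.
    by have := dot11 (R := R) k; rewrite c1 dot0l => /esym/eqP; rewrite oner_eq0.
  rewrite subr_eq0 => /eqP e; rewrite (star_diag j sx) scalerA mulrC e.
  by rewrite (star_entry j l sx) cdmul_conjr.
have := entry_sharp_off sx (uniq3 ij li lj); rewrite sh0 e0 => /esym/eqP.
by rewrite subr_eq0 => /eqP.
Qed.

Theorem plane_eigdim_diff_le : (2 <= cddim k * 2)%N -> exists C : R, forall n, (1 <= n)%N ->
  `|(eigdim X (cddim k * 2) n)%:R - (eigdim X (cddim k * 2) n.-1)%:R|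
    <= C * n%:R ^+ (cddim k * 2 - 2).
Proof.
apply: proj_eigdim_diff_le k3 _ _ _.
- exact: plane_peirce.
- exact: plane_tangent_square.
- exact: plane_rank_one.
Qed.

End AlternativePlane.

(** * Dimensions of the eigenspaces *)

Section Multiplicities.
Context {R : realType}.
Implicit Types (X : rank_one_space) (n : nat).

Lemma dimX_ge2 X : admissible X -> (2 <= dimX X)%N.
Proof. by case: X => [d|d|d|d|] //= /andP[h _]; apply: leq_trans h. Qed.

Lemma dimH_diff_le X : admissible X -> exists C : R, forall n, (1 <= n)%N ->
  `|(dimH R X n)%:R - (dimH R X n.-1)%:R| <= C * n%:R ^+ (dimX X - 2).
Proof.
case: X => [d|d|d|d|] /=.
- exact: sphere_eigdim_diff_le.
- move=> d2; have := @assoc_proj_eigdim_diff_le R 0 d isT.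
  by rewrite (_ : cddim 0 * d = d)%N; [apply | exact: mul1n].
- move=> /andP[d4 dd]; have := @assoc_proj_eigdim_diff_le R 1 (d %/ 2) isT.
  rewrite (_ : cddim 1 * (d %/ 2) = d)%N; last by rewrite mulnC divnK.
  by apply; exact: leq_trans d4.
- move=> /andP[d8 dd]; have := @assoc_proj_eigdim_diff_le R 2 (d %/ 4) isT.
  rewrite (_ : cddim 2 * (d %/ 4) = d)%N; last by rewrite mulnC divnK.
  by apply; exact: leq_trans d8.
- by move=> _; exact: (@plane_eigdim_diff_le R 3 isT isT).
Qed.

Lemma dimH_le X : admissible X -> exists C : R, forall n, (1 <= n)%N ->
  (dimH R X n)%:R <= C * n%:R ^+ (dimX X - 1) /\
  `|(dimH R X n)%:R - (dimH R X n.-1)%:R| <= C * n%:R ^+ (dimX X - 2).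
Proof.
move=> aX; have [C hC] := dimH_diff_le aX; have d2 := dimX_ge2 aX.
have C0 : 0 <= C by have := hC 1%N isT; rewrite expr1n mulr1; apply: le_trans.
pose D n : R := (dimH R X n)%:R.
have D0 : 0 <= D 0%N by rewrite ler0n.
have hD n : D n <= D 0%N + C * n%:R ^+ (dimX X - 1).
  elim: n => [|n IH]; first by rewrite lerDl mulr_ge0 // exprn_ge0.
  have h := hC n.+1 isT; have {}h := le_trans (ler_norm _) h; rewrite /= -/(D n) -/(D n.+1) in h.
  have e : (dimX X - 1 = (dimX X - 2).+1)%N by lia.
  have p : n%:R ^+ (dimX X - 1) + n.+1%:R ^+ (dimX X - 2) <= n.+1%:R ^+ (dimX X - 1) :> R.
    rewrite e !exprS -natr1 mulrDl mul1r lerD2r ler_wpM2l // lerXn2r ?nnegrE ?lerDl ?addr_ge0 //.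
  have := ler_wpM2l C0 p; lra.
exists (D 0%N + C) => n n1; split.
  apply: le_trans (hD n) _; rewrite mulrDl lerD2r ler_peMr // exprn_ege1 // ler1n //.
by apply: le_trans (hC n n1) _; rewrite ler_wpM2r ?exprn_ge0 // lerDr.
Qed.

End Multiplicities.

(** * Jacobi polynomials as hypergeometric sums *)

Section JacobiAlgebra.
Context {R : realType}.
Implicit Types (a b c x y z : R) (i j k m n p : nat).

Definition rising x k : R := \prod_(i < k) (x + i%:R).

Lemma rising0 x : rising x 0 = 1. Proof. exact: big_ord0. Qed.

Lemma risingS x k : rising x k.+1 = rising x k * (x + k%:R).
Proof. exact: big_ord_recr. Qed.

Lemma risingSl x k : rising x k.+1 = x * rising (x + 1) k.
Proof.
rewrite /rising big_ord_recl addr0; congr (_ * _); apply: eq_bigr => i _.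
by rewrite -addrA nat1r.
Qed.

Lemma rising_gt0 x k : 0 < x -> 0 < rising x k.
Proof. by move=> x0; apply: prodr_gt0 => i _; rewrite ltr_pwDl. Qed.

Lemma risingN n k : (n < k)%N -> rising (- n%:R) k = 0.
Proof. by move=> nk; rewrite /rising (bigD1 (Ordinal nk)) //= addNr mul0r. Qed.

Lemma gbin0 x : gbin x 0 = 1. Proof. by rewrite /gbin big_ord0 divr1. Qed.

Lemma fact_neq0 n : n`!%:R != 0 :> R.
Proof. by rewrite pnatr_eq0 -lt0n fact_gt0. Qed.

Lemma gbinS x k : gbin x k.+1 * k.+1%:R = gbin x k * (x - k%:R).
Proof.
rewrite /gbin big_ord_recr /= factS natrM; have := fact_neq0 k => h.
have s0 : k.+1%:R != 0 :> R by rewrite pnatr_eq0.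
move: (k.+1%:R : R) s0 => s s0; by field; rewrite h s0.
Qed.

Lemma gbin_bin z i p : gbin z (i + p) * 'C(i + p, i)%:R = gbin z p * gbin (z - p%:R) i.
Proof.
have := bin_fact (leq_addr p i); rewrite addnC addnK addnC => e.
have {}e : 'C(i + p, i)%:R * (i`!%:R * p`!%:R) = (i + p)`!%:R :> R by rewrite -!natrM e.
have h := fact_neq0; rewrite /gbin -e.
have -> : \prod_(t < i + p) (z - t%:R) =
    (\prod_(t < p) (z - t%:R)) * \prod_(t < i) (z - p%:R - t%:R) :> R.
  rewrite addnC big_split_ord /=; congr (_ * _); apply: eq_bigr => t _.
  by rewrite natrD opprD addrA.
have hC : 'C(i + p, i)%:R != 0 :> R.
  by rewrite pnatr_eq0 -lt0n bin_gt0 leq_addr.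
by field; rewrite hC !h.
Qed.

(** Vandermonde's identity, by induction from the ratio of consecutive
    binomials. *)
Lemma gbin_vandermonde x y m : \sum_(k < m.+1) gbin x (m - k) * gbin y k = gbin (x + y) m.
Proof.
elim: m => [|m IH]; first by rewrite big_ord1 !gbin0 mulr1.
have s0 : m.+1%:R != 0 :> R by rewrite pnatr_eq0.
apply: (mulIf s0); rewrite gbinS -IH !mulr_suml.
pose F k := gbin x (m.+1 - k) * gbin y k.
have E : \sum_(k < m.+2) F k * m.+1%:R =
   \sum_(k < m.+2) (gbin x (m.+1 - k) * (m.+1 - k)%:R) * gbin y k +
   \sum_(k < m.+2) gbin x (m.+1 - k) * (gbin y k * k%:R).
  rewrite -big_split /=; apply: eq_bigr => k _.
  have -> : m.+1%:R = (m.+1 - k)%:R + k%:R :> R by rewrite -natrD subnK // -ltnS.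
  by rewrite /F mulrDr mulrAC -[gbin x _ * _ * k%:R]mulrA.
rewrite E big_ord_recr /= subnn mulr0 mul0r addr0 [X in _ + X]big_ord_recl /= mulr0 mulr0 add0r.
rewrite -big_split /=; apply: eq_bigr => k _; have km : (k <= m)%N by rewrite -ltnS.
rewrite subSn // gbinS /bump /= add1n subSS gbinS natrB //.
by move: (gbin x _) (gbin y _) => u v; ring.
Qed.

Lemma geometric_binomial y k e :
  y ^+ k * (1 + y) ^+ e = \sum_(m < k + e.+1) (k <= m)%:R * 'C(e, m - k)%:R * y ^+ m.
Proof.
rewrite big_split_ord /= big1 ?add0r => [|i _]; last by rewrite leqNgt ltn_ord /= !mul0r.
rewrite exprDn mulr_sumr; apply: eq_bigr => i _.
by rewrite leq_addr mul1r addKn expr1n mul1r exprD -[in LHS]mulr_natl; ring.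
Qed.

Definition hypc a c n k : R :=
  rising (- n%:R) k * rising (n%:R + c) k / (rising (a + 1) k * k`!%:R).

(** The terminating hypergeometric series 2F1(-n, n + c; a + 1; y). *)
Definition hyp a c n y : R := \sum_(k < n.+1) hypc a c n k * y ^+ k.

Lemma gbin_hypc a b n m : -1 < a -> (m <= n)%N ->
  (-1) ^+ m * (gbin (n%:R + a) (n - m) * gbin (n%:R + a + b + m%:R) m) =
  gbin (n%:R + a) n * hypc a (a + b + 1) n m.
Proof.
move=> a1 mn.
have h0 k : rising (a + 1) k != 0 by rewrite gt_eqF // rising_gt0 // -ltrBlDr sub0r.
have e1 : gbin (n%:R + a + b + m%:R) m * m`!%:R = rising (n%:R + (a + b + 1)) m.
  rewrite /gbin mulfVK ?fact_neq0 // (reindex_inj rev_ord_inj) /=; apply: eq_bigr => i _.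
  by rewrite natrB // -natr1; ring.
have e2 : (-1) ^+ m * gbin (n%:R + a) (n - m) * rising (a + 1) m =
    gbin (n%:R + a) n * rising (- n%:R) m.
  elim: m mn {e1} => [|m IH] mn; first by rewrite subn0 !rising0 expr0 mul1r.
  have := IH (ltnW mn); rewrite !risingS mulrA => <-.
  have := gbinS (n%:R + a) (n - m.+1); rewrite subnSK // => e.
  have -> : a + 1 + m%:R = n%:R + a - (n - m.+1)%:R by rewrite natrB // -natr1; ring.
  transitivity ((-1) ^+ m.+1 * (gbin (n%:R + a) (n - m.+1) * (n%:R + a - (n - m.+1)%:R)) * rising (a + 1) m).
    by ring.
  rewrite -e natrB ?(ltnW mn) // exprS.
  by move: (gbin _ _) (rising _ _) => u v; ring.
rewrite /hypc mulrA [gbin _ n * (_ * _)]mulrA -e2 -e1.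
have := h0 m; have := fact_neq0 m.
move: (m`!%:R : R) (rising (a + 1) m) (gbin _ _) (gbin _ _) ((-1) ^+ m) => f r u v t f0 r0.
by field; rewrite f0 r0.
Qed.

Lemma jacobi_hyp a b n x : -1 < a ->
  jacobi a b n x = gbin (n%:R + a) n * hyp a (a + b + 1) n ((1 - x) / 2).
Proof.
move=> a1; set y := (1 - x) / 2; rewrite /jacobi.
have e1 : (x - 1) / 2 = - y by rewrite /y; field.
have e2 : (x + 1) / 2 = 1 + - y by rewrite /y; field.
rewrite e1 e2.
under eq_bigr => k _.
  rewrite -mulrA geometric_binomial addnS subnKC; last by rewrite -ltnS ltn_ord.
  rewrite mulr_sumr; over.
rewrite exchange_big /= /hyp mulr_sumr; apply: eq_bigr => m _.
have mn : (m <= n)%N by rewrite -ltnS.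
rewrite mulrA -gbin_hypc //.
have -> : (-1) ^+ m * (gbin (n%:R + a) (n - m) * gbin (n%:R + a + b + m%:R) m) * y ^+ m =
    gbin (n%:R + a) (n - m) * gbin (n%:R + a + b + m%:R) m * (- y) ^+ m.
  by rewrite (exprNn y) mulrC mulrA mulrC; congr (_ * _); rewrite mulrC.
rewrite (_ : n%:R + a + b + m%:R = (a + m%:R) + (n%:R + b)); last by ring.
rewrite -gbin_vandermonde (big_ord_widen n.+1 (fun k => gbin (a + m%:R) (m - k) * gbin (n%:R + b) k)) //.
rewrite mulr_sumr mulr_suml [RHS]big_mkcond /=; apply: eq_bigr => i _; rewrite ltnS.
case: leqP => im; rewrite ?mul0r ?mulr0 // mul1r.
have := gbin_bin (n%:R + a) (m - i) (n - m).
rewrite addnC addnBA // subnK // natrB // (_ : n%:R + a - (n%:R - m%:R) = a + m%:R); last by ring.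
by move=> e; rewrite mulrACA e !mulrA.
Qed.

Lemma hypc0 a c n : hypc a c n 0 = 1.
Proof. by rewrite /hypc !rising0 !mul1r invr1. Qed.

Lemma hypc_gt a c n k : (n < k)%N -> hypc a c n k = 0.
Proof. by move=> nk; rewrite /hypc risingN // !mul0r. Qed.

Lemma hyp_widen a c n N y : (n < N)%N -> hyp a c n y = \sum_(k < N) hypc a c n k * y ^+ k.
Proof.
move=> nN; rewrite /hyp (big_ord_widen N (fun k => hypc a c n k * y ^+ k)) // big_mkcond /=.
by apply: eq_bigr => k _; case: ifP => // /negbT; rewrite -leqNgt => nk; rewrite hypc_gt // mul0r.
Qed.

Definition recA a c (n : R) : R := (n + c) * (n + a + 1) / ((2 * n + c) * (2 * n + c + 1)).
Definition recC a c (n : R) : R := n * (n + c - a - 1) / ((2 * n + c - 1) * (2 * n + c)).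

(** The three-term recurrence in n, coefficient by coefficient.  Written with
    differences, its two coefficients are nonnegative. *)
Lemma hypc_rec a c n m : 0 < a + 1 -> 0 < c -> (1 <= n)%N ->
  hypc a c n m = - recA a c n%:R * (hypc a c n.+1 m.+1 - hypc a c n m.+1)
   + recC a c n%:R * (hypc a c n m.+1 - hypc a c n.-1 m.+1).
Proof.
move=> a0 c0; case: n => [//|n] _ /=.
rewrite /recA /recC /hypc.
have -> : n.+2%:R = n%:R + 2 :> R by rewrite -!natr1; ring.
have -> : n.+1%:R = n%:R + 1 :> R by rewrite -natr1.
have n0 : 0 <= n%:R :> R by [].
move: (n%:R : R) n0 => t t0.
case: m => [|m].
  rewrite !risingS !rising0 !addr0 !mul1r /= !mulr1 ?invr1.
  by field; rewrite !gt_eqF //; lra.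
have f0 := fact_neq0 m; have r0 : rising (a + 1) m != 0 by rewrite gt_eqF // rising_gt0.
have m0 : 0 <= m%:R :> R by [].
have a2 : a + 1 + m%:R != 0 by rewrite gt_eqF //; lra.
have a3 : a + 1 + (m%:R + 1) != 0 by rewrite gt_eqF //; lra.
pose G := rising (- t) m; pose H := rising (t + c + 2) m.
have g1 : rising (- (t + 2)) m.+2 = (t + 2) * (t + 1) * G.
  rewrite !risingSl (_ : - (t + 2) + 1 + 1 = - t); last by ring.
  by rewrite /G; ring.
have g2 : rising (- (t + 1)) m.+2 = - (t + 1) * (G * (m%:R - t)).
  by rewrite risingSl risingS (_ : - (t + 1) + 1 = - t) ?[_ + m%:R]addrC //; ring.
have g3 : rising (- t) m.+2 = G * (m%:R - t) * (m%:R + 1 - t).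
  by rewrite !risingS -natr1 /G; ring.
have g4 : rising (- (t + 1)) m.+1 = - (t + 1) * G.
  by rewrite risingSl (_ : - (t + 1) + 1 = - t) //; ring.
have h1 : rising (t + 2 + c) m.+2 = H * (t + c + 2 + m%:R) * (t + c + 3 + m%:R).
  by rewrite !risingS -natr1 /H (_ : t + 2 + c = t + c + 2); ring.
have h2 : rising (t + 1 + c) m.+2 = (t + 1 + c) * (H * (t + c + 2 + m%:R)).
  by rewrite risingSl risingS /H (_ : t + 1 + c + 1 = t + c + 2) //; ring.
have h3 : rising (t + c) m.+2 = (t + c) * (t + 1 + c) * H.
  by rewrite !risingSl /H (_ : t + c + 1 + 1 = t + c + 2); [ring|ring].
have h4 : rising (t + 1 + c) m.+1 = (t + 1 + c) * H.
  by rewrite risingSl /H (_ : t + 1 + c + 1 = t + c + 2) //; ring.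
rewrite g1 g2 g3 g4 h1 h2 h3 h4 !risingS !factS !natrM.
have -> : m.+2%:R = m%:R + 2 :> R by rewrite -!natr1; ring.
have -> : m.+1%:R = m%:R + 1 :> R by rewrite -natr1.
move: (m`!%:R : R) (rising (a + 1) m) G H f0 r0 {g1 g2 g3 g4 h1 h2 h3 h4} => f r G H f0 r0.
move: (m%:R : R) m0 a2 a3 => s s0 a2 a3.
field; rewrite f0 r0 a2 a3 /=.
by apply/and5P; split; rewrite gt_eqF //; lra.
Qed.

Lemma hyp_rec a c n y : 0 < a + 1 -> 0 < c -> (1 <= n)%N ->
  y * hyp a c n y = - recA a c n%:R * (hyp a c n.+1 y - hyp a c n y)
   + recC a c n%:R * (hyp a c n y - hyp a c n.-1 y).
Proof.
move=> a0 c0 n1; rewrite [X in y * X]/hyp mulr_sumr.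
rewrite (@hyp_widen a c n n.+2 y) // (@hyp_widen a c n.-1 n.+2 y); last first.
  by rewrite (leq_ltn_trans (leq_pred _)).
rewrite {1}/hyp -!sumrB !mulr_sumr -big_split /= [RHS]big_ord_recl !hypc0 !subrr !mulr0 !add0r.
apply: eq_bigr => k _; rewrite (hypc_rec k a0 c0 n1) (_ : lift ord0 k = k.+1 :> nat) // exprS.
move: (recA a c _) (recC a c _) (y ^+ k) (hypc _ _ _ _) (hypc _ _ _ _) (hypc _ _ _ _) => *.
by ring.
Qed.

Lemma hyp0n a c y : hyp a c 0 y = 1.
Proof. by rewrite /hyp big_ord1 hypc0 mulr1. Qed.

Lemma hyp1n a c y : 0 < a + 1 -> hyp a c 1 y = 1 - y * (c + 1) / (a + 1).
Proof.
move=> a0; rewrite /hyp big_ord_recl big_ord1 hypc0 (_ : lift ord0 ord0 = 1%N :> nat) //.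
rewrite /hypc !risingS !rising0 (_ : 1`! = 1%N) // expr0 expr1.
by field; rewrite gt_eqF.
Qed.

Lemma hyp_n0 a c n : hyp a c n 0 = 1.
Proof.
rewrite /hyp big_ord_recl hypc0 expr0 mulr1 big1 ?addr0 // => i _.
by rewrite expr0n mulr0.
Qed.

Lemma jacobi_N a b n x : jacobi a b n (- x) = (-1) ^+ n * jacobi b a n x.
Proof.
rewrite /jacobi (reindex_inj rev_ord_inj) mulr_sumr /=; apply: eq_bigr => k _.
have kn : (k <= n)%N by rewrite -ltnS.
rewrite subSS subKn // (_ : (- x - 1) / 2 = - ((x + 1) / 2)); last by field.
rewrite (_ : (- x + 1) / 2 = - ((x - 1) / 2)); last by field.
rewrite !(exprNn (_ / 2)) (_ : (-1) ^+ n = (-1) ^+ (n - k) * (-1) ^+ k); last by rewrite -exprD subnK.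
by move: ((-1) ^+ (n - k)) ((-1) ^+ k) (((x + 1) / 2) ^+ _) (((x - 1) / 2) ^+ _) (gbin (n%:R + a) k) (gbin (n%:R + b) _) => *; ring.
Qed.

(** Of order n^g.  The same product gives the value at 1 of a Jacobi polynomial and
    the normalisation that removes the decay of the oscillations. *)
Definition growth g n : R := \prod_(k < n) (1 + g / k.+1%:R).

Lemma growthS g n : growth g n.+1 = growth g n * (1 + g / n.+1%:R).
Proof. exact: big_ord_recr. Qed.

Lemma growth_gt0 g n : 0 <= g -> 0 < growth g n.
Proof. by move=> g0; apply: prodr_gt0 => i _; rewrite ltr_pwDl // divr_ge0. Qed.

Lemma gbin_growth a n : gbin (n%:R + a) n = growth a n.
Proof.
rewrite /gbin (reindex_inj rev_ord_inj) /= /growth.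
have h : n`!%:R = \prod_(i < n) i.+1%:R :> R.
  elim: n => [|n IH]; first by rewrite big_ord0.
  by rewrite big_ord_recr /= factS natrM IH mulrC.
rewrite h -prodf_div; apply: eq_bigr => i _; rewrite natrB //.
have s0 : i.+1%:R != 0 :> R by rewrite pnatr_eq0.
by rewrite mulrDl -{2}(mulfV s0); field.
Qed.

Lemma jacobi1 a b n : -1 < a -> jacobi a b n 1 = growth a n.
Proof.
by move=> a1; rewrite jacobi_hyp // subrr mul0r hyp_n0 mulr1 gbin_growth.
Qed.

Lemma jacobi_ratio a b n x : 0 <= a ->
  jacobi a b n x / jacobi a b n 1 = hyp a (a + b + 1) n ((1 - x) / 2).
Proof.
move=> a0; have a1 : -1 < a by lra.
by rewrite jacobi1 // jacobi_hyp // gbin_growth mulrAC mulfV ?mul1r // gt_eqF // growth_gt0.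
Qed.

End JacobiAlgebra.

(** * Asymptotics of the recurrence *)

Section Asymptotics.
Context {R : realType}.
Implicit Types (f g : nat -> R) (p l m : R) (n : nat).

Definition expand2 f l m : Prop := exists K : R, forall n, (1 <= n)%N ->
  `|f n - (l + m / n%:R)| <= K / n%:R ^+ 2.

Lemma inv_nat_le1 n : (1 <= n)%N -> 0 < (n%:R^-1 : R) <= 1.
Proof.
move=> n1; rewrite invr_gt0 ltr0n n1 /=; by rewrite invf_le1 ?ler1n ?ltr0n.
Qed.

Lemma expand2_lin p : expand2 (fun n => 1 + p / n%:R) 1 p.
Proof. by exists 0 => n n1; rewrite subrr normr0 mul0r. Qed.

Lemma expand2_inv p : 0 <= p -> expand2 (fun n => (1 + p / n%:R)^-1) 1 (- p).
Proof.
move=> p0; exists (p ^+ 2) => n n1; have /andP[t0 t1] := inv_nat_le1 n1.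
rewrite -exprVn.
move: (n%:R^-1 : R) t0 t1 => t t0 t1.
have pt : 0 <= p * t by rewrite mulr_ge0 // ltW.
have h : 0 < 1 + p * t by lra.
rewrite (_ : _ - _ = (p * t) ^+ 2 / (1 + p * t)); last by field; rewrite gt_eqF.
rewrite ger0_norm ?divr_ge0 ?sqr_ge0 // ?(ltW h) // ler_pdivrMr // -exprMn.
by rewrite ler_peMr ?sqr_ge0 // lerDl.
Qed.

Lemma expand2M f g l m l' m' : expand2 f l m -> expand2 g l' m' ->
  expand2 (fun n => f n * g n) (l * l') (l * m' + m * l').
Proof.
move=> [K hK] [K' hK'].
exists ((`|l| + `|m|) * K' + K * (`|l'| + `|m'| + K') + `|m * m'|) => n n1.
have := hK n n1; have := hK' n n1; have /andP[t0 t1] := inv_nat_le1 n1.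
rewrite -exprVn; move: (n%:R^-1 : R) t0 t1 (f n) (g n) => t t0 t1 u v hv hu.
have t20 : 0 < t ^+ 2 by rewrite exprn_gt0.
have t21 : t ^+ 2 <= 1 by rewrite expr_le1 // ltW.
have K0 : 0 <= K by rewrite -(pmulr_lge0 _ t20); apply: le_trans hu.
have K'0 : 0 <= K' by rewrite -(pmulr_lge0 _ t20); apply: le_trans hv.
have aff (x y : R) : `|x + y * t| <= `|x| + `|y|.
  apply: le_trans (ler_normD _ _) _; rewrite lerD2l normrM (gtr0_norm t0).
  by rewrite ler_piMr.
have v1 : `|v| <= `|l'| + `|m'| + K'.
  rewrite -[v](subrK (l' + m' * t)) addrC; apply: le_trans (ler_normD _ _) _.
  by apply: lerD (aff _ _) _; apply: le_trans hv _; rewrite ler_piMr.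
rewrite (_ : _ - _ = (l + m * t) * (v - (l' + m' * t)) + (u - (l + m * t)) * v + m * m' * t ^+ 2); last by ring.
rewrite [leRHS]mulrDl; apply: le_trans (ler_normD _ _) _; apply: lerD; last first.
  by rewrite normrM (gtr0_norm t20).
rewrite [leRHS]mulrDl; apply: le_trans (ler_normD _ _) _; rewrite !normrM; apply: lerD.
  by rewrite -mulrA; apply: ler_pM.
by rewrite mulrAC; apply: ler_pM.
Qed.

Lemma eq_expand2 f g l m l' m' : expand2 f l m -> (forall n, (1 <= n)%N -> f n = g n) ->
  l = l' -> m = m' -> expand2 g l' m'.
Proof. by move=> [K hK] fg <- <-; exists K => n n1; rewrite -fg // hK. Qed.

End Asymptotics.

Section Trigonometry.
Context {R : realType}.
Implicit Types (t : R).

Lemma ge0_of_derive (F dF : R -> R) t : (forall x : R, is_derive x 1 F (dF x)) ->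
  (forall x : R, 0 <= x -> 0 <= dF x) -> F 0 = 0 -> 0 <= t -> 0 <= F t.
Proof.
move=> hd dF0 F0 t0.
have [|x + e] := @MVT_segment R F dF 0 t t0 (fun x _ => hd x).
  apply: derivable_within_continuous => x _; by case: (hd x).
rewrite in_itv /= F0 !subr0 in e * => /andP[x0 _].
by rewrite e mulr_ge0 // dF0.
Qed.

Lemma sin_le_id t : 0 <= t -> sin t <= t.
Proof.
move=> t0; rewrite -subr_ge0.
refine (@ge0_of_derive (fun x => x - sin x) (fun x => 1 - cos x) t _ _ _ t0).
- by move=> x _; rewrite subr_ge0 cos_le1.
- by rewrite sin0 subr0.
Qed.

Lemma cos_ge_quadratic t : 0 <= t -> 1 - t ^+ 2 / 2 <= cos t.
Proof.
move=> t0; rewrite -subr_ge0.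
refine (@ge0_of_derive (fun x => cos x - (1 - x ^+ 2 / 2)) (fun x => x - sin x) t _ _ _ t0).
- move=> x; apply: is_derive_eq; rewrite /GRing.scale /=.
  by move: (sin x) => y; field.
- by move=> x x0; rewrite subr_ge0; exact: sin_le_id.
- by rewrite cos0 expr0n /= mul0r subr0 subrr.
Qed.

Lemma sin_ge_cubic t : 0 <= t -> t - t ^+ 3 / 6 <= sin t.
Proof.
move=> t0; rewrite -subr_ge0.
refine (@ge0_of_derive (fun x => sin x - (x - x ^+ 3 / 6)) (fun x => cos x - (1 - x ^+ 2 / 2)) t _ _ _ t0).
- move=> x; apply: is_derive_eq; rewrite /GRing.scale /=.
  by move: (cos x) => y; field.
- by move=> x x0; rewrite subr_ge0; exact: cos_ge_quadratic.
- by rewrite sin0 expr0n /= mul0r !subr0.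
Qed.

Lemma sin_ge_third t : 0 <= t <= pi / 2 -> t / 3 <= sin t.
Proof.
move=> /andP[t0 tp]; apply: le_trans (sin_ge_cubic t0).
have t2 : t < 2 by apply: le_lt_trans tp _; have /andP[] := pihalf_02 R.
have : t ^+ 2 <= 4 by nra.
by rewrite exprSr => h; have := ler_wpM2r t0 h; lra.
Qed.

End Trigonometry.

Section RecurrenceCoefficients.
Context {R : realType} (a b : R).
Local Notation c := (a + b + 1).
Local Notation g := (a + 1 / 2).
Local Notation A n := (recA a c n%:R).
Local Notation C n := (recC a c n%:R).
Implicit Types (n : nat).

Lemma recA_ge n : 0 <= a -> 0 <= b -> (1 <= n)%N -> (2 * (b + 2))^-1 <= A n.
Proof.
move=> a0 b0 n1; have h : (1 : R) <= n%:R by rewrite ler1n.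
move: (n%:R : R) h => t t1; rewrite /recA.
have p1 : 0 < (2 * t + c) * (2 * t + c + 1) by apply: mulr_gt0; lra.
rewrite ler_pdivlMr // mulrC ler_pdivrMr; last lra.
have ab : 0 <= a * b by rewrite mulr_ge0.
have h1 : 2 * t + c + 1 <= (t + a + 1) * (b + 2) by nra.
have h2 : 2 * t + c <= 2 * (t + c) by lra.
have := ler_pM _ _ h2 h1; rewrite (_ : (t + c) * (t + a + 1) * (2 * (b + 2)) =
  2 * (t + c) * ((t + a + 1) * (b + 2))); last by ring.
by apply; lra.
Qed.

Lemma recA_gt0 n : 0 <= a -> 0 <= b -> (1 <= n)%N -> 0 < A n.
Proof. by move=> a0 b0 n1; apply: lt_le_trans (recA_ge a0 b0 n1); rewrite invr_gt0; lra. Qed.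

Lemma recC_ge0 n : 0 <= a -> 0 <= b -> (1 <= n)%N -> 0 <= C n.
Proof.
move=> a0 b0 n1; have h : (1 : R) <= n%:R by rewrite ler1n.
move: (n%:R : R) h => t t1; rewrite /recC.
by rewrite divr_ge0 // mulr_ge0 //; lra.
Qed.

Lemma recC_le n : 0 <= a -> 0 <= b -> (1 <= n)%N -> C n <= A n.
Proof.
move=> a0 b0 n1; have h : (1 : R) <= n%:R by rewrite ler1n.
move: (n%:R : R) h => t t1; rewrite /recC /recA.
have p1 : 0 < (2 * t + c - 1) * (2 * t + c) by apply: mulr_gt0; lra.
have p2 : 0 < (2 * t + c) * (2 * t + c + 1) by apply: mulr_gt0; lra.
rewrite ler_pdivrMr // mulrAC ler_pdivlMr //.
rewrite (_ : t * (t + c - a - 1) * ((2 * t + c) * (2 * t + c + 1)) =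
  (2 * t + c) * ((t + b) * (t * (2 * t + c + 1)))); last by ring.
rewrite (_ : (t + c) * (t + a + 1) * ((2 * t + c - 1) * (2 * t + c)) =
  (2 * t + c) * ((t + c) * ((t + a + 1) * (2 * t + c - 1)))); last by ring.
rewrite ler_pM2l; last lra.
have ab : 0 <= a * b by rewrite mulr_ge0.
by apply: ler_pM; [lra| rewrite mulr_ge0 //; lra | lra | nra].
Qed.


Lemma expand_recA_inv : 0 <= a -> 0 <= b -> expand2 (fun n => (A n)^-1) 4 (- (4 * g)).
Proof.
move=> a0 b0; have c0 : 0 <= c by lra.
have h := expand2M (expand2M (expand2_lin (c / 2)) (expand2_lin ((c + 1) / 2)))
  (expand2M (expand2_inv c0) (expand2_inv (_ : 0 <= a + 1))).
have k4 : expand2 (fun n : nat => 4 : R) 4 0 by exists 0 => n _; rewrite !mul0r addr0 subrr normr0.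
apply: (eq_expand2 (expand2M k4 (h _))) => [|n n1||]; [lra| |ring|by field].
have h1 : (1 : R) <= n%:R by rewrite ler1n.
move: (n%:R : R) h1 => t t1; rewrite /recA.
by field; rewrite !gt_eqF //; lra.
Qed.

Lemma expand_recCA : 0 <= a -> 0 <= b -> expand2 (fun n => C n / A n) 1 (- (2 * g)).
Proof.
move=> a0 b0; have c0 : 0 <= c by lra. have a1 : 0 <= a + 1 by lra. have c1 : 0 <= (c - 1) / 2 by lra.
have h := expand2M (expand2M (expand2_lin b) (expand2_lin ((c + 1) / 2)))
  (expand2M (expand2_inv c1) (expand2M (expand2_inv c0) (expand2_inv a1))).
apply: (eq_expand2 h) => [n n1||]; [|ring|by field].
have h1 : (1 : R) <= n%:R by rewrite ler1n.
move: (n%:R : R) h1 => t t1; rewrite /recA /recC.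
by field; rewrite !gt_eqF //; lra.
Qed.

Lemma expand_growth_step (p : R) : 0 <= p -> expand2 (fun n => 1 + p / n.+1%:R : R) 1 p.
Proof.
move=> p0; have h := expand2M (expand2_lin (p + 1)) (expand2_inv ler01).
apply: (eq_expand2 h) => [n n1||]; [|ring|ring].
have h1 : (1 : R) <= n%:R by rewrite ler1n.
rewrite -natr1; move: (n%:R : R) h1 => t t1.
by field; rewrite !gt_eqF //; lra.
Qed.

(** The normalisation by growth factors cancels the first order terms of the
    recurrence, so that it differs from that of the Chebyshev polynomials by
    summable terms. *)
Lemma recurrence_errors : 0 <= a -> 0 <= b -> exists K : R, 0 <= K /\ forall n, (1 <= n)%N ->
  [/\ `|(1 + g / n.+1%:R) * (1 + C n / A n) - 2| <= K / n%:R ^+ 2,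
      `|(1 + g / n.+1%:R) / A n - 4| <= K / n%:R ^+ 2 &
      `|(1 + g / n.+1%:R) * (1 + g / n%:R) * (C n / A n) - 1| <= K / n%:R ^+ 2].
Proof.
move=> a0 b0; have g0 : 0 <= g by lra.
have [K1 h1] : expand2 (fun n => (1 + g / n.+1%:R) * (1 + C n / A n)) 2 0.
  have k : expand2 (fun n => 1 + C n / A n) 2 (- (2 * g)).
    have [K hK] := expand_recCA a0 b0; exists K => n n1; apply: le_trans (hK n n1).
    by rewrite le_eqVlt; apply/orP; left; apply/eqP; congr `|_|; ring.
  apply: (eq_expand2 (expand2M (expand_growth_step g0) k)) => [//||]; ring.
have [K2 h2] : expand2 (fun n => (1 + g / n.+1%:R) / A n) 4 0.
  by apply: (eq_expand2 (expand2M (expand_growth_step g0) (expand_recA_inv a0 b0))) => [//||]; ring.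
have [K3 h3] : expand2 (fun n => (1 + g / n.+1%:R) * (1 + g / n%:R) * (C n / A n)) 1 0.
  apply: (eq_expand2 (expand2M (expand2M (expand_growth_step g0) (expand2_lin g)) (expand_recCA a0 b0))) => [//||]; ring.
have le (K K' : R) n : K <= K' -> K / n%:R ^+ 2 <= K' / n%:R ^+ 2.
  by move=> ?; rewrite ler_wpM2r // invr_ge0 exprn_ge0.
exists (`|K1| + `|K2| + `|K3|); split; first by rewrite !addr_ge0.
have n1 := ler_norm K1; have n2 := ler_norm K2; have n3 := ler_norm K3.
have p1 := normr_ge0 K1; have p2 := normr_ge0 K2; have p3 := normr_ge0 K3.
move=> n hn; have := h1 n hn; have := h2 n hn; have := h3 n hn; rewrite !mul0r !addr0 => e3 e2 e1.
by split; [apply: le_trans e1 (le _ _ _ _)|apply: le_trans e2 (le _ _ _ _)|apply: le_trans e3 (le _ _ _ _)]; lra.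
Qed.

End RecurrenceCoefficients.

(** * Oscillatory decomposition of the Jacobi polynomials *)

Section Growth.
Context {R : realType}.
Implicit Types (g t : R) (n : nat).

Lemma powR_ratio_le g t : 0 <= g -> 0 <= t -> (1 + t) `^ g <= expR (g * t).
Proof.
move=> g0 t0; rewrite mulrC expRM; apply: ge0_ler_powR => //; rewrite ?nnegrE ?addr_ge0 ?expR_ge0 //.
exact: expR_ge1Dx.
Qed.

Lemma expR_ratio_le t : 0 <= t -> expR (t / (1 + t)) <= 1 + t.
Proof.
move=> t0; have h : 0 < 1 + t by lra.
rewrite -[leRHS]invrK -lef_pV2 ?posrE ?expR_gt0 ?invr_gt0 // invrK -expRN.
apply: le_trans (expR_ge1Dx _); rewrite le_eqVlt; apply/orP; left; apply/eqP.
by field; rewrite gt_eqF.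
Qed.

Lemma growth_ge g n : 0 <= g -> n.+1%:R `^ g <= growth g n * expR (2 * g ^+ 2).
Proof.
move=> g0; have : n.+1%:R `^ g <= growth g n * expR (2 * g ^+ 2 * (1 - n.+1%:R^-1)).
  elim: n => [|n IH]; first by rewrite powR1 /growth big_ord0 invr1 subrr mulr0 expR0 mulr1.
  set t : R := n.+1%:R^-1; have t0 : 0 < t by rewrite invr_gt0.
  have e : n.+2%:R = n.+1%:R * (1 + t) :> R by rewrite mulrDr mulr1 mulfV ?natr1 // pnatr_eq0.
  rewrite e powRM // ?addr_ge0 ?(ltW t0) // growthS.
  have gt : 0 <= g * t by rewrite mulr_ge0 // ltW.
  have h1 : (1 + t) `^ g <= (1 + g * t) * expR (g ^+ 2 * t ^+ 2).
    apply: le_trans (powR_ratio_le g0 (ltW t0)) _.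
    have h : g * t <= g * t / (1 + g * t) + g ^+ 2 * t ^+ 2.
      rewrite -exprMn -lerBlDr ler_pdivlMr; last lra.
      move: (g * t) gt => s s0; have : 0 <= s ^+ 3 by rewrite exprn_ge0.
      by rewrite (_ : (s - s ^+ 2) * (1 + s) = s - s ^+ 3); [lra|ring].
    apply: le_trans (_ : expR (g * t / (1 + g * t) + g ^+ 2 * t ^+ 2) <= _); first by rewrite ler_expR.
    by rewrite expRD ler_wpM2r ?expR_ge0 // expR_ratio_le.
  apply: le_trans (ler_pM (powR_ge0 _ _) (powR_ge0 _ _) IH h1) _.
  rewrite mulrACA -expRD -/(g / _) ler_wpM2l //; first by rewrite mulr_ge0 // ?(ltW (growth_gt0 _ _)) //; lra.
  rewrite ler_expR -mulrA -mulrA mulrCA -mulrDr.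
  have -> : (n.+1%:R * (1 + t))^-1 = t / (1 + t) by rewrite invfM.
  have : t ^+ 2 <= 2 * (t - t / (1 + t)).
    have t1 : t <= 1 by rewrite invf_le1 ?ler1n.
    rewrite (_ : t - t / (1 + t) = t ^+ 2 / (1 + t)); last by field; rewrite gt_eqF //; lra.
    rewrite mulrA ler_pdivlMr; last lra.
    by rewrite mulrC ler_wpM2r ?sqr_ge0 //; lra.
  rewrite -/t; have := sqr_ge0 g; move: (g ^+ 2) (t ^+ 2) (t / (1 + t)) => x y z x0 yz; nra.
move=> h; apply: le_trans h _; rewrite ler_wpM2l ?(ltW (growth_gt0 _ _)) // ler_expR.
by rewrite ler_piMr ?mulr_ge0 ?sqr_ge0 // gerBl invr_ge0.
Qed.

Lemma growth_le g n : 0 <= g -> growth g n <= n.+1%:R `^ g * expR g.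
Proof.
move=> g0; have : growth g n <= n.+1%:R `^ g * expR (g * (1 - n.+1%:R^-1)).
  elim: n => [|n IH]; first by rewrite powR1 /growth big_ord0 invr1 subrr mulr0 expR0 mulr1.
  set t : R := n.+1%:R^-1; have t0 : 0 < t by rewrite invr_gt0.
  have e : n.+2%:R = n.+1%:R * (1 + t) :> R by rewrite mulrDr mulr1 mulfV ?natr1 // pnatr_eq0.
  rewrite e powRM // ?addr_ge0 ?(ltW t0) // growthS -/t.
  have h1 : 1 + g * t <= (1 + t) `^ g * expR (g * (t - t / (1 + t))).
    apply: le_trans (expR_ge1Dx _) _.
    rewrite mulrBr -[in leLHS](subrK (g * (t / (1 + t))) (g * t)) addrC expRD ler_wpM2r ?expR_ge0 //.
    rewrite mulrC expRM; apply: ge0_ler_powR => //; rewrite ?nnegrE ?expR_ge0 ?addr_ge0 ?(ltW t0) //.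
    by apply: expR_ratio_le; exact: ltW.
  have gt : 0 <= 1 + g * t by rewrite addr_ge0 // mulr_ge0 // ltW.
  apply: le_trans (ler_pM (ltW (growth_gt0 _ g0)) gt IH h1) _.
  rewrite mulrACA -expRD le_eqVlt; apply/orP; left; apply/eqP; congr (_ * expR _).
  by rewrite -mulrDr invfM -/t; congr (_ * _); ring.
move=> h; apply: le_trans h _; rewrite ler_wpM2l ?powR_ge0 // ler_expR.
by rewrite ler_piMr // gerBl invr_ge0.
Qed.

End Growth.

Section ComplexModulus.
Context {R : realType}.
Implicit Types (z w : R[i]) (s t x : R).

Lemma cabs_ge0 z : 0 <= cabs z.
Proof. by case: z => a b; rewrite /cabs /= sqrtr_ge0. Qed.

Lemma cabsM z w : cabs (z * w) = cabs z * cabs w.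
Proof. exact: Normc.normcM. Qed.

Lemma cabs_real x : cabs (real_complex R x) = `|x|.
Proof. by rewrite /cabs /= expr0n addr0 sqrtr_sqr. Qed.

Lemma cabs_expi t : cabs (expi t) = 1.
Proof. by rewrite /cabs /expi /= cos2Dsin2 sqrtr1. Qed.

Lemma cabsD z w : cabs (z + w) <= cabs z + cabs w.
Proof.
case: z => a b; case: w => c d; rewrite /cabs /=.
set p := Num.sqrt (a ^+ 2 + _); set q := Num.sqrt (c ^+ 2 + _).
have p0 : 0 <= p := sqrtr_ge0 _; have q0 : 0 <= q := sqrtr_ge0 _.
have p2 : p ^+ 2 = a ^+ 2 + b ^+ 2 by rewrite sqr_sqrtr // addr_ge0 ?sqr_ge0.
have q2 : q ^+ 2 = c ^+ 2 + d ^+ 2 by rewrite sqr_sqrtr // addr_ge0 ?sqr_ge0.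
have pq : a * c + b * d <= p * q.
  apply: le_trans (ler_norm _) _; rewrite -ler_sqr ?nnegrE ?mulr_ge0 // real_normK ?num_real //.
  rewrite exprMn p2 q2; have := sqr_ge0 (a * d - b * c); nra.
rewrite -(ger0_norm (addr_ge0 p0 q0)) -sqrtr_sqr ler_sqrt ?sqr_ge0 //.
by rewrite [leRHS]sqrrD p2 q2; clearbody p q; lra.
Qed.

Lemma cabsN z : cabs (- z) = cabs z.
Proof. by case: z => a b; rewrite /cabs /= !sqrrN. Qed.

Lemma cabsB z w : cabs (z - w) <= cabs z + cabs w.
Proof. by rewrite -(cabsN w); exact: cabsD. Qed.

Lemma cabs_conj a b : cabs (Complex a (- b) : R[i]) = cabs (Complex a b : R[i]).
Proof. by rewrite /cabs /= sqrrN. Qed.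

Lemma Re_le_cabs a b : `|a| <= cabs (Complex a b : R[i]).
Proof.
by rewrite /cabs /= -sqrtr_sqr ler_sqrt ?addr_ge0 ?sqr_ge0 // lerDl sqr_ge0.
Qed.

Lemma cabs_le a b : cabs (Complex a b : R[i]) <= `|a| + `|b|.
Proof.
have := cabsD (Complex a 0 : R[i]) (Complex 0 b).
rewrite {1}/GRing.add /= !addr0 add0r => h; apply: le_trans h _.
by rewrite /cabs /= expr0n addr0 add0r !sqrtr_sqr.
Qed.

Lemma expiD s t : expi (s + t) = expi s * expi t.
Proof. by rewrite /expi cosD sinD; congr (Complex _ _); rewrite addrC. Qed.

Lemma expi0 : expi 0 = 1 :> R[i].
Proof. by rewrite /expi cos0 sin0. Qed.

Lemma cabs_expi1 t : 0 <= t -> cabs (expi t - 1) <= t.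
Proof.
move=> t0; have -> : expi t - 1 = Complex (cos t - 1) (sin t) by rewrite /expi /=; congr Complex; rewrite subr0.
rewrite /cabs /= -[leRHS](ger0_norm t0) -sqrtr_sqr ler_sqrt ?sqr_ge0 //.
have := cos2Dsin2 t; have := cos_ge_quadratic t0; nra.
Qed.

End ComplexModulus.

Section NearRegion.
Context {R : realType} (a b : R).
Local Notation c := (a + b + 1).
Local Notation g := (a + 1 / 2).
Implicit Types (n N : nat) (p y : R).

Lemma hyp_step n y : 0 <= a -> 0 <= b -> (1 <= n)%N ->
  hyp a c n.+1 y - hyp a c n y =
  recC a c n%:R / recA a c n%:R * (hyp a c n y - hyp a c n.-1 y)
   - y / recA a c n%:R * hyp a c n y.
Proof.
move=> a0 b0 n1; have A0 := recA_gt0 a0 b0 n1.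
have a1 : 0 < a + 1 by lra.
have c0 : 0 < c by lra.
have := hyp_rec y a1 c0 n1; move: (recA a c n%:R) A0 (recC _ _ _) => A A0 C e.
have An : A != 0 by rewrite gt_eqF.
rewrite (mulrAC y) e; move: (hyp _ _ _ _) (hyp _ _ _ _) (hyp _ _ _ _) => u v w.
by field.
Qed.

(** In the range n p <= 3 the polynomial does not oscillate yet: the differences
    grow at most geometrically with ratio 1 + O(p). *)
Lemma hyp_near : 0 <= a -> 0 <= b -> exists E : R, 0 <= E /\ forall p n,
  0 <= p <= pi / 2 -> n%:R * p <= 3 ->
  `|hyp a c n ((1 - cos p) / 2)| <= E /\
  `|hyp a c n ((1 - cos p) / 2) - hyp a c n.-1 ((1 - cos p) / 2)| <= E * p.
Proof.
move=> a0 b0; pose K : R := 2 * (b + 2); have K4 : 4 <= K by rewrite /K; lra.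
pose E0 := expR (3 * K * (1 + 2 * K)); have E00 : 0 < E0 by exact: expR_gt0.
exists ((1 + K) * E0); split; first by rewrite mulr_ge0 ?(ltW E00) //; lra.
move=> p n /andP[p0 pp] np; set y := (1 - cos p) / 2.
have p2 : p < 2 by apply: le_lt_trans pp _; have /andP[] := pihalf_02 R.
have [pe|pn0] := eqVneq p 0.
  rewrite /y pe cos0 subrr mul0r !hyp_n0 subrr normr0 mulr0 normr1; split=> //.
  have : 1 <= E0 by rewrite -expR0 ler_expR mulr_ge0 //; lra.
  by move=> h; nra.
have {p0 pn0} p0 : 0 < p by rewrite lt_def pn0.
have y0 : 0 <= y by rewrite /y; have := cos_le1 p; lra.
have yp : y <= p ^+ 2 / 4 by rewrite /y; have := cos_ge_quadratic (ltW p0); lra.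
clearbody y; pose d := K * p; have d0 : 0 < d by rewrite mulr_gt0 //; lra.
have Kyd : K * y <= d ^+ 2.
  rewrite /d exprMn; apply: le_trans (ler_wpM2l _ yp) _; first lra.
  have KK : K * 1 <= K * K by rewrite ler_wpM2l //; lra.
  by rewrite mulrCA mulrC ler_wpM2r ?sqr_ge0 // expr2; lra.
pose r m := hyp a c m y.
have step m : `|r m.+1 - r m| <= `|r m - r m.-1| + d ^+ 2 * `|r m|.
  case: m => [|m].
    rewrite /= subrr normr0 add0r /r hyp1n ?hyp0n; last lra.
    rewrite normr1 mulr1 addrC addKr normrN ger0_norm; last first.
      by rewrite divr_ge0 ?mulr_ge0 //; lra.
    apply: le_trans Kyd; rewrite -mulrA mulrC ler_wpM2r // ler_pdivrMr; last lra.
    by rewrite /K; have := mulr_ge0 a0 b0; lra.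
  have A0 := recA_gt0 a0 b0 (ltn0Sn m); have C0 := recC_ge0 a0 b0 (ltn0Sn m).
  have CA := recC_le a0 b0 (ltn0Sn m); have AK := recA_ge a0 b0 (ltn0Sn m).
  rewrite /r hyp_step // -/(r _) -/(r _) -/(r _); apply: le_trans (ler_normB _ _) _.
  move: (recA _ _ _) (recC _ _ _) A0 C0 CA AK => A C A0 C0 CA AK.
  rewrite !normrM normfV (gtr0_norm A0) (ger0_norm C0) (ger0_norm y0); apply: lerD.
    by rewrite ler_piMl // ler_pdivrMr // mul1r.
  rewrite ler_wpM2r //; apply: le_trans Kyd; rewrite mulrC ler_wpM2r //.
  by rewrite -[leRHS]invrK lef_pV2 ?posrE ?invr_gt0 //; lra.
pose T m := d * `|r m| + `|r m - r m.-1|.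
have T0 m : 0 <= T m by rewrite addr_ge0 // mulr_ge0 // ltW.
have hT m : T m <= d * expR (m%:R * (d + d ^+ 2)).
  elim: m => [|m IH]; first by rewrite /T /= subrr normr0 addr0 /r hyp0n normr1 mul0r expR0.
  have h1 : T m.+1 <= (1 + (d + d ^+ 2)) * T m.
    have h := step m; have h2 : `|r m.+1| <= `|r m| + `|r m.+1 - r m|.
      by rewrite -[in leLHS](subrK (r m) (r m.+1)) addrC; exact: ler_normD.
    rewrite /T /=; move: h h2 (normr_ge0 (r m)) (normr_ge0 (r m - r m.-1)).
    move: `|r m.+1| `|r m| `|r m.+1 - r m| `|r m - r m.-1| => u v w x h h2 v0 x0.
    have dv : 0 <= d ^+ 2 * v by rewrite mulr_ge0 // sqr_ge0.
    have dx : 0 <= d ^+ 2 * x by rewrite mulr_ge0 // sqr_ge0.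
    have e1 : d * u <= d * v + d * w by rewrite -mulrDr ler_wpM2l // ltW.
    have e2 : d * w <= d * x + d * (d ^+ 2 * v) by rewrite -mulrDr ler_wpM2l // ltW.
    by nra.
  have -> : m.+1%:R * (d + d ^+ 2) = (d + d ^+ 2) + m%:R * (d + d ^+ 2) by rewrite -natr1; ring.
  apply: le_trans h1 _; rewrite expRD mulrCA.
  apply: ler_pM => //; last exact: expR_ge1Dx.
  by rewrite !addr_ge0 // ?sqr_ge0 // ltW.
have En : expR (n%:R * (d + d ^+ 2)) <= E0.
  rewrite ler_expR (_ : n%:R * (d + d ^+ 2) = K * (n%:R * p) * (1 + d)); last by rewrite /d; ring.
  apply: ler_pM; [|lra| |]; first by rewrite !mulr_ge0 // ?(ltW p0) //; lra.
    by rewrite mulrC ler_wpM2r //; lra.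
  by rewrite lerD2l /d mulrC ler_wpM2r //; [lra|exact: ltW].
have hTn : T n <= d * E0 by apply: le_trans (hT n) _; rewrite ler_wpM2l // ltW.
have h1 : d * `|r n| <= d * E0 by apply: le_trans hTn; rewrite lerDl.
have h2 : `|r n - r n.-1| <= d * E0 by apply: le_trans hTn; rewrite lerDr mulr_ge0 // ltW.
split.
  by move: h1; rewrite ler_pM2l // => h1; apply: le_trans h1 _; rewrite ler_peMl ?(ltW E00) //; lra.
apply: le_trans h2 _; rewrite /d mulrAC ler_wpM2r ?(ltW p0) // mulrDl mul1r.
by rewrite lerDr ltW.
Qed.

End NearRegion.

Section FarRegion.
Context {R : realType} (a b : R).
Local Notation c := (a + b + 1).
Local Notation g := (a + 1 / 2).
Implicit Types (n N : nat) (p : R).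

Definition renorm p n : R := growth g n * hyp a c n ((1 - cos p) / 2).

Lemma renorm_rec : 0 <= a -> 0 <= b -> exists K : R, 0 <= K /\ forall p n, (1 <= n)%N ->
  `|renorm p n.+1 - 2 * cos p * renorm p n + renorm p n.-1| <=
    K / n%:R ^+ 2 * (`|renorm p n| + `|renorm p n.-1|).
Proof.
move=> a0 b0; have [K [K0 hK]] := recurrence_errors a0 b0; exists (2 * K); split; first lra.
move=> p [//|n] _; have [e1 e2 e3] := hK n.+1 isT.
have c1 := cos_le1 p; have c2 := cos_geN1 p.
rewrite /renorm; have := hyp_step ((1 - cos p) / 2) a0 b0 (ltn0Sn n); rewrite /= => /(canRL (subrK _)) ->.
move: (hyp _ _ n.+1 _) (hyp _ _ n _) => u v.
rewrite [growth g n.+2]growthS [growth g n.+1]growthS; move: (growth g n) => w.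
rewrite -[2 * K / _]mulrA.
move: (1 + g / n.+2%:R) (1 + g / n.+1%:R) (recC _ _ _) (recA _ _ _)^-1 (K / n.+1%:R ^+ 2) e1 e2 e3 => q s C B k e1 e2 e3.
have [y [y0 y1 yE]] : exists y : R, [/\ 0 <= y, y <= 1 & y = (1 - cos p) / 2].
  by exists ((1 - cos p) / 2); split=> //; lra.
rewrite -yE (_ : cos p = 1 - 2 * y); last by rewrite yE; field.
have -> : w * s * q * (C * B * (u - v) - y * B * u + u) - 2 * (1 - 2 * y) * (w * s * u) + w * v =
   (w * s * u) * ((q * (1 + C * B) - 2) - y * (q * B - 4)) - (w * v) * (q * s * (C * B) - 1) by ring.
move: (w * s * u) (w * v) => m m'.
apply: le_trans (ler_normB _ _) _; rewrite [leRHS]mulrDr (normrM m) (normrM m'); apply: lerD.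
  rewrite mulrC ler_wpM2r //; apply: le_trans (ler_normB _ _) _; rewrite normrM (ger0_norm y0).
  have h : y * `|q * B - 4| <= 1 * `|q * B - 4| by rewrite ler_wpM2r.
  by lra.
rewrite mulrC ler_wpM2r //; apply: le_trans e3 _.
by rewrite ler_peMl ?ler1n //; apply: le_trans e2.
Qed.

(** The Wronskian-type quantity whose argument rotates by p at each step; the
    real part of twice its product with exp(i n p) is the renormalised polynomial. *)
Definition amplitude p n : R[i] :=
  expi (- (n%:R * p)) * Complex (renorm p n / 2) ((renorm p n.-1 - cos p * renorm p n) / (2 * sin p)).

Definition cconj (z : R[i]) : R[i] := Complex (complex.Re z) (- complex.Im z).

Lemma cabs_cconj z : cabs (cconj z) = cabs z.
Proof. by case: z => x y; rewrite /cconj cabs_conj. Qed.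

Lemma cconjM z w : cconj (z * w) = cconj z * cconj w.
Proof. by case: z => x y; case: w => u v; rewrite /cconj /=; congr Complex; ring. Qed.

Lemma cconj_expi (t : R) : cconj (expi t) = expi (- t).
Proof. by rewrite /cconj /expi /= cosN sinN. Qed.

Lemma amplitudeE p n : real_complex R (renorm p n) =
  amplitude p n * expi (n%:R * p) + cconj (amplitude p n) * expi (- (n%:R * p)).
Proof.
rewrite /amplitude cconjM cconj_expi opprK.
have e1 (t : R) z : expi (- t) * z * expi t = z by rewrite mulrAC -expiD addNr expi0 mul1r.
have e2 (t : R) z : expi t * z * expi (- t) = z by rewrite mulrAC -expiD subrr expi0 mul1r.
rewrite e1 e2.
by rewrite /cconj /=; congr Complex; rewrite ?subrr //; field.
Qed.

Lemma renorm_le_amplitude p n : 0 < sin p ->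
  `|renorm p n| <= 2 * cabs (amplitude p n) /\ `|renorm p n.-1| <= 2 * cabs (amplitude p n).
Proof.
move=> s0; have sn : sin p != 0 by rewrite gt_eqF.
rewrite /amplitude cabsM cabs_expi mul1r.
move: (renorm p n) (renorm p n.-1) => u v; set z := Complex _ _; split.
  have := Re_le_cabs (u / 2) ((v - cos p * u) / (2 * sin p)).
  by rewrite -/z normrM normfV (ger0_norm (ler0n _ 2)) ler_pdivrMr // mulrC.
have -> : cabs z = cabs (expi (- p) * z) by rewrite cabsM cabs_expi mul1r.
have -> : expi (- p) * z = Complex (v / 2) (- (sin p * u / 2) + cos p * ((v - cos p * u) / (2 * sin p))).
  by rewrite /expi /z cosN sinN; congr Complex; [field|ring].
have := Re_le_cabs (v / 2) (- (sin p * u / 2) + cos p * ((v - cos p * u) / (2 * sin p))).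
by rewrite normrM normfV (ger0_norm (ler0n _ 2)) ler_pdivrMr // mulrC.
Qed.

Lemma amplitude_step p n : 0 < sin p -> (1 <= n)%N ->
  cabs (amplitude p n.+1 - amplitude p n) =
  `|renorm p n.+1 - 2 * cos p * renorm p n + renorm p n.-1| / (2 * sin p).
Proof.
move=> s0 n1; have sn : sin p != 0 by rewrite gt_eqF.
set e := _ - _ + _.
have cs := cos2Dsin2 p.
have -> : amplitude p n.+1 - amplitude p n =
    expi (- (n.+1%:R * p)) * Complex (e / 2) (- (cos p * e / (2 * sin p))).
  rewrite /amplitude (_ : - (n%:R * p) = - (n.+1%:R * p) + p); last by rewrite -natr1; ring.
  rewrite expiD -mulrA -mulrBr; congr (_ * _); rewrite /e /=.
  move: (renorm p n.+1) (renorm p n) (renorm p n.-1) cs sn; rewrite /expi.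
  move: (cos p) (sin p) => C S u v w cs sn.
  have {}cs : S ^+ 2 = 1 - C ^+ 2 by rewrite -cs addrC addKr.
  rewrite /=; congr Complex; first by field.
  by field: cs.
rewrite cabsM cabs_expi mul1r.
have -> : Complex (e / 2) (- (cos p * e / (2 * sin p))) =
   real_complex R (e / (2 * sin p)) * Complex (sin p) (- cos p).
  by rewrite /=; congr Complex; field.
clearbody e; rewrite cabsM cabs_real /cabs /= sqrrN [sin p ^+ 2 + _]addrC cs sqrtr1 mulr1 normrM normfV.
by rewrite [`|2 * _|]ger0_norm // mulr_ge0 // ltW.
Qed.

(** Discrete Gronwall: the relative increments of the amplitude are summable with
    sum O(1) beyond the index 1/p. *)
Lemma amplitude_bounds : 0 <= a -> 0 <= b -> exists M : R, 0 <= M /\ forall p N,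
  0 < p <= pi / 2 -> (1 <= N)%N -> 1 <= N%:R * p -> forall n, (N <= n)%N ->
  cabs (amplitude p n) <= M * cabs (amplitude p N) /\
  cabs (amplitude p n.+1 - amplitude p n) <= M / n%:R * cabs (amplitude p N).
Proof.
move=> a0 b0; have [K [K0 hK]] := renorm_rec a0 b0.
have [L [L0 LE]] : exists L : R, 0 <= L /\ L = 6 * K by exists (6 * K); split=> //; lra.
have E1 : 1 <= expR (2 * L) by have := expR_ge1Dx (2 * L); lra.
exists ((1 + L) * expR (2 * L)); split; first by rewrite mulr_ge0 ?expR_ge0 //; lra.
move=> p N /andP[p0 pp] N1 Np.
have sp : p / 3 <= sin p by apply: sin_ge_third; rewrite ltW.
have s0 : 0 < sin p by apply: lt_le_trans sp; rewrite divr_gt0.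
pose q n := cabs (amplitude p n); have q0 n : 0 <= q n := cabs_ge0 _.
have step n : (N <= n)%N -> cabs (amplitude p n.+1 - amplitude p n) <= L / (p * n%:R ^+ 2) * q n.
  move=> Nn; have n1 : (1 <= n)%N by exact: leq_trans Nn.
  have n0 : 0 < n%:R :> R by rewrite ltr0n.
  rewrite amplitude_step // ler_pdivrMr ?mulr_gt0 //.
  apply: le_trans (hK p n n1) _.
  have [h1 h2] := renorm_le_amplitude n s0.
  have k0 : 0 <= K / n%:R ^+ 2 by rewrite divr_ge0 // exprn_ge0 // ltW.
  apply: le_trans (ler_wpM2l k0 (lerD h1 h2)) _.
  rewrite -/(q n) -mulrDr (_ : L / (p * n%:R ^+ 2) * q n * (2 * sin p) =
     K / n%:R ^+ 2 * q n * (4 * (3 * sin p / p))); last by rewrite LE; field; rewrite !gt_eqF.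
  rewrite -mulrA ler_wpM2l // -[leRHS]mulrC.
  have h3 : 1 <= 3 * sin p / p by rewrite ler_pdivlMr //; lra.
  have := ler_wpM2r (q0 n) h3; lra.
have gron n : (N <= n)%N -> q n <= q N * expR (2 * L / p * (N%:R^-1 - n%:R^-1)).
  move=> /subnK <-; elim: (n - N)%N => [|k IH]; first by rewrite add0n subrr mulr0 expR0 mulr1.
  rewrite addSn; set m := (k + N)%N in IH *.
  have Nm : (N <= m)%N by rewrite leq_addl.
  have m1 : (1 <= m)%N by exact: leq_trans Nm.
  have m0 : (1 : R) <= m%:R by rewrite ler1n.
  have h1 : q m.+1 <= q m * (1 + L / (p * m%:R ^+ 2)).
    have := cabsD (amplitude p m) (amplitude p m.+1 - amplitude p m).
    rewrite addrC subrK => h; apply: le_trans h _.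
    by rewrite mulrDr mulr1 lerD2l mulrC; exact: step.
  apply: le_trans h1 _.
  have e : N%:R^-1 - m.+1%:R^-1 = (N%:R^-1 - m%:R^-1) + (m%:R^-1 - m.+1%:R^-1) :> R by ring.
  rewrite e (mulrDr (2 * L / p)) expRD mulrA; apply: ler_pM => //.
    by rewrite addr_ge0 // divr_ge0 // mulr_ge0 ?exprn_ge0 // ltW.
  apply: le_trans (expR_ge1Dx _) _; rewrite ler_expR.
  have eS : m.+1%:R = m%:R + 1 :> R by rewrite natr1.
  rewrite eS; move: (m%:R : R) m0 => t t1.
  rewrite -subr_ge0 (_ : _ - _ = L * (t - 1) / (p * t ^+ 2 * (t + 1))); last first.
    by field; rewrite !gt_eqF //; lra.
  rewrite divr_ge0 ?mulr_ge0 ?exprn_ge0 //; lra.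
move=> n Nn; have n0 : 0 < n%:R :> R by rewrite ltr0n; exact: leq_trans Nn.
have N0 : 0 < N%:R :> R by rewrite ltr0n.
have qn : q n <= expR (2 * L) * q N.
  apply: le_trans (gron n Nn) _; rewrite mulrC ler_wpM2r // ler_expR.
  apply: le_trans (_ : 2 * L / p * N%:R^-1 <= _).
    by rewrite ler_wpM2l ?divr_ge0 ?mulr_ge0 ?(ltW p0) // gerBl invr_ge0 ltW.
  rewrite -mulrA -invfM mulrC ler_piMl ?mulr_ge0 // invf_le1 ?mulr_gt0 //.
  by rewrite mulrC.
split.
  by apply: le_trans qn _; rewrite ler_wpM2r // ler_peMl ?expR_ge0 //; lra.
apply: le_trans (step n Nn) _.
have np : 1 <= n%:R * p.
  by apply: le_trans Np _; rewrite ler_wpM2r ?(ltW p0) // ler_nat.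
have h : L / (p * n%:R ^+ 2) <= L / n%:R.
  rewrite ler_wpM2l // lef_pV2 ?posrE ?mulr_gt0 ?exprn_gt0 // expr2 mulrA mulrC.
  by rewrite ler_peMr ?(ltW n0) // mulrC.
apply: le_trans (ler_pM _ (q0 n) h qn) _; first by rewrite divr_ge0 // mulr_ge0 ?exprn_ge0 ?(ltW p0) ?(ltW n0).
rewrite -/(q N) mulrA ler_wpM2r // mulrAC ler_wpM2r ?invr_ge0 ?(ltW n0) //.
by rewrite ler_wpM2r ?expR_ge0 //; lra.
Qed.


End FarRegion.

Section SlowAmplitudes.
Context {R : realType} (a b : R).
Local Notation c := (a + b + 1).
Local Notation g := (a + 1 / 2).
Local Notation r p n := (hyp a c n ((1 - cos p) / 2)).
Local Notation amp := (amplitude a b).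
Implicit Types (n N : nat) (p : R).

Lemma growth_step_le n : 0 <= a -> growth g n.+1 - growth g n <= growth g n.+1 * (g / n.+1%:R).
Proof.
move=> a0; have g0 : 0 <= g by lra.
rewrite growthS mulrDr mulr1 addrAC subrr add0r ler_wpM2r ?divr_ge0 //.
by rewrite lerDl mulr_ge0 ?divr_ge0 // ltW // growth_gt0.
Qed.

(** At the index 1/p the polynomial is O(1) and its increment is O(p), which the
    factor 1 / sin p in the amplitude compensates. *)
Lemma amplitude_start : 0 <= a -> 0 <= b -> exists M : R, 0 <= M /\ forall p N,
  0 < p <= pi / 2 -> (1 <= N)%N -> 1 <= N%:R * p -> N%:R * p <= 3 ->
  cabs (amp p N) <= M * growth g N.
Proof.
move=> a0 b0; have [E [E0 hE]] := hyp_near a0 b0; have g0 : 0 <= g by lra.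
exists (E + 3 * (E * (2 + g))); split; first by rewrite addr_ge0 ?mulr_ge0 //; lra.
move=> p [//|N] /andP[p0 pp] _ Np Np3.
have pI : 0 <= p <= pi / 2 by rewrite ltW.
have sp : p / 3 <= sin p by exact: sin_ge_third.
have s0 : 0 < sin p by apply: lt_le_trans sp; rewrite divr_gt0.
have p2 : p < 2 by apply: le_lt_trans pp _; have /andP[] := pihalf_02 R.
have [h1 h2] := hE p N.+1 pI Np3.
have Np3' : N%:R * p <= 3 by apply: le_trans Np3; rewrite ler_wpM2r ?(ltW p0) // ler_nat.
have [h3 _] := hE p N pI Np3'.
have G0 := growth_gt0 N.+1 g0; have G1 := growth_gt0 N g0.
rewrite /amplitude cabsM cabs_expi mul1r; apply: le_trans (cabs_le _ _) _.
have u1 : `|renorm a b p N.+1| <= growth g N.+1 * E.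
  by rewrite /renorm normrM (gtr0_norm G0) ler_wpM2l // ltW.
have d1 : `|renorm a b p N.+1 - renorm a b p N| <= growth g N.+1 * (E * p * (1 + g)).
  rewrite /renorm; have := growth_step_le N a0; rewrite /= in h2.
  have : growth g N <= growth g N.+1 by rewrite growthS ler_peMr ?(ltW G1) // lerDl divr_ge0.
  move: (r p N.+1) (r p N) (growth g N.+1) (growth g N) G0 G1 h1 h2 h3 => u v G G' G0 G1 h1 h2 h3 GG Gs.
  have gN : g / N.+1%:R <= g * p.
    by rewrite ler_wpM2l // -[leLHS]mul1r ler_pdivrMr // mulrC.
  rewrite (_ : G * u - G' * v = G * (u - v) + (G - G') * v); last by ring.
  apply: le_trans (ler_normD _ _) _.
  rewrite [E * p * (1 + g)]mulrDr mulr1 [leRHS]mulrDr; apply: lerD.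
    by rewrite normrM (gtr0_norm G0) ler_wpM2l // ltW.
  rewrite normrM ger0_norm ?subr_ge0 //.
  have h : G - G' <= G * (g * p) by apply: le_trans Gs _; rewrite ler_wpM2l // ltW.
  have := ler_pM _ (normr_ge0 v) h h3; rewrite subr_ge0 => /(_ GG) hh; apply: le_trans hh _.
  by rewrite le_eqVlt; apply/orP; left; apply/eqP; ring.
have c1 := cos_le1 p; have c2 := cos_ge_quadratic (ltW p0).
have cp : 1 - cos p <= p by move: c2; rewrite expr2; nra.
have w1 : `|renorm a b p N - cos p * renorm a b p N.+1| <= growth g N.+1 * (E * p * (2 + g)).
  rewrite (_ : _ - _ = (1 - cos p) * renorm a b p N.+1 - (renorm a b p N.+1 - renorm a b p N)); last by ring.
  apply: le_trans (ler_normB _ _) _.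
  rewrite (_ : E * p * (2 + g) = p * E + E * p * (1 + g)); last by ring.
  rewrite [leRHS]mulrDr; apply: lerD => //; rewrite normrM ger0_norm ?subr_ge0 //.
  rewrite mulrCA; apply: ler_pM => //; by rewrite subr_ge0.
rewrite /=; move: (renorm _ _ _ _) (renorm _ _ _ _) u1 w1 {d1} => u v u1 w1.
rewrite !normf_div (ger0_norm (ler0n _ 2)) [`|2 * _|]ger0_norm; last by rewrite mulr_ge0 // ltW.
rewrite [leRHS]mulrDl; apply: lerD.
  rewrite ler_pdivrMr // (mulrC E); apply: le_trans u1 _.
  by rewrite ler_peMr ?mulr_ge0 ?(ltW G0) // ler1n.
rewrite ler_pdivrMr ?mulr_gt0 //; apply: le_trans w1 _.
rewrite (_ : 3 * _ * _ * _ = growth g N.+1 * (E * (2 + g) * (6 * sin p))); last by ring.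
rewrite ler_wpM2l ?(ltW G0) // mulrAC ler_wpM2l ?mulr_ge0 //; lra.
Qed.

Definition weight p n : R := (japanese (n%:R * p) `^ g)^-1.

Lemma japanese_gt0 (x : R) : 0 < japanese x.
Proof. by rewrite sqrtr_gt0 ltr_pwDl // sqr_ge0. Qed.

Lemma japanese_le (x : R) : 0 <= x -> japanese x <= 1 + x.
Proof.
move=> x0; rewrite /japanese ger0_norm // -[leRHS]ger0_norm ?addr_ge0 // -sqrtr_sqr ler_sqrt ?sqr_ge0 //.
by rewrite sqrrD expr1n mul1r -addrA lerD2l lerDr mulrn_wge0.
Qed.

Lemma weight_gt0 p n : 0 < weight p n.
Proof. by rewrite invr_gt0 powR_gt0 // japanese_gt0. Qed.

Lemma weight_near p n : 0 <= a -> 0 <= p -> n%:R * p <= 3 -> 1 <= 4 `^ g * weight p n.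
Proof.
move=> a0 p0 np; have np0 : 0 <= n%:R * p by rewrite mulr_ge0.
have h := japanese_le np0; rewrite /weight ler_pdivlMr ?powR_gt0 ?japanese_gt0 // [leLHS]mul1r.
by apply: ge0_ler_powR; rewrite ?nnegrE ?(ltW (japanese_gt0 _)) //; lra.
Qed.

(** The left side is of order (N/n)^g, and N <= 3/p. *)
Lemma weight_far : 0 <= a -> exists w : R, 0 <= w /\ forall p N n, 0 < p ->
  (1 <= N)%N -> N%:R * p <= 3 -> (N <= n)%N -> growth g N / growth g n <= w * weight p n.
Proof.
move=> a0; have g0 : 0 <= g by lra.
exists (expR g * expR (2 * g ^+ 2) * 8 `^ g); split; first by rewrite !mulr_ge0 ?expR_ge0 ?powR_ge0.
move=> p N n p0 N1 Np Nn.
have n1 : (1 : R) <= n%:R by rewrite ler1n; exact: leq_trans Nn.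
have Nn' : N%:R <= n%:R :> R by rewrite ler_nat.
have N1' : (1 : R) <= N%:R by rewrite ler1n.
have np0 : 0 <= n%:R * p by rewrite mulr_ge0 // ltW.
have J0 := japanese_gt0 (n%:R * p); have Gn := growth_gt0 n g0.
rewrite ler_pdivrMr //; apply: le_trans (growth_le N g0) _.
have h1 : N.+1%:R `^ g * japanese (n%:R * p) `^ g <= 8 `^ g * n.+1%:R `^ g.
  rewrite -!powRM ?(ltW J0) //; apply: ge0_ler_powR; rewrite ?nnegrE ?mulr_ge0 ?(ltW J0) //.
  apply: le_trans (ler_wpM2l _ (japanese_le np0)) _ => //.
  have eN : N.+1%:R = N%:R + 1 :> R by rewrite natr1.
  have en : n.+1%:R = n%:R + 1 :> R by rewrite natr1.
  rewrite eN en.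
  have h : n%:R * (N%:R * p) <= n%:R * 3 by rewrite ler_wpM2l.
  have h' : n%:R * p <= n%:R * (N%:R * p) by rewrite ler_wpM2l // ler_peMl // ltW.
  move: (N%:R : R) (n%:R : R) n1 Nn' N1' h h' => x y n1 Nn' N1' h h'; lra.
have h2 := ler_wpM2l (powR_ge0 8 g) (growth_ge n g0).
have W : weight p n * japanese (n%:R * p) `^ g = 1 by rewrite mulVf // gt_eqF // powR_gt0.
have h3 : N.+1%:R `^ g <= weight p n * (8 `^ g * (growth g n * expR (2 * g ^+ 2))).
  by have := ler_wpM2l (ltW (weight_gt0 p n)) (le_trans h1 h2); rewrite mulrCA W mulr1.
rewrite (_ : _ * _ * _ * _ * _ = weight p n * (8 `^ g * (growth g n * expR (2 * g ^+ 2))) * expR g).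
  by rewrite ler_wpM2r ?expR_ge0.
by move: (8 `^ g) (weight _ _) (growth _ _) (expR _) (expR _) => *; ring.
Qed.

(** The value at n - 1 is compared with the weight at n, as the product rule for
    differences requires. *)
Definition slow (C : R) p (f : nat -> R[i]) : Prop := forall n, (1 <= n)%N ->
  [/\ cabs (f n) <= C * weight p n, cabs (f n.-1) <= C * weight p n &
     cabs (f n - f n.-1) <= C / n%:R * weight p n].

Lemma slow_le (C C' : R) p f : C <= C' -> slow C p f -> slow C' p f.
Proof.
move=> CC h n n1; have [h1 h2 h3] := h n n1; have w0 := ltW (weight_gt0 p n).
split; [apply: le_trans h1 _|apply: le_trans h2 _|apply: le_trans h3 _]; rewrite ler_wpM2r //.
by rewrite ler_wpM2r // invr_ge0.
Qed.

Definition unit_amplitude p n : R[i] := real_complex R (growth g n)^-1 * amp p n.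

Lemma cconjB (z w : R[i]) : cconj (z - w) = cconj z - cconj w.
Proof. by case: z => x y; case: w => u v; rewrite /cconj /=; congr Complex; ring. Qed.

Lemma cconj_real (x : R) : cconj (real_complex R x) = real_complex R x.
Proof. by rewrite /cconj /= oppr0. Qed.

Lemma hyp_unit_amplitude p n : 0 <= a -> real_complex R (r p n) =
  unit_amplitude p n * expi (n%:R * p) + cconj (unit_amplitude p n) * expi (- (n%:R * p)).
Proof.
move=> a0; have G0 : growth g n != 0 by rewrite gt_eqF // growth_gt0 //; lra.
have e := amplitudeE a b p n; rewrite /unit_amplitude cconjM cconj_real.
rewrite -[X in _ = X + _]mulrA -[X in _ = _ + X]mulrA -mulrDr -e -rmorphM /= /renorm.
by rewrite mulrA mulVf // mul1r.
Qed.

Lemma unit_amplitude_bounds : 0 <= a -> 0 <= b -> exists M : R, 0 <= M /\ forall p N,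
  0 < p <= pi / 2 -> (1 <= N)%N -> 1 <= N%:R * p -> N%:R * p <= 3 ->
  cabs (unit_amplitude p N) <= M /\ forall n, (N < n)%N ->
  [/\ cabs (unit_amplitude p n) <= M * weight p n,
      cabs (unit_amplitude p n.-1) <= M * weight p n &
      cabs (unit_amplitude p n - unit_amplitude p n.-1) <= M / n%:R * weight p n].
Proof.
move=> a0 b0; have g0 : 0 <= g by lra.
have [M1 [M10 h1]] := amplitude_bounds a0 b0; have [M0 [M00 h0]] := amplitude_start a0 b0.
have [w [w0 hw]] := weight_far a0.
have G0 n := growth_gt0 n g0.
pose M := M0 + M1 * M0 * (2 + g) * w.
exists M; have M_ge : M1 * M0 * (2 + g) * w <= M by rewrite /M lerDr.
split; first by rewrite addr_ge0 // !mulr_ge0 //; lra.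
move=> p N pI N1 Np Np3; have /andP[p0 pp] := pI.
have hN := h0 p N pI N1 Np Np3; have hamp := h1 p N pI N1 Np.
have absG n z : cabs (real_complex R (growth g n)^-1 * z) = cabs z / growth g n.
  by rewrite cabsM cabs_real gtr0_norm ?invr_gt0 // mulrC.
split.
  rewrite /unit_amplitude absG ler_pdivrMr //; apply: le_trans hN _.
  by rewrite ler_wpM2r ?(ltW (G0 _)) // /M lerDl !mulr_ge0 //; lra.
move=> [//|n]; rewrite ltnS -pred_Sn => Nn; have n0 : 0 < n%:R :> R by rewrite ltr0n; exact: leq_trans Nn.
have [e1 e2] := hamp n Nn; have [e3 _] := hamp n.+1 (leqW Nn).
have W := hw p N n.+1 p0 N1 Np3 (leqW Nn).
set B := weight p n.+1 in W *.
have GN : growth g N = growth g N / growth g n.+1 * growth g n.+1 by rewrite mulfVK // gt_eqF.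
have K0 : 0 <= M1 * M0 by rewrite mulr_ge0.
have aN k : M1 * cabs (amp p N) / growth g k <= M1 * M0 * (growth g N / growth g k).
  rewrite mulrA ler_wpM2r ?invr_ge0 ?(ltW (G0 _)) // -mulrA ler_wpM2l //.
have b1 : M1 * M0 * (growth g N / growth g n.+1) <= M1 * M0 * (w * B) by rewrite ler_wpM2l.
have s1 : 0 < 1 + g / n.+1%:R by rewrite ltr_pwDl // divr_ge0.
have s2 : g / n.+1%:R <= g by rewrite ler_piMr // invf_le1 ?ler1n.
have B0 : 0 <= w * B by rewrite mulr_ge0 // ltW // weight_gt0.
have KB : 0 <= M1 * M0 * (w * B) by rewrite mulr_ge0.
have fin (x t : R) : x <= M1 * M0 * (w * B) * t -> t <= 2 + g -> x <= M * B.
  move=> h ht; apply: le_trans h _; apply: le_trans (_ : M1 * M0 * (2 + g) * w * B <= _).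
    by rewrite (_ : _ * _ * B = M1 * M0 * (w * B) * (2 + g)); [rewrite ler_wpM2l|ring].
  by rewrite ler_wpM2r // ltW // weight_gt0.
have Gs : growth g n.+1 = growth g n * (1 + g / n.+1%:R) by exact: growthS.
have u1 : cabs (unit_amplitude p n) <= M1 * M0 * (w * B) * (1 + g / n.+1%:R).
  rewrite /unit_amplitude absG.
  apply: le_trans (_ : M1 * cabs (amp p N) / growth g n.+1 * (1 + g / n.+1%:R) <= _).
    rewrite Gs invfM -!mulrA mulVf ?mulr1 ?gt_eqF // mulrA ler_wpM2r ?invr_ge0 ?(ltW (G0 _)) //.
  by rewrite ler_wpM2r ?(ltW s1) //; apply: le_trans (aN _) b1.
split.
- apply: (fin _ 1); last lra.
  rewrite mulr1 /unit_amplitude absG; apply: le_trans b1; apply: le_trans (aN _).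
  by rewrite ler_wpM2r ?invr_ge0 ?(ltW (G0 _)).
- by apply: (fin _ _ u1); apply: lerD => //; rewrite ler1n.
have -> : unit_amplitude p n.+1 - unit_amplitude p n = real_complex R (growth g n.+1)^-1 *
    ((amp p n.+1 - amp p n) - real_complex R (g / n.+1%:R) * amp p n).
  rewrite /unit_amplitude.
  have -> : (growth g n)^-1 = (growth g n.+1)^-1 * (1 + g / n.+1%:R).
    by rewrite Gs invfM -mulrA mulVf ?mulr1 // gt_eqF.
  move: (growth g n.+1)^-1 (g / n.+1%:R) (amp p n.+1) (amp p n) => X Y u v.
  by rewrite rmorphM rmorphD rmorph1; ring.
rewrite absG; set q := M1 * cabs (amp p N) in e1.
have q0 : 0 <= q by rewrite mulr_ge0 // cabs_ge0.
have h : cabs ((amp p n.+1 - amp p n) - real_complex R (g / n.+1%:R) * amp p n) <= q * ((2 + g) / n.+1%:R).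
  apply: le_trans (cabsB _ _) _.
  rewrite (_ : q * ((2 + g) / n.+1%:R) = q * (2 / n.+1%:R) + g / n.+1%:R * q); last by ring.
  apply: lerD; last first.
    rewrite cabsM cabs_real ger0_norm ?divr_ge0 //; apply: ler_wpM2l => //; by rewrite divr_ge0.
  apply: le_trans e2 _; rewrite mulrAC ler_wpM2l //.
  have eS : n.+1%:R = n%:R + 1 :> R by rewrite natr1.
  have n1 : (1 : R) <= n%:R by rewrite ler1n; exact: leq_trans Nn.
  rewrite eS ler_pdivlMr; last lra.
  by rewrite mulrC ler_pdivrMr //; lra.
rewrite ler_pdivrMr //; apply: le_trans h _.
have := le_trans (aN n.+1) b1; rewrite -/q ler_pdivrMr // => h.
have t0 : 0 <= (2 + g) / n.+1%:R by rewrite divr_ge0 //; lra.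
apply: le_trans (ler_wpM2r t0 h) _.
rewrite (_ : _ * _ * ((2 + g) / _) = M1 * M0 * (2 + g) * w * (B / n.+1%:R * growth g n.+1)); last by ring.
rewrite (_ : M / n.+1%:R * B * growth g n.+1 = M * (B / n.+1%:R * growth g n.+1)); last by ring.
have B1 : 0 <= B := ltW (weight_gt0 _ _).
rewrite ler_wpM2r //; apply: mulr_ge0; first by rewrite divr_ge0.
exact: ltW (G0 _).
Qed.

End SlowAmplitudes.

Section JacobiDecomposition.
Context {R : realType} (a b : R).
Local Notation c := (a + b + 1).
Local Notation g := (a + 1 / 2).
Local Notation r p n := (hyp a c n ((1 - cos p) / 2)).
Local Notation weight := (weight a).
Local Notation slow := (slow a).
Local Notation unit_amplitude := (unit_amplitude a b).
Implicit Types (n N : nat) (p : R).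

(** Below the index 1/p the weight is of order 1, and p is at most 3/n. *)
Lemma slow_near (E p : R) N (f : nat -> R[i]) : 0 <= a -> 0 <= E -> 0 <= p -> N%:R * p <= 3 ->
  (forall n, (n <= N)%N -> cabs (f n) <= E) ->
  (forall n, (n < N)%N -> cabs (f n.+1 - f n) <= E * p) ->
  forall n, (1 <= n)%N -> (n <= N)%N ->
  [/\ cabs (f n) <= 3 * E * 4 `^ g * weight p n, cabs (f n.-1) <= 3 * E * 4 `^ g * weight p n &
     cabs (f n - f n.-1) <= 3 * E * 4 `^ g / n%:R * weight p n].
Proof.
move=> a0 E0 p0 Np h1 h2 [//|n] _ nN.
have n0 : 0 < n.+1%:R :> R by [].
have np : n.+1%:R * p <= 3 by apply: le_trans Np; rewrite ler_wpM2r // ler_nat.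
have W := weight_near a0 p0 np; set B := weight p n.+1 in W *.
have bd (x : R) : x <= E -> x <= 3 * E * 4 `^ g * B.
  move=> h; apply: le_trans h _; rewrite -mulrA; have := ler_wpM2l E0 W.
  by move: (_ * B) W => t t1; nra.
split; [exact: bd (h1 _ nN)|exact: bd (h1 _ (ltnW nN))|].
apply: le_trans (h2 _ nN) _.
rewrite (_ : _ / _ * B = E * (3 / n.+1%:R) * (4 `^ g * B)); last by ring.
have h : E * p <= E * (3 / n.+1%:R).
  by rewrite ler_wpM2l // ler_pdivlMr // mulrC.
apply: le_trans h _; rewrite ler_peMr // mulr_ge0 // divr_ge0 //.
Qed.

(** Below the index 1/p the first amplitude absorbs the non-oscillating polynomial
    and the second one is frozen; beyond it both are conjugate. *)
Theorem jacobi_decomposition : 0 <= a -> 0 <= b -> exists C : R, 0 <= C /\ forall p,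
  0 <= p <= pi / 2 -> exists fp fm : nat -> R[i],
  [/\ forall n, real_complex R (jacobi a b n (cos p) / jacobi a b n 1) =
        fp n * expi (n%:R * p) + fm n * expi (- (n%:R * p)),
      slow C p fp & slow C p fm].
Proof.
move=> a0 b0; have g0 : 0 <= g by lra.
have [E [E0 hE]] := hyp_near a0 b0; have [M [M0 hM]] := unit_amplitude_bounds a0 b0.
have [F [F0 FE]] : exists F : R, 0 <= F /\ F = 2 * (E + M) + 1 by exists (2 * (E + M) + 1); split=> //; lra.
pose C := 3 * F * 4 `^ g + M; have P0 : 0 <= 3 * F * 4 `^ g by rewrite !mulr_ge0 ?powR_ge0.
exists C; split=> [|p pI]; first by rewrite addr_ge0.
have CM : M <= C by rewrite /C lerDr.
have CF : 3 * F * 4 `^ g <= C by rewrite /C lerDl.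
clearbody C.
have up (D x : R) n : D <= C -> x <= D * weight p n -> x <= C * weight p n.
  by move=> DC h; apply: le_trans h _; apply: ler_wpM2r => //; exact: ltW (weight_gt0 _ _ _).
have up' (D x : R) n : D <= C -> x <= D / n%:R * weight p n -> x <= C / n%:R * weight p n.
  move=> DC h; apply: le_trans h _; apply: ler_wpM2r; first exact: ltW (weight_gt0 _ _ _).
  by apply: ler_wpM2r => //; rewrite invr_ge0.
have /andP[p0 pp] := pI.
have p2 : p < 2 by apply: le_lt_trans pp _; have /andP[] := pihalf_02 R.
have [pe|pn0] := eqVneq p 0.
  exists (fun=> 1), (fun=> 0); split.
  - by move=> n; rewrite jacobi_ratio // pe cos0 subrr mul0r hyp_n0 mulr0 expi0 mulr1 mul0r addr0.
  - apply: slow_le CF _ => n n1.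
    apply: (@slow_near F p n (fun=> 1)) => // [|m _|m _].
    + by rewrite pe mulr0.
    + by rewrite /cabs /= expr0n addr0 expr1n sqrtr1 FE; lra.
    + by rewrite subrr /cabs /= expr0n addr0 sqrtr0 mulr_ge0.
  - apply: slow_le CF _ => n n1.
    apply: (@slow_near F p n (fun=> 0)) => // [|m _|m _].
    + by rewrite pe mulr0.
    + by rewrite /cabs /= expr0n addr0 sqrtr0.
    + by rewrite subrr /cabs /= expr0n addr0 sqrtr0 mulr_ge0.
have {pn0} pp0 : 0 < p by rewrite lt_def pn0.
have pI' : 0 < p <= pi / 2 by rewrite pp0.
pose N := (Num.truncn p^-1).+1.
have iv0 : 0 <= p^-1 by rewrite invr_ge0.
have /andP[N1 N2] := truncn_itv iv0; rewrite -/N in N2.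
have Np1 : 1 <= N%:R * p by move: (ltW N2); rewrite -ler_pdivrMr // mul1r.
have Np3 : N%:R * p <= 3.
  have h : (Num.truncn p^-1)%:R * p <= 1 by rewrite -ler_pdivlMr // mul1r.
  have eS : N%:R = (Num.truncn p^-1)%:R + 1 :> R by rewrite natr1.
  by rewrite eS mulrDl mul1r; lra.
have [k1 hfar] := hM p N pI' (ltn0Sn _) Np1 Np3.
clearbody N; set k := unit_amplitude p N in k1.
pose fp n := if (n <= N)%N then
  expi (- (n%:R * p)) * (real_complex R (r p n) - cconj k * expi (- (n%:R * p)))
  else unit_amplitude p n.
pose fm n := if (n <= N)%N then cconj k else cconj (unit_amplitude p n).
have near n : (n <= N)%N -> `|r p n| <= E /\ `|r p n - r p n.-1| <= E * p.
  by move=> nN; apply: hE => //; apply: le_trans Np3; rewrite ler_wpM2r // ler_nat.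
have fpN : fp N = unit_amplitude p N.
  rewrite /fp leqnn hyp_unit_amplitude // -/k addrK mulrCA -expiD addNr expi0 mulr1 //.
have fmN : fm N = cconj (unit_amplitude p N) by rewrite /fm leqnn.
exists fp, fm; split.
- move=> n; rewrite jacobi_ratio // /fp /fm; case: leqP => nN; last exact: hyp_unit_amplitude.
  have e (t : R) z : expi (- t) * z * expi t = z by rewrite mulrAC -expiD addNr expi0 mul1r.
  by rewrite e subrK.
- move=> n n1; case: (leqP n N) => nN.
    have [] := @slow_near F p N fp a0 F0 p0 Np3 _ _ n n1 nN.
    + move=> m mN; rewrite /fp mN cabsM cabs_expi mul1r; apply: le_trans (cabsB _ _) _.
      have [h _] := near m mN; rewrite cabs_real cabsM cabs_expi mulr1 cabs_cconj FE.
      have := cabs_ge0 k; lra.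
    + move=> m mN; rewrite /fp mN (ltnW mN).
      have [h1 h2] := near m.+1 mN; have [h3 _] := near m (ltnW mN); rewrite /= in h2.
      have -> : - (m%:R * p) = - (m.+1%:R * p) + p by rewrite -natr1; ring.
      rewrite expiD; set z := expi _.
      have -> : z * (real_complex R (r p m.+1) - cconj k * z) -
         z * expi p * (real_complex R (r p m) - cconj k * (z * expi p)) =
         z * (real_complex R (r p m.+1 - r p m) - (expi p - 1) * real_complex R (r p m)) +
         z * z * cconj k * (expi p * (expi p - 1) + (expi p - 1)).
        rewrite rmorphB; ring.
      have zz : cabs z = 1 by exact: cabs_expi.
      have e1 := cabs_expi1 p0.
      apply: le_trans (cabsD _ _) _; rewrite !cabsM zz !mul1r cabs_cconj.
      have g1 : cabs (real_complex R (r p m.+1 - r p m) - (expi p - 1) * real_complex R (r p m)) <= E * p + p * E.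
        apply: le_trans (cabsB _ _) _; rewrite cabs_real cabsM cabs_real; apply: lerD => //.
        by apply: ler_pM => //; exact: cabs_ge0.
      have g2 : cabs (expi p * (expi p - 1) + (expi p - 1)) <= p + p.
        by apply: le_trans (cabsD _ _) _; rewrite cabsM cabs_expi mul1r lerD.
      have := ler_pM (cabs_ge0 k) (cabs_ge0 _) k1 g2; rewrite FE; lra.
    by move=> h1 h2 h3; split; [exact: up CF h1|exact: up CF h2|exact: up' CF h3].
  have [h1 h2 h3] := hfar n nN.
  have -> : fp n = unit_amplitude p n by rewrite /fp leqNgt nN.
  have -> : fp n.-1 = unit_amplitude p n.-1.
    have [e|h] := eqVneq n.-1 N; first by rewrite e.
    by rewrite /fp leqNgt ltn_neqAle eq_sym h -ltnS prednK ?nN.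
  by split; [exact: up CM h1|exact: up CM h2|exact: up' CM h3].
- move=> n n1; case: (leqP n N) => nN.
    have [] := @slow_near F p N fm a0 F0 p0 Np3 _ _ n n1 nN.
    + by move=> m mN; rewrite /fm mN cabs_cconj; apply: le_trans k1 _; rewrite FE; lra.
    + by move=> m mN; rewrite /fm mN (ltnW mN) subrr /cabs /= expr0n addr0 sqrtr0 mulr_ge0.
    by move=> h1 h2 h3; split; [exact: up CF h1|exact: up CF h2|exact: up' CF h3].
  have [h1 h2 h3] := hfar n nN.
  have -> : fm n = cconj (unit_amplitude p n) by rewrite /fm leqNgt nN.
  have -> : fm n.-1 = cconj (unit_amplitude p n.-1).
    have [e|h] := eqVneq n.-1 N; first by rewrite e.
    by rewrite /fm leqNgt ltn_neqAle eq_sym h -ltnS prednK ?nN.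
  rewrite -cconjB !cabs_cconj.
  by split; [exact: up CM h1|exact: up CM h2|exact: up' CM h3].
Qed.

End JacobiDecomposition.

(** * Multiplication by the dimensions, and the three ranges of the angle *)

Section Assembly.
Context {R : realType}.
Implicit Types (D B : nat -> R) (e K C p : R) (n : nat).

(** The first order symbols of order e in the variable n, a class stable under
    products. *)
Definition tame K e D : Prop := forall n, (1 <= n)%N ->
  `|D n| <= K * n%:R `^ e /\ `|D n - D n.-1| <= K * n%:R `^ (e - 1).

Lemma powRB1 n e : (1 <= n)%N -> n%:R `^ (e - 1) = n%:R `^ e / n%:R :> R.
Proof. by move=> n1; rewrite powRB ?powRr1 ?ler0n // pnatr_eq0 -lt0n n1 implybT. Qed.

Lemma tame_prev K e D n : tame K e D -> (1 <= n)%N -> `|D n.-1| <= 2 * K * n%:R `^ e.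
Proof.
move=> tD n1; have [h1 h2] := tD n n1.
have h3 : n%:R `^ (e - 1) <= n%:R `^ e :> R by rewrite ler_powR ?ler1n //; lra.
have K0 : 0 <= K.
  rewrite -(pmulr_lge0 _ (_ : 0 < n%:R `^ e)) ?powR_gt0 ?ltr0n //.
  exact: le_trans (normr_ge0 _) h1.
have h4 := ler_wpM2l K0 h3.
have := ler_normB (D n) (D n - D n.-1); rewrite subKr => h; lra.
Qed.

Lemma tame_mul K e D L f B : tame K e D -> tame L f B ->
  tame (3 * K * L) (e + f) (fun n => D n * B n).
Proof.
move=> tD tB n n1; have [d1 d2] := tD n n1; have [b1 b2] := tB n n1.
have b3 := tame_prev tB n1.
have n0 : n%:R != 0 :> R by rewrite pnatr_eq0 -lt0n.
rewrite powRB1 // !powRD ?n0 ?implybT //; rewrite !powRB1 // in d2 b2.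
move: (powR_ge0 (n%:R : R) e) (powR_ge0 (n%:R : R) f) d1 d2 b1 b2 b3.
have : 0 <= n%:R^-1 :> R by rewrite invr_ge0.
move: (_ `^ e) (_ `^ f) n%:R^-1 => u v w w0 u0 v0 d1 d2 b1 b2 b3.
have h1 := ler_pM (normr_ge0 _) (normr_ge0 _) d1 b1.
have h2 := ler_pM (normr_ge0 _) (normr_ge0 _) d1 b2.
have h3 := ler_pM (normr_ge0 _) (normr_ge0 _) d2 b3.
split.
  have := le_trans (mulr_ge0 (normr_ge0 _) (normr_ge0 _)) h1.
  by rewrite normrM; move: h1 => h1 h; lra.
have -> : D n * B n - D n.-1 * B n.-1 = D n * (B n - B n.-1) + (D n - D n.-1) * B n.-1 by ring.
apply: le_trans (ler_normD _ _) _; rewrite !normrM; lra.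
Qed.

Lemma tame_slow K e D a C p (f : nat -> R[i]) n : tame K e D -> slow a C p f -> (1 <= n)%N ->
  cabs (real_complex R (D n) * f n) <= 2 * K * C * (n%:R `^ e * weight a p n) /\
  cabs (real_complex R (D n) * f n - real_complex R (D n.-1) * f n.-1) <=
    2 * K * C * (n%:R `^ (e - 1) * weight a p n).
Proof.
move=> tD sf n1; have [d1 d2] := tD n n1; have [f1 f2 f3] := sf n n1.
rewrite powRB1 //; rewrite powRB1 // in d2.
have := ltW (weight_gt0 a p n).
move: (powR_ge0 (n%:R : R) e) d1 d2 f1 f2 f3.
have : 0 <= n%:R^-1 :> R by rewrite invr_ge0.
move: (_ `^ e) (weight _ _ _) n%:R^-1 => u v w w0 u0 d1 d2 f1 f2 f3 v0.
have h1 := ler_pM (normr_ge0 _) (cabs_ge0 _) d1 f1.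
have h2 := ler_pM (normr_ge0 _) (cabs_ge0 _) d1 f3.
have h3 := ler_pM (normr_ge0 _) (cabs_ge0 _) d2 f2.
split.
  have := le_trans (mulr_ge0 (normr_ge0 _) (cabs_ge0 _)) h1.
  by rewrite cabsM cabs_real; move: h1 => h1 h; lra.
have -> : real_complex R (D n) * f n - real_complex R (D n.-1) * f n.-1 =
    real_complex R (D n) * (f n - f n.-1) + real_complex R (D n - D n.-1) * f n.-1.
  by rewrite rmorphB; ring.
apply: le_trans (cabsD _ _) _; rewrite !cabsM !cabs_real; lra.
Qed.

Lemma tame_dimension X : admissible X ->
  exists K : R, tame K ((dimX X)%:R - 1) (fun n => (dimH R X n)%:R).
Proof.
move=> aX; have [C hC] := @dimH_le R X aX; have d2 := dimX_ge2 aX.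
exists C => n n1; have [h1 h2] := hC n n1.
have e1 : n%:R `^ ((dimX X)%:R - 1) = n%:R ^+ (dimX X - 1) :> R.
  by rewrite -powR_mulrn // natrB // (leq_trans _ d2).
have e2 : n%:R `^ ((dimX X)%:R - 1 - 1) = n%:R ^+ (dimX X - 2) :> R.
  by rewrite -powR_mulrn // natrB // -addrA -opprD.
by rewrite e1 e2 ger0_norm.
Qed.

Lemma growth_ratio_le (a b : R) n : 0 <= a -> 0 <= b -> (1 <= n)%N ->
  growth b n / growth a n <= 2 `^ b * expR b * expR (2 * a ^+ 2) * n%:R `^ (b - a).
Proof.
move=> a0 b0 n1; have n0 : n%:R != 0 :> R by rewrite pnatr_eq0 -lt0n.
have eS : n.+1%:R = n%:R + 1 :> R by rewrite natr1.
have l1 : (1 : R) <= n%:R by rewrite ler1n.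
have hb : growth b n <= 2 `^ b * n%:R `^ b * expR b.
  apply: le_trans (growth_le _ b0) _; rewrite ler_wpM2r ?expR_ge0 // -powRM //.
  by rewrite ge0_ler_powR ?nnegrE ?mulr_ge0 // eS; lra.
have ha : n%:R `^ a <= growth a n * expR (2 * a ^+ 2).
  apply: le_trans (growth_ge n a0); apply: ge0_ler_powR; rewrite ?nnegrE //.
  by rewrite eS; lra.
rewrite ler_pdivrMr ?growth_gt0 //; apply: le_trans hb _.
have p0 : 0 < n%:R `^ a :> R by rewrite powR_gt0 // lt0r n0 ler0n.
rewrite powRB ?n0 ?implybT //.
have hq : 1 <= growth a n * expR (2 * a ^+ 2) / n%:R `^ a by rewrite ler_pdivlMr // mul1r.
have q0 : 0 <= 2 `^ b * n%:R `^ b * expR b :> R by rewrite !mulr_ge0 ?powR_ge0 ?expR_ge0.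
have := ler_wpM2l q0 hq; rewrite mulr1 => h; apply: le_trans h _.
by rewrite le_eqVlt; apply/orP; left; apply/eqP; ring.
Qed.

(** The ratio of the values at 1 for exchanged parameters is what turns the size
    n^(d-1) at one pole into n^(b+d/2) at the other. *)
Lemma tame_growth_ratio (a b : R) : 0 <= a -> 0 <= b ->
  exists K : R, tame K (b - a) (fun n => growth b n / growth a n).
Proof.
move=> a0 b0; set Q := 2 `^ b * expR b * expR (2 * a ^+ 2).
have Q0 : 0 <= Q by rewrite !mulr_ge0 ?powR_ge0 ?expR_ge0.
exists (Q * (1 + a + b)) => n n1.
have h := growth_ratio_le a0 b0 n1; rewrite -/Q in h.
have g0 k : 0 < growth a k by exact: growth_gt0.
have h0 : 0 <= growth b n / growth a n by rewrite divr_ge0 // ltW // growth_gt0.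
rewrite powRB1 //.
split.
  rewrite ger0_norm //; apply: le_trans h _.
  by rewrite ler_wpM2r ?powR_ge0 // ler_peMr //; lra.
case: n n1 h h0 => [//|n] _ h h0 /=.
have k0 : 0 < n.+1%:R :> R by [].
have -> : growth b n.+1 / growth a n.+1 - growth b n / growth a n =
    growth b n.+1 / growth a n.+1 * ((b - a) / (n.+1%:R + b)).
  rewrite !growthS; have := g0 n; move: (growth a n) (growth b n) n.+1%:R k0 => x y k k0 x0.
  field. lra.
rewrite normrM (ger0_norm h0) mulrA.
apply: le_trans (ler_wpM2r _ h) _; first exact: normr_ge0.
rewrite [leRHS](_ : _ = Q * n.+1%:R `^ (b - a) * ((1 + a + b) / n.+1%:R)); last by ring.
apply: ler_wpM2l; first by rewrite mulr_ge0 ?powR_ge0.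
rewrite normrM normfV (ger0_norm (_ : 0 <= n.+1%:R + b)) ?addr_ge0 //.
apply: ler_pM => //; first by rewrite invr_ge0 addr_ge0.
  by rewrite ler_norml; lra.
by rewrite lef_pV2 ?posrE ?ltr_pwDl //; lra.
Qed.

Lemma tame_decomposition K e D (a b : R) : 0 <= a -> 0 <= b -> tame K e D ->
  exists (C : R) (F G : nat -> R -> R[i]), 0 <= C /\
  forall n p, (1 <= n)%N -> 0 <= p <= pi / 2 ->
  [/\ real_complex R (D n * (jacobi a b n (cos p) / jacobi a b n 1)) =
        F n p * expi (n%:R * p) + G n p * expi (- (n%:R * p)),
      cabs (F n p) <= C * (n%:R `^ e * weight a p n)
      /\ cabs (G n p) <= C * (n%:R `^ e * weight a p n)
    & cabs (F n p - F n.-1 p) <= C * (n%:R `^ (e - 1) * weight a p n)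
      /\ cabs (G n p - G n.-1 p) <= C * (n%:R `^ (e - 1) * weight a p n)].
Proof.
move=> a0 b0 tD; have [C [C0 hC]] := jacobi_decomposition a0 b0.
have K0 : 0 <= K.
  by have [h _] := tD 1%N isT; move: h; rewrite powR1 mulr1; apply: le_trans.
have /choice[fg hfg] : forall p, exists q : (nat -> R[i]) * (nat -> R[i]), 0 <= p <= pi / 2 ->
    [/\ forall n, real_complex R (jacobi a b n (cos p) / jacobi a b n 1) =
          q.1 n * expi (n%:R * p) + q.2 n * expi (- (n%:R * p)),
        slow a C p q.1 & slow a C p q.2].
  move=> p; have [pI|pI] := boolP (0 <= p <= pi / 2); last by exists (fun=> 0, fun=> 0).
  by have [fp [fm h]] := hC p pI; exists (fp, fm).
exists (2 * K * C), (fun n p => real_complex R (D n) * (fg p).1 n),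
  (fun n p => real_complex R (D n) * (fg p).2 n).
split=> [|n p n1 pI]; first by rewrite !mulr_ge0.
have [h1 h2 h3] := hfg p pI.
have [f1 f2] := tame_slow tD h2 n1; have [g1 g2] := tame_slow tD h3 n1.
by split=> //; rewrite -!mulrA -mulrDr -h1 -rmorphM.
Qed.

Lemma japanese_scale (x : R) : japanese x <= 2 * japanese (x / 2).
Proof.
rewrite -(@ler_pXn2r _ 2) ?nnegrE ?sqrtr_ge0 ?mulr_ge0 ?sqrtr_ge0 //.
have s (y : R) : japanese y ^+ 2 = 1 + y ^+ 2.
  by rewrite /japanese sqr_sqrtr ?real_normK ?num_real // addr_ge0 // sqr_ge0.
by rewrite exprMn !s; have := sqr_ge0 x; nra.
Qed.

Lemma weight_half (a : R) n p : 0 <= a ->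
  weight a (p / 2) n <= 2 `^ (a + 1 / 2) / japanese (n%:R * p) `^ (a + 1 / 2).
Proof.
move=> a0; have j0 (x : R) : 0 < japanese x `^ (a + 1 / 2) by rewrite powR_gt0 // japanese_gt0.
rewrite /weight ler_pdivlMr // mulrC ler_pdivrMr // mulrA.
have k0 (x : R) : 0 <= japanese x := ltW (japanese_gt0 x).
rewrite -powRM ?ler0n //; apply: ge0_ler_powR; rewrite ?nnegrE ?mulr_ge0 //; first lra.
exact: japanese_scale.
Qed.

Lemma expi_npi n : expi (n%:R * pi) = (-1) ^+ n :> R[i].
Proof.
elim: n => [|n IH]; first by rewrite mul0r expi0.
rewrite -natr1 mulrDl mul1r expiD IH exprS mulrC; congr (_ * _).
by rewrite /expi cospi sinpi; apply/eqP; rewrite eq_complex /= oppr0 !eqxx.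
Qed.

Lemma alpha_ge0 X : admissible X -> 0 <= alpha R X.
Proof.
move=> /dimX_ge2 h; rewrite /alpha divr_ge0 // subr_ge0.
by rewrite (ler_nat _ 2).
Qed.

Lemma beta_ge0 X : admissible X -> 0 <= beta R X.
Proof. by case: X => [d|d|d|d|] h //=; exact: (alpha_ge0 h). Qed.

End Assembly.

Theorem theorem6p1 (R : realType) :
  (forall (d m : nat), (2 <= d)%N -> (1 <= m)%N ->
    exists (psip psim : nat -> R -> R[i]) (E : R -> nat -> R[i]) (C : R),
    forall (n : nat) (theta : R), (1 <= n)%N -> 0 <= theta <= pi ->
      [/\ real_complex R (zonal (RealProj d) n theta) =
            psip n theta * expi (n%:R * (theta / 2))
            + psim n theta * expi (- (n%:R * (theta / 2))) + E theta n,
          cabs (psip n theta) <=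
            C * (n%:R `^ (d%:R - 1) / japanese (n%:R * theta) `^ ((d%:R - 1) / 2))
          /\ cabs (psim n theta) <=
            C * (n%:R `^ (d%:R - 1) / japanese (n%:R * theta) `^ ((d%:R - 1) / 2)),
          cabs (psip n theta - psip n.-1 theta) <=
            C * (n%:R `^ (d%:R - 2) / japanese (n%:R * theta) `^ ((d%:R - 1) / 2))
          /\ cabs (psim n theta - psim n.-1 theta) <=
            C * (n%:R `^ (d%:R - 2) / japanese (n%:R * theta) `^ ((d%:R - 1) / 2))
        & cabs (E theta n) <= C * n%:R `^ (d%:R - (m%:R + 1))])
  /\
  (forall (X : rank_one_space) (m : nat), admissible X -> ~~ is_real_proj X ->
    (1 <= m)%N ->
    let d : R := (dimX X)%:R in
    exists (psip psim : nat -> R -> R[i]) (E1 : R -> nat -> R[i]) (C : R),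
    forall (n : nat) (theta : R), (1 <= n)%N -> 0 <= theta <= pi / 2 ->
      [/\ real_complex R (zonal X n theta) =
            psip n theta * expi (n%:R * theta)
            + psim n theta * expi (- (n%:R * theta)) + E1 theta n,
          cabs (psip n theta) <=
            C * (n%:R `^ (d - 1) / japanese (n%:R * theta) `^ ((d - 1) / 2))
          /\ cabs (psim n theta) <=
            C * (n%:R `^ (d - 1) / japanese (n%:R * theta) `^ ((d - 1) / 2)),
          cabs (psip n theta - psip n.-1 theta) <=
            C * (n%:R `^ (d - 2) / japanese (n%:R * theta) `^ ((d - 1) / 2))
          /\ cabs (psim n theta - psim n.-1 theta) <=
            C * (n%:R `^ (d - 2) / japanese (n%:R * theta) `^ ((d - 1) / 2))
        & cabs (E1 theta n) <= C * n%:R `^ (d - (m%:R + 1))])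
  /\
  (forall (X : rank_one_space) (m : nat), admissible X -> ~~ is_real_proj X ->
    (1 <= m)%N ->
    let d : R := (dimX X)%:R in
    let b : R := beta R X in
    (d - 2 * (1 + b)) / 4 < m%:R ->
    exists (lamp lamm : nat -> R -> R[i]) (E2 : R -> nat -> R[i]) (C : R),
    forall (n : nat) (theta : R), (1 <= n)%N -> pi / 2 <= theta <= pi ->
      [/\ real_complex R (zonal X n theta) =
            lamp n theta * expi (n%:R * theta)
            + lamm n theta * expi (- (n%:R * theta)) + E2 theta n,
          cabs (lamp n theta) <=
            C * (n%:R `^ (b + d / 2)
                 / japanese (n%:R * (pi - theta)) `^ (b + 1 / 2))
          /\ cabs (lamm n theta) <=
            C * (n%:R `^ (b + d / 2)
                 / japanese (n%:R * (pi - theta)) `^ (b + 1 / 2)),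
          cabs (lamp n theta - lamp n.-1 theta) <=
            C * (n%:R `^ (b + d / 2 - 1)
                 / japanese (n%:R * (pi - theta)) `^ (b + 1 / 2))
          /\ cabs (lamm n theta - lamm n.-1 theta) <=
            C * (n%:R `^ (b + d / 2 - 1)
                 / japanese (n%:R * (pi - theta)) `^ (b + 1 / 2))
        & cabs (E2 theta n) <= C * n%:R `^ (b + d / 2 - m%:R)]).
Proof.
split; [|split].
- move=> d m d2 m1; have aX : admissible (RealProj d) by [].
  have [K tD] := @tame_dimension R _ aX; have al := @alpha_ge0 R _ aX.
  have [C [F [G [C0 h]]]] := tame_decomposition al al tD.
  exists (fun n t => F n (t / 2)), (fun n t => G n (t / 2)), (fun _ _ => 0),
    (C * 2 `^ (alpha R (RealProj d) + 1 / 2)) => n t n1 /andP[t0 tpi].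
  have C1 : 0 <= C * 2 `^ (alpha R (RealProj d) + 1 / 2) by rewrite mulr_ge0 ?powR_ge0.
  have [|h1 [h2 h3] [h4 h5]] := h n (t / 2) n1; first by apply/andP; split; lra.
  have e1 : alpha R (RealProj d) + 1 / 2 = (d%:R - 1) / 2 by rewrite /alpha /=; lra.
  have e2 : (dimX (RealProj d))%:R - 1 - 1 = d%:R - 2 :> R by rewrite /=; lra.
  have W := weight_half n t al; rewrite e1 in W C1 *; rewrite e2 in h4 h5.
  have up (e x : R) : x <= C * (n%:R `^ e * weight (alpha R (RealProj d)) (t / 2) n) ->
      x <= C * 2 `^ ((d%:R - 1) / 2) * (n%:R `^ e / japanese (n%:R * t) `^ ((d%:R - 1) / 2)).
    have V := ler_wpM2l C0 (ler_wpM2l (powR_ge0 n%:R e) W).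
    by move=> H; apply: le_trans H (le_trans V _); rewrite -[leRHS]mulrA (mulrCA (2 `^ _)).
  split.
  + by rewrite addr0 -h1.
  + by split; apply: up.
  + by split; apply: up.
  + by rewrite /cabs /= expr0n addr0 sqrtr0 mulr_ge0 ?powR_ge0.
- move=> X m aX rX m1 d.
  have [K tD] := @tame_dimension R _ aX.
  have [C [F [G [C0 h]]]] := tame_decomposition (@alpha_ge0 R _ aX) (@beta_ge0 R _ aX) tD.
  exists F, G, (fun _ _ => 0), C => n t n1 tI.
  have [h1 h2 h3] := h n t n1 tI.
  have e1 : (d - 1) / 2 = alpha R X + 1 / 2 by rewrite /alpha -/d; lra.
  have e2 : d - 2 = d - 1 - 1 by lra.
  rewrite e1 e2; split=> //.
  + by rewrite addr0 -h1 /zonal /sX (negbTE rX) divr1.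
  + by rewrite /cabs /= expr0n addr0 sqrtr0 mulr_ge0 ?powR_ge0.
- move=> X m aX rX m1 d b _.
  have a0 := @alpha_ge0 R _ aX; have b0 := @beta_ge0 R _ aX.
  have [K tD] := @tame_dimension R _ aX.
  have [L tB] := tame_growth_ratio a0 b0.
  have [C [F [G [C0 h]]]] := tame_decomposition b0 a0 (tame_mul tD tB).
  exists (fun n t => G n (pi - t)), (fun n t => F n (pi - t)), (fun _ _ => 0), C => n t n1 /andP[t1 t2].
  have [|h1 [h2 h3] [h4 h5]] := h n (pi - t) n1; first by apply/andP; split; lra.
  (* The reflection of theta exchanges the parameters, which costs (-1)^n and the
     ratio of the values at 1; the sign also exchanges the two exponentials. *)
  have e1 : b + d / 2 = d - 1 + (b - alpha R X) by rewrite /alpha -/d; lra.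
  rewrite e1; split=> //.
  + have ex : (-1) ^+ n * expi (n%:R * (pi - t)) = expi (- (n%:R * t)).
      by rewrite mulrBr expiD expi_npi signrMK.
    have ey : (-1) ^+ n * expi (- (n%:R * (pi - t))) = expi (n%:R * t).
      by rewrite -expi_npi -expiD; congr expi; ring.
    have ez : zonal X n t = (-1) ^+ n * ((dimH R X n)%:R * (growth b n / growth (alpha R X) n) *
        (jacobi b (alpha R X) n (cos (pi - t)) / jacobi b (alpha R X) n 1)).
      rewrite /zonal /sX (negbTE rX) divr1 -/b.
      have -> : cos t = - cos (pi - t) by rewrite cosB cospi sinpi mul0r addr0 mulN1r opprK.
      have gb : growth b n != 0 by rewrite gt_eqF // growth_gt0.
      have b1 : -1 < b by apply: lt_le_trans b0; exact: ltrN10.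
      have a1 : -1 < alpha R X by apply: lt_le_trans a0; exact: ltrN10.
      rewrite jacobi_N !jacobi1 //; move: (jacobi _ _ _ _) (growth b n) gb => J B B0.
      rewrite -!mulrA [RHS]mulrCA; congr (_ * (_ * _)).
      by rewrite [RHS]mulrCA [B * _]mulrC divfK // mulrC.
    rewrite addr0 -ex -ey mulrCA [F _ _ * _]mulrCA addrC -mulrDr -h1.
    by rewrite -(rmorph_sign (real_complex R)) -rmorphM ez.
  + by rewrite /cabs /= expr0n addr0 sqrtr0 mulr_ge0 ?powR_ge0.
Qed.
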